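(* Let $\mathcal{P}$ be a (normal) class of posets and let $A$ be a set (of parameters). (1) $(\mathcal{P},A)$-$\mathsf{RcA}^+$ is equivalent to $\mathsf{MP}(\mathcal{P},A)$. (2) $(\mathcal{P},A)$-$\mathsf{RcA}$ is equivalent to the following assertion (scheme): for any $\mathcal{L}_\in$-formula $\varphi(\overline{x})$ and any $\overline{a}\in A$, if $\varphi(\overline{a})$ is a $\mathcal{P}$-button, then $\varphi(\overline{a})$ holds in a ground of $\mathsf{V}$.
   Context: The background theory is $\mathsf{ZFC}$, $\mathsf V$ is the universe, and $\mathcal{L}_\in$ is the language of set theory. A class $\mathcal{P}$ of posets is identified with the $\mathcal{L}_\in$-formula defining it and is reinterpreted accordingly in other models. $\overline a\in A$ means that $\overline a$ is a finite tuple of elements of $A$. Normal: a class $\mathcal{P}$ of posets is normal if the trivial poset $\{\mathbb{1}\}$ belongs to $\mathcal{P}$ and $\mathcal{P}$ is closed under forcing equivalence. Normality is understood as a property of the formula defining $\mathcal P$, holding in $\mathsf V$, in its grounds and in their set-generic extensions. Grounds: an inner model $\mathsf{W}_0$ of $\mathsf{W}$ is a ground of $\mathsf{W}$ if there are a poset $\mathbb{P}\in\mathsf{W}_0$ and a $(\mathsf{W}_0,\mathbb{P})$-generic $\mathbb{G}\in\mathsf{W}$ with $\mathsf{W}_0[\mathbb{G}]=\mathsf{W}$; it is a $\mathcal{P}$-ground if $\mathbb{P}$ can moreover be chosen with $\mathsf{W}_0\models\mathbb{P}\in\mathcal{P}$. Grounds are uniformly definable with parameters, so one can quantify over them in $\mathcal{L}_\in$.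 When a formula is said to hold at $\overline a$ in a ground, it is meant that the ground contains $\overline a$. $(\mathcal{P},A)$-$\mathsf{RcA}$ (Recurrence Axiom) is the scheme: for any $\mathbb{P}\in\mathcal{P}$, any $\mathcal{L}_\in$-formula $\varphi(\overline{x})$ and $\overline{a}\in A$, if $\Vdash_{\mathbb{P}}\varphi(\check{\overline{a}})$, then there is a ground $M$ of $\mathsf{V}$ with $\overline{a}\in M$ and $M\models\varphi(\overline{a})$. $(\mathcal{P},A)$-$\mathsf{RcA}^+$ is the same scheme with ''ground'' replaced by ''$\mathcal{P}$-ground''. A formula $\varphi(\overline{a})$ with parameters is a $\mathcal{P}$-button if there is $\mathbb{P}\in\mathcal{P}$ such that for any $\mathbb{P}$-name $\dot{\mathbb{Q}}$ of a poset with $\Vdash_{\mathbb{P}}\dot{\mathbb{Q}}\in\mathcal{P}$ we have $\Vdash_{\mathbb{P}*\dot{\mathbb{Q}}}\varphi(\check{\overline{a}})$. $\mathsf{MP}(\mathcal{P},A)$ (Maximality Principle) is the scheme: for any $\mathcal{L}_\in$-formula $\varphi(\overline{x})$ and $\overline{a}\in A$, if $\varphi(\overline{a})$ is a $\mathcal{P}$-button then $\varphi(\overline{a})$ holds (in $\mathsf{V}$). *)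

(* Defs.v *)
From Stdlib Require Import Arith.

(** * Formulas and structures for the language of set theory *)

(** Variables are named by natural numbers; binders may shadow. *)
Inductive formula : Type :=
| Mem (x y : nat)
| Eq (x y : nat)
| Neg (phi : formula)
| And (phi psi : formula)
| All (x : nat) (phi : formula).

Fixpoint free (i : nat) (phi : formula) : Prop :=
  match phi with
  | Mem x y | Eq x y => i = x \/ i = y
  | Neg phi => free i phi
  | And phi psi => free i phi \/ free i psi
  | All x phi => i <> x /\ free i phi
  end.

Record structure : Type := Structure {
  dom :> Type;
  mem : dom -> dom -> Prop
}.
Arguments mem {_} _ _.
Infix "∈" := mem (at level 70, no associativity).

Definition upd {T : Type} (e : nat -> T) (x : nat) (a : T) : nat -> T :=
  fun i => if Nat.eqb i x then a else e i.

Fixpoint sat (W : structure) (e : nat -> W) (phi : formula) : Prop :=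
  match phi with
  | Mem x y => e x ∈ e y
  | Eq x y => e x = e y
  | Neg phi => ~ sat W e phi
  | And phi psi => sat W e phi /\ sat W e psi
  | All x phi => forall a : W, sat W (upd e x a) phi
  end.

Definition sub (W : structure) (M : W -> Prop) : structure :=
  Structure {x : W | M x} (fun x y => proj1_sig x ∈ proj1_sig y).

(** * ZFC *)

Definition subset {W : structure} (x y : W) : Prop := forall z, z ∈ x -> z ∈ y.
Definition is_upair {W : structure} (z x y : W) : Prop :=
  forall u, u ∈ z <-> u = x \/ u = y.

Record ZFC (W : structure) : Prop := {
  zf_extensionality : forall x y : W, (forall z, z ∈ x <-> z ∈ y) -> x = y;
  zf_foundation : forall x : W, (exists y, y ∈ x) ->
    exists y, y ∈ x /\ ~ exists z, z ∈ y /\ z ∈ x;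
  zf_pairing : forall x y : W, exists z, is_upair z x y;
  zf_union : forall x : W, exists u, forall z, z ∈ u <-> exists y, y ∈ x /\ z ∈ y;
  zf_powerset : forall x : W, exists p, forall z, z ∈ p <-> subset z x;
  zf_infinity : exists w : W,
    (exists o, o ∈ w /\ forall z, ~ z ∈ o) /\
    (forall x, x ∈ w -> exists y, y ∈ w /\ forall z, z ∈ y <-> z ∈ x \/ z = x);
  zf_separation : forall (phi : formula) (e : nat -> W) (x : W),
    exists y, forall z, z ∈ y <-> z ∈ x /\ sat W (upd e 0 z) phi;
  zf_replacement : forall (phi : formula) (e : nat -> W) (x : W),
    (forall u, u ∈ x -> exists! v, sat W (upd (upd e 0 u) 1 v) phi) ->
    exists y, forall v, v ∈ y <-> exists u, u ∈ x /\ sat W (upd (upd e 0 u) 1 v) phi;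
  zf_choice : forall x : W,
    (forall y, y ∈ x -> exists z, z ∈ y) ->
    (forall y y' z, y ∈ x -> y' ∈ x -> z ∈ y -> z ∈ y' -> y = y') ->
    exists c, forall y, y ∈ x -> exists! z, z ∈ y /\ z ∈ c
}.

(** * Pairs, triples and set functions inside a structure *)

Section Coding.
Variable W : structure.
Implicit Types x y z w f D : W.

Definition is_pair w x y : Prop :=
  exists a b, is_upair a x x /\ is_upair b x y /\ is_upair w a b.

(** [w] is <<x,y>,z>. *)
Definition is_triple w x y z : Prop := exists a, is_pair a x y /\ is_pair w a z.

Definition pair_in x y f : Prop := exists w, is_pair w x y /\ w ∈ f.
Definition triple_in x y z f : Prop := exists w, is_triple w x y z /\ w ∈ f.

Definition function_on f D : Prop := forall x, x ∈ D -> exists! y, pair_in x y f.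

Definition transitive_set x : Prop := forall y, y ∈ x -> subset y x.
Definition ordinal x : Prop :=
  transitive_set x /\ forall y, y ∈ x -> transitive_set y.

End Coding.
Arguments is_pair {W}. Arguments is_triple {W}.
Arguments pair_in {W}. Arguments triple_in {W}.
Arguments function_on {W}. Arguments transitive_set {W}. Arguments ordinal {W}.

(** * Formulas about posets *)

Declare Scope form_scope.
Delimit Scope form_scope with form.
Bind Scope form_scope with formula.

Definition Imp (phi psi : formula) : formula := Neg (And phi (Neg psi)).
Definition Or (phi psi : formula) : formula := Neg (And (Neg phi) (Neg psi)).
Definition Iff (phi psi : formula) : formula := And (Imp phi psi) (Imp psi phi).
Definition Ex (x : nat) (phi : formula) : formula := Neg (All x (Neg phi)).
Definition AllIn (x a : nat) (phi : formula) : formula := All x (Imp (Mem x a) phi).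
Definition ExIn (x a : nat) (phi : formula) : formula := Ex x (And (Mem x a) phi).

Infix "∧" := And (at level 80, right associativity) : form_scope.
Infix "⟹" := Imp (at level 90, right associativity) : form_scope.
Local Open Scope form_scope.

(** The macros from here to [fForcingEquivalent] bind only variables above all
    their arguments, so no argument is ever captured. *)

Definition fUpair (z x y : nat) : formula :=
  let u := S (max z (max x y)) in
  All u (Iff (Mem u z) (Or (Eq u x) (Eq u y))).

Definition fPair (w x y : nat) : formula :=
  let a := S (max w (max x y)) in let b := S a in
  Ex a (Ex b (fUpair a x x ∧ fUpair b x y ∧ fUpair w a b)).

Definition fTriple (w x y z : nat) : formula :=
  let a := S (max w (max x (max y z))) in
  Ex a (fPair a x y ∧ fPair w a z).

Definition fPairIn (x y f : nat) : formula :=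
  let w := S (max f (max x y)) in
  Ex w (fPair w x y ∧ Mem w f).

(** [l] is a preorder on [P] with largest element [o]. *)
Definition fPreorder (P l o : nat) : formula :=
  let x := S (max P (max l o)) in let y := 1 + x in let z := 2 + x in
  let w := 3 + x in
  AllIn w l (ExIn x P (ExIn y P (fPair w x y))) ∧
  Mem o P ∧
  AllIn x P (fPairIn x x l) ∧
  AllIn x P (AllIn y P (AllIn z P
    (fPairIn x y l ⟹ fPairIn y z l ⟹ fPairIn x z l))) ∧
  AllIn x P (fPairIn x o l).

(** A poset is a triple (P, <=, 1), where, as usual in forcing, <= is a preorder
    with largest element 1. *)
Definition fPoset (c : nat) : formula :=
  let P := 1 + c in let l := 2 + c in let o := 3 + c in
  Ex P (Ex l (Ex o (fTriple c P l o ∧ fPreorder P l o))).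

Definition fTrivialPoset (c : nat) : formula :=
  let P := 1 + c in let l := 2 + c in let o := 3 + c in let x := 4 + c in
  Ex P (Ex l (Ex o (fTriple c P l o ∧ fPreorder P l o ∧ AllIn x P (Eq x o)))).

Definition fFunction (f P Q : nat) : formula :=
  let x := S (max f (max P Q)) in let y := 1 + x in let z := 2 + x in
  let w := 3 + x in
  AllIn w f (ExIn x P (ExIn y Q (fPair w x y))) ∧
  AllIn x P (Ex y (All z (Iff (fPairIn x z f) (Eq z y)))).

Definition fCompatible (P l x y : nat) : formula :=
  let z := S (max (max P l) (max x y)) in
  ExIn z P (fPairIn z x l ∧ fPairIn z y l).

(** [f] is a dense embedding of the poset [c] into the poset [d]. *)
Definition fDenseEmbedding (f c d : nat) : formula :=
  let P := S (max f (max c d)) in let l := 1 + P in let o := 2 + P in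
  let Q := 3 + P in let m := 4 + P in let t := 5 + P in
  let x := 6 + P in let x' := 7 + P in let y := 8 + P in let y' := 9 + P in
  Ex P (Ex l (Ex o (Ex Q (Ex m (Ex t (
    fTriple c P l o ∧ fTriple d Q m t ∧ fFunction f P Q ∧
    AllIn x P (AllIn x' P (AllIn y Q (AllIn y' Q
      (fPairIn x y f ⟹ fPairIn x' y' f ⟹
        ((fPairIn x x' l ⟹ fPairIn y y' m) ∧
         (fCompatible Q m y y' ⟹ fCompatible P l x x')))))) ∧
    AllIn y' Q (ExIn x P (ExIn y Q (fPairIn x y f ∧ fPairIn y y' m))))))))).

(** Forcing equivalence: both posets embed densely into a common one
    (equivalently, their Boolean completions are isomorphic). *)
Definition fForcingEquivalent (c d : nat) : formula :=
  let r := S (max c d) in let f := 1 + r in let g := 2 + r in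
  Ex r (Ex f (Ex g
    (fPoset r ∧ fDenseEmbedding f c r ∧ fDenseEmbedding g d r))).

(** A class of posets is given by a formula [chi] with free variable 0: it
    consists of the posets satisfying [chi].  The inner quantifiers substitute
    the variable [x] for the variable 0. *)
Definition fClass (chi : formula) (x : nat) : formula :=
  let y := S x in
  fPoset x ∧ Ex y (Eq y x ∧ Ex 0 (Eq 0 y ∧ chi)).

Definition fNormal (chi : formula) : formula :=
  All 1 (fTrivialPoset 1 ⟹ fClass chi 1) ∧
  All 1 (All 2 (fPoset 2 ⟹ fClass chi 1 ⟹ fForcingEquivalent 1 2 ⟹ fClass chi 2)).

Local Close Scope form_scope.

Definition is_poset (W : structure) (c : W) : Prop := sat W (fun _ => c) (fPoset 0).

Definition in_class (W : structure) (chi : formula) (c : W) : Prop :=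
  sat W (fun _ => c) (fClass chi 0).

(** * Names and the forcing relation for a poset [c] of [W] *)

(** [W] need not be well-founded from outside, so recursion on names means
    internal recursion: it is expressed by set-sized attempts in [W]. *)

Section Forcing.
Variables (W : structure) (c : W).

Definition cond (p : W) : Prop := exists P l o, is_triple c P l o /\ p ∈ P.
Definition le (p q : W) : Prop := exists P l o, is_triple c P l o /\ pair_in p q l.
Definition top (o : W) : Prop := exists P l, is_triple c P l o.

(** Every element of [D] is a set of pairs <pi,p> with [pi] in [D] and [p] a condition. *)
Definition closed_names (D : W) : Prop :=
  forall sigma w, sigma ∈ D -> w ∈ sigma ->
    exists pi p, is_pair w pi p /\ pi ∈ D /\ cond p.

Definition is_name (tau : W) : Prop := exists D, closed_names D /\ tau ∈ D.

Definition dense_below (p : W) (X : W -> Prop) : Prop :=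
  forall q, le q p -> exists r, le r q /\ X r.

(** One half of the recursion clause for "p forces sigma = tau". *)
Definition eq_half (R p sigma tau : W) : Prop :=
  forall pi s, pair_in pi s sigma ->
    dense_below p (fun q => le q s ->
      exists pi' s', pair_in pi' s' tau /\ le q s' /\ triple_in q pi pi' R).

Definition eq_attempt (D R : W) : Prop :=
  closed_names D /\
  forall p sigma tau, cond p -> sigma ∈ D -> tau ∈ D ->
    (triple_in p sigma tau R <-> eq_half R p sigma tau /\ eq_half R p tau sigma).

Definition forces_eq (p sigma tau : W) : Prop :=
  exists D R, eq_attempt D R /\ sigma ∈ D /\ tau ∈ D /\ triple_in p sigma tau R.

Definition forces_mem (p sigma tau : W) : Prop :=
  dense_below p (fun q =>
    exists pi s, pair_in pi s tau /\ le q s /\ forces_eq q sigma pi).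

Fixpoint forces (p : W) (nu : nat -> W) (phi : formula) : Prop :=
  match phi with
  | Mem x y => forces_mem p (nu x) (nu y)
  | Eq x y => forces_eq p (nu x) (nu y)
  | Neg phi => forall q, le q p -> ~ forces q nu phi
  | And phi psi => forces p nu phi /\ forces p nu psi
  | All x phi => forall tau, is_name tau -> forces p (upd nu x tau) phi
  end.

(** The poset forces [phi] at the names [nu]. *)
Definition forced (nu : nat -> W) (phi : formula) : Prop :=
  forall p, cond p -> forces p nu phi.

(** [tau] is the check name of [x], i.e. { <check y, 1> : y ∈ x }. *)
Definition is_check (x tau : W) : Prop :=
  exists D f,
    transitive_set D /\ function_on f D /\
    (forall y t, y ∈ D -> pair_in y t f ->
      forall w, w ∈ t <->
        exists z u o, z ∈ y /\ pair_in z u f /\ top o /\ is_pair w u o) /\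
    x ∈ D /\ pair_in x tau f.

Definition forced_at (e : nat -> W) (phi : formula) : Prop :=
  forall nu, (forall i, free i phi -> is_check (e i) (nu i)) -> forced nu phi.

(** [x] is the evaluation of the name [tau] by [G], for [c]-names of [W]. *)
Definition is_value (G tau x : W) : Prop :=
  exists D f,
    closed_names D /\ function_on f D /\
    (forall sigma t, sigma ∈ D -> pair_in sigma t f ->
      forall w, w ∈ t <->
        exists pi p, pair_in pi p sigma /\ p ∈ G /\ pair_in pi w f) /\
    tau ∈ D /\ pair_in tau x f.

(** The name [Q] denotes a poset with underlying set [q], order [l] and largest
    element [o] (where [o] is chosen in the domain of [q]), and [i] is the
    two-step iteration, with conditions <p,s> such that [s] is in the domain of
    [q] and [p] forces [s] to be in [q]. *)
Definition is_iteration (Q i : W) : Prop :=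
  exists q l o,
    is_name q /\ is_name l /\
    (exists s, pair_in o s q) /\
    forced (fun k => match k with 0 => Q | 1 => q | 2 => l | _ => o end)
      (fTriple 0 1 2 3) /\
    exists I L t, is_triple i I L t /\
      (forall w, w ∈ I <->
        exists p s, is_pair w p s /\ cond p /\ (exists r, pair_in s r q) /\
          forces_mem p s q) /\
      (forall w, w ∈ L <->
        exists u u' p s p' s', is_pair w u u' /\ u ∈ I /\ u' ∈ I /\
          is_pair u p s /\ is_pair u' p' s' /\ le p p' /\
          forces p (fun k => match k with 0 => s | 1 => s' | _ => l end)
            (fPairIn 0 1 2)) /\
      (exists one, top one /\ is_pair t one o).

(** [G] is a filter on [c] meeting all dense subsets of [c] that lie in [M]. *)
Definition generic (M : W -> Prop) (G : W) : Prop :=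
  (forall p, p ∈ G -> cond p) /\
  (exists p, p ∈ G) /\
  (forall p q, p ∈ G -> le p q -> q ∈ G) /\
  (forall p q, p ∈ G -> q ∈ G -> exists r, r ∈ G /\ le r p /\ le r q) /\
  (forall D, M D ->
    (forall p, p ∈ D -> cond p) ->
    (forall p, cond p -> exists q, q ∈ D /\ le q p) ->
    exists p, p ∈ D /\ p ∈ G).

End Forcing.

(** * Grounds *)

Section Grounds.
Variable W : structure.

Definition inner_model (M : W -> Prop) : Prop :=
  (forall x y, M y -> x ∈ y -> M x) /\
  (forall x, ordinal x -> M x) /\
  ZFC (sub W M).

(** [M[G] = W] for some [G] in [W] generic over [M] for the poset [c] of [M]. *)
Definition extends_to (M : W -> Prop) (c : sub W M) : Prop :=
  is_poset (sub W M) c /\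
  exists G : W, generic W (proj1_sig c) M G /\
    forall x : W, exists tau : sub W M,
      is_name (sub W M) c tau /\ is_value W (proj1_sig c) G (proj1_sig tau) x.

Definition ground (M : W -> Prop) : Prop :=
  inner_model M /\ exists c : sub W M, extends_to M c.

Definition class_ground (chi : formula) (M : W -> Prop) : Prop :=
  inner_model M /\
  exists c : sub W M, in_class (sub W M) chi c /\ extends_to M c.

(** The parameters of [phi] lie in [M], and [phi] holds there. *)
Definition holds_in (M : W -> Prop) (phi : formula) (e : nat -> W) : Prop :=
  exists e' : nat -> sub W M,
    (forall i, free i phi -> proj1_sig (e' i) = e i) /\ sat (sub W M) e' phi.

End Grounds.

(** * Normality, Recurrence Axioms, buttons and the Maximality Principle *)

(** Normality holds in [V], in its grounds, and in all set-generic extensions of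
    grounds ([V] being a ground of itself). *)
Definition normal (V : structure) (chi : formula) : Prop :=
  (forall e : nat -> V, sat V e (fNormal chi)) /\
  (forall M : V -> Prop, ground V M ->
    (forall e : nat -> sub V M, sat (sub V M) e (fNormal chi)) /\
    (forall c : sub V M, is_poset (sub V M) c ->
      forall nu, forced (sub V M) c nu (fNormal chi))).

Section Principles.
Variables (V : structure) (chi : formula) (A : V).

(** A finite tuple of parameters from [A] for [phi] is an assignment of elements
    of [A] to the free variables of [phi]. *)
Definition parameters (phi : formula) (e : nat -> V) : Prop :=
  forall i, free i phi -> e i ∈ A.

Definition RcA : Prop :=
  forall c : V, in_class V chi c ->
  forall phi e, parameters phi e -> forced_at V c e phi ->
    exists M : V -> Prop, ground V M /\ holds_in V M phi e.

Definition RcA_plus : Prop :=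
  forall c : V, in_class V chi c ->
  forall phi e, parameters phi e -> forced_at V c e phi ->
    exists M : V -> Prop, class_ground V chi M /\ holds_in V M phi e.

Definition button (phi : formula) (e : nat -> V) : Prop :=
  exists c : V, in_class V chi c /\
    forall Q, is_name V c Q -> forced V c (fun _ => Q) (fClass chi 0) ->
    forall i, is_iteration V c Q i -> forced_at V i e phi.

Definition MP : Prop :=
  forall phi e, parameters phi e -> button phi e -> sat V e phi.

End Principles.

(* Main.v *)
From Stdlib Require Import Arith Lia List Classical ClassicalEpsilon FunctionalExtensionality PropExtensionality.
From Stdlib Require Cantor.
Require Import Defs.

(** The two kinds of statement in the equivalences are converted into each other as
    follows.

    From recurrence to maximality: if [c] witnesses that [phi] is a button, then [c]
    forces the statement that every poset of the class forces [phi]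
    ([button_forces_all_force]), because a poset of the class in an extension by [c] is
    the value of a name, and forcing with it amounts to forcing with an iteration that
    begins with [c].  By recurrence this statement holds in a ground.  If [V] extends the
    ground by a poset of the class, then [phi] holds in [V].  For an arbitrary ground,
    apply the statement there to the trivial poset: [phi] holds in the ground itself.

    From maximality to recurrence: if [c] forces [phi], then the statement that [phi]
    holds in some ground, for a poset of the class, is a button witnessed by [c]: in the
    extension by an iteration beginning with [c], the extension by [c] is such a ground
    ([iteration_forces_ground]).  Hence the statement holds in [V].  In the second
    equivalence it holds in a ground of [V] only, and speaks of arbitrary grounds; but a
    ground of a ground is a ground ([ground_trans]).

    This requires that the statement be first-order ([ground_statement]), that is, the
    definability of grounds due to Laver and Woodin ([ground_definable]).  As in Hamkins'
    proof, a ground has the cover and approximation properties for sets that are small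
    with respect to a sufficiently large set [I] of the ground, and the initial segments
    of the ground are determined by these properties together with a set [r] of codes
    ([approximation_sub]).  That the class so defined satisfies ZFC must also be said by
    a single formula; given collection, which the class inherits, finitely many instances
    of separation suffice ([ZFC_of_base]).

    As [V] is an arbitrary model, neither countable nor well-founded, filters generic over
    it need not exist.  Yet the claims about the forcing relation are first-order, so it is
    enough to prove them in countable models ([countable_reduction]), where generic
    filters exist and what is true in all extensions is forced ([forces_by_extensions]).
    The two ways of seeing a two-step extension are compared by [compose_grounds] and
    [decompose_ground]; in both directions the submodel generated by one filter is shown to
    contain the others. *)


(** * Formulas: renaming and definable families of relations *)

Fixpoint ren (f : nat -> nat) (phi : formula) : formula :=
  match phi with
  | Mem x y => Mem (f x) (f y)
  | Eq x y => Eq (f x) (f y)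
  | Neg phi => Neg (ren f phi)
  | And phi psi => And (ren f phi) (ren f psi)
  | All x phi => All (f x) (ren f phi)
  end.

Fixpoint bnd (phi : formula) : nat :=
  match phi with
  | Mem x y | Eq x y => S (max x y)
  | Neg phi => bnd phi
  | And phi psi => max (bnd phi) (bnd psi)
  | All x phi => max (S x) (bnd phi)
  end.

Lemma free_bnd phi i : free i phi -> i < bnd phi.
Proof.
  induction phi; cbn [free bnd]; intros H; try lia; auto.
  - destruct H as [H|H]; [apply IHphi1 in H|apply IHphi2 in H]; lia.
  - destruct H as [_ H]. apply IHphi in H. lia.
Qed.

Lemma upd_eq {T} (e : nat -> T) x a : upd e x a x = a.
Proof. unfold upd. now rewrite Nat.eqb_refl. Qed.

Lemma upd_ne {T} (e : nat -> T) x a i : i <> x -> upd e x a i = e i.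
Proof. unfold upd. intros H. apply Nat.eqb_neq in H. now rewrite H. Qed.

Lemma sat_ext (W : structure) phi : forall e e' : nat -> W,
  (forall i, free i phi -> e i = e' i) -> (sat W e phi <-> sat W e' phi).
Proof.
  induction phi; simpl; intros e e' H.
  - rewrite (H x), (H y); tauto.
  - rewrite (H x), (H y); tauto.
  - rewrite (IHphi e e'); auto. tauto.
  - rewrite (IHphi1 e e'), (IHphi2 e e'); auto. tauto.
  - split; intros H1 a; [rewrite <- (IHphi (upd e x a))|rewrite (IHphi _ (upd e' x a))]; auto;
    intros i Hi; unfold upd; destruct (Nat.eqb_spec i x); auto.
Qed.

Lemma sat_ren (W : structure) f b phi : bnd phi <= b ->
  (forall x y, x < b -> y < b -> f x = f y -> x = y) ->
  forall e : nat -> W, sat W e (ren f phi) <-> sat W (fun i => e (f i)) phi.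
Proof.
  intros Hb Hf. induction phi; cbn [ren sat bnd] in *; intros e; try tauto.
  - rewrite IHphi by lia. tauto.
  - rewrite IHphi1, IHphi2 by lia. tauto.
  - assert (E : forall a, sat W (upd e (f x) a) (ren f phi) <->
                          sat W (upd (fun i => e (f i)) x a) phi).
    { intros a. rewrite IHphi by lia. apply sat_ext. intros i Hi.
      apply free_bnd in Hi. unfold upd. destruct (Nat.eqb_spec i x) as [->|n].
      - now rewrite Nat.eqb_refl.
      - destruct (Nat.eqb_spec (f i) (f x)) as [E|]; auto.
        apply Hf in E; lia. }
    split; intros H a; apply E, H.
Qed.

Definition scons {T : Type} (a : T) (e : nat -> T) : nat -> T :=
  fun n => match n with 0 => a | S n => e n end.

Fixpoint cat {T : Type} (l : list T) (e : nat -> T) : nat -> T :=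
  match l with nil => e | a :: l => scons a (cat l e) end.

Lemma cat_ge {T} (l : list T) e n : cat l e (length l + n) = e n.
Proof. induction l; simpl; auto. Qed.

Lemma cat_lt {T} (l : list T) e e' n : n < length l -> cat l e n = cat l e' n.
Proof.
  revert n; induction l; simpl; intros n Hn; [lia|].
  destruct n; simpl; auto. apply IHl; lia.
Qed.

Lemma cat_app {T} (l l' : list T) e : cat (l ++ l') e = cat l (cat l' e).
Proof. induction l; simpl; congruence. Qed.

Lemma cat_app_ge {T} (l l' : list T) e n : cat (l ++ l') e (length l + n) = cat l' e n.
Proof. now rewrite cat_app, cat_ge. Qed.

(** A relation between environments is definable over a whole family of structures
    at once when a single formula expresses it in all of them.  Constants from a
    prescribed set [K] may be put in front of the environment: taking one structure
    and all its elements gives definability with parameters, taking all structures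
    and no constants gives plain formulas. *)
Section Definability.
Variables (I : Type) (S : I -> structure) (K : (forall i, S i) -> Prop).

Definition dfn (R : forall i, (nat -> S i) -> Prop) : Prop :=
  exists (l : list (forall i, S i)) (phi : formula),
    (forall c, In c l -> K c) /\
    forall i e, R i e <-> sat (S i) (cat (map (fun c => c i) l) e) phi.

Definition tm (t : forall i, (nat -> S i) -> S i) : Prop :=
  dfn (fun i e => e 0 = t i (fun n => e (Datatypes.S n))).

Lemma dfn_iff (R R' : forall i, (nat -> S i) -> Prop) :
  (forall i e, R i e <-> R' i e) -> dfn R -> dfn R'.
Proof.
  intros H (l & phi & Hl & HR). exists l, phi. split; auto.
  intros i e. rewrite <- H. apply HR.
Qed.

Lemma dfn_not R : dfn R -> dfn (fun i e => ~ R i e).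
Proof.
  intros (l & phi & Hl & HR). exists l, (Neg phi). split; auto.
  intros i e. simpl. now rewrite HR.
Qed.

(** The constants of the two formulas are concatenated, so their variables have to be
    renamed apart. *)
Lemma dfn_and R R' : dfn R -> dfn R' -> dfn (fun i e => R i e /\ R' i e).
Proof.
  intros (l & phi & Hl & HR) (l' & phi' & Hl' & HR').
  set (f := fun n => if n <? length l then n else n + length l').
  exists (l ++ l'), (And (ren f phi) (ren (fun n => length l + n) phi')).
  split. { intros c Hc. apply in_app_or in Hc. destruct Hc; auto. }
  intros i e. simpl. rewrite HR, HR'.
  rewrite (sat_ren _ f _ _ (le_n _)), (sat_ren _ (fun n => length l + n) _ _ (le_n _)).
  - rewrite map_app.
    assert (E1 : (fun n => cat (map (fun c => c i) l ++ map (fun c => c i) l') e (f n))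
                 = cat (map (fun c => c i) l) e).
    { extensionality n. unfold f. destruct (Nat.ltb_spec n (length l)).
      - rewrite cat_app. apply cat_lt. now rewrite length_map.
      - replace (n + length l') with
          (length (map (fun c : forall i, S i => c i) l) +
           (length (map (fun c : forall i, S i => c i) l') + (n - length l)))
          by (rewrite !length_map; lia).
        rewrite cat_app_ge, cat_ge.
        replace n with (length (map (fun c : forall i, S i => c i) l) + (n - length l)) at 2
          by (rewrite !length_map; lia).
        now rewrite cat_ge. }
    assert (E2 : (fun n => cat (map (fun c => c i) l ++ map (fun c => c i) l') e (length l + n))
                 = cat (map (fun c => c i) l') e).
    { extensionality n.
      replace (length l) with (length (map (fun c : forall i, S i => c i) l))
        by now rewrite length_map.
      apply cat_app_ge. }
    rewrite E1, E2. tauto.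
  - intros; lia.
  - intros x y _ _. unfold f.
    destruct (Nat.ltb_spec x (length l)), (Nat.ltb_spec y (length l)); lia.
Qed.

(** The new variable sits right after the constants and is moved to a number above the
    bound of the formula, where a quantifier captures nothing else. *)
Lemma dfn_all (R : forall i, (nat -> S i) -> S i -> Prop) :
  dfn (fun i e => R i (fun n => e (Datatypes.S n)) (e 0)) ->
  dfn (fun i e => forall x, R i e x).
Proof.
  intros (l & phi & Hl & HR).
  set (k := length l). set (m := k + Datatypes.S (bnd phi)).
  set (f := fun n => if n <? k then n else if n =? k then m else n - 1).
  exists l, (All m (ren f phi)). split; auto.
  intros i e. simpl.
  assert (E : forall a, R i e a <->
     sat (S i) (upd (cat (map (fun c => c i) l) e) m a) (ren f phi)).
  { intros a. specialize (HR i (scons a e)). simpl in HR.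
    change (fun n => e n) with e in HR. rewrite HR.
    rewrite (sat_ren _ f (bnd phi) _ (le_n _)).
    - apply sat_ext. intros n Hn. apply free_bnd in Hn. unfold f.
      destruct (Nat.ltb_spec n k) as [H|H].
      + rewrite upd_ne by lia. apply cat_lt. now rewrite length_map.
      + destruct (Nat.eqb_spec n k) as [->|H'].
        * rewrite upd_eq.
          replace k with (length (map (fun c : forall i, S i => c i) l) + 0)
            by (rewrite length_map; unfold k; lia).
          now rewrite cat_ge.
        * rewrite upd_ne by lia.
          replace n with (length (map (fun c : forall i, S i => c i) l) + (n - k)) at 1
            by (rewrite length_map; unfold k in *; lia).
          replace (n - 1) with (length (map (fun c : forall i, S i => c i) l) + (n - k - 1))
            by (rewrite length_map; unfold k in *; lia).
          rewrite !cat_ge. destruct (n - k) eqn:En; simpl; [lia|].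
          now rewrite Nat.sub_0_r.
    - intros x y Hx Hy. unfold f.
      destruct (Nat.ltb_spec x k), (Nat.ltb_spec y k),
        (Nat.eqb_spec x k), (Nat.eqb_spec y k); lia. }
  split; intros H a; apply E, H.
Qed.

Lemma dfn_ex (R : forall i, (nat -> S i) -> S i -> Prop) :
  dfn (fun i e => R i (fun n => e (Datatypes.S n)) (e 0)) ->
  dfn (fun i e => exists x, R i e x).
Proof.
  intros H. apply dfn_iff with (fun i e => ~ forall x, ~ R i e x).
  - intros i e. split.
    + intros H'. apply not_all_not_ex. exact H'.
    + intros [x Hx] H'. exact (H' x Hx).
  - apply dfn_not. apply (dfn_all (fun i e x => ~ R i e x)). now apply dfn_not.
Qed.

Lemma dfn_or R R' : dfn R -> dfn R' -> dfn (fun i e => R i e \/ R' i e).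
Proof.
  intros H H'. apply dfn_iff with (fun i e => ~ (~ R i e /\ ~ R' i e)).
  - intros. tauto.
  - apply dfn_not, dfn_and; now apply dfn_not.
Qed.

Lemma dfn_imp R R' : dfn R -> dfn R' -> dfn (fun i e => R i e -> R' i e).
Proof.
  intros H H'. apply dfn_iff with (fun i e => ~ (R i e /\ ~ R' i e)).
  - intros. tauto.
  - apply dfn_not, dfn_and; auto. now apply dfn_not.
Qed.

Lemma dfn_iffP R R' : dfn R -> dfn R' -> dfn (fun i e => R i e <-> R' i e).
Proof. intros H H'. apply dfn_and; apply dfn_imp; auto. Qed.

Lemma dfn_shift R f : (forall n m : nat, f n = f m -> n = m) ->
  dfn R -> dfn (fun i e => R i (fun n => e (f n))).
Proof.
  intros Hf (l & phi & Hl & HR).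
  set (k := length l). set (g := fun n => if n <? k then n else k + f (n - k)).
  exists l, (ren g phi). split; auto. intros i e.
  rewrite HR, (sat_ren _ g (bnd phi) _ (le_n _)).
  - apply sat_ext. intros n _. unfold g. destruct (Nat.ltb_spec n k).
    + apply cat_lt. now rewrite length_map.
    + replace n with (length (map (fun c : forall i, S i => c i) l) + (n - k)) at 1
        by (rewrite length_map; unfold k in *; lia).
      replace k with (length (map (fun c : forall i, S i => c i) l)) at 2
        by (rewrite length_map; auto).
      now rewrite !cat_ge.
  - intros x y _ _. unfold g.
    destruct (Nat.ltb_spec x k), (Nat.ltb_spec y k); try lia.
    intros E. assert (x - k = y - k) by (apply Hf; lia). lia.
Qed.

Lemma tm_var k : tm (fun i e => e k).
Proof.
  exists nil, (Eq 0 (Datatypes.S k)). split; [intros c []|]. intros; simpl; tauto.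
Qed.

Lemma tm_const c : K c -> tm (fun i _ => c i).
Proof.
  intros Hc. exists (c :: nil), (Eq 1 0). split; [intros d [<-|[]]; auto|].
  intros; simpl; tauto.
Qed.

Lemma tm_tail t : tm t -> tm (fun i e => t i (fun n => e (Datatypes.S n))).
Proof.
  intros H. unfold tm in *.
  apply (dfn_shift _ (fun n => match n with 0 => 0 | _ => Datatypes.S n end)) in H; auto.
  intros [|n] [|m]; lia.
Qed.

Lemma dfn_base (B : forall i, S i -> S i -> Prop) t u :
  dfn (fun i e => B i (e 1) (e 0)) -> tm t -> tm u -> dfn (fun i e => B i (t i e) (u i e)).
Proof.
  intros HB Ht Hu.
  apply dfn_iff with
    (fun i e => exists x, x = t i e /\ exists y, y = u i e /\ B i x y).
  - intros i e. split; [intros (x & -> & y & -> & H)|]; eauto.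
  - apply (dfn_ex (fun i e x => x = t i e /\ exists y, y = u i e /\ B i x y)).
    apply dfn_and; auto.
    apply (dfn_ex (fun i e y => y = u i (fun n => e (Datatypes.S n)) /\ B i (e 0) y)).
    apply dfn_and; [now apply (tm_tail u)|exact HB].
Qed.

Lemma dfn_mem t u : tm t -> tm u -> dfn (fun i e => t i e ∈ u i e).
Proof.
  apply (dfn_base (fun i x y => x ∈ y)).
  exists nil, (Mem 1 0). split; [intros c []|]. simpl; tauto.
Qed.

Lemma dfn_eq t u : tm t -> tm u -> dfn (fun i e => t i e = u i e).
Proof.
  apply (dfn_base (fun i x y => x = y)).
  exists nil, (Eq 1 0). split; [intros c []|]. simpl; tauto.
Qed.

Lemma dfn_sat phi : forall t : nat -> forall i, (nat -> S i) -> S i,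
  (forall n, tm (t n)) -> dfn (fun i e => sat (S i) (fun n => t n i e) phi).
Proof.
  induction phi; simpl; intros t Ht.
  - now apply dfn_mem.
  - now apply dfn_eq.
  - apply dfn_not; auto.
  - apply dfn_and; auto.
  - apply (dfn_all (fun i e a => sat (S i) (upd (fun n => t n i e) x a) phi)).
    apply dfn_iff with (fun i e => sat (S i)
      (fun n => (fun n i e => if n =? x then e 0 else t n i (fun n => e (Datatypes.S n))) n i e) phi).
    + intros. apply sat_ext. reflexivity.
    + apply IHphi. intros n. destruct (n =? x); [apply tm_var|now apply tm_tail].
Qed.

(** Terms are substituted for all variables at once, which the closure properties below
    need when binders shift the environment. *)
Lemma dfn_comp R (t : nat -> forall i, (nat -> S i) -> S i) :
  dfn R -> (forall n, tm (t n)) -> dfn (fun i e => R i (fun n => t n i e)).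
Proof.
  intros (l & phi & Hl & HR) Ht.
  apply dfn_iff with (fun i e => sat (S i) (fun k =>
     (fun k i e => cat (map (fun c : forall i, S i => c i) l) (fun n => t n i e) k) k i e) phi).
  - intros. symmetry. apply HR.
  - apply dfn_sat. intros n.
    destruct (le_lt_dec (length l) n) as [H|H].
    + unfold tm. apply dfn_iff with (2 := Ht (n - length l)). intros i e.
      replace n with (length (map (fun c : forall i, S i => c i) l) + (n - length l)) at 2
        by (rewrite length_map; lia).
      now rewrite cat_ge.
    + destruct (nth_error l n) as [c|] eqn:E.
      2:{ apply nth_error_None in E. lia. }
      assert (Hc : K c) by (apply Hl; eapply nth_error_In; eauto).
      unfold tm. apply dfn_iff with (2 := tm_const c Hc). intros i e.
      assert (Hn : forall v, cat (map (fun c : forall i, S i => c i) l) v n = c i).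
      { intros v. clear -E. revert n E. induction l; intros [|n]; simpl; intros; try discriminate.
        - congruence.
        - auto. }
      now rewrite Hn.
Qed.

Lemma tm_comp u (t : nat -> forall i, (nat -> S i) -> S i) :
  tm u -> (forall n, tm (t n)) -> tm (fun i e => u i (fun n => t n i e)).
Proof.
  intros Hu Ht. unfold tm in *.
  apply (dfn_comp _ (fun n => match n with 0 => fun i e => e 0
     | Datatypes.S n => fun i e => t n i (fun n => e (Datatypes.S n)) end)) in Hu.
  - exact Hu.
  - intros [|n]; [apply tm_var|exact (tm_tail _ (Ht n))].
Qed.

Lemma tm_ren u (f : nat -> nat) : tm u -> tm (fun i e => u i (fun n => e (f n))).
Proof. intros Hu. apply (tm_comp u (fun n i e => e (f n))); auto. intros; apply tm_var. Qed.

Lemma dfn_ren R (f : nat -> nat) : dfn R -> dfn (fun i e => R i (fun n => e (f n))).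
Proof. intros Hu. apply (dfn_comp R (fun n i e => e (f n))); auto. intros; apply tm_var. Qed.

Lemma dfn_app1 (P : forall i, S i -> Prop) t :
  dfn (fun i e => P i (e 0)) -> tm t -> dfn (fun i e => P i (t i e)).
Proof. intros H Ht. now apply (dfn_comp _ (fun _ => t)) in H. Qed.

Lemma dfn_app2 (P : forall i, S i -> S i -> Prop) t u :
  dfn (fun i e => P i (e 0) (e 1)) -> tm t -> tm u -> dfn (fun i e => P i (t i e) (u i e)).
Proof.
  intros H Ht Hu.
  apply (dfn_comp _ (fun n => match n with 0 => t | _ => u end)) in H; auto.
  intros [|n]; auto.
Qed.

Lemma dfn_app3 (P : forall i, S i -> S i -> S i -> Prop) t u v :
  dfn (fun i e => P i (e 0) (e 1) (e 2)) -> tm t -> tm u -> tm v ->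
  dfn (fun i e => P i (t i e) (u i e) (v i e)).
Proof.
  intros H Ht Hu Hv.
  apply (dfn_comp _ (fun n => match n with 0 => t | 1 => u | _ => v end)) in H; auto.
  intros [|[|n]]; auto.
Qed.


Lemma dfn_const (P : Prop) : dfn (fun i e => P).
Proof.
  destruct (classic P) as [H|H].
  - exists nil, (All 0 (Eq 0 0)). split; [intros c []|]. simpl. tauto.
  - exists nil, (Neg (All 0 (Eq 0 0))). split; [intros c []|]. simpl.
    intros i e. split; [tauto|]. intros H'. exfalso. apply H'. reflexivity.
Qed.

Lemma dfn_unique (R : forall i, (nat -> S i) -> S i -> Prop) :
  dfn (fun i e => R i (fun n => e (Datatypes.S n)) (e 0)) ->
  dfn (fun i e => exists! x, R i e x).
Proof.
  intros H. unfold unique. apply (dfn_ex (fun i e x => R i e x /\ forall x', R i e x' -> x = x')).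
  apply dfn_and; auto.
  apply (dfn_all (fun i e x' => R i (fun n => e (Datatypes.S n)) x' -> e 0 = x')).
  apply dfn_imp.
  - apply (dfn_ren _ (fun n => match n with 0 => 0 | _ => Datatypes.S n end)) in H; auto.
  - apply dfn_eq; apply tm_var.
Qed.

End Definability.
Arguments dfn {I S} K R. Arguments tm {I S} K t.

(** Redefined after each group of new notions, so that [dfn_tac] proves definability of
    whatever is built from the notions introduced so far. *)
Ltac dfn_ext := fail.

Ltac tm_tac :=
  first [ eassumption
        | apply tm_var
        | apply (tm_const _ _ (fun _ => True) (fun _ => _)); exact Logic.I
        | match goal with H : tm ?K ?t |- tm ?K _ =>
            first [exact H | refine (tm_ren _ _ _ t _ H) ] end
        | dfn_ext; tm_tac ].

Ltac dfn_tac :=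
  cbv beta;
  first
  [ eassumption
  | apply dfn_const
  | lazymatch goal with
    | |- tm _ _ => tm_tac
    | |- dfn _ (fun i e => _ /\ _) => apply dfn_and
    | |- dfn _ (fun i e => _ \/ _) => apply dfn_or
    | |- dfn _ (fun i e => ~ _) => apply dfn_not
    | |- dfn _ (fun i e => _ <-> _) => apply dfn_iffP
    | |- dfn _ (fun i e => exists! x, _) => apply dfn_unique
    | |- dfn _ (fun i e => exists x, _) => apply dfn_ex
    | |- dfn _ (fun i e => _ ∈ _) => apply dfn_mem
    | |- dfn _ (fun i e => _ = _) => apply dfn_eq
    end
  | dfn_ext
  | lazymatch goal with
    | |- dfn _ (fun i e => forall x, _) => first [apply dfn_imp | apply dfn_all]
    end ];
  try dfn_tac.


(** ** The basic notions are definable in every family of structures *)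
Section BasicNotions.
Variables (I : Type) (S : I -> structure) (K : (forall i, S i) -> Prop).
Local Notation D := (@dfn I S K). Local Notation T := (@tm I S K).

Section Terms.
Variables (a b c d f : forall i, (nat -> S i) -> S i).
Hypotheses (ha : T a) (hb : T b) (hc : T c) (hd : T d) (hf : T f).

Lemma dfn_subset : D (fun i e => subset (a i e) (b i e)).
Proof. unfold subset. dfn_tac. Qed.
Lemma dfn_is_upair : D (fun i e => is_upair (a i e) (b i e) (c i e)).
Proof. unfold is_upair. dfn_tac. Qed.
Lemma dfn_is_pair : D (fun i e => is_pair (a i e) (b i e) (c i e)).
Proof. unfold is_pair, is_upair. dfn_tac. Qed.
Lemma dfn_is_triple : D (fun i e => is_triple (a i e) (b i e) (c i e) (d i e)).
Proof. unfold is_triple, is_pair, is_upair. dfn_tac. Qed.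
Lemma dfn_pair_in : D (fun i e => pair_in (a i e) (b i e) (c i e)).
Proof. unfold pair_in, is_pair, is_upair. dfn_tac. Qed.
Lemma dfn_triple_in : D (fun i e => triple_in (a i e) (b i e) (c i e) (d i e)).
Proof. unfold triple_in, is_triple, is_pair, is_upair. dfn_tac. Qed.
Lemma dfn_transitive_set : D (fun i e => transitive_set (a i e)).
Proof. unfold transitive_set, subset. dfn_tac. Qed.
Lemma dfn_ordinal : D (fun i e => ordinal (a i e)).
Proof. unfold ordinal, transitive_set, subset. dfn_tac. Qed.
Lemma dfn_function_on : D (fun i e => function_on (a i e) (b i e)).
Proof. unfold function_on, pair_in, is_pair, is_upair. dfn_tac. Qed.
End Terms.
End BasicNotions.

Ltac dfn_ext1 := first
  [ apply dfn_subset | apply dfn_is_upair | apply dfn_is_pair | apply dfn_is_triple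
  | apply dfn_pair_in | apply dfn_triple_in | apply dfn_transitive_set
  | apply dfn_ordinal | apply dfn_function_on ].
Ltac dfn_ext ::= dfn_ext1.

Section ForcingNotions.
Variables (I : Type) (S : I -> structure) (K : (forall i, S i) -> Prop).
Local Notation D := (@dfn I S K). Local Notation T := (@tm I S K).

Lemma dfn_finite (P : nat -> Prop) b (R : nat -> forall i, (nat -> S i) -> Prop) :
  (forall k, P k -> k < b) -> (forall k, D (R k)) ->
  D (fun i e => forall k, P k -> R k i e).
Proof.
  intros HP HR. revert P HP. induction b; intros P HP.
  - apply dfn_iff with (fun _ _ => True); [|apply dfn_const].
    intros i e. split; auto. intros _ k Hk. apply HP in Hk. lia.
  - apply dfn_iff with (fun i e => (P b -> R b i e) /\ forall k, (P k /\ k < b) -> R k i e).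
    + intros i e. split.
      * intros [H1 H2] k Hk. specialize (HP k Hk).
        destruct (Nat.eq_dec k b) as [->|n]; auto. apply H2. split; auto. lia.
      * intros H. split; auto. intros k [Hk _]. auto.
    + apply dfn_and.
      * apply dfn_imp; auto. apply dfn_const.
      * apply IHb. intros k [_ H]; auto.
Qed.

(** A quantifier over infinite environments is a finite block of quantifiers when only
    finitely many entries matter; this makes [forced_at] definable. *)
Lemma dfn_all_env (R : forall i, (nat -> S i) -> (nat -> S i) -> Prop) b :
  (forall i e nu nu', (forall k, k < b -> nu k = nu' k) -> R i e nu -> R i e nu') ->
  (forall t : nat -> forall i, (nat -> S i) -> S i, (forall n, T (t n)) ->
     forall f, D (fun i e => R i (fun n => e (f n)) (fun n => t n i e))) ->
  D (fun i e => forall nu, R i e nu).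
Proof.
  intros Hb HR.
  assert (H : forall k, k <= b -> forall t : nat -> forall i, (nat -> S i) -> S i,
      (forall n, T (t n)) -> forall f : nat -> nat,
      D (fun i e => forall nu, (forall n, k <= n -> n < b -> nu n = t n i e) ->
                      R i (fun n => e (f n)) nu)).
  { induction k; intros Hk t Ht f.
    - apply dfn_iff with (2 := HR t Ht f). intros i e. split.
      + intros H nu Hnu. eapply Hb; [|exact H]. intros k Hk'. symmetry. apply Hnu; lia.
      + intros H. apply H. auto.
    - apply dfn_iff with (fun i e => forall x, forall nu,
        (forall n, k <= n -> n < b -> nu n = upd (fun n => t n i e) k x n) ->
        R i (fun n => e (f n)) nu).
      + intros i e. split.
        * intros H nu Hnu. apply (H (nu k)). intros n H1 H2.
          unfold upd. destruct (Nat.eqb_spec n k) as [->|]; auto. apply Hnu; lia.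
        * intros H x nu Hnu. apply H. intros n H1 H2. rewrite Hnu by lia.
          rewrite upd_ne by lia. reflexivity.
      + apply (dfn_all _ _ _ (fun i e x => forall nu, (forall n, k <= n -> n < b ->
           nu n = upd (fun n => t n i e) k x n) -> R i (fun n => e (f n)) nu)).
        apply dfn_iff with (2 := IHk (Nat.le_trans _ _ _ (Nat.le_succ_diag_r k) Hk)
          (fun n i e => if n =? k then e 0 else t n i (fun n => e (Datatypes.S n)))
          (fun n => if n =? k as b0 return T (fun i e => if b0 then e 0 else
             t n i (fun n => e (Datatypes.S n)))
             then tm_var _ _ _ 0 else tm_ren _ _ _ _ Datatypes.S (Ht n))
          (fun n => Datatypes.S (f n))).
        reflexivity. }
  apply dfn_iff with (2 := H b (le_n _) (fun _ i e => e 0) (fun _ => tm_var _ _ _ 0) (fun n => n)).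
  intros i e. split; intros H' nu; [apply H'; intros; lia|intros _; apply H'].
Qed.

Section Terms.
Variables (a b c d f g : forall i, (nat -> S i) -> S i).
Hypotheses (ha : T a) (hb : T b) (hc : T c) (hd : T d) (hf : T f) (hg : T g).

Lemma dfn_cond : D (fun i e => cond (S i) (a i e) (b i e)).
Proof. unfold cond. dfn_tac. Qed.
Lemma dfn_le : D (fun i e => le (S i) (a i e) (b i e) (c i e)).
Proof. unfold le. dfn_tac. Qed.
Lemma dfn_top : D (fun i e => top (S i) (a i e) (b i e)).
Proof. unfold top. dfn_tac. Qed.
End Terms.

End ForcingNotions.

Ltac dfn_ext2 := first [ dfn_ext1 | apply dfn_cond | apply dfn_le | apply dfn_top ].
Ltac dfn_ext ::= dfn_ext2.

Section ForcingNotions2.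
Variables (I : Type) (S : I -> structure) (K : (forall i, S i) -> Prop).
Local Notation D := (@dfn I S K). Local Notation T := (@tm I S K).

Section Terms.
Variables (a b c d f g : forall i, (nat -> S i) -> S i).
Hypotheses (ha : T a) (hb : T b) (hc : T c) (hd : T d) (hf : T f) (hg : T g).
Lemma dfn_closed_names : D (fun i e => closed_names (S i) (a i e) (b i e)).
Proof. unfold closed_names. dfn_tac. Qed.
Lemma dfn_is_name : D (fun i e => is_name (S i) (a i e) (b i e)).
Proof. unfold is_name, closed_names. dfn_tac. Qed.
Lemma dfn_forces_eq : D (fun i e => forces_eq (S i) (a i e) (b i e) (c i e) (d i e)).
Proof. unfold forces_eq, eq_attempt, eq_half, dense_below, closed_names. dfn_tac. Qed.
End Terms.

Section Terms.
Variables (a b c d f g : forall i, (nat -> S i) -> S i).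
Hypotheses (ha : T a) (hb : T b) (hc : T c) (hd : T d) (hf : T f) (hg : T g).
Lemma dfn_forces_mem : D (fun i e => forces_mem (S i) (a i e) (b i e) (c i e) (d i e)).
Proof.
  unfold forces_mem, dense_below. dfn_tac. apply dfn_forces_eq; dfn_tac.
Qed.
Lemma dfn_is_check : D (fun i e => is_check (S i) (a i e) (b i e) (c i e)).
Proof. unfold is_check. dfn_tac. Qed.
Lemma dfn_is_value : D (fun i e => is_value (S i) (a i e) (b i e) (c i e) (d i e)).
Proof. unfold is_value, closed_names. dfn_tac. Qed.
End Terms.

Lemma dfn_forces phi : forall c p, T c -> T p ->
  forall t : nat -> forall i, (nat -> S i) -> S i, (forall n, T (t n)) ->
  D (fun i e => forces (S i) (c i e) (p i e) (fun n => t n i e) phi).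
Proof.
  induction phi; cbn [forces]; intros c p hc hp t ht.
  - apply dfn_forces_mem; auto.
  - apply dfn_forces_eq; auto.
  - dfn_tac. apply (IHphi (fun i e => c i (fun n => e (Datatypes.S n))) (fun i e => e 0)
      (tm_ren _ _ _ _ _ hc) (tm_var _ _ _ _) (fun n i e => t n i (fun n => e (Datatypes.S n)))).
    intros n. apply (tm_ren _ _ _ _ _ (ht n)).
  - apply dfn_and; auto.
  - dfn_tac. { apply dfn_is_name; dfn_tac. }
    apply (IHphi (fun i e => c i (fun n => e (Datatypes.S n)))
      (fun i e => p i (fun n => e (Datatypes.S n)))
      (tm_ren _ _ _ _ _ hc) (tm_ren _ _ _ _ _ hp)
      (fun n i e => if n =? x then e 0 else t n i (fun n => e (Datatypes.S n)))).
    intros n. destruct (n =? x); [apply tm_var|apply (tm_ren _ _ _ _ _ (ht n))].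
Qed.

Lemma dfn_forced phi c (t : nat -> forall i, (nat -> S i) -> S i) :
  T c -> (forall n, T (t n)) ->
  D (fun i e => forced (S i) (c i e) (fun n => t n i e) phi).
Proof.
  intros hc ht. unfold forced. dfn_tac.
  apply (dfn_forces phi (fun i e => c i (fun n => e (Datatypes.S n))) (fun i e => e 0)
      (tm_ren _ _ _ _ _ hc) (tm_var _ _ _ _) (fun n i e => t n i (fun n => e (Datatypes.S n)))).
  intros n. apply (tm_ren _ _ _ _ _ (ht n)).
Qed.

Lemma dfn_in_class chi c : T c -> D (fun i e => in_class (S i) chi (c i e)).
Proof. intros hc. unfold in_class. apply (dfn_sat _ _ _ (fClass chi 0) (fun _ => c)); auto. Qed.
Lemma dfn_is_poset c : T c -> D (fun i e => is_poset (S i) (c i e)).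
Proof. intros hc. unfold is_poset. apply (dfn_sat _ _ _ (fPoset 0) (fun _ => c)); auto. Qed.

End ForcingNotions2.

Lemma forces_ext W c phi : forall p nu nu', (forall i, free i phi -> nu i = nu' i) ->
  (forces W c p nu phi <-> forces W c p nu' phi).
Proof.
  induction phi; cbn [forces free]; intros p nu nu' H.
  - rewrite (H x), (H y); tauto.
  - rewrite (H x), (H y); tauto.
  - split; intros H1 q Hq; specialize (H1 q Hq); erewrite IHphi; eauto; intros; symmetry; auto.
  - erewrite IHphi1, IHphi2; [reflexivity|auto..].
  - split; intros H1 tau Ht; specialize (H1 tau Ht);
      (erewrite IHphi; [exact H1|]); intros i Hi; unfold upd;
      destruct (Nat.eqb_spec i x); auto; symmetry; auto.
Qed.

Lemma forced_ext W c phi nu nu' : (forall i, free i phi -> nu i = nu' i) ->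
  forced W c nu phi -> forced W c nu' phi.
Proof. intros H F p Hp. erewrite <- forces_ext; eauto. Qed.

Section ForcingNotions3.
Variables (I : Type) (S : I -> structure) (K : (forall i, S i) -> Prop).
Local Notation D := (@dfn I S K). Local Notation T := (@tm I S K).

Lemma dfn_forced_at phi c (t : nat -> forall i, (nat -> S i) -> S i) :
  T c -> (forall n, T (t n)) ->
  D (fun i e => forced_at (S i) (c i e) (fun n => t n i e) phi).
Proof.
  intros hc ht. unfold forced_at.
  apply (dfn_all_env _ _ _ (fun i e nu => (forall k, free k phi ->
      is_check (S i) (c i e) (t k i e) (nu k)) -> forced (S i) (c i e) nu phi) (bnd phi)).
  - intros i e nu nu' E H H'. eapply forced_ext with nu.
    + intros k Hk. apply E. now apply free_bnd.
    + apply H. intros k Hk. rewrite E by now apply free_bnd. auto.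
  - intros u hu f. apply dfn_imp.
    + apply (dfn_finite _ _ _ (fun k => free k phi) (bnd phi)).
      * apply free_bnd.
      * intros k. apply dfn_is_check; auto; [apply (tm_ren _ _ _ _ _ hc)|apply (tm_ren _ _ _ _ _ (ht k))].
    + apply (dfn_forced _ _ _ phi (fun i e => c i (fun n => e (f n))) u); auto.
      apply (tm_ren _ _ _ _ _ hc).
Qed.
End ForcingNotions3.


Ltac dfn_ext3 := first
  [ dfn_ext2 | apply dfn_closed_names | apply dfn_is_name | apply dfn_forces_eq
  | apply dfn_forces_mem | apply dfn_is_check | apply dfn_is_value
  | apply dfn_in_class | apply dfn_is_poset
  | match goal with
    | |- dfn _ (fun i e => forces _ (@?c i e) (@?p i e) (fun k => @?u k i e) ?phi) =>
        apply (dfn_forces _ _ _ phi c p) with (t := fun k i e => u k i e)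
    | |- dfn _ (fun i e => forced _ (@?c i e) (fun k => @?u k i e) ?phi) =>
        apply (dfn_forced _ _ _ phi c) with (t := fun k i e => u k i e)
    | |- dfn _ (fun i e => forced_at _ (@?c i e) (fun k => @?u k i e) ?phi) =>
        apply (dfn_forced_at _ _ _ phi c) with (t := fun k i e => u k i e)
    | |- forall n : nat, tm _ _ =>
        let n := fresh in intros n; cbv beta;
        repeat (match goal with |- tm _ (fun i e => match ?m with _ => _ end) => destruct m end)
    end ].
Ltac dfn_ext ::= dfn_ext3.

Section Iteration.
Variables (I : Type) (S : I -> structure) (K : (forall i, S i) -> Prop).
Local Notation D := (@dfn I S K). Local Notation T := (@tm I S K).
Lemma dfn_is_iteration c q r : T c -> T q -> T r ->
  D (fun i e => is_iteration (S i) (c i e) (q i e) (r i e)).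
Proof. intros. unfold is_iteration. dfn_tac. Qed.
Lemma dfn_generic c (M : forall i, (nat -> S i) -> S i -> Prop) g : T c -> T g ->
  D (fun i e => M i (fun n => e (Datatypes.S n)) (e 0)) ->
  D (fun i e => generic (S i) (c i e) (M i e) (g i e)).
Proof. intros. unfold generic. dfn_tac. Qed.
End Iteration.

Ltac dfn_ext3' := first [ dfn_ext3 | apply dfn_is_iteration ].
Ltac dfn_ext ::= dfn_ext3'.

(** * Set theory inside a structure *)

(** Forcing extensions are first shown to satisfy the axioms without choice. *)
Class ZF (W : structure) : Prop := {
  ax_extensionality : forall x y : W, (forall z, z ∈ x <-> z ∈ y) -> x = y;
  ax_foundation : forall x : W, (exists y, y ∈ x) ->
    exists y, y ∈ x /\ ~ exists z, z ∈ y /\ z ∈ x;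
  ax_pairing : forall x y : W, exists z, is_upair z x y;
  ax_union : forall x : W, exists u, forall z, z ∈ u <-> exists y, y ∈ x /\ z ∈ y;
  ax_powerset : forall x : W, exists p, forall z, z ∈ p <-> subset z x;
  ax_infinity : exists w : W,
    (exists o, o ∈ w /\ forall z, ~ z ∈ o) /\
    (forall x, x ∈ w -> exists y, y ∈ w /\ forall z, z ∈ y <-> z ∈ x \/ z = x);
  ax_separation : forall (phi : formula) (e : nat -> W) (x : W),
    exists y, forall z, z ∈ y <-> z ∈ x /\ sat W (upd e 0 z) phi;
  ax_replacement : forall (phi : formula) (e : nat -> W) (x : W),
    (forall u, u ∈ x -> exists! v, sat W (upd (upd e 0 u) 1 v) phi) ->
    exists y, forall v, v ∈ y <-> exists u, u ∈ x /\ sat W (upd (upd e 0 u) 1 v) phi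
}.

Existing Class ZFC.
#[global] Instance ZFC_ZF (W : structure) (h : ZFC W) : ZF W.
Proof. destruct h; constructor; assumption. Qed.

Section OneStructure.
Variable W : structure.
Definition def1 (P : W -> Prop) : Prop :=
  @dfn unit (fun _ => W) (fun _ => True) (fun _ e => P (e 0)).
Definition def2 (P : W -> W -> Prop) : Prop :=
  @dfn unit (fun _ => W) (fun _ => True) (fun _ e => P (e 0) (e 1)).
Definition def3 (P : W -> W -> W -> Prop) : Prop :=
  @dfn unit (fun _ => W) (fun _ => True) (fun _ e => P (e 0) (e 1) (e 2)).
End OneStructure.
Arguments def1 {W}. Arguments def2 {W}. Arguments def3 {W}.

Ltac df := unfold def1, def2, def3; dfn_tac.

Section SetTheory.
Context {W : structure} {hW : ZF W}.
Implicit Types x y z u v a b h t : W.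

(** Turns definability with any number of constants into the form in which the axiom
    schemes are stated, with the constants moved into the environment. *)
Lemma two_variable_formula (R : W -> W -> Prop) (d : W) : def2 R ->
  exists phi (E : nat -> W), forall u v,
    R u v <-> sat W (upd (upd E 0 u) 1 v) phi.
Proof.
  intros (l & phi & _ & H). set (k := length l).
  set (L := map (fun c : unit -> W => c tt) l).
  exists (Ex (2 + k) (Ex (3 + k) (And (Eq (2 + k) 0) (And (Eq (3 + k) 1) (ren (Nat.add 2) phi))))).
  exists (fun n => cat L (fun _ => d) (n - 2)). intros u v.
  specialize (H tt (scons u (scons v (fun _ => d)))). cbn [scons] in H. rewrite H. clear H.
  set (E := upd _ 1 v).
  assert (E0 : E 0 = u) by (unfold E; rewrite upd_ne, upd_eq by lia; reflexivity).
  assert (E1 : E 1 = v) by (unfold E; now rewrite upd_eq).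
  assert (HE : forall u' v', u' = u -> v' = v ->
     (sat W (upd (upd E (2 + k) u') (3 + k) v') (ren (Nat.add 2) phi)
        <-> sat W (cat L (scons u (scons v (fun _ => d)))) phi)).
  { intros u' v' -> ->. rewrite (sat_ren _ _ _ _ (le_n _)) by (intros; lia).
    apply sat_ext. intros n _. unfold upd at 1 2.
    destruct (Nat.eqb_spec (2 + n) (3 + k)).
    - replace n with (length L + 1) by (unfold L; rewrite length_map; fold k; lia).
      now rewrite cat_ge.
    - destruct (Nat.eqb_spec (2 + n) (2 + k)).
      + replace n with (length L + 0) by (unfold L; rewrite length_map; fold k; lia).
        now rewrite cat_ge.
      + unfold E. rewrite !upd_ne by lia. replace (2 + n - 2) with n by lia.
        destruct (le_lt_dec k n).
        * replace n with (length L + (2 + (n - k - 2)))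
            by (unfold L; rewrite length_map; fold k; lia).
          now rewrite !cat_ge.
        * apply cat_lt. unfold L. now rewrite length_map. }
  unfold Ex. cbn [sat]. split.
  - intros H H'. apply (H' u). intros H''. apply (H'' v).
    rewrite HE by auto. repeat split; auto.
    all: unfold upd at 1 2; rewrite ?Nat.eqb_refl;
      repeat (match goal with |- context [?a =? ?b] => destruct (Nat.eqb_spec a b); try lia end); auto.
  - intros H. apply NNPP. intros H0. apply H. intros u' H1. apply H1. intros v' (A & B & C).
    apply H0. apply (HE u' v'); auto.
    + revert A. unfold upd at 1 2 3 4. rewrite ?Nat.eqb_refl.
      repeat (match goal with |- context [?a =? ?b] => destruct (Nat.eqb_spec a b); try lia end).
      congruence.
    + revert B. unfold upd at 1 2 3 4. rewrite ?Nat.eqb_refl.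
      repeat (match goal with |- context [?a =? ?b] => destruct (Nat.eqb_spec a b); try lia end).
      congruence.
Qed.

Lemma separation (P : W -> Prop) x : def1 P ->
  exists y, forall z, z ∈ y <-> z ∈ x /\ P z.
Proof.
  intros HP. destruct (two_variable_formula (fun u _ => P u) x) as (phi & E & H).
  { exact HP. }
  destruct (ax_separation phi E x) as [y Hy]. exists y. intros z.
  rewrite Hy, (H z (E 1)). apply and_iff_compat_l, sat_ext. intros i _.
  unfold upd. destruct (Nat.eqb_spec i 1) as [->|]; auto.
Qed.

Lemma replacement (R : W -> W -> Prop) x : def2 R ->
  (forall u v v', u ∈ x -> R u v -> R u v' -> v = v') ->
  exists y, forall v, v ∈ y <-> exists u, u ∈ x /\ R u v.
Proof.
  intros HR Hf.
  destruct (separation (fun u => exists v, R u v) x) as [x' Hx'].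
  { unfold def1, def2 in *. dfn_tac. now apply (dfn_app2 _ _ _ (fun _ => R)); dfn_tac. }
  destruct (two_variable_formula R x HR) as (phi & E & H).
  destruct (ax_replacement phi E x') as [y Hy].
  - intros u Hu. apply Hx' in Hu. destruct Hu as [Hu [v Hv]]. exists v. split.
    + now apply H.
    + intros v' Hv'. apply H in Hv'. eauto.
  - exists y. intros v. rewrite Hy. split.
    + intros (u & Hu & Hv). apply H in Hv. apply Hx' in Hu. exists u. tauto.
    + intros (u & Hu & Hv). exists u. split; [apply Hx'; eauto|now apply H].
Qed.

Lemma ext x y : (forall z, z ∈ x <-> z ∈ y) -> x = y.
Proof. apply (ax_extensionality). Qed.

Lemma inhabited_structure : inhabited W.
Proof. destruct (ax_infinity) as [w _]. exact (inhabits w). Qed.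

(** Set-builder notation for classes that are sets; every operation below is an instance
    and is used through its membership lemma. *)
Definition compr (P : W -> Prop) : W :=
  epsilon inhabited_structure (fun s => forall z, z ∈ s <-> P z).

Lemma in_compr_ex (P : W -> Prop) : (exists s, forall z, z ∈ s <-> P z) ->
  forall z, z ∈ compr P <-> P z.
Proof.
  exact (epsilon_spec inhabited_structure (fun s => forall z, z ∈ s <-> P z)).
Qed.

Lemma in_compr (P : W -> Prop) b : def1 P -> (forall z, P z -> z ∈ b) ->
  forall z, z ∈ compr P <-> P z.
Proof.
  intros HP Hb. apply in_compr_ex. destruct (separation P b HP) as [y Hy].
  exists y. intros z. rewrite Hy. firstorder.
Qed.


Definition emp : W := compr (fun _ => False).
Definition upair x y : W := compr (fun z => z = x \/ z = y).
Definition union x : W := compr (fun z => exists y, y ∈ x /\ z ∈ y).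
Definition power x : W := compr (fun z => subset z x).
Definition sing x : W := upair x x.
Definition cup x y : W := union (upair x y).
Definition pr x y : W := upair (sing x) (upair x y).
Definition suc x : W := cup x (sing x).
Definition sep x (P : W -> Prop) : W := compr (fun z => z ∈ x /\ P z).

Lemma in_emp z : ~ z ∈ emp.
Proof.
  destruct (ax_infinity) as (w & (o & _ & Ho) & _).
  unfold emp. rewrite in_compr_ex; auto. exists o. intros; split; [apply Ho|tauto].
Qed.
Lemma in_upair x y z : z ∈ upair x y <-> z = x \/ z = y.
Proof. exact (in_compr_ex (fun z => z = x \/ z = y) (ax_pairing x y) z). Qed.
Lemma in_union x z : z ∈ union x <-> exists y, y ∈ x /\ z ∈ y.
Proof. exact (in_compr_ex (fun z => exists y, y ∈ x /\ z ∈ y) (ax_union x) z). Qed.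
Lemma in_power x z : z ∈ power x <-> subset z x.
Proof. exact (in_compr_ex (fun z => subset z x) (ax_powerset x) z). Qed.
Lemma in_sing x z : z ∈ sing x <-> z = x.
Proof. unfold sing. rewrite in_upair. tauto. Qed.
Lemma in_cup x y z : z ∈ cup x y <-> z ∈ x \/ z ∈ y.
Proof.
  unfold cup. rewrite in_union. split.
  - intros (u & Hu & Hz). apply in_upair in Hu. destruct Hu as [->| ->]; auto.
  - intros [H|H]; eexists; (split; [apply in_upair|exact H]); auto.
Qed.
Lemma in_suc x z : z ∈ suc x <-> z ∈ x \/ z = x.
Proof. unfold suc. now rewrite in_cup, in_sing. Qed.
Lemma in_sep x P z : def1 P -> (z ∈ sep x P <-> z ∈ x /\ P z).
Proof. intros HP. exact (in_compr_ex (fun z => z ∈ x /\ P z) (separation P x HP) z). Qed.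

Lemma is_upair_iff w x y : is_upair w x y <-> w = upair x y.
Proof.
  split.
  - intros H. apply ext. intros z. now rewrite in_upair.
  - intros ->. intros z. apply in_upair.
Qed.
Lemma is_pair_iff w x y : is_pair w x y <-> w = pr x y.
Proof.
  split.
  - intros (a & b & Ha & Hb & Hw). apply is_upair_iff in Ha, Hb, Hw. now subst.
  - intros ->. exists (sing x), (upair x y). rewrite !is_upair_iff. auto.
Qed.
Lemma pair_in_iff x y f : pair_in x y f <-> pr x y ∈ f.
Proof.
  unfold pair_in. split.
  - intros (w & Hw & H). apply is_pair_iff in Hw. now subst.
  - intros H. exists (pr x y). now rewrite is_pair_iff.
Qed.
Lemma is_triple_iff w x y z : is_triple w x y z <-> w = pr (pr x y) z.
Proof.
  split.
  - intros (a & Ha & Hb). apply is_pair_iff in Ha, Hb. now subst.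
  - intros ->. exists (pr x y). now rewrite !is_pair_iff.
Qed.
Lemma triple_in_iff x y z f : triple_in x y z f <-> pr (pr x y) z ∈ f.
Proof.
  unfold triple_in. split.
  - intros (w & Hw & H). apply is_triple_iff in Hw. now subst.
  - intros H. eexists; split; [now apply is_triple_iff|auto].
Qed.

Lemma upair_inj x y x' y' : upair x y = upair x' y' -> (x = x' /\ y = y') \/ (x = y' /\ y = x').
Proof.
  intros E. assert (H : forall z, z = x \/ z = y <-> z = x' \/ z = y').
  { intros z. now rewrite <- !in_upair, E. }
  destruct (proj1 (H x) (or_introl eq_refl)) as [<-|<-],
           (proj1 (H y) (or_intror eq_refl)) as [<-|<-]; auto.
  - destruct (proj2 (H y') (or_intror eq_refl)) as [->| ->]; auto.
  - destruct (proj2 (H x') (or_introl eq_refl)) as [->| ->]; auto.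
Qed.
Lemma pr_inj x y x' y' : pr x y = pr x' y' -> x = x' /\ y = y'.
Proof.
  intros E. unfold pr, sing in E. apply upair_inj in E.
  destruct E as [[E1 E2]|[E1 E2]]; apply upair_inj in E1, E2;
    destruct E1 as [[? ?]|[? ?]], E2 as [[? ?]|[? ?]]; subst; auto.
Qed.

End SetTheory.

Section DefinableOperations.
Context {W : structure} {hW : ZF W}.
Local Notation T := (@tm unit (fun _ => W) (fun _ => True)).
Local Notation D := (@dfn unit (fun _ => W) (fun _ => True)).
Implicit Types t u : unit -> (nat -> W) -> W.

Lemma tm_fun1 (F : W -> W) t : def2 (fun x y => y = F x) -> T t -> T (fun i e => F (t i e)).
Proof.
  intros HF Ht. unfold tm.
  apply (dfn_app2 _ _ _ (fun _ x y => y = F x) (fun i e => t i (fun n => e (S n)))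
    (fun i e => e 0)); auto; dfn_tac.
Qed.
Lemma tm_fun2 (F : W -> W -> W) t u :
  def3 (fun x y z => z = F x y) -> T t -> T u -> T (fun i e => F (t i e) (u i e)).
Proof.
  intros HF Ht Hu. unfold tm.
  apply (dfn_app3 _ _ _ (fun _ x y z => z = F x y) (fun i e => t i (fun n => e (S n)))
    (fun i e => u i (fun n => e (S n))) (fun i e => e 0)); auto; dfn_tac.
Qed.
Lemma dfn_def1 (P : W -> Prop) t : def1 P -> T t -> D (fun i e => P (t i e)).
Proof. intros. now apply (dfn_app1 _ _ _ (fun _ => P)). Qed.
Lemma dfn_def2 (P : W -> W -> Prop) t u : def2 P -> T t -> T u -> D (fun i e => P (t i e) (u i e)).
Proof. intros. now apply (dfn_app2 _ _ _ (fun _ => P)). Qed.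
Lemma dfn_def3 (P : W -> W -> W -> Prop) t u v : def3 P -> T t -> T u -> T v ->
  D (fun i e => P (t i e) (u i e) (v i e)).
Proof. intros. now apply (dfn_app3 _ _ _ (fun _ => P)). Qed.

Lemma tm_upair t u : T t -> T u -> T (fun i e => upair (t i e) (u i e)).
Proof.
  intros. unfold tm. eapply dfn_iff; [intros; apply is_upair_iff|]. dfn_tac.
Qed.
Lemma tm_union t : T t -> T (fun i e => union (t i e)).
Proof.
  intros. unfold tm. apply dfn_iff with
    (fun i e => forall z, z ∈ e 0 <-> exists y, y ∈ t i (fun n => e (S n)) /\ z ∈ y).
  - intros i e. split.
    + intros E. apply ext. intros z. now rewrite E, in_union.
    + intros -> z. apply in_union.
  - dfn_tac.
Qed.
Lemma tm_power t : T t -> T (fun i e => power (t i e)).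
Proof.
  intros. unfold tm. apply dfn_iff with
    (fun i e => forall z, z ∈ e 0 <-> subset z (t i (fun n => e (S n)))).
  - intros i e. split.
    + intros E. apply ext. intros z. now rewrite E, in_power.
    + intros -> z. apply in_power.
  - dfn_tac.
Qed.
Lemma tm_sing t : T t -> T (fun i e => sing (t i e)).
Proof. intros. now apply tm_upair. Qed.
Lemma tm_cup t u : T t -> T u -> T (fun i e => cup (t i e) (u i e)).
Proof. intros. now apply tm_union, tm_upair. Qed.
Lemma tm_pr t u : T t -> T u -> T (fun i e => pr (t i e) (u i e)).
Proof. intros. apply tm_upair; [now apply tm_sing|now apply tm_upair]. Qed.
Lemma tm_suc t : T t -> T (fun i e => suc (t i e)).
Proof. intros. apply tm_cup; auto. now apply tm_sing. Qed.
End DefinableOperations.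

Ltac dfn_ext4 := first
  [ dfn_ext3'
  | lazymatch goal with
    | |- tm _ (fun i e => upair _ _) => apply tm_upair
    | |- tm _ (fun i e => union _) => apply tm_union
    | |- tm _ (fun i e => power _) => apply tm_power
    | |- tm _ (fun i e => sing _) => apply tm_sing
    | |- tm _ (fun i e => cup _ _) => apply tm_cup
    | |- tm _ (fun i e => pr _ _) => apply tm_pr
    | |- tm _ (fun i e => suc _) => apply tm_suc
    end
  | match goal with
    | H : def2 (fun x y => y = ?F x) |- tm _ (fun i e => ?F _) => apply (tm_fun1 F _ H)
    | H : def3 (fun x y z => z = ?F x y) |- tm _ (fun i e => ?F _ _) => apply (tm_fun2 F _ _ H)
    | H : def1 ?P |- dfn _ (fun i e => ?P _) => apply (dfn_def1 P _ H)
    | H : def2 ?P |- dfn _ (fun i e => ?P _ _) => apply (dfn_def2 P _ _ H)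
    | H : def3 ?P |- dfn _ (fun i e => ?P _ _ _) => apply (dfn_def3 P _ _ _ H)
    end ].
Ltac dfn_ext ::= dfn_ext4.

(** ** Natural numbers, iteration and transitive closures *)

Section MoreSetTheory.
Context {W : structure} {hW : ZF W}.
Implicit Types x y z u v a b h t : W.

Lemma no_mem_cycle1 x : ~ x ∈ x.
Proof.
  intros H. destruct (ax_foundation (sing x)) as (y & Hy & N).
  { exists x. now apply in_sing. }
  apply in_sing in Hy. subst y. apply N. exists x. split; auto. now apply in_sing.
Qed.
Lemma no_mem_cycle2 x y : x ∈ y -> y ∈ x -> False.
Proof.
  intros H1 H2. destruct (ax_foundation (upair x y)) as (z & Hz & N).
  { exists x. apply in_upair; auto. }
  apply in_upair in Hz. apply N. destruct Hz as [-> | ->].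
  - exists y. rewrite in_upair. auto.
  - exists x. rewrite in_upair. auto.
Qed.
Lemma suc_inj x y : suc x = suc y -> x = y.
Proof.
  intros E. assert (H1 : x ∈ suc y) by (rewrite <- E; apply in_suc; auto).
  assert (H2 : y ∈ suc x) by (rewrite E; apply in_suc; auto).
  apply in_suc in H1, H2. destruct H1, H2; auto. exfalso. eapply no_mem_cycle2; eauto.
Qed.

Definition prod x y : W := compr (fun z => exists a b, a ∈ x /\ b ∈ y /\ z = pr a b).
Lemma in_prod x y z : z ∈ prod x y <-> exists a b, a ∈ x /\ b ∈ y /\ z = pr a b.
Proof.
  unfold prod. refine (in_compr _ (power (power (cup x y))) _ _ _).
  - df.
  - intros w (a & b & Ha & Hb & ->). apply in_power. intros s Hs. apply in_power.
    unfold pr, sing in Hs. apply in_upair in Hs.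
    destruct Hs as [-> | ->]; intros r Hr; apply in_upair in Hr; apply in_cup;
      destruct Hr as [-> | ->]; auto.
Qed.
Lemma pr_in_prod x y a b : pr a b ∈ prod x y <-> a ∈ x /\ b ∈ y.
Proof.
  rewrite in_prod. split.
  - intros (a' & b' & Ha & Hb & E). apply pr_inj in E. destruct E; subst; auto.
  - intros [? ?]. eauto.
Qed.
Lemma pr_in_uu a b h : pr a b ∈ h -> a ∈ union (union h) /\ b ∈ union (union h).
Proof.
  intros H. split; apply in_union; exists (upair a b); (split; [|rewrite in_upair; auto]);
    apply in_union; exists (pr a b); (split; [auto|]); unfold pr; rewrite in_upair; auto.
Qed.

Definition inductive u : Prop := emp ∈ u /\ forall x, x ∈ u -> suc x ∈ u.
Lemma def_inductive : def1 inductive.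
Proof. unfold inductive. df. Qed.
Lemma inductive_ex : exists w, inductive w.
Proof.
  destruct (ax_infinity) as (w & (o & Ho & Ho') & Hs). exists w. split.
  - replace emp with o; auto. apply ext. intros z. split; intros H; [destruct (Ho' _ H)|destruct (in_emp _ H)].
  - intros x Hx. destruct (Hs x Hx) as (y & Hy & Hy'). replace (suc x) with y; auto.
    apply ext. intros z. now rewrite Hy', in_suc.
Qed.
Definition omega : W := compr (fun n => forall u, inductive u -> n ∈ u).
Lemma in_omega n : n ∈ omega <-> forall u, inductive u -> n ∈ u.
Proof.
  destruct inductive_ex as [w Hw]. pose proof def_inductive.
  apply (in_compr (fun n => forall u, inductive u -> n ∈ u) w); auto. df.
Qed.
Lemma omega_inductive : inductive omega.
Proof.
  split; [apply in_omega; intros u [H _]; auto|].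
  intros n Hn. rewrite in_omega in *. intros u Hu. apply Hu. auto.
Qed.
Lemma omega_ind (P : W -> Prop) : def1 P -> P emp ->
  (forall n, n ∈ omega -> P n -> P (suc n)) -> forall n, n ∈ omega -> P n.
Proof.
  intros HP H0 HS n Hn.
  assert (H : n ∈ sep omega P); [|apply in_sep in H; tauto].
  rewrite in_omega in Hn. apply Hn. split.
  - apply in_sep; auto. split; auto. apply omega_inductive.
  - intros m Hm. apply in_sep in Hm; auto. apply in_sep; auto. destruct Hm. split; auto.
    now apply omega_inductive.
Qed.

(** The values of the finite iterates of an operation form a set by replacement along
    [omega].  Iterates are described by sets of pairs each of which is justified by an
    earlier one. *)
Section Iterates.
Variables (F : W -> W) (x0 : W).
Hypothesis HF : def2 (fun x y => y = F x).
Let good h := forall m z, pr m z ∈ h ->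
  (m = emp /\ z = x0) \/ exists m' z', m = suc m' /\ pr m' z' ∈ h /\ z = F z'.
Let iter n y := exists h, good h /\ pr n y ∈ h.

Lemma closure_under : exists u, x0 ∈ u /\ forall y, y ∈ u -> F y ∈ u.
Proof.
  assert (Hg : def1 good) by (unfold good; df).
  assert (Hi : def2 iter) by (unfold iter; df).
  assert (I0 : iter emp x0).
  { exists (sing (pr emp x0)). split; [|now apply in_sing].
    intros m z H. apply in_sing, pr_inj in H. tauto. }
  assert (IS : forall n y, iter n y -> iter (suc n) (F y)).
  { intros n y (h & Hh & H). exists (cup h (sing (pr (suc n) (F y)))). split.
    - intros m z Hm. apply in_cup in Hm. destruct Hm as [Hm|Hm].
      + destruct (Hh _ _ Hm) as [?|(m' & z' & ? & ? & ?)]; auto.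
        right. exists m', z'. rewrite in_cup. auto.
      + apply in_sing, pr_inj in Hm. destruct Hm; subst. right. exists n, y.
        rewrite in_cup. auto.
    - apply in_cup. rewrite in_sing. auto. }
  assert (U : forall n, n ∈ omega -> forall y y', iter n y -> iter n y' -> y = y').
  { apply (omega_ind (fun n => forall y y', iter n y -> iter n y' -> y = y')).
    - df.
    - assert (E : forall y, iter emp y -> y = x0).
      { intros y (h & Hh & H). destruct (Hh _ _ H) as [[_ ?]|(m' & ? & E & _)]; auto.
        exfalso. apply (in_emp m'). rewrite E. apply in_suc; auto. }
      intros y y' H H'. apply E in H, H'. congruence.
    - intros n Hn IH.
      assert (E : forall y, iter (suc n) y -> exists z, iter n z /\ y = F z).
      { intros y (h & Hh & H). destruct (Hh _ _ H) as [[E _]|(m' & z & E & Hz & ->)].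
        - exfalso. apply (in_emp n). rewrite <- E. apply in_suc; auto.
        - apply suc_inj in E. subst m'. exists z. split; auto. exists h; auto. }
      intros y y' H H'. apply E in H as (z & Hz & ->), H' as (z' & Hz' & ->).
      f_equal. eauto. }
  destruct (replacement iter omega Hi) as [u Hu].
  - intros n y y' Hn. apply U; auto.
  - exists u. split.
    + apply Hu. exists emp. split; auto. apply omega_inductive.
    + intros y Hy. apply Hu in Hy as (n & Hn & Hy). apply Hu. exists (suc n). split; auto.
      now apply omega_inductive.
Qed.
End Iterates.

Lemma trans_superset x : exists t, transitive_set t /\ subset x t.
Proof.
  destruct (closure_under union x) as (u & Hx & Hu); [df|].
  exists (union u). split.
  - intros y Hy z Hz. apply in_union in Hy as (v & Hv & Hy).
    apply in_union. exists (union v). split; auto. apply in_union. eauto.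
  - intros z Hz. apply in_union. eauto.
Qed.

Definition trcl x : W := compr (fun z => forall t, transitive_set t -> subset x t -> z ∈ t).
Lemma in_trcl x z : z ∈ trcl x <-> forall t, transitive_set t -> subset x t -> z ∈ t.
Proof.
  destruct (trans_superset x) as (t & Ht & Hx).
  apply (in_compr (fun z => forall t, transitive_set t -> subset x t -> z ∈ t) t); [df|auto].
Qed.
Lemma tm_trcl (t : unit -> (nat -> W) -> W) : @tm unit (fun _ => W) (fun _ => True) t ->
  @tm unit (fun _ => W) (fun _ => True) (fun i e => trcl (t i e)).
Proof.
  intros H. unfold tm. apply dfn_iff with (fun i e => forall z, z ∈ e 0 <->
     forall t', transitive_set t' -> subset (t i (fun n => e (S n))) t' -> z ∈ t').
  - intros i e. split.
    + intros E. apply ext. intros z. now rewrite E, in_trcl.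
    + intros -> z. apply in_trcl.
  - dfn_tac.
Qed.
End MoreSetTheory.

Ltac dfn_ext5 := first
  [ dfn_ext4
  | lazymatch goal with
    | |- tm _ (fun i e => trcl _) => apply tm_trcl
    end].
Ltac dfn_ext ::= dfn_ext5.

Section TransitiveClosure.
Context {W : structure} {hW : ZF W}.
Implicit Types x y z u v a b h t : W.

Lemma trcl_trans x : transitive_set (trcl x).
Proof.
  intros y Hy z Hz. rewrite in_trcl in *. intros t Ht Hx. apply (Ht y); auto.
Qed.
Lemma trcl_sub x : subset x (trcl x).
Proof. intros z Hz. apply in_trcl. auto. Qed.
Lemma trcl_least x t : transitive_set t -> subset x t -> subset (trcl x) t.
Proof. intros Ht Hx z Hz. rewrite in_trcl in Hz. auto. Qed.
Lemma trcl_mem x y : y ∈ x -> subset (trcl y) (trcl x).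
Proof. intros H. apply trcl_least; [apply trcl_trans|].
  exact (trcl_trans x y (trcl_sub x y H)). Qed.
Lemma trcl_in x y : y ∈ trcl x -> subset (trcl y) (trcl x).
Proof. intros H. apply trcl_least; [apply trcl_trans|].
  exact (trcl_trans x y H). Qed.

Lemma mem_ind (P : W -> Prop) : def1 P ->
  (forall x, (forall y, y ∈ x -> P y) -> P x) -> forall x, P x.
Proof.
  intros HP IH x. apply NNPP. intros Hx.
  assert (HN : def1 (fun y => ~ P y)) by df.
  destruct (ax_foundation (sep (trcl (sing x)) (fun y => ~ P y))) as (y & Hy & N).
  - exists x. apply in_sep; auto. split; auto. apply trcl_sub. now apply in_sing.
  - apply in_sep in Hy as [Hy Hy']; auto. apply Hy', IH. intros z Hz.
    apply NNPP. intros Hz'. apply N. exists z. split; auto. apply in_sep; auto. split; auto.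
    eapply trcl_trans; eauto.
Qed.

Lemma trcl_unfold x z : z ∈ trcl x <-> exists y, y ∈ x /\ (z = y \/ z ∈ trcl y).
Proof.
  split.
  - intros H. 
    assert (HP : def1 (fun z => exists y, y ∈ x /\ (z = y \/ z ∈ trcl y))).
    { df. }
    set (t := sep (trcl x) (fun z => exists y, y ∈ x /\ (z = y \/ z ∈ trcl y))).
    assert (Ht : transitive_set t).
    { intros a Ha b Hb. apply in_sep in Ha as [Ha (y & Hy & Ha')]; auto. apply in_sep; auto.
      split; [eapply trcl_trans; eauto|]. exists y. split; auto. right.
      destruct Ha' as [->|Ha']; [now apply trcl_sub|eapply trcl_trans; eauto]. }
    assert (Hx : subset x t).
    { intros y Hy. apply in_sep; auto. split; [now apply trcl_sub|eauto]. }
    apply (trcl_least x t Ht Hx) in H. apply in_sep in H; tauto.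
  - intros (y & Hy & [->|Hz]); [now apply trcl_sub|]. eapply trcl_mem; eauto.
Qed.

End TransitiveClosure.

(** ** Recursion and ranks *)

Section Recursion.
Context {W : structure} {hW : ZF W}.
Implicit Types x y z u v a b h t : W.

Lemma trcl_ind (P : W -> Prop) : def1 P ->
  (forall x, (forall y, y ∈ trcl x -> P y) -> P x) -> forall x, P x.
Proof.
  intros HP IH. assert (Q : forall x, forall y, y ∈ trcl x -> P y).
  - apply (mem_ind (fun x => forall y, y ∈ trcl x -> P y)); [df|].
    intros x Hx y Hy. apply trcl_unfold in Hy as (z & Hz & [->|Hy]).
    + apply IH, Hx, Hz.
    + eauto.
  - intros x. apply IH, Q.
Qed.

Lemma not_in_trcl x : ~ x ∈ trcl x.
Proof.
  revert x. apply (trcl_ind (fun x => ~ x ∈ trcl x)); [df|]. intros x IH Hx. exact (IH x Hx Hx).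
Qed.

Section RecursionTheorem.
Variable F : W -> W -> W.
Hypothesis HF : def3 (fun x a y => y = F x a).
Hypothesis local : forall x a a',
  (forall z v, z ∈ trcl x -> (pr z v ∈ a <-> pr z v ∈ a')) -> F x a = F x a'.

Let good h := forall x y, pr x y ∈ h -> y = F x h /\ forall z, z ∈ x -> exists v, pr z v ∈ h.
Let val x y := exists h, good h /\ pr x y ∈ h.

Let def_good : def1 good.
Proof. unfold good. df. Qed.
Let def_val : def2 val.
Proof. unfold val. df. Qed.

Let good_trcl h : good h -> forall x y, pr x y ∈ h -> forall z, z ∈ trcl x -> exists v, pr z v ∈ h.
Proof.
  intros Hh. apply (mem_ind (fun x => forall y, pr x y ∈ h -> forall z, z ∈ trcl x -> exists v, pr z v ∈ h)).
  - df.
  - intros x IH y Hy z Hz. apply trcl_unfold in Hz as (w & Hw & Hz).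
    destruct (proj2 (Hh _ _ Hy) w Hw) as [v Hv].
    destruct Hz as [->|Hz]; eauto.
Qed.

Let val_unique : forall x y y', val x y -> val x y' -> y = y'.
Proof.
  apply (trcl_ind (fun x => forall y y', val x y -> val x y' -> y = y')); [df|].
  intros x IH y y' (h & Hh & Hy) (h' & Hh' & Hy').
  rewrite (proj1 (Hh _ _ Hy)), (proj1 (Hh' _ _ Hy')). apply local.
  intros z v Hz.
  destruct (good_trcl h Hh x y Hy z Hz) as [w Hw].
  destruct (good_trcl h' Hh' x y' Hy' z Hz) as [w' Hw'].
  split; intros Hv.
  - replace v with w'; auto. apply (IH z Hz); [exists h'|exists h]; auto.
  - replace v with w; auto. apply (IH z Hz); [exists h|exists h']; auto.
Qed.

Let val_ex : forall x, exists y, val x y.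
Proof.
  apply (trcl_ind (fun x => exists y, val x y)); [df|].
  intros x IH.
  destruct (replacement (fun z p => exists v, val z v /\ p = pr z v) (trcl x)) as [U HU].
  { df. }
  { intros z p p' _ (v & Hv & ->) (v' & Hv' & ->). f_equal. eauto. }
  assert (HU' : forall z v, pr z v ∈ U <-> z ∈ trcl x /\ val z v).
  { intros z v. rewrite HU. split.
    - intros (z' & Hz & v' & Hv & E). apply pr_inj in E as [-> ->]. auto.
    - intros []. eauto. }
  assert (FU : forall z v, pr z v ∈ U -> v = F z U).
  { intros z v H. apply HU' in H as [Hz (h & Hh & H)].
    rewrite (proj1 (Hh _ _ H)). apply local. intros w u Hw. rewrite HU'. split.
    - intros Hu. split; [|exists h; auto]. eapply trcl_in; eauto.
    - intros [_ Hu]. destruct (good_trcl h Hh z v H w Hw) as [u' Hu'].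
      replace u with u'; auto. apply (val_unique w); [exists h; auto|auto]. }
  set (h := cup U (sing (pr x (F x U)))).
  assert (Hh : forall z v, pr z v ∈ h <-> pr z v ∈ U \/ (z = x /\ v = F x U)).
  { intros z v. unfold h. rewrite in_cup, in_sing. split; intros [H|H]; auto.
    - apply pr_inj in H; auto.
    - destruct H; subst; auto. }
  assert (Fh : forall z, z = x \/ z ∈ trcl x -> F z U = F z h).
  { intros z Hz. apply local. intros w u Hw. rewrite Hh. split; auto.
    intros [H|[-> _]]; auto. exfalso. destruct Hz as [->|Hz].
    - eapply not_in_trcl; eauto.
    - apply (not_in_trcl z). apply (trcl_in _ _ Hw). auto. }
  exists (F x U), h. split.
  - intros z v H. apply Hh in H. destruct H as [H|[-> ->]].
    + split.
      * rewrite <- Fh; auto. right. apply HU' in H; tauto.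
      * intros w Hw. apply HU' in H as [Hz _].
        assert (Hw' : w ∈ trcl x) by exact (trcl_trans x z Hz w Hw).
        destruct (IH w Hw') as [u Hu]. exists u. rewrite Hh, HU'. auto.
    + split; [rewrite <- Fh; auto|]. intros w Hw.
      destruct (IH w (trcl_sub x w Hw)) as [u Hu]. exists u. rewrite Hh, HU'.
      left. split; auto. now apply trcl_sub.
  - apply Hh; auto.
Qed.

(** Recursion along transitive closures.  The operation takes a set [a] of pairs that
    agrees with the values below [x], whatever else [a] contains. *)
Lemma recursion : exists H : W -> W, def2 (fun x y => y = H x) /\
  forall x a, (forall z v, z ∈ trcl x -> (pr z v ∈ a <-> v = H z)) -> H x = F x a.
Proof.
  set (H := fun x => epsilon inhabited_structure (val x)).
  assert (HH : forall x, val x (H x)) by (intros x; apply epsilon_spec, val_ex).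
  exists H. split.
  - unfold def2. apply dfn_iff with (fun _ e => val (e 0) (e 1)); [|df].
    intros _ e. split; [intros; eapply val_unique; eauto|intros ->; auto].
  - intros x a Ha. destruct (HH x) as (h & Hh & Hx). rewrite (proj1 (Hh _ _ Hx)).
    apply local. intros z v Hz. rewrite Ha by auto.
    destruct (good_trcl h Hh _ _ Hx z Hz) as [v' Hv'].
    assert (E : v' = H z) by (apply (val_unique z); [exists h; auto|auto]).
    subst v'. split; [intros Hv; apply (val_unique z); [exists h; auto|auto]|intros ->; auto].
Qed.
End RecursionTheorem.

Definition graph (H : W -> W) x : W := compr (fun p => exists z, z ∈ x /\ p = pr z (H z)).
Lemma in_graph H x z v : def2 (fun x y => y = H x) -> (pr z v ∈ graph H x <-> z ∈ x /\ v = H z).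
Proof.
  intros HH. unfold graph. rewrite in_compr_ex.
  - split.
    + intros (z' & Hz & E). apply pr_inj in E as [-> ->]. auto.
    + intros [Hz ->]. eauto.
  - destruct (replacement (fun z p => p = pr z (H z)) x) as [y Hy]; [df|congruence|].
    exists y. exact Hy.
Qed.

Lemma recursion' (F : W -> W -> W) : def3 (fun x a y => y = F x a) ->
  (forall x a a', (forall z v, z ∈ trcl x -> (pr z v ∈ a <-> pr z v ∈ a')) -> F x a = F x a') ->
  exists H : W -> W, def2 (fun x y => y = H x) /\ forall x, H x = F x (graph H (trcl x)).
Proof.
  intros HF Hl. destruct (recursion F HF Hl) as (H & HH & E). exists H. split; auto.
  intros x. apply E. intros z v Hz. rewrite in_graph; auto. tauto.
Qed.

End Recursion.

Section Rank.
Context {W : structure} {hW : ZF W}.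
Implicit Types x y z u v a b h t : W.

(** The recursion [L x = { y : y is a subset of some L u with u in x }] yields the levels
    of the cumulative hierarchy indexed by the ranks of sets. *)
Lemma rank_exists : exists L : W -> W, def2 (fun x y => y = L x) /\
  forall x y, y ∈ L x <-> exists u, u ∈ x /\ subset y (L u).
Proof.
  assert (B : forall x a, exists s, forall y, y ∈ s <->
      exists u l, u ∈ x /\ pr u l ∈ a /\ subset y l).
  { intros x a. destruct (separation (fun y => exists u l, u ∈ x /\ pr u l ∈ a /\ subset y l)
       (power (union (union (union a))))) as [s Hs]; [df|].
    exists s. intros y. rewrite Hs. split; [tauto|]. intros H; split; auto.
    destruct H as (u & l & _ & Hl & Hy). apply in_power. intros z Hz.
    apply in_union. exists l. split; auto. now apply pr_in_uu in Hl. }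
  set (F := fun x a => compr (fun y => exists u l, u ∈ x /\ pr u l ∈ a /\ subset y l)).
  assert (HF : forall x a y, y ∈ F x a <-> exists u l, u ∈ x /\ pr u l ∈ a /\ subset y l).
  { intros x a. exact (in_compr_ex _ (B x a)). }
  destruct (recursion' F) as (L & HL & E).
  - unfold def3. apply dfn_iff with (fun _ e => forall y, y ∈ e 2 <->
      exists u l, u ∈ e 0 /\ pr u l ∈ e 1 /\ subset y l); [|df].
    intros _ e. split.
    + intros H. apply ext. intros z. now rewrite H, HF.
    + intros -> y. apply HF.
  - intros x a a' H. apply ext. intros z. rewrite !HF.
    split; intros (u & l & Hu & Hl & Hz); exists u, l; repeat split; auto;
      apply H; auto; now apply trcl_sub.
  - exists L. split; auto. intros x y. rewrite E, HF. split.
    + intros (u & l & Hu & Hl & Hy). apply in_graph in Hl as [_ ->]; eauto.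
    + intros (u & Hu & Hy). exists u, (L u). rewrite in_graph by auto.
      repeat split; auto. now apply trcl_sub.
Qed.

(** [L x] is the level of the cumulative hierarchy whose index is the rank of [x], so
    [y ∈ L x] compares ranks; used in place of ordinals it avoids rank arithmetic. *)
Definition L : W -> W :=
  proj1_sig (constructive_indefinite_description _ rank_exists).
Lemma def_L : def2 (fun x y => y = L x).
Proof. exact (proj1 (proj2_sig (constructive_indefinite_description _ rank_exists))). Qed.
Lemma in_L x y : y ∈ L x <-> exists u, u ∈ x /\ subset y (L u).
Proof. exact (proj2 (proj2_sig (constructive_indefinite_description _ rank_exists)) x y). Qed.
End Rank.

Ltac dfn_ext6 := first
  [ dfn_ext5
  | lazymatch goal with
    | |- tm _ (fun i e => L _) => apply (tm_fun1 L _ def_L)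
    end].
Ltac dfn_ext ::= dfn_ext6.

Section RankTheory.
Context {W : structure} {hW : ZF W}.
Implicit Types x y z u v a b h t : W.

Lemma L_trans x : transitive_set (L x).
Proof.
  revert x. apply (mem_ind (fun x => transitive_set (L x))); [df|]. intros x IH y Hy z Hz.
  apply in_L in Hy as (u & Hu & Hy). apply in_L. exists u. split; auto.
  apply (IH u Hu). auto.
Qed.
Lemma L_sub x y z : z ∈ L x -> subset y z -> y ∈ L x.
Proof.
  intros Hz Hy. apply in_L in Hz as (u & Hu & Hz). apply in_L. exists u. split; auto.
  intros w Hw. auto.
Qed.
Lemma sub_L x : subset x (L x).
Proof.
  revert x. apply (mem_ind (fun x => subset x (L x))); [df|]. intros x IH y Hy. apply in_L. exists y. auto.
Qed.
Lemma mem_L x y : y ∈ x -> y ∈ L x.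
Proof. apply sub_L. Qed.
Lemma L_in_aux x : forall y, y ∈ L x -> L y ∈ L x.
Proof.
  revert x. apply (mem_ind (fun x => forall y, y ∈ L x -> L y ∈ L x)); [df|].
  intros x IH y Hy. apply in_L in Hy as (u & Hu & Hy). apply in_L. exists u. split; auto.
  intros z Hz. apply in_L in Hz as (v & Hv & Hz). apply (L_sub u z (L v)); auto.
Qed.
Lemma L_in x y : y ∈ L x -> L y ∈ L x.
Proof. apply L_in_aux. Qed.
Lemma L_le x y : y ∈ L x -> subset (L y) (L x).
Proof. intros H. exact (L_trans x _ (L_in x y H)). Qed.
Lemma L_mono x y : subset x (L y) -> subset (L x) (L y).
Proof.
  intros H z Hz. apply in_L in Hz as (u & Hu & Hz). apply (L_sub y z (L u)); auto.
  apply L_in; auto.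
Qed.

Lemma rank_linear x : forall y, y ∈ L x \/ subset (L x) (L y).
Proof.
  revert x. apply (mem_ind (fun x => forall y, y ∈ L x \/ subset (L x) (L y))); [df|].
  intros x IH y. destruct (classic (y ∈ L x)) as [|N]; auto. right.
  intros w Hw. apply in_L in Hw as (u & Hu & Hw).
  assert (H : exists v, v ∈ y /\ ~ v ∈ L u).
  { apply NNPP. intros H. apply N. apply in_L. exists u. split; auto.
    intros v Hv. apply NNPP. eauto. }
  destruct H as (v & Hv & Hv'). destruct (IH u Hu v) as [|H]; [contradiction|].
  apply in_L. exists v. split; auto. intros z Hz. auto.
Qed.

Lemma rank_ind (P : W -> Prop) : def1 P ->
  (forall x, (forall y, y ∈ L x -> P y) -> P x) -> forall x, P x.
Proof.
  intros HP IH. assert (Q : forall x, forall y, y ∈ L x -> P y).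
  - apply (mem_ind (fun x => forall y, y ∈ L x -> P y)); [df|].
    intros x Hx y Hy. apply in_L in Hy as (u & Hu & Hy).
    apply IH. intros z Hz. apply (Hx u Hu). apply (L_mono y u); auto.
  - intros x. apply IH, Q.
Qed.

(** Scott's trick: the witnesses of minimal rank form a set. *)
Lemma collection (R : W -> W -> Prop) x : def2 R ->
  exists b, forall u, u ∈ x -> (exists v, R u v) -> exists v, v ∈ b /\ R u v.
Proof.
  intros HR.
  set (M := fun u v => R u v /\ forall v', R u v' -> ~ v' ∈ L v).
  assert (HM : def2 M) by (unfold M; df).
  assert (Mex : forall u v, R u v -> exists v, M u v).
  { intros u. apply (rank_ind (fun v => R u v -> exists v, M u v)); [df|].
    intros v IH Hv. destruct (classic (M u v)) as [|N]; eauto.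
    unfold M in N. apply not_and_or in N. destruct N as [N|N]; [tauto|].
    apply not_all_ex_not in N as (v' & N). apply imply_to_and in N as [N1 N2].
    apply NNPP in N2. apply (IH v'); auto. }
  destruct (replacement (fun u s => (exists v, R u v) /\ forall v, v ∈ s <-> M u v) x) as [y Hy].
  { df. }
  { intros u s s' _ [_ H] [_ H']. apply ext. intros z. now rewrite H, H'. }
  exists (union y). intros u Hu [v0 Hv0].
  destruct (Mex u v0 Hv0) as [v Hv]. exists v. split; [|apply Hv].
  destruct (separation (M u) (power (L v0))) as [s Hs]; [df|].
  assert (Hs' : forall v, v ∈ s <-> M u v).
  { intros w. rewrite Hs. split; [tauto|]. intros Hw. split; auto. apply in_power.
    destruct (rank_linear w v0) as [H|H].
    - destruct Hw as [_ Hw]. exfalso. eapply Hw; eauto.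
    - intros z Hz. apply H. now apply mem_L. }
  apply in_union. exists s. split; [|now apply Hs'].
  apply Hy. exists u. split; auto. split; eauto.
Qed.

(** The intersection of all sets closed under the operator. *)
Lemma least_fixpoint (Phi : W -> W -> Prop) A : def2 Phi ->
  (forall x R R', subset R R' -> Phi x R -> Phi x R') ->
  exists R, (forall x, x ∈ R <-> x ∈ A /\ Phi x R) /\
    forall R', (forall y, y ∈ A -> Phi y R' -> y ∈ R') -> subset R R'.
Proof.
  intros HP Hm.
  set (Q := fun x => forall R, (forall y, y ∈ A -> Phi y R -> y ∈ R) -> x ∈ R).
  assert (HQ : def1 Q) by (unfold Q; df).
  exists (sep A Q).
  assert (H2 : forall R', (forall y, y ∈ A -> Phi y R' -> y ∈ R') -> subset (sep A Q) R').
  { intros R' HR' x Hx. apply in_sep in Hx as [_ Hx]; auto. }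
  assert (H1 : forall x, x ∈ A -> Phi x (sep A Q) -> x ∈ sep A Q).
  { intros x Hx HPx. apply in_sep; auto. split; auto. intros R HR. apply HR; auto.
    eapply Hm; [|exact HPx]. auto. }
  split; auto. intros x. split; [|intros []; auto].
  intros Hx. assert (HA : x ∈ A) by (apply in_sep in Hx; tauto). split; auto.
  assert (HA' : def1 (fun x => Phi x (sep A Q))) by df.
  assert (Hs : subset (sep A Q) (sep A (fun x => Phi x (sep A Q)))).
  { apply H2. intros y Hy HPy. apply in_sep; auto. split; auto.
    eapply Hm; [|exact HPy]. intros z Hz. apply in_sep in Hz; auto. destruct Hz; auto. }
  apply Hs in Hx. apply in_sep in Hx; tauto.
Qed.

Definition functional f := forall x y y' : W, pr x y ∈ f -> pr x y' ∈ f -> y = y'.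

Lemma ordinal_mem a b : ordinal a -> b ∈ a -> ordinal b.
Proof.
  intros [Ht He] Hb. split; auto. intros y Hy. apply He. exact (Ht b Hb y Hy).
Qed.
Lemma ordinal_linear a : forall b, ordinal a -> ordinal b -> a ∈ b \/ a = b \/ b ∈ a.
Proof.
  revert a. apply (mem_ind (fun a => forall b, ordinal a -> ordinal b -> a ∈ b \/ a = b \/ b ∈ a)); [df|].
  intros a IHa. apply (mem_ind (fun b => ordinal a -> ordinal b -> a ∈ b \/ a = b \/ b ∈ a)); [df|].
  intros b IHb Ha Hb. apply NNPP. intros N. apply N. right; left.
  apply ext. intros z. split; intros Hz.
  - destruct (IHa z Hz b (ordinal_mem a z Ha Hz) Hb) as [|[->|H]]; auto.
    + tauto.
    + exfalso. apply N. right; right. exact (proj1 Ha z Hz b H).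
  - destruct (IHb z Hz Ha (ordinal_mem b z Hb Hz)) as [H|[H|H]]; auto.
    + exfalso. apply N. left. exact (proj1 Hb z Hz a H).
    + subst z. tauto.
Qed.
Lemma burali_forti s : ~ forall a, ordinal a -> a ∈ s.
Proof.
  intros H. assert (Do : def1 (@ordinal W)) by df.
  assert (Ho : ordinal (sep s ordinal)).
  { split.
    - intros a Ha b Hb. apply in_sep in Ha as [_ Ha]; auto. apply in_sep; auto.
      assert (ordinal b) by (eapply ordinal_mem; eauto). auto.
    - intros a Ha. apply in_sep in Ha as [_ Ha]; auto. exact (proj1 Ha). }
  apply (no_mem_cycle1 (sep s ordinal)). apply in_sep; auto.
Qed.

End RankTheory.

(** ** Choice *)

Section Choice.
Context {W : structure} {hW : ZFC W}.
Implicit Types x y z u v a b h t : W.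

(** The axiom of choice selects from the disjoint sets of pairs [(u,v)] with [R u v], one
    for each [u]; collection makes these sets. *)
Lemma choice_function (R : W -> W -> Prop) x : def2 R ->
  (forall u, u ∈ x -> exists v, R u v) ->
  exists f, functional f /\ (forall p, p ∈ f -> exists u v, p = pr u v) /\
    (forall u v, pr u v ∈ f -> u ∈ x /\ R u v) /\
    (forall u, u ∈ x -> exists v, pr u v ∈ f).
Proof.
  intros HR Hx. destruct (collection R x HR) as [b Hb].
  assert (Fs : forall u, exists s, forall z, z ∈ s <-> exists v, v ∈ b /\ R u v /\ z = pr u v).
  { intros u. destruct (separation (fun z => exists v, v ∈ b /\ R u v /\ z = pr u v) (prod (sing u) b))
      as [s Hs]; [df|]. exists s. intros z. rewrite Hs. split; [tauto|].
    intros H; split; auto. destruct H as (v & ? & ? & ->). apply pr_in_prod. rewrite in_sing. auto. }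
  destruct (replacement (fun u s => forall z, z ∈ s <-> exists v, v ∈ b /\ R u v /\ z = pr u v) x)
    as [X HX].
  { df. } { intros u s s' _ H H'. apply ext. intros z. now rewrite H, H'. }
  destruct (zf_choice _ hW X) as [c Hc].
  - intros s Hs. apply HX in Hs as (u & Hu & Hs). destruct (Hb u Hu (Hx u Hu)) as (v & Hv & Hr).
    exists (pr u v). apply Hs. eauto.
  - intros s s' z Hs Hs' Hz Hz'. apply HX in Hs as (u & Hu & Hs), Hs' as (u' & Hu' & Hs').
    apply Hs in Hz as (v & _ & _ & Ev). apply Hs' in Hz' as (v' & _ & _ & Ev').
    rewrite Ev' in Ev. apply pr_inj in Ev as [E1 E2]. subst u'. apply ext. intros w. now rewrite Hs, Hs'.
  - assert (Dq : def1 (fun z => exists s, s ∈ X /\ z ∈ s /\ z ∈ c)) by df.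
    set (f := sep (union X) (fun z => exists s, s ∈ X /\ z ∈ s /\ z ∈ c)).
    assert (Hf : forall u v, pr u v ∈ f <-> u ∈ x /\ v ∈ b /\ R u v /\ pr u v ∈ c).
    { intros u v. unfold f. rewrite in_sep by auto. split.
      - intros (_ & s & Hs & Hz & Hzc). apply HX in Hs as (u' & Hu' & Hs).
        apply Hs in Hz as (v' & ? & ? & E). apply pr_inj in E as [-> ->]. auto.
      - intros (Hu & Hv & Hr & Hvc). destruct (Fs u) as [s Hs].
        assert (HsX : s ∈ X) by (apply HX; eauto).
        assert (Hp : pr u v ∈ s) by (apply Hs; eauto).
        split; [apply in_union; eauto|eauto]. }
    exists f. repeat split.
    + intros u v v' Hv Hv'. apply Hf in Hv as (Hu & Hv & Hr & Hvc), Hv' as (_ & Hv' & Hr' & Hvc').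
      destruct (Fs u) as [s Hs]. assert (HsX : s ∈ X) by (apply HX; eauto).
      destruct (Hc s HsX) as (z & _ & Hz).
      assert (E1 : z = pr u v) by (apply Hz; split; auto; apply Hs; eauto).
      assert (E2 : z = pr u v') by (apply Hz; split; auto; apply Hs; eauto).
      rewrite E1 in E2. now apply pr_inj in E2.
    + intros p Hp. unfold f in Hp. apply in_sep in Hp as (_ & s & Hs & Hp & _); auto.
      apply HX in Hs as (u & Hu & Hs). apply Hs in Hp as (v & _ & _ & ->). eauto.
    + apply Hf in H; tauto.
    + apply Hf in H; tauto.
    + intros u Hu. destruct (Fs u) as [s Hs]. assert (HsX : s ∈ X) by (apply HX; eauto).
      destruct (Hc s HsX) as (z & [Hz Hzc] & _). apply Hs in Hz as (v & Hv & Hr & ->).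
      exists v. apply Hf; auto.
Qed.

(** Elements are chosen one after the other along the ordinals by recursion, the value [D]
    signalling that none is left; this must happen, since otherwise the ordinals would
    be injected into [D]. *)
Lemma enumeration D : exists a h, ordinal a /\ functional h /\
  (forall x y, pr x y ∈ h -> x ∈ a /\ y ∈ D) /\
  (forall y, y ∈ D -> exists x, pr x y ∈ h).
Proof.
  destruct (choice_function (fun s d => d ∈ s) (sep (power D) (fun s => exists d, d ∈ s)))
    as (g & Hg & _ & Hgm & Hgt); [df| |].
  { intros u Hu. apply in_sep in Hu; [tauto|df]. }
  assert (De : def1 (fun s : W => exists d, d ∈ s)) by df.
  assert (Gin : forall s d, pr s d ∈ g -> d ∈ s /\ d ∈ D).
  { intros s d H. apply Hgm in H as [Hs Hd]. apply in_sep in Hs as [Hs _]; auto.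
    apply in_power in Hs. auto. }
  assert (Gt : forall s, subset s D -> (exists d, d ∈ s) -> exists d, pr s d ∈ g).
  { intros s H H'. apply Hgt. apply in_sep; auto. split; auto. now apply in_power. }
  (* the elements not yet chosen, when [a] holds the choices made at members of [x] *)
  set (rem := fun x a => compr (fun d => d ∈ D /\ ~ exists z, z ∈ x /\ pr z d ∈ a)).
  assert (Hrem : forall x a d, d ∈ rem x a <-> d ∈ D /\ ~ exists z, z ∈ x /\ pr z d ∈ a).
  { intros x a. refine (in_compr _ D _ _); [df|tauto]. }
  assert (Drem : def3 (fun x a y => y = rem x a)).
  { unfold def3. apply dfn_iff with
      (fun _ e => forall d, d ∈ e 2 <-> d ∈ D /\ ~ exists z, z ∈ e 0 /\ pr z d ∈ e 1); [|df].
    intros _ e. split; [|intros ->; auto].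
    intros H. apply ext. intros z. now rewrite H, Hrem. }
  set (R := fun x a y => pr (rem x a) y ∈ g \/ ((~ exists d, pr (rem x a) d ∈ g) /\ y = D)).
  set (F := fun x a => epsilon inhabited_structure (R x a)).
  assert (HF : forall x a, R x a (F x a)).
  { intros x a. apply epsilon_spec. unfold R.
    destruct (classic (exists d, pr (rem x a) d ∈ g)) as [[d H]|H]; eauto. }
  assert (HF' : forall x a y, y = F x a <-> R x a y).
  { intros x a y. split; [intros ->; auto|]. intros H. specialize (HF x a). unfold R in *.
    destruct H as [H|[H H']], HF as [H0|[H0 H0']]; try congruence; eauto.
    - exfalso; eauto.
    - exfalso; eauto. }
  destruct (recursion' F) as (H & HH & E).
  { unfold def3. apply dfn_iff with (fun _ e => R (e 0) (e 1) (e 2)); [intros; symmetry; apply HF'|].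
    unfold R. df. }
  { intros x a a' Ha. replace (F x a') with (epsilon inhabited_structure (R x a')) by reflexivity.
    unfold F, R. replace (rem x a') with (rem x a); auto.
    apply ext. intros d. rewrite !Hrem. split; intros [Hd N]; split; auto;
      intros (z & Hz & Hz'); apply N; exists z; split; auto; apply Ha; auto; now apply trcl_sub. }
  assert (E' : forall x, R x (graph H (trcl x)) (H x)) by (intros x; apply HF', E).
  assert (Er : forall x d, d ∈ rem x (graph H (trcl x)) <-> d ∈ D /\ forall z, z ∈ x -> d <> H z).
  { intros x d. rewrite Hrem. split; intros [Hd N]; split; auto.
    - intros z Hz Ed. apply N. exists z. split; auto. apply in_graph; auto. split; auto.
      now apply trcl_sub.
    - intros (z & Hz & Hp). apply in_graph in Hp as [_ Ed]; auto. exact (N z Hz Ed). }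
  assert (Hin : forall x, H x <> D -> H x ∈ D /\ forall z, z ∈ x -> H x <> H z).
  { intros x Hx. destruct (E' x) as [Hp|[_ Hp]]; [|contradiction].
    apply Gin in Hp as [Hp _]. now apply Er in Hp. }
  destruct (classic (exists a, ordinal a /\ H a = D)) as [(a & Ha & Ha')|N].
  - assert (Dh : def1 (fun p => exists x, x ∈ a /\ H x <> D /\ p = pr x (H x))) by df.
    set (h := sep (prod a D) (fun p => exists x, x ∈ a /\ H x <> D /\ p = pr x (H x))).
    assert (Hh : forall x y, pr x y ∈ h <-> x ∈ a /\ H x <> D /\ y = H x).
    { intros x y. unfold h. rewrite in_sep, pr_in_prod by auto. split.
      - intros [_ (x' & ? & ? & Ep)]. apply pr_inj in Ep as [-> ->]. auto.
      - intros (Hx & Hn & ->). split; eauto. split; auto. now apply Hin. }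
    exists a, h. split; [exact Ha|]. split; [|split].
    + intros x y y' Hy Hy'. apply Hh in Hy as (_ & _ & ->), Hy' as (_ & _ & ->). auto.
    + intros x y Hp. apply Hh in Hp as (Hx & Hn & ->). split; auto. now apply Hin.
    + intros y Hy. apply NNPP. intros Ny.
      assert (Hr : exists d, pr (rem a (graph H (trcl a))) d ∈ g).
      { apply Gt.
        - intros d Hd. apply Er in Hd; tauto.
        - exists y. apply Er. split; auto. intros z Hz Ez. apply Ny. exists z. apply Hh.
          repeat split; auto. intros HD. rewrite HD in Ez. subst y. eapply no_mem_cycle1; eauto. }
      destruct (E' a) as [Hp|[Hp _]]; [|contradiction].
      rewrite Ha' in Hp. apply Gin in Hp as [_ Hp]. eapply no_mem_cycle1; eauto.
  - exfalso.
    assert (Hn : forall a, ordinal a -> H a <> D) by (intros a Ha Ha'; apply N; eauto).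
    destruct (replacement (fun d a => ordinal a /\ d = H a) D) as [s Hs]; [df| |].
    + intros d a b _ [Ha Ea] [Hb Eb].
      destruct (ordinal_linear a b Ha Hb) as [K|[K|K]]; auto; exfalso.
      * apply (proj2 (Hin b (Hn b Hb)) a K). congruence.
      * apply (proj2 (Hin a (Hn a Ha)) b K). congruence.
    + apply (burali_forti s). intros a Ha. apply Hs. exists (H a). split; auto.
      apply Hin; auto.
Qed.
End Choice.

(** * Posets and the forcing relation *)

(** ** What the formulas about posets say *)
Section Macros.
Variable W : structure.
Implicit Types e : nat -> W.

Lemma iff_Neg e phi Q : (sat W e phi <-> Q) -> (sat W e (Neg phi) <-> ~ Q).
Proof. simpl. tauto. Qed.
Lemma iff_And e phi psi P Q : (sat W e phi <-> P) -> (sat W e psi <-> Q) ->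
  (sat W e (And phi psi) <-> P /\ Q).
Proof. simpl. tauto. Qed.
Lemma iff_Imp e phi psi (P Q : Prop) : (sat W e phi <-> P) -> (sat W e psi <-> Q) ->
  (sat W e (Imp phi psi) <-> (P -> Q)).
Proof. simpl. intros -> ->. tauto. Qed.
Lemma iff_Or e phi psi (P Q : Prop) : (sat W e phi <-> P) -> (sat W e psi <-> Q) ->
  (sat W e (Or phi psi) <-> (P \/ Q)).
Proof. simpl. intros -> ->. tauto. Qed.
Lemma iff_Iff e phi psi (P Q : Prop) : (sat W e phi <-> P) -> (sat W e psi <-> Q) ->
  (sat W e (Iff phi psi) <-> (P <-> Q)).
Proof. simpl. intros -> ->. tauto. Qed.
Lemma iff_All e x phi (Q : W -> Prop) : (forall a, sat W (upd e x a) phi <-> Q a) ->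
  (sat W e (All x phi) <-> forall a, Q a).
Proof. simpl. intros H. split; intros H' a; apply H; auto. Qed.
Lemma iff_Ex e x phi (Q : W -> Prop) : (forall a, sat W (upd e x a) phi <-> Q a) ->
  (sat W e (Ex x phi) <-> exists a, Q a).
Proof.
  simpl. intros H. split.
  - intros H'. apply NNPP. intros N. apply H'. intros a Ha. apply N. exists a. now apply H.
  - intros [a Ha] H'. apply (H' a). now apply H.
Qed.
Lemma iff_AllIn e x y phi v (Q : W -> Prop) : x <> y -> e y = v ->
  (forall a, sat W (upd e x a) phi <-> Q a) ->
  (sat W e (AllIn x y phi) <-> forall a, a ∈ v -> Q a).
Proof.
  intros Hn <- H. apply iff_All. intros a. apply iff_Imp; auto.
  simpl. rewrite upd_eq, upd_ne; auto. tauto.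
Qed.
Lemma iff_ExIn e x y phi v (Q : W -> Prop) : x <> y -> e y = v ->
  (forall a, sat W (upd e x a) phi <-> Q a) ->
  (sat W e (ExIn x y phi) <-> exists a, a ∈ v /\ Q a).
Proof.
  intros Hn <- H. apply iff_Ex. intros a. apply iff_And; auto.
  simpl. rewrite upd_eq, upd_ne; auto. tauto.
Qed.
End Macros.

Ltac upd_simp := repeat match goal with
  | |- context [upd ?e ?x ?a ?i] =>
     first [ rewrite (upd_eq e x a) | rewrite (upd_ne e x a i) by lia ] end.
Ltac sat_ext := fail.
Ltac sat_tac := cbv zeta; first
  [ sat_ext; upd_simp; reflexivity
  | lazymatch goal with
    | |- sat _ _ (Mem _ _) <-> _ => cbn [sat]; upd_simp; reflexivity
    | |- sat _ _ (Eq _ _) <-> _ => cbn [sat]; upd_simp; reflexivity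
    | |- sat _ _ (Neg _) <-> _ => apply iff_Neg
    | |- sat _ _ (And _ _) <-> _ => apply iff_And
    | |- sat _ _ (Imp _ _) <-> _ => apply iff_Imp
    | |- sat _ _ (Or _ _) <-> _ => apply iff_Or
    | |- sat _ _ (Iff _ _) <-> _ => apply iff_Iff
    | |- sat _ _ (All _ _) <-> _ => apply iff_All; intros ?
    | |- sat _ _ (Ex _ _) <-> _ => apply iff_Ex; intros ?
    | |- sat _ _ (AllIn _ _ _) <-> _ =>
        apply iff_AllIn; [lia|upd_simp; reflexivity|intros ?]
    | |- sat _ _ (ExIn _ _ _) <-> _ =>
        apply iff_ExIn; [lia|upd_simp; reflexivity|intros ?]
    end ]; try sat_tac.

Section Macros2.
Variable W : structure.
Implicit Types e : nat -> W.
Lemma sat_fUpair e z x y : sat W e (fUpair z x y) <-> is_upair (e z) (e x) (e y).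
Proof. unfold fUpair, is_upair. sat_tac. Qed.
End Macros2.
Ltac sat_ext1 := rewrite sat_fUpair.
Ltac sat_ext ::= sat_ext1.
Section Macros3.
Variable W : structure.
Implicit Types e : nat -> W.
Lemma sat_fPair e z x y : sat W e (fPair z x y) <-> is_pair (e z) (e x) (e y).
Proof. unfold fPair, is_pair. sat_tac. Qed.
End Macros3.
Ltac sat_ext2 := first [rewrite sat_fPair | sat_ext1].
Ltac sat_ext ::= sat_ext2.
Section Macros4.
Variable W : structure.
Implicit Types e : nat -> W.
Lemma sat_fTriple e w x y z : sat W e (fTriple w x y z) <-> is_triple (e w) (e x) (e y) (e z).
Proof. unfold fTriple, is_triple. sat_tac. Qed.
Lemma sat_fPairIn e x y f : sat W e (fPairIn x y f) <-> pair_in (e x) (e y) (e f).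
Proof. unfold fPairIn, pair_in. sat_tac. Qed.
End Macros4.
Ltac sat_ext3 := first [rewrite sat_fTriple | rewrite sat_fPairIn | sat_ext2].
Ltac sat_ext ::= sat_ext3.

Definition preorder {W : structure} (P l o : W) : Prop :=
  (forall w, w ∈ l -> exists x, x ∈ P /\ exists y, y ∈ P /\ is_pair w x y) /\
  o ∈ P /\
  (forall x, x ∈ P -> pair_in x x l) /\
  (forall x, x ∈ P -> forall y, y ∈ P -> forall z, z ∈ P ->
     pair_in x y l -> pair_in y z l -> pair_in x z l) /\
  (forall x, x ∈ P -> pair_in x o l).

Section Macros5.
Variable W : structure.
Implicit Types e : nat -> W.
Lemma sat_fPreorder e P l o : sat W e (fPreorder P l o) <-> preorder (e P) (e l) (e o).
Proof.
  unfold fPreorder, preorder. sat_tac.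
Qed.
End Macros5.
Ltac sat_ext4 := first [rewrite sat_fPreorder | sat_ext3].
Ltac sat_ext ::= sat_ext4.

Section Macros6.
Variable W : structure.
Implicit Types e : nat -> W.
Lemma sat_fPoset e c : sat W e (fPoset c) <->
  exists P l o, is_triple (e c) P l o /\ preorder P l o.
Proof. unfold fPoset. sat_tac. Qed.
Lemma sat_fTrivialPoset e c : sat W e (fTrivialPoset c) <->
  exists P l o, is_triple (e c) P l o /\ preorder P l o /\ forall x, x ∈ P -> x = o.
Proof. unfold fTrivialPoset. sat_tac. Qed.
Lemma is_poset_iff (c : W) : is_poset W c <-> exists P l o, is_triple c P l o /\ preorder P l o.
Proof. unfold is_poset. now rewrite sat_fPoset. Qed.
Lemma sat_fClass e chi x : (forall i, free i chi -> i = 0) ->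
  (sat W e (fClass chi x) <-> is_poset W (e x) /\ sat W (fun _ => e x) chi).
Proof.
  intros Hchi. unfold fClass. cbv zeta. apply iff_And.
  - now rewrite sat_fPoset, is_poset_iff.
  - transitivity (exists a, a = e x /\ exists b, b = a /\ sat W (fun _ => b) chi).
    + sat_tac. apply sat_ext. intros i Hi. apply Hchi in Hi. subst. now rewrite upd_eq.
    + split; [intros (a & -> & b & -> & H); auto|eauto].
Qed.
Lemma in_class_iff chi (c : W) : (forall i, free i chi -> i = 0) ->
  (in_class W chi c <-> is_poset W c /\ sat W (fun _ => c) chi).
Proof. intros H. unfold in_class. now rewrite sat_fClass. Qed.
End Macros6.

(** ** The forcing relation *)
Section ForcingRelation.
Context {M : structure} {hM : ZF M} {c : M}.
Hypothesis hc : is_poset M c.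
Implicit Types p q r s pi sigma tau rho : M.
Local Notation cond := (cond M c).
Local Notation le := (le M c).
Local Notation feq := (forces_eq M c).
Local Notation fmem := (forces_mem M c).
Local Notation frc := (forces M c).

Lemma poset_data : exists C l o, c = pr (pr C l) o /\ preorder C l o /\
  (forall p, cond p <-> p ∈ C) /\ (forall p q, le p q <-> pr p q ∈ l) /\
  (forall p, top M c p <-> p = o).
Proof.
  apply is_poset_iff in hc as (C & l & o & E & HP). apply is_triple_iff in E.
  exists C, l, o. split; auto. split; auto.
  assert (T : forall C' l' o', is_triple c C' l' o' -> C' = C /\ l' = l /\ o' = o).
  { intros C' l' o' E'. apply is_triple_iff in E'. rewrite E in E'.
    apply pr_inj in E' as [E1 ->]. apply pr_inj in E1 as [-> ->]. auto. }
  assert (T0 : is_triple c C l o) by now apply is_triple_iff.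
  repeat split.
  - intros (C' & l' & o' & E' & H). apply T in E' as (-> & -> & ->). auto.
  - intros H. exists C, l, o. auto.
  - intros (C' & l' & o' & E' & H). apply T in E' as (-> & -> & ->). now apply pair_in_iff.
  - intros H. exists C, l, o. split; auto. now apply pair_in_iff.
  - intros (C' & l' & E'). apply T in E' as (-> & -> & ->). auto.
  - intros ->. exists C, l. auto.
Qed.

Lemma conditions_set : exists C, forall p, cond p <-> p ∈ C.
Proof. destruct poset_data as (C & l & o & _ & _ & H & _). eauto. Qed.
Lemma le_refl p : cond p -> le p p.
Proof.
  destruct poset_data as (C & l & o & _ & (_ & _ & Hr & _) & Hc & Hl & _).
  rewrite Hc, Hl. intros H. apply pair_in_iff. auto.
Qed.
Lemma le_cond p q : le p q -> cond p /\ cond q.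
Proof.
  destruct poset_data as (C & l & o & _ & (H & _) & Hc & Hl & _).
  rewrite !Hc, Hl. intros Hp. destruct (H _ Hp) as (x & Hx & y & Hy & E).
  apply is_pair_iff, pr_inj in E as [-> ->]. auto.
Qed.
Lemma le_trans p q r : le p q -> le q r -> le p r.
Proof.
  intros H1 H2. pose proof (le_cond _ _ H1) as [Hp Hq]. pose proof (le_cond _ _ H2) as [_ Hr].
  destruct poset_data as (C & l & o & _ & (_ & _ & _ & Ht & _) & Hc & Hl & _).
  rewrite Hc in *. rewrite Hl, <- pair_in_iff in *. eauto.
Qed.
Lemma top_ex : exists o, top M c o /\ cond o /\ forall p, cond p -> le p o.
Proof.
  destruct poset_data as (C & l & o & _ & (_ & Ho & _ & _ & Hm) & Hc & Hl & Ht).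
  exists o. rewrite Ht, Hc. repeat split; auto. intros p Hp. apply Hl, pair_in_iff.
  apply Hm. now apply Hc.
Qed.
Lemma top_unique o o' : top M c o -> top M c o' -> o = o'.
Proof.
  destruct poset_data as (C & l & o'' & _ & _ & _ & _ & Ht). rewrite !Ht. congruence.
Qed.

Lemma closed_names_iff D : closed_names M c D <->
  forall sigma w, sigma ∈ D -> w ∈ sigma -> exists pi p, w = pr pi p /\ pi ∈ D /\ cond p.
Proof.
  unfold closed_names. split; intros H sigma w Hs Hw;
    destruct (H sigma w Hs Hw) as (pi & p & E & ?); exists pi, p; split; auto;
    now apply is_pair_iff.
Qed.
Lemma closed_names_cup D D' : closed_names M c D -> closed_names M c D' ->
  closed_names M c (cup D D').
Proof.
  rewrite !closed_names_iff. intros H H' sigma w Hs Hw. apply in_cup in Hs.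
  destruct Hs as [Hs|Hs].
  - destruct (H sigma w Hs Hw) as (pi & p & E & ? & ?). exists pi, p. rewrite in_cup. auto.
  - destruct (H' sigma w Hs Hw) as (pi & p & E & ? & ?). exists pi, p. rewrite in_cup. auto.
Qed.
Lemma name_dom sigma w : is_name M c sigma -> w ∈ sigma ->
  exists pi p, w = pr pi p /\ is_name M c pi /\ cond p.
Proof.
  intros (D & HD & Hs) Hw. pose proof HD as HD'. rewrite closed_names_iff in HD.
  destruct (HD sigma w Hs Hw) as (pi & p & E & ? & ?). exists pi, p. repeat split; auto.
  exists D; auto.
Qed.
Lemma name_pair sigma pi s : is_name M c sigma -> pr pi s ∈ sigma -> is_name M c pi /\ cond s.
Proof.
  intros H H'. destruct (name_dom _ _ H H') as (pi' & p & E & ?).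
  apply pr_inj in E as [-> ->]. auto.
Qed.
Lemma name_intro tau : (forall w, w ∈ tau -> exists pi p, w = pr pi p /\ is_name M c pi /\ cond p) ->
  is_name M c tau.
Proof.
  intros H.
  destruct (collection (fun w D => exists pi p, w = pr pi p /\ pi ∈ D /\ closed_names M c D) tau)
    as [b Hb]; [df|].
  assert (Db : def1 (closed_names M c)) by df.
  exists (cup (union (sep b (closed_names M c))) (sing tau)). split; [|apply in_cup; rewrite in_sing; auto].
  apply closed_names_iff. intros sigma w Hs Hw. apply in_cup in Hs. rewrite in_sing in Hs.
  destruct Hs as [Hs| ->].
  - apply in_union in Hs as (D & HD & Hs). apply in_sep in HD as [HDb HD]; auto.
    pose proof HD as HD'. rewrite closed_names_iff in HD.
    destruct (HD sigma w Hs Hw) as (pi & p & E & ? & ?). exists pi, p. repeat split; auto.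
    apply in_cup. left. apply in_union. exists D. split; auto. apply in_sep; auto.
  - destruct (H w Hw) as (pi & p & E & (D & HD & Hpi) & Hp). exists pi, p. repeat split; auto.
    destruct (Hb w Hw) as (D' & HD' & pi' & p' & E' & Hpi' & HDc).
    { exists D, pi, p. auto. }
    rewrite E in E'. apply pr_inj in E' as [-> ->].
    apply in_cup. left. apply in_union. exists D'. split; auto. apply in_sep; auto.
Qed.

Lemma mem_dom_trcl pi s sigma : pr pi s ∈ sigma -> pi ∈ trcl sigma.
Proof.
  intros H. assert (H1 := trcl_sub _ _ H). 
  assert (H2 : sing pi ∈ pr pi s) by (apply in_upair; auto).
  assert (H3 : pi ∈ sing pi) by now apply in_sing.
  exact (trcl_trans sigma _ (trcl_trans sigma _ H1 _ H2) _ H3).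
Qed.

(** The clause defining forced equality is monotone in the relation, so a fixed point on a
    set of names exists. *)
Lemma eq_attempt_ex D : closed_names M c D -> exists R, eq_attempt M c D R.
Proof.
  intros HD. destruct conditions_set as [C HC].
  destruct (least_fixpoint (fun x R => exists p sigma tau, x = pr (pr p sigma) tau /\
     eq_half M c R p sigma tau /\ eq_half M c R p tau sigma) (prod (prod C D) D)) as (R & HR & _).
  - unfold eq_half, dense_below. df.
  - intros x R R' Hs (p & sigma & tau & -> & H1 & H2). exists p, sigma, tau.
    assert (K : forall sigma tau, eq_half M c R p sigma tau -> eq_half M c R' p sigma tau).
    { intros sg ta H pi s Hpi q Hq. destruct (H pi s Hpi q Hq) as (r & Hr & H').
      exists r. split; auto. intros Hrs. destruct (H' Hrs) as (pi' & s' & ? & ? & w & ? & ?).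
      exists pi', s'. repeat split; auto. exists w. auto. }
    auto.
  - exists R. split; auto. intros p sigma tau Hp Hs Ht. rewrite triple_in_iff, HR.
    rewrite !pr_in_prod, <- HC. split.
    + intros (_ & p' & sg & ta & E & H). apply pr_inj in E as [E ->]. apply pr_inj in E as [-> ->].
      auto.
    + intros H. split; auto. exists p, sigma, tau. auto.
Qed.

Lemma eq_half_iff R p sigma tau : eq_half M c R p sigma tau <->
  forall pi s, pr pi s ∈ sigma -> forall q, le q p -> exists r, le r q /\ (le r s ->
    exists pi' s', pr pi' s' ∈ tau /\ le r s' /\ pr (pr r pi) pi' ∈ R).
Proof.
  unfold eq_half, dense_below. split.
  - intros H pi s Hp q Hq. apply pair_in_iff in Hp. destruct (H pi s Hp q Hq) as (r & Hr & H').
    exists r. split; auto. intros Hs. destruct (H' Hs) as (pi' & s' & A & B & C).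
    exists pi', s'. rewrite <- pair_in_iff, <- triple_in_iff. auto.
  - intros H pi s Hp q Hq. apply pair_in_iff in Hp. destruct (H pi s Hp q Hq) as (r & Hr & H').
    exists r. split; auto. intros Hs. destruct (H' Hs) as (pi' & s' & A & B & C).
    exists pi', s'. rewrite pair_in_iff, triple_in_iff. auto.
Qed.

(** The clause for two names refers to pairs of a subname of each in both orders, so the
    induction on [sigma] treats both orders together. *)
Lemma eq_attempt_unique D R D' R' : eq_attempt M c D R -> eq_attempt M c D' R' ->
  forall sigma tau p, cond p -> sigma ∈ D -> tau ∈ D -> sigma ∈ D' -> tau ∈ D' ->
  (pr (pr p sigma) tau ∈ R <-> pr (pr p sigma) tau ∈ R').
Proof.
  intros [HD HR] [HD' HR'].
  assert (K : forall sigma, forall tau p, cond p -> sigma ∈ D -> tau ∈ D -> sigma ∈ D' -> tau ∈ D' ->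
    (pr (pr p sigma) tau ∈ R <-> pr (pr p sigma) tau ∈ R') /\
    (pr (pr p tau) sigma ∈ R <-> pr (pr p tau) sigma ∈ R')).
  { apply (trcl_ind (fun sigma => forall tau p, cond p -> sigma ∈ D -> tau ∈ D -> sigma ∈ D' ->
      tau ∈ D' -> (pr (pr p sigma) tau ∈ R <-> pr (pr p sigma) tau ∈ R') /\
      (pr (pr p tau) sigma ∈ R <-> pr (pr p tau) sigma ∈ R'))); [df|].
    intros sigma IH tau p Hp H1 H2 H3 H4.
    rewrite closed_names_iff in HD, HD'.
    assert (S1 : forall ta pi s, ta ∈ D -> ta ∈ D' -> pr pi s ∈ ta -> pi ∈ D /\ pi ∈ D').
    { intros ta pi s Ht Ht' Hp0. destruct (HD _ _ Ht Hp0) as (pi1 & p1 & E1 & ? & ?).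
      destruct (HD' _ _ Ht' Hp0) as (pi2 & p2 & E2 & ? & ?).
      apply pr_inj in E1, E2. destruct E1, E2. subst. auto. }
    assert (A1 : eq_half M c R p sigma tau <-> eq_half M c R' p sigma tau).
    { rewrite !eq_half_iff.
      split; intros H pi s Hpi q Hq; destruct (H pi s Hpi q Hq) as (r & Hr & H'); exists r;
        split; auto; intros Hs; destruct (H' Hs) as (pi' & s' & Hp' & Hs' & Hx); exists pi', s';
        repeat split; auto; destruct (S1 sigma pi s) as [? ?]; auto; destruct (S1 tau pi' s'); auto;
        apply (IH pi); auto; try (apply mem_dom_trcl with s; auto); now apply le_cond in Hr. }
    assert (A2 : eq_half M c R p tau sigma <-> eq_half M c R' p tau sigma).
    { rewrite !eq_half_iff.
      split; intros H pi s Hpi q Hq; destruct (H pi s Hpi q Hq) as (r & Hr & H'); exists r;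
        split; auto; intros Hs; destruct (H' Hs) as (pi' & s' & Hp' & Hs' & Hx); exists pi', s';
        repeat split; auto; destruct (S1 tau pi s) as [? ?]; auto; destruct (S1 sigma pi' s'); auto;
        apply (IH pi'); auto; try (apply mem_dom_trcl with s'; auto); now apply le_cond in Hr. }
    rewrite <- !triple_in_iff, !HR, !HR' by auto. tauto. }
  intros sigma tau p H1 H2 H3 H4 H5. now apply K.
Qed.

(** The recursion clause, free of the sets on which the relation was constructed and with
    the two halves treated symmetrically. *)
Lemma forces_eq_iff p sigma tau : cond p -> is_name M c sigma -> is_name M c tau ->
  (feq p sigma tau <->
   forall sg ta, (sg = sigma /\ ta = tau) \/ (sg = tau /\ ta = sigma) ->
    forall pi s, pr pi s ∈ sg -> forall q, le q p -> le q s ->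
      exists r pi' s', le r q /\ pr pi' s' ∈ ta /\ le r s' /\ feq r pi pi').
Proof.
  intros Hp (D1 & HD1 & Hs) (D2 & HD2 & Ht).
  set (D := cup D1 D2).
  assert (HD : closed_names M c D) by now apply closed_names_cup.
  destruct (eq_attempt_ex D HD) as [R HR].
  assert (Hs' : sigma ∈ D) by (apply in_cup; auto).
  assert (Ht' : tau ∈ D) by (apply in_cup; auto).
  assert (E : forall p sg ta, cond p -> sg ∈ D -> ta ∈ D -> (feq p sg ta <-> pr (pr p sg) ta ∈ R)).
  { intros q sg ta Hq Hsg Hta. split.
    - intros (D' & R' & HR' & Hsg' & Hta' & H). apply triple_in_iff in H.
      eapply eq_attempt_unique; eauto.
    - intros H. exists D, R. rewrite triple_in_iff. auto. }
  assert (Hd : forall sg pi s, sg ∈ D -> pr pi s ∈ sg -> pi ∈ D).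
  { rewrite closed_names_iff in HD. intros sg pi s H1 H2.
    destruct (HD _ _ H1 H2) as (pi' & p' & E' & ? & ?). apply pr_inj in E' as [-> _]. auto. }
  rewrite E, <- triple_in_iff by auto. destruct HR as [_ HR]. rewrite HR by auto.
  assert (K : forall sg ta, sg ∈ D -> ta ∈ D -> (eq_half M c R p sg ta <->
    forall pi s, pr pi s ∈ sg -> forall q, le q p -> le q s ->
      exists r pi' s', le r q /\ pr pi' s' ∈ ta /\ le r s' /\ feq r pi pi')).
  { intros sg ta Hsg Hta. rewrite eq_half_iff. split.
    - intros H pi s Hpi q Hq Hqs. destruct (H pi s Hpi q Hq) as (r & Hr & H').
      destruct H' as (pi' & s' & H1 & H2 & H3); [solve [eauto 6 using le_trans]|].
      exists r, pi', s'. repeat split; auto. apply E; eauto. now apply le_cond in Hr.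
    - intros H pi s Hpi q Hq. destruct (classic (exists q', le q' q /\ le q' s)) as [(q' & H1 & H2)|N].
      + destruct (H pi s Hpi q' (le_trans _ _ _ H1 Hq) H2) as (r & pi' & s' & A & B & C0 & F).
        exists r. split; [solve [eauto 6 using le_trans]|]. intros _. exists pi', s'. repeat split; auto.
        apply E; eauto. now apply le_cond in A.
      + exists q. split; [apply le_refl; now apply le_cond in Hq|]. intros H1. exfalso. apply N.
        exists q. split; auto. apply le_refl. now apply le_cond in Hq. }
  rewrite !K by auto. split.
  - intros [H1 H2] sg ta [[-> ->]|[-> ->]]; auto.
  - intros H. split; apply H; auto.
Qed.

Lemma feq_names p sigma tau : feq p sigma tau -> is_name M c sigma /\ is_name M c tau.
Proof. intros (D & R & [HD _] & ? & ? & _). split; exists D; auto. Qed.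

Lemma feq_sym p sigma tau : cond p -> feq p sigma tau -> feq p tau sigma.
Proof.
  intros Hp H. destruct (feq_names _ _ _ H) as [Hs Ht].
  rewrite forces_eq_iff in * by auto. intros sg ta H'. apply H. tauto.
Qed.
Lemma feq_mono p q sigma tau : le q p -> feq p sigma tau -> feq q sigma tau.
Proof.
  intros Hq H. destruct (feq_names _ _ _ H) as [Hs Ht]. pose proof (le_cond _ _ Hq) as [? ?].
  rewrite forces_eq_iff in * by auto. intros sg ta H' pi s Hpi r Hr Hrs.
  apply (H sg ta H' pi s Hpi); auto. solve [eauto 6 using le_trans].
Qed.
Lemma feq_regular p sigma tau : cond p -> is_name M c sigma -> is_name M c tau ->
  (forall q, le q p -> exists r, le r q /\ feq r sigma tau) -> feq p sigma tau.
Proof.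
  intros Hp Hs Ht H. apply forces_eq_iff; auto. intros sg ta H' pi s Hpi q Hq Hqs.
  destruct (H q Hq) as (r & Hr & Hf). pose proof (le_cond _ _ Hr) as [? ?].
  rewrite forces_eq_iff in Hf by auto.
  destruct (Hf sg ta H' pi s Hpi r) as (r' & pi' & s' & ? & ? & ? & ?).
  { now apply le_refl. } { solve [eauto 6 using le_trans]. }
  exists r', pi', s'. repeat split; auto. solve [eauto 6 using le_trans].
Qed.
Lemma feq_refl p sigma : cond p -> is_name M c sigma -> feq p sigma sigma.
Proof.
  intros Hp Hs. revert sigma p Hp Hs.
  apply (trcl_ind (fun sigma => forall p, cond p -> is_name M c sigma -> feq p sigma sigma)); [df|].
  intros sigma IH p Hp Hs. apply forces_eq_iff; auto.
  intros sg ta H pi s Hpi q Hq Hqs. exists q, pi, s.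
  assert (sg = sigma /\ ta = sigma) as [-> ->] by tauto.
  assert (cond q) by now apply le_cond in Hq.
  repeat split; auto; [now apply le_refl|].
  apply IH; auto; [eapply mem_dom_trcl; eauto|]. now apply name_pair in Hpi.
Qed.
(** Induction on the first name, for all conditions and all other names at once. *)
Lemma feq_trans p sigma tau rho : cond p -> feq p sigma tau -> feq p tau rho -> feq p sigma rho.
Proof.
  revert sigma tau rho p.
  apply (trcl_ind (fun sigma => forall tau rho p,
    cond p -> feq p sigma tau -> feq p tau rho -> feq p sigma rho)); [df|].
  intros sigma IH tau rho p Hp H1 H2.
  destruct (feq_names _ _ _ H1) as [Hs Ht], (feq_names _ _ _ H2) as [_ Hr].
  rewrite forces_eq_iff in * by auto.
  intros sg ta [[-> ->]|[-> ->]] pi s Hpi q Hq Hqs.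
  - destruct (H1 sigma tau (or_introl (conj eq_refl eq_refl)) pi s Hpi q Hq Hqs)
      as (r & pi' & s' & A & B & C & D).
    destruct (H2 tau rho (or_introl (conj eq_refl eq_refl)) pi' s' B r)
      as (r' & pi2 & s2 & A' & B' & C' & D'); auto; [solve [eauto 6 using le_trans]|].
    exists r', pi2, s2. repeat split; auto; [solve [eauto 6 using le_trans]|].
    apply (IH pi) with pi'; auto; [eapply mem_dom_trcl; eauto|now apply le_cond in A'|].
    solve [eauto 6 using feq_mono, le_trans].
  - destruct (H2 rho tau (or_intror (conj eq_refl eq_refl)) pi s Hpi q Hq Hqs)
      as (r & pi' & s' & A & B & C & D).
    destruct (H1 tau sigma (or_intror (conj eq_refl eq_refl)) pi' s' B r)
      as (r' & pi2 & s2 & A' & B' & C' & D'); auto; [solve [eauto 6 using le_trans]|].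
    exists r', pi2, s2. repeat split; auto; [solve [eauto 6 using le_trans]|].
    assert (cond r') by now apply le_cond in A'.
    apply feq_sym; auto.
    apply (IH pi2) with pi'; auto; [eapply mem_dom_trcl; eauto|now apply feq_sym|].
    apply feq_sym; auto. solve [eauto 6 using feq_mono, le_trans].
Qed.

Lemma fmem_iff p sigma tau : fmem p sigma tau <->
  forall q, le q p -> exists r pi s, le r q /\ pr pi s ∈ tau /\ le r s /\ feq r sigma pi.
Proof.
  unfold forces_mem, dense_below. split.
  - intros H q Hq. destruct (H q Hq) as (r & Hr & pi & s & A & B & C).
    exists r, pi, s. rewrite pair_in_iff in A. auto.
  - intros H q Hq. destruct (H q Hq) as (r & pi & s & Hr & A & B & C).
    exists r. split; auto. exists pi, s. rewrite pair_in_iff. auto.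
Qed.
Lemma fmem_mono p q sigma tau : le q p -> fmem p sigma tau -> fmem q sigma tau.
Proof. rewrite !fmem_iff. intros Hq H r Hr. apply H. solve [eauto 6 using le_trans]. Qed.
Lemma fmem_regular p sigma tau :
  (forall q, le q p -> exists r, le r q /\ fmem r sigma tau) -> fmem p sigma tau.
Proof.
  intros H. apply fmem_iff. intros q Hq. destruct (H q Hq) as (r & Hr & Hf).
  rewrite fmem_iff in Hf. destruct (Hf r) as (r' & pi & s & ? & ? & ? & ?).
  { apply le_refl. now apply le_cond in Hr. }
  exists r', pi, s. repeat split; auto. solve [eauto 6 using le_trans].
Qed.
Lemma fmem_feq_l p sigma sigma' tau : feq p sigma sigma' -> fmem p sigma tau -> fmem p sigma' tau.
Proof.
  intros He. rewrite !fmem_iff. intros H q Hq. destruct (H q Hq) as (r & pi & s & A & B & C & D).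
  pose proof (le_cond _ _ A) as [? ?].
  exists r, pi, s. repeat split; auto. apply feq_trans with sigma; auto. apply feq_sym; auto.
  apply feq_mono with p; auto. solve [eauto 6 using le_trans].
Qed.
Lemma fmem_feq_r p sigma tau tau' : cond p -> feq p tau tau' -> fmem p sigma tau -> fmem p sigma tau'.
Proof.
  intros Hp He. destruct (feq_names _ _ _ He). rewrite forces_eq_iff in He by auto.
  rewrite !fmem_iff. intros H1 q Hq. destruct (H1 q Hq) as (r & pi & s & A & B & C & D).
  destruct (He tau tau' (or_introl (conj eq_refl eq_refl)) pi s B r) as (r' & pi' & s' & A' & B' & C' & D').
  { solve [eauto 6 using le_trans]. } { auto. }
  exists r', pi', s'. repeat split; auto; [solve [eauto 6 using le_trans]|].
  apply feq_trans with pi; auto; [now apply le_cond in A'|]. solve [eauto 6 using feq_mono, le_trans].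
Qed.
Lemma fmem_intro pi s sigma p : is_name M c sigma -> pr pi s ∈ sigma -> le p s -> fmem p pi sigma.
Proof.
  intros Hn H Hp. apply fmem_iff. intros q Hq. exists q, pi, s.
  pose proof (le_cond _ _ Hq) as [? ?].
  repeat split; auto; [now apply le_refl|solve [eauto 6 using le_trans]|].
  apply feq_refl; auto. now apply name_pair in H.
Qed.

Lemma forces_mono phi : forall p q nu, le q p -> frc p nu phi -> frc q nu phi.
Proof.
  induction phi; cbn [forces]; intros p q nu Hq H.
  - solve [eauto 6 using fmem_mono, le_trans].
  - solve [eauto 6 using feq_mono, le_trans].
  - intros r Hr. apply H. solve [eauto 6 using le_trans].
  - destruct H; eauto.
  - eauto.
Qed.
Lemma forces_regular phi : forall p nu, cond p -> (forall i, is_name M c (nu i)) ->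
  (forall q, le q p -> exists r, le r q /\ frc r nu phi) -> frc p nu phi.
Proof.
  induction phi; cbn [forces]; intros p nu Hp Hn H.
  - now apply fmem_regular.
  - now apply feq_regular.
  - intros q Hq Hf. destruct (H q Hq) as (r & Hr & H').
    apply (H' r); [apply le_refl; now apply le_cond in Hr|]. eapply forces_mono; eauto.
  - split; [apply IHphi1|apply IHphi2]; auto; intros q Hq; destruct (H q Hq) as (r & Hr & ? & ?); eauto.
  - intros tau Ht. apply IHphi; auto.
    + intros i. unfold upd. destruct (i =? x); auto.
    + intros q Hq. destruct (H q Hq) as (r & Hr & H'). exists r; auto.
Qed.
Lemma not_forces phi p nu : cond p -> (forall i, is_name M c (nu i)) -> ~ frc p nu phi ->
  exists q, le q p /\ frc q nu (Neg phi).
Proof.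
  intros Hp Hn H. apply NNPP. intros N. apply H. apply forces_regular; auto.
  intros q Hq. apply NNPP. intros N'. apply N. exists q. split; auto.
  cbn [forces]. intros r Hr Hf. apply N'. eauto.
Qed.
End ForcingRelation.

(** * Generic filters and generic extensions *)

Record generic_filter (M : structure) (c : M) (G : M -> Prop) : Prop := {
  gf_cond : forall p, G p -> cond M c p;
  gf_inhabited : exists p, G p;
  gf_up : forall p q, G p -> le M c p q -> G q;
  gf_dir : forall p q, G p -> G q -> exists r, G r /\ le M c r p /\ le M c r q;
  gf_dense : forall D : M, (forall p, p ∈ D -> cond M c p) ->
    (forall p, cond M c p -> exists q, q ∈ D /\ le M c q p) -> exists p, p ∈ D /\ G p
}.
Arguments gf_cond {M c G}. Arguments gf_inhabited {M c G}. Arguments gf_up {M c G}.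
Arguments gf_dir {M c G}. Arguments gf_dense {M c G}.

(** An extension is described by its evaluation map rather than constructed, because it
    arises in several ways: as a quotient of the names and as a submodel of a structure
    that contains the filter. *)
Record extension (M : structure) (c : M) (G : M -> Prop) (N : structure) (val : M -> N) : Prop := {
  ext_surj : forall x, exists tau, is_name M c tau /\ val tau = x;
  ext_mem : forall tau y, is_name M c tau ->
    (y ∈ val tau <-> exists pi s, pair_in pi s tau /\ G s /\ y = val pi);
  ext_eq : forall sigma tau, is_name M c sigma -> is_name M c tau ->
    (val sigma = val tau <-> exists p, G p /\ forces_eq M c p sigma tau)
}.
Arguments ext_surj {M c G N val}. Arguments ext_mem {M c G N val}. Arguments ext_eq {M c G N val}.

Section DefForces.
Context {M : structure} {hM : ZF M} {c : M}.
Lemma def_forces phi nu : def1 (fun p => forces M c p nu phi).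
Proof.
  unfold def1. apply (dfn_forces _ _ _ phi (fun _ _ => c) (fun _ e => e 0)
    ltac:(dfn_tac) ltac:(dfn_tac) (fun n _ _ => nu n)). dfn_tac.
Qed.
Lemma def_forces_upd phi nu x : def2 (fun p tau => forces M c p (upd nu x tau) phi).
Proof.
  unfold def2. apply (dfn_forces _ _ _ phi (fun _ _ => c) (fun _ e => e 0)
    ltac:(dfn_tac) ltac:(dfn_tac) (fun n _ e => if n =? x then e 1 else nu n)).
  intros n. cbv beta. destruct (n =? x); dfn_tac.
Qed.
Lemma def_forces_upd2 phi nu x y :
  def3 (fun p sigma tau => forces M c p (upd (upd nu x sigma) y tau) phi).
Proof.
  unfold def3. apply (dfn_forces _ _ _ phi (fun _ _ => c) (fun _ e => e 0)
    ltac:(dfn_tac) ltac:(dfn_tac)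
    (fun n _ e => if n =? y then e 2 else if n =? x then e 1 else nu n)).
  intros n. cbv beta. destruct (n =? y), (n =? x); dfn_tac.
Qed.
End DefForces.

Section Generic.
Context {M : structure} {hM : ZF M} {c : M} {G : M -> Prop}.
Hypothesis hc : is_poset M c.
Hypothesis hG : generic_filter M c G.
Implicit Types p q r s pi sigma tau rho : M.
Local Notation cond := (cond M c).
Local Notation le := (le M c).
Local Notation name := (is_name M c).
Local Notation feq := (forces_eq M c).
Local Notation fmem := (forces_mem M c).
Local Notation frc := (forces M c).

(** Definable dense classes of conditions are sets, so the filter meets them. *)
Lemma generic_dense (P : M -> Prop) : def1 P ->
  (forall p, cond p -> exists q, le q p /\ P q) -> exists p, G p /\ P p.
Proof.
  intros HP Hd. destruct (conditions_set hc) as [C HC].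
  destruct (gf_dense hG (sep C P)) as (p & Hp & HGp).
  - intros p Hp. apply in_sep in Hp as [Hp _]; auto. now apply HC.
  - intros p Hp. destruct (Hd p Hp) as (q & Hq & HPq). exists q. split; auto.
    apply in_sep; auto. split; auto. apply HC. now apply (le_cond hc) in Hq.
  - apply in_sep in Hp as [_ Hp]; eauto.
Qed.

(** The conditions incompatible with [p0] are added to make the class dense; the filter
    contains none of them. *)
Lemma generic_dense_below (P : M -> Prop) p0 : def1 P -> G p0 ->
  (forall p, le p p0 -> exists q, le q p /\ P q) -> exists p, G p /\ le p p0 /\ P p.
Proof.
  intros HP H0 Hd.
  destruct (generic_dense (fun q => (le q p0 /\ P q) \/ ~ exists r, le r q /\ le r p0))
    as (p & Hp & [[H1 H2]|N]).
  - df.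
  - intros p Hp. destruct (classic (exists r, le r p /\ le r p0)) as [(r & Hr & Hr')|N].
    + destruct (Hd r Hr') as (q & Hq & HPq). exists q.
      split; [|left; split]; eauto using le_trans.
    + exists p. split; auto. now apply le_refl.
  - eauto.
  - destruct (gf_dir hG p p0 Hp H0) as (r & _ & ? & ?). exfalso. eauto.
Qed.

Lemma top_in_filter o : top M c o -> G o.
Proof.
  intros Ho. destruct (top_ex hc) as (o' & Ho' & _ & Hm).
  rewrite (top_unique hc o o') by auto. destruct (gf_inhabited hG) as [p Hp].
  apply (gf_up hG p); auto. apply Hm. now apply (gf_cond hG).
Qed.

Lemma filter_common p q : G p -> G q -> exists r, G r /\ cond r /\ le r p /\ le r q.
Proof.
  intros Hp Hq. destruct (gf_dir hG p q Hp Hq) as (r & Hr & ? & ?). exists r.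
  repeat split; auto. now apply (gf_cond hG).
Qed.

(** A failure of forced equality is witnessed below some condition by an element of one
    name that is kept out of the other. *)
Lemma feq_decided sigma tau : name sigma -> name tau ->
  exists q, G q /\ (feq q sigma tau \/
   exists sg ta, ((sg = sigma /\ ta = tau) \/ (sg = tau /\ ta = sigma)) /\
     exists pi s, pr pi s ∈ sg /\ le q s /\
      forall r pi' s', le r q -> pr pi' s' ∈ ta -> le r s' -> ~ feq r pi pi').
Proof.
  intros Hs Ht.
  destruct (generic_dense (fun q => feq q sigma tau \/
   exists sg ta, ((sg = sigma /\ ta = tau) \/ (sg = tau /\ ta = sigma)) /\
     exists pi s, pr pi s ∈ sg /\ le q s /\
      forall r pi' s', le r q -> pr pi' s' ∈ ta -> le r s' -> ~ feq r pi pi')) as (q & Hq & H).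
  - df.
  - intros p Hp. destruct (classic (feq p sigma tau)) as [H|H].
    + exists p. split; auto. now apply le_refl.
    + rewrite forces_eq_iff in H by auto.
      apply not_all_ex_not in H as [sg H]. apply not_all_ex_not in H as [ta H].
      apply imply_to_and in H as [Ho H].
      apply not_all_ex_not in H as [pi H]. apply not_all_ex_not in H as [s H].
      apply imply_to_and in H as [Hpi H]. apply not_all_ex_not in H as [q H].
      apply imply_to_and in H as [Hq H]. apply imply_to_and in H as [Hqs H].
      exists q. split; auto. right. exists sg, ta. split; auto. exists pi, s.
      repeat split; auto. intros r pi' s' H1 H2 H3 H4. apply H. exists r, pi', s'. auto.
  - exists q. auto.
Qed.

Section Truth.
Context {N : structure} {val : M -> N}.
Hypothesis hE : extension M c G N val.

Lemma val_mem tau y : name tau ->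
  (y ∈ val tau <-> exists pi s, pr pi s ∈ tau /\ G s /\ y = val pi).
Proof.
  intros Ht. rewrite (ext_mem hE) by auto.
  split; intros (pi & s & H & ?); exists pi, s; apply pair_in_iff in H || rewrite pair_in_iff; auto.
Qed.

Lemma truth_mem sigma tau : name sigma -> name tau ->
  (val sigma ∈ val tau <-> exists p, G p /\ fmem p sigma tau).
Proof.
  intros Hs Ht. rewrite val_mem by auto. split.
  - intros (pi & s & Hpi & HGs & E). destruct (name_pair _ _ _ Ht Hpi) as [Hn _].
    apply (ext_eq hE) in E as (p & Hp & E); auto.
    destruct (filter_common p s Hp HGs) as (q & Hq & Hcq & Hqp & Hqs). exists q. split; auto.
    apply (fmem_feq_l hc q pi); [|apply (fmem_intro hc pi s); auto].
    + apply feq_sym; auto. apply (feq_mono hc p); auto.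
  - intros (p & Hp & Hf). rewrite fmem_iff in Hf.
    destruct (generic_dense_below (fun r => exists pi s, pr pi s ∈ tau /\ le r s /\ feq r sigma pi) p)
      as (r & Hr & _ & pi & s & H1 & H2 & H3); auto.
    + df.
    + intros q Hq. destruct (Hf q Hq) as (r & pi & s & ? & ? & ? & ?). exists r. eauto 8.
    + exists pi, s. repeat split; auto.
      * apply (gf_up hG r); auto.
      * apply (ext_eq hE); auto; [exact (proj1 (name_pair _ _ _ Ht H1))|]. eauto.
Qed.

Lemma extension_ext (x y : N) : (forall z, z ∈ x <-> z ∈ y) -> x = y.
Proof.
  intros H. destruct (ext_surj hE x) as (sigma & Hs & <-), (ext_surj hE y) as (tau & Ht & <-).
  destruct (feq_decided sigma tau Hs Ht) as (q & Hq & [Hf|(sg & ta & Ho & pi & s & Hpi & Hqs & Hn)]).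
  - apply (ext_eq hE); eauto.
  - exfalso.
    assert (Hsg : name sg) by (destruct Ho as [[-> ->]|[-> ->]]; auto).
    assert (Hta : name ta) by (destruct Ho as [[-> ->]|[-> ->]]; auto).
    assert (H1 : val pi ∈ val sg).
    { apply val_mem; auto. exists pi, s. repeat split; auto. apply (gf_up hG q); auto. }
    assert (H2 : val pi ∈ val ta) by (destruct Ho as [[-> ->]|[-> ->]]; now apply H).
    apply val_mem in H2 as (pi' & s' & Hpi' & Hs' & E); auto.
    apply (ext_eq hE) in E as (p & Hp & E); [|exact (proj1 (name_pair _ _ _ Hsg Hpi))|exact (proj1 (name_pair _ _ _ Hta Hpi'))].
    destruct (filter_common q p Hq Hp) as (r & Hr & _ & Hrq & Hrp).
    destruct (filter_common r s' Hr Hs') as (r' & Hr' & _ & Hrr & Hrs).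
    apply (Hn r' pi' s'); auto; eauto using le_trans.
    apply (feq_mono hc p); eauto using le_trans.
Qed.

Lemma names_upd nu x tau : (forall i, name (nu i)) -> name tau -> forall i, name (upd nu x tau i).
Proof. intros H Ht i. unfold upd. destruct (i =? x); auto. Qed.

Lemma val_upd nu x tau : (fun i => val (upd nu x tau i)) = upd (fun i => val (nu i)) x (val tau).
Proof. extensionality i. unfold upd. now destruct (i =? x). Qed.

(** At a negation or a quantifier, genericity provides a condition that decides the
    statement or the instance refuting it. *)
Theorem truth phi : forall nu, (forall i, name (nu i)) ->
  (sat N (fun i => val (nu i)) phi <-> exists p, G p /\ frc p nu phi).
Proof.
  assert (Common : forall phi p q nu, G p -> G q -> frc p nu phi -> frc q nu (Neg phi) -> False).
  { intros psi p q nu Hp Hq H1 H2. destruct (filter_common p q Hp Hq) as (r & _ & _ & Hrp & Hrq).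
    apply (H2 r Hrq). apply (forces_mono hc psi p); auto. }
  induction phi; cbn [sat forces]; intros nu Hn.
  - now apply truth_mem.
  - now apply (ext_eq hE).
  - rewrite IHphi by auto. split.
    + intros H. destruct (generic_dense (fun q => frc q nu phi \/ frc q nu (Neg phi))) as (p & Hp & [Hf|Hf]).
      * pose proof (def_forces (c:=c) phi nu). pose proof (def_forces (c:=c) (Neg phi) nu). df.
      * intros p Hp. destruct (classic (frc p nu phi)) as [Hf|Hf].
        { exists p. split; auto. now apply le_refl. }
        destruct (not_forces hc phi p nu Hp Hn Hf) as (q & ? & ?). eauto.
      * exfalso. eauto.
      * exists p. exact (conj Hp Hf).
    + intros (p & Hp & H) (q & Hq & H'). exact (Common phi q p nu Hq Hp H' H).
  - rewrite IHphi1, IHphi2 by auto. split.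
    + intros [(p & Hp & H) (q & Hq & H')]. destruct (filter_common p q Hp Hq) as (r & Hr & _ & ? & ?).
      exists r. split; auto. split; [apply (forces_mono hc phi1 p)|apply (forces_mono hc phi2 q)]; auto.
    + intros (p & Hp & H & H'). split; eauto.
  - split.
    + intros H. destruct (generic_dense (fun q => frc q nu (All x phi) \/
          exists tau, name tau /\ frc q (upd nu x tau) (Neg phi))) as (p & Hp & [Hf|(tau & Ht & Hf)]).
      * pose proof (def_forces (c:=c) (All x phi) nu).
        pose proof (def_forces_upd (c:=c) (Neg phi) nu x) as H1. unfold def1.
        apply dfn_or; [dfn_tac|]. apply dfn_ex. apply dfn_and; [dfn_tac|].
        apply (dfn_app2 _ _ _ (fun _ p tau => frc p (upd nu x tau) (Neg phi)) (fun _ e => e 1)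
          (fun _ e => e 0)); auto; dfn_tac.
      * intros p Hp. destruct (classic (frc p nu (All x phi))) as [Hf|Hf].
        { exists p. split; auto. now apply le_refl. }
        cbn [forces] in Hf. apply not_all_ex_not in Hf as [tau Hf].
        apply imply_to_and in Hf as [Ht Hf].
        destruct (not_forces hc phi p (upd nu x tau) Hp (names_upd nu x tau Hn Ht) Hf) as (q & ? & ?).
        exists q. eauto.
      * exists p. exact (conj Hp Hf).
      * exfalso. specialize (H (val tau)). rewrite <- val_upd in H.
        apply IHphi in H as (q & Hq & H); [|now apply names_upd]. eauto.
    + intros (p & Hp & H) a. destruct (ext_surj hE a) as (tau & Ht & <-).
      rewrite <- val_upd. apply IHphi; [now apply names_upd|]. eauto.
Qed.

Lemma truth_free phi nu : (forall i, free i phi -> name (nu i)) ->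
  (sat N (fun i => val (nu i)) phi <-> exists p, G p /\ frc p nu phi).
Proof.
  intros Hn. set (nu' := fun i => if excluded_middle_informative (free i phi) then nu i else emp).
  assert (He : name emp).
  { apply name_intro. intros w Hw. destruct (in_emp _ Hw). }
  assert (E : forall i, free i phi -> nu' i = nu i).
  { intros i Hi. unfold nu'. destruct excluded_middle_informative; tauto. }
  assert (Hn' : forall i, name (nu' i)).
  { intros i. unfold nu'. destruct excluded_middle_informative; auto. }
  rewrite (sat_ext _ phi (fun i => val (nu i)) (fun i => val (nu' i))).
  - rewrite truth by auto. split; intros (p & Hp & H); exists p; split; auto;
      eapply forces_ext; [|exact H| |exact H]; auto; intros; symmetry; auto.
  - intros i Hi. now rewrite E.
Qed.
End Truth.
End Generic.

(** ** The extension as a quotient of the names *)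
Section Quotient.
Context {M : structure} {hM : ZF M} (c : M) (G : M -> Prop).
Hypothesis hc : is_poset M c.
Hypothesis hG : generic_filter M c G.
Local Notation name := (is_name M c).
Local Notation feq := (forces_eq M c).
Local Notation fmem := (forces_mem M c).

Lemma name_emp : name emp.
Proof. apply name_intro. intros w Hw. destruct (in_emp _ Hw). Qed.

Definition eq_by (sigma tau : M) : Prop := exists p, G p /\ feq p sigma tau.
Definition quotient_dom : Type := {X : M -> Prop | exists sigma, name sigma /\ X = eq_by sigma}.
Definition quotient_val (sigma : M) : quotient_dom :=
  match excluded_middle_informative (name sigma) with
  | left h => exist _ (eq_by sigma) (ex_intro _ sigma (conj h eq_refl))
  | right _ => exist _ (eq_by emp) (ex_intro _ emp (conj name_emp eq_refl))
  end.
Definition quotient_mem (X Y : quotient_dom) : Prop :=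
  exists sigma tau, name sigma /\ name tau /\ X = quotient_val sigma /\ Y = quotient_val tau /\
    exists p, G p /\ fmem p sigma tau.
Definition quotient : structure := Structure quotient_dom quotient_mem.

Lemma eq_by_refl sigma : name sigma -> eq_by sigma sigma.
Proof.
  intros H. destruct (gf_inhabited hG) as [p Hp]. exists p. split; auto.
  apply feq_refl; auto. now apply (gf_cond hG).
Qed.
Lemma eq_by_sym sigma tau : eq_by sigma tau -> eq_by tau sigma.
Proof.
  intros (p & Hp & H). exists p. split; auto. apply feq_sym; auto. now apply (gf_cond hG).
Qed.
Lemma eq_by_trans sigma tau rho : eq_by sigma tau -> eq_by tau rho -> eq_by sigma rho.
Proof.
  intros (p & Hp & H) (q & Hq & H'). destruct (filter_common hG p q Hp Hq) as (r & Hr & Hc & ? & ?).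
  exists r. split; auto. apply (feq_trans hc r sigma tau); auto; [apply (feq_mono hc p)|apply (feq_mono hc q)]; auto.
Qed.

Lemma quotient_val_eq sigma tau : name sigma -> name tau ->
  (quotient_val sigma = quotient_val tau <-> eq_by sigma tau).
Proof.
  intros Hs Ht. unfold quotient_val.
  destruct excluded_middle_informative as [h|]; [|contradiction].
  destruct excluded_middle_informative as [h'|]; [|contradiction]. split.
  - intros E. apply (f_equal (@proj1_sig _ _)) in E. simpl in E. rewrite E. now apply eq_by_refl.
  - intros E. assert (E' : eq_by sigma = eq_by tau).
    { extensionality rho. apply propositional_extensionality. split; intros H.
      - apply eq_by_trans with sigma; auto. now apply eq_by_sym.
      - apply eq_by_trans with tau; auto. }
    apply eq_sig_hprop; [intros; apply proof_irrelevance|exact E'].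
Qed.

Lemma quotient_extension : extension M c G quotient quotient_val.
Proof.
  assert (R : forall sigma tau pi s, name sigma -> name tau -> pr pi s ∈ tau -> G s -> eq_by sigma pi ->
     exists p, G p /\ fmem p sigma tau).
  { intros sigma tau pi s Hs Ht Hp HGs He. apply eq_by_sym in He as (p & Hp' & He).
    destruct (filter_common hG p s Hp' HGs) as (r & Hr & Hcr & Hrp & Hrs).
    exists r. split; auto. apply (fmem_feq_l hc r pi); [apply (feq_mono hc p); auto|].
    apply (fmem_intro hc pi s); auto. }
  constructor.
  - intros [X (sigma & Hs & ->)]. exists sigma. split; auto. unfold quotient_val.
    destruct excluded_middle_informative; [|contradiction].
    apply eq_sig_hprop; [intros; apply proof_irrelevance|reflexivity].
  - intros tau y Ht. split.
    + intros (sigma' & tau' & Hs' & Ht' & -> & E & p & Hp & Hf).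
      apply quotient_val_eq in E as (q & Hq & E); auto.
      destruct (filter_common hG p q Hp Hq) as (r & Hr & Hcr & Hrp & Hrq).
      assert (Hf' : fmem r sigma' tau).
      { apply (fmem_feq_r hc r sigma' tau'); auto.
        - apply feq_sym; auto. apply (feq_mono hc q); auto.
        - apply (fmem_mono hc p); auto. }
      rewrite fmem_iff in Hf'.
      destruct (generic_dense_below hc hG
        (fun r => exists pi s, pr pi s ∈ tau /\ le M c r s /\ feq r sigma' pi) r)
        as (r' & Hr' & _ & pi & s & H1 & H2 & H3); auto.
      * df.
      * intros q' Hq'. destruct (Hf' q' Hq') as (r1 & pi & s & ? & ? & ? & ?). exists r1. eauto 8.
      * exists pi, s. repeat split.
        { now apply pair_in_iff. } { apply (gf_up hG r'); auto. }
        apply quotient_val_eq; auto; [exact (proj1 (name_pair _ _ _ Ht H1))|]. exists r'; auto.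
    + intros (pi & s & H1 & H2 & ->). apply pair_in_iff in H1.
      destruct (name_pair _ _ _ Ht H1) as [Hpi _].
      exists pi, tau. repeat split; auto. apply (R pi tau pi s); auto. now apply eq_by_refl.
  - intros sigma tau Hs Ht. now apply quotient_val_eq.
Qed.
End Quotient.

(** ** Generic filters over countable structures *)
Definition countable (T : Type) : Prop := exists f : nat -> T, forall x, exists n, f n = x.

Section Countable.
Context {M : structure} {hM : ZF M} {c : M}.
Hypothesis hc : is_poset M c.
Hypothesis hcount : countable M.

(** A countable structure has only countably many dense sets, so they can be met one after
    the other; the enumeration is external. *)
Lemma generic_exists p0 : cond M c p0 -> exists G, generic_filter M c G /\ G p0.
Proof.
  intros Hp0. destruct hcount as [f Hf].
  set (next := fun D p => epsilon (inhabits p)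
     (fun q => le M c q p /\ ((exists r, r ∈ D /\ le M c r p) -> q ∈ D))).
  assert (Hn : forall D p, cond M c p -> le M c (next D p) p /\
     ((exists r, r ∈ D /\ le M c r p) -> next D p ∈ D)).
  { intros D p Hp. unfold next. apply epsilon_spec.
    destruct (classic (exists r, r ∈ D /\ le M c r p)) as [(r & Hr & Hr')|N].
    - exists r. auto.
    - exists p. split; [now apply le_refl|tauto]. }
  set (g := fix g n := match n with 0 => p0 | S n => next (f n) (g n) end).
  assert (Hc : forall n, cond M c (g n)).
  { induction n; simpl; auto. exact (proj1 (le_cond hc _ _ (proj1 (Hn (f n) (g n) IHn)))). }
  assert (Hmono : forall m n, n <= m -> le M c (g m) (g n)).
  { induction m; intros n Hnm.
    - replace n with 0 by lia. now apply le_refl.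
    - destruct (Nat.eq_dec n (S m)) as [->|Hne]; [now apply le_refl|].
      apply (le_trans hc _ (g m)); [apply Hn; auto|apply IHm; lia]. }
  exists (fun p => exists n, le M c (g n) p). split.
  - constructor.
    + intros p [n Hp]. now apply (le_cond hc) in Hp.
    + exists p0, 0. now apply le_refl.
    + intros p q [n Hp] Hq. exists n. apply (le_trans hc _ p); auto.
    + intros p q [n Hp] [m Hq]. exists (g (max n m)). split; [exists (max n m); now apply le_refl|].
      split; [apply (le_trans hc _ (g n))|apply (le_trans hc _ (g m))]; auto; apply Hmono; lia.
    + intros D HD Hd. destruct (Hf D) as [n <-]. exists (g (S n)). split.
      * simpl. apply (Hn (f n) (g n) (Hc n)). destruct (Hd (g n) (Hc n)) as (q & ? & ?). eauto.
      * exists (S n). now apply le_refl.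
  - exists 0. now apply le_refl.
Qed.

(** A condition that does not force the statement has an extension forcing the negation,
    and some generic filter contains that extension. *)
Theorem forces_by_extensions p phi nu : cond M c p -> (forall i, free i phi -> is_name M c (nu i)) ->
  (forall G N val, generic_filter M c G -> G p -> extension M c G N val -> countable N ->
     sat N (fun i => val (nu i)) phi) -> forces M c p nu phi.
Proof.
  intros Hp Hn H.
  set (nu' := fun i => if excluded_middle_informative (free i phi) then nu i else emp).
  assert (E : forall i, free i phi -> nu' i = nu i).
  { intros i Hi. unfold nu'. destruct excluded_middle_informative; tauto. }
  assert (Hn' : forall i, is_name M c (nu' i)).
  { intros i. unfold nu'. destruct excluded_middle_informative; auto. apply name_emp. }
  assert (F : forces M c p nu' phi).
  { apply NNPP. intros N. destruct (not_forces hc phi p nu' Hp Hn' N) as (q & Hq & Hf).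
    destruct (generic_exists q) as (G & HG & HGq); [now apply (le_cond hc) in Hq|].
    pose proof (quotient_extension c G hc HG) as HE.
    assert (Hs : sat (quotient c G) (fun i => quotient_val c G (nu i)) phi).
    { apply (H G); auto.
      - apply (gf_up HG q); auto.
      - destruct hcount as [f Hf']. exists (fun n => quotient_val c G (f n)). intros x.
        destruct (ext_surj HE x) as (tau & _ & <-). destruct (Hf' tau) as [n <-]. eauto. }
    assert (Hs' : sat (quotient c G) (fun i => quotient_val c G (nu' i)) (Neg phi)).
    { apply (truth hc HG HE); eauto. }
    apply Hs'. eapply sat_ext; [|exact Hs]. intros i Hi. simpl. now rewrite E. }
  eapply forces_ext; [|exact F]. intros; symmetry; auto.
Qed.
End Countable.

(** ** Check names *)
Section Check.
Context {M : structure} {hM : ZF M}.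
Implicit Types x y z o : M.

Lemma check_exists o : exists H : M -> M, def2 (fun x y => y = H x) /\
  forall x w, w ∈ H x <-> exists z, z ∈ x /\ w = pr (H z) o.
Proof.
  assert (B : forall x a, exists s, forall w, w ∈ s <-> exists z u, z ∈ x /\ pr z u ∈ a /\ w = pr u o).
  { intros x a. destruct (separation (fun w => exists z u, z ∈ x /\ pr z u ∈ a /\ w = pr u o)
      (prod (union (union a)) (sing o))) as [s Hs]; [df|].
    exists s. intros w. rewrite Hs. split; [tauto|]. intros H. split; auto.
    destruct H as (z & u & _ & Hu & ->). apply pr_in_prod. rewrite in_sing. split; auto.
    now apply pr_in_uu in Hu. }
  set (F := fun x a => compr (fun w => exists z u, z ∈ x /\ pr z u ∈ a /\ w = pr u o)).
  assert (HF : forall x a w, w ∈ F x a <-> exists z u, z ∈ x /\ pr z u ∈ a /\ w = pr u o).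
  { intros x a. exact (in_compr_ex _ (B x a)). }
  destruct (recursion' F) as (H & HH & E).
  - unfold def3. apply dfn_iff with (fun _ e => forall w, w ∈ e 2 <->
       exists z u, z ∈ e 0 /\ pr z u ∈ e 1 /\ w = pr u o); [|df].
    intros _ e. split; [|intros ->; auto]. intros H. apply ext. intros w. now rewrite H, HF.
  - intros x a a' Ha. apply ext. intros w. rewrite !HF.
    split; intros (z & u & Hz & Hu & ->); exists z, u; repeat split; auto; apply Ha; auto;
      now apply trcl_sub.
  - exists H. split; auto. intros x w. rewrite E, HF. split.
    + intros (z & u & Hz & Hu & ->). apply in_graph in Hu as [_ ->]; eauto.
    + intros (z & Hz & ->). exists z, (H z). rewrite in_graph by auto. repeat split; auto.
      now apply trcl_sub.
Qed.

Definition check_with (o : M) : M -> M :=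
  proj1_sig (constructive_indefinite_description _ (check_exists o)).
Lemma def_check_with o : def2 (fun x y => y = check_with o x).
Proof. exact (proj1 (proj2_sig (constructive_indefinite_description _ (check_exists o)))). Qed.
Lemma in_check_with o x w : w ∈ check_with o x <-> exists z, z ∈ x /\ w = pr (check_with o z) o.
Proof. exact (proj2 (proj2_sig (constructive_indefinite_description _ (check_exists o))) x w). Qed.

Definition one (c : M) : M := epsilon inhabited_structure (top M c).
Lemma one_top c : is_poset M c -> top M c (one c).
Proof.
  intros hc. destruct (top_ex hc) as (o & Ho & _).
  exact (epsilon_spec inhabited_structure (top M c) (ex_intro _ o Ho)).
Qed.
Lemma one_cond c : is_poset M c -> cond M c (one c).
Proof.
  intros hc. destruct (top_ex hc) as (o & Ho & Hc & _).
  now rewrite (top_unique hc _ _ (one_top c hc) Ho).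
Qed.
Lemma one_max c p : is_poset M c -> cond M c p -> le M c p (one c).
Proof.
  intros hc. destruct (top_ex hc) as (o & Ho & _ & Hm).
  rewrite (top_unique hc _ _ (one_top c hc) Ho). auto.
Qed.
Definition check (c : M) : M -> M := check_with (one c).
Lemma in_check c x w : w ∈ check c x <-> exists z, z ∈ x /\ w = pr (check c z) (one c).
Proof. apply in_check_with. Qed.
End Check.

Ltac dfn_ext7 := first
  [ dfn_ext6
  | lazymatch goal with
    | |- tm _ (fun i e => check ?c _) => apply (tm_fun1 (check c) _ (def_check_with (one c)))
    end
  | match goal with
    | |- dfn _ (fun i e => forces _ ?c (@?p i e) ?nu ?phi) =>
        apply (dfn_def1 (fun q0 => forces _ c q0 nu phi) p (def_forces phi nu))
    | |- dfn _ (fun i e => forces _ ?c (@?p i e) (upd ?nu ?x (@?u i e)) ?phi) =>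
        apply (dfn_def2 (fun q0 t0 => forces _ c q0 (upd nu x t0) phi) p u (def_forces_upd phi nu x))
    | |- dfn _ (fun i e => forces _ ?c (@?p i e) (upd (upd ?nu ?x (@?u i e)) ?y (@?v i e)) ?phi) =>
        apply (dfn_def3 (fun q0 s0 t0 => forces _ c q0 (upd (upd nu x s0) y t0) phi) p u v
          (def_forces_upd2 phi nu x y))
    end ].
Ltac dfn_ext ::= dfn_ext7.

Section Check2.
Context {M : structure} {hM : ZF M} {c : M}.
Hypothesis hc : is_poset M c.

Lemma check_name x : is_name M c (check c x).
Proof.
  revert x. apply (mem_ind (fun x => is_name M c (check c x))); [df|].
  intros x IH. apply name_intro. intros w Hw. apply in_check in Hw as (z & Hz & ->).
  exists (check c z), (one c). repeat split; auto. now apply one_cond.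
Qed.

(** The internal recursion by which check names are defined has a unique solution. *)
Lemma is_check_iff x tau : is_check M c x tau <-> tau = check c x.
Proof.
  assert (U : forall D f, transitive_set D -> function_on f D ->
    (forall y t, y ∈ D -> pair_in y t f -> forall w, w ∈ t <->
        exists z u o, z ∈ y /\ pair_in z u f /\ top M c o /\ is_pair w u o) ->
    forall y, forall t, y ∈ D -> pair_in y t f -> t = check c y).
  { intros D f HD Hf H.
    apply (mem_ind (fun y => forall t, y ∈ D -> pair_in y t f -> t = check c y)); [df|].
    intros y IH t Hy Ht. apply ext. intros w. rewrite (H y t Hy Ht), in_check. split.
    - intros (z & u & o & Hz & Hu & Ho & Hw). apply is_pair_iff in Hw. exists z. split; auto.
      rewrite <- (IH z Hz u); auto; [|exact (HD y Hy z Hz)].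
      rewrite Hw. f_equal. exact (top_unique hc _ _ Ho (one_top c hc)).
    - intros (z & Hz & ->). destruct (Hf z (HD y Hy z Hz)) as (u & Hu & _).
      exists z, u, (one c). repeat split; auto; [now apply one_top|]. apply is_pair_iff.
      f_equal. symmetry. apply IH; auto. exact (HD y Hy z Hz). }
  split.
  - intros (D & f & HD & Hf & H & Hx & Ht). eapply U; eauto.
  - intros ->. set (D := trcl (sing x)). exists D, (graph (check c) D).
    assert (Hg : forall y t, pair_in y t (graph (check c) D) <-> y ∈ D /\ t = check c y).
    { intros y t. rewrite pair_in_iff. apply in_graph. apply def_check_with. }
    assert (Hx : x ∈ D) by (apply trcl_sub; now apply in_sing).
    split; [apply trcl_trans|]. split; [|split; [|split; auto; apply Hg; auto]].
    + intros y Hy. exists (check c y). split; [apply Hg; auto|]. intros t Ht. apply Hg in Ht.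
      symmetry. tauto.
    + intros y t Hy Ht w. apply Hg in Ht as [_ ->]. rewrite in_check. split.
      * intros (z & Hz & ->). exists z, (check c z), (one c). repeat split; auto.
        { apply Hg. split; auto. exact (trcl_trans _ y Hy z Hz). } { now apply one_top. }
        now apply is_pair_iff.
      * intros (z & u & o & Hz & Hu & Ho & Hw). apply is_pair_iff in Hw. apply Hg in Hu as [_ ->].
        exists z. split; auto. rewrite Hw. f_equal. exact (top_unique hc _ _ Ho (one_top c hc)).
Qed.

(** Induction on the first set: a forced equality of check names makes every element of
    one set equal to an element of the other. *)
Lemma feq_check_inj x : forall y p, cond M c p -> forces_eq M c p (check c x) (check c y) -> x = y.
Proof.
  revert x. apply (mem_ind (fun x => forall y p, cond M c p ->
    forces_eq M c p (check c x) (check c y) -> x = y)); [df|].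
  intros x IH y p Hp H. rewrite forces_eq_iff in H; auto using check_name.
  apply ext. intros z. split; intros Hz.
  - destruct (H _ _ (or_introl (conj eq_refl eq_refl)) (check c z) (one c)) with (q := p)
      as (r & pi & s & Hr & Hpi & _ & Hf).
    { apply in_check. eauto. } { now apply le_refl. } { now apply one_max. }
    apply in_check in Hpi as (z' & Hz' & E). apply pr_inj in E as [-> _].
    rewrite (IH z Hz z' r); auto. now apply (le_cond hc) in Hr.
  - destruct (H _ _ (or_intror (conj eq_refl eq_refl)) (check c z) (one c)) with (q := p)
      as (r & pi & s & Hr & Hpi & _ & Hf).
    { apply in_check. eauto. } { now apply le_refl. } { now apply one_max. }
    apply in_check in Hpi as (z' & Hz' & E). apply pr_inj in E as [-> _].
    assert (Hcr : cond M c r) by now apply (le_cond hc) in Hr.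
    rewrite <- (IH z' Hz' z r); auto. now apply feq_sym.
Qed.
End Check2.

(** ** Transitive embeddings *)
(** Inner models are handled through such embeddings, so that a model, its copy inside an
    extension and a submodel given by a predicate can be treated alike. *)
Record trans_embedding (M W : structure) (j : M -> W) : Prop := {
  te_inj : forall x y, j x = j y -> x = y;
  te_mem : forall x y, j x ∈ j y <-> x ∈ y;
  te_trans : forall z y, z ∈ j y -> exists x, z = j x
}.
Arguments te_inj {M W j}. Arguments te_mem {M W j}. Arguments te_trans {M W j}.

Section CheckEmbedding.
Context {M : structure} {hM : ZF M} {c : M} {G : M -> Prop}.
Hypothesis hc : is_poset M c.
Hypothesis hG : generic_filter M c G.
Context {N : structure} {val : M -> N}.
Hypothesis hE : extension M c G N val.

Lemma val_check x y : y ∈ val (check c x) <-> exists z, z ∈ x /\ y = val (check c z).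
Proof.
  rewrite (val_mem hE) by (now apply check_name). split.
  - intros (pi & s & H & _ & ->). apply in_check in H as (z & Hz & E). apply pr_inj in E as [-> _].
    eauto.
  - intros (z & Hz & ->). exists (check c z), (one c). rewrite in_check. repeat split; eauto.
    apply (top_in_filter hc hG). now apply one_top.
Qed.

(** A value with an element among the values of check names need not be one itself, but
    every element of the value of a check name is the value of a check name. *)
Theorem check_embedding : trans_embedding M N (fun x => val (check c x)).
Proof.
  assert (I : forall x y, val (check c x) = val (check c y) -> x = y).
  { intros x y H. apply (ext_eq hE) in H as (p & Hp & H); try now apply check_name.
    apply (feq_check_inj hc x y p); auto. now apply (gf_cond hG). }
  constructor; auto.
  - intros x y. rewrite val_check. split; [|eauto]. intros (z & Hz & E). apply I in E. now subst.
  - intros z y H. apply val_check in H as (x & _ & ->). eauto.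
Qed.
End CheckEmbedding.

(** ** Extensions satisfy the axioms *)
Section ExtensionAxioms.
Context {M : structure} {hM : ZF M} {c : M} {G : M -> Prop}.
Hypothesis hc : is_poset M c.
Hypothesis hG : generic_filter M c G.
Context {N : structure} {val : M -> N}.
Hypothesis hE : extension M c G N val.
Local Notation name := (is_name M c).
Local Notation frc := (forces M c).

Lemma one_in : G (one c).
Proof. apply (top_in_filter hc hG). now apply one_top. Qed.

(** The set from which the names of elements, and of elements of elements, can be taken when
    sets of names are formed in the ground model. *)
Lemma closed_superset tau : name tau ->
  exists D, tau ∈ D /\ (forall pi, pi ∈ D -> name pi) /\
    forall sigma pi s, sigma ∈ D -> pr pi s ∈ sigma -> pi ∈ D.
Proof.
  intros (D & HD & Ht). exists D. split; auto. split.
  - intros pi Hpi. exists D. auto.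
  - intros sigma pi s Hs Hp. rewrite closed_names_iff in HD.
    destruct (HD _ _ Hs Hp) as (pi' & p & E & ? & _). apply pr_inj in E as [-> _]. auto.
Qed.

(** Every name in [D] is put in with the largest condition. *)
Lemma set_of_values D : (forall pi, pi ∈ D -> name pi) ->
  exists x : N, forall y, y ∈ x <-> exists pi, pi ∈ D /\ y = val pi.
Proof.
  intros HD. set (tau := prod D (sing (one c))).
  assert (Ht : name tau).
  { apply name_intro. intros w Hw. apply in_prod in Hw as (pi & s & Hpi & Hs & ->).
    apply in_sing in Hs. subst s. exists pi, (one c). repeat split; auto. now apply one_cond. }
  exists (val tau). intros y. rewrite (val_mem hE) by auto. split.
  - intros (pi & s & H & _ & ->). apply pr_in_prod in H as [H _]. eauto.
  - intros (pi & H & ->). exists pi, (one c). unfold tau. rewrite pr_in_prod, in_sing.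
    auto using one_in.
Qed.

Lemma names_choose (e : nat -> N) : exists nu, (forall i, name (nu i)) /\ e = fun i => val (nu i).
Proof.
  destruct (choice (fun i tau => name tau /\ val tau = e i)) as [nu H].
  - intros i. apply (ext_surj hE).
  - exists nu. split; [intros i; apply H|]. extensionality i. symmetry. apply H.
Qed.

(** The name collects the pairs of a subname and a condition that forces the subname to
    belong and to satisfy the formula. *)
Lemma extension_separation phi (e : nat -> N) (x : N) :
  exists y, forall z, z ∈ y <-> z ∈ x /\ sat N (upd e 0 z) phi.
Proof.
  destruct (names_choose e) as (nu & Hn & ->). destruct (ext_surj hE x) as (tau & Ht & <-).
  destruct (closed_superset tau Ht) as (D & HtD & HD & Hcl).
  destruct (conditions_set hc) as [C HC].
  assert (DP : def1 (fun w => exists pi q s, w = pr pi q /\ pr pi s ∈ tau /\ le M c q s /\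
      frc q (upd nu 0 pi) phi)) by df.
  set (S := sep (prod D C) (fun w => exists pi q s, w = pr pi q /\ pr pi s ∈ tau /\ le M c q s /\
      frc q (upd nu 0 pi) phi)).
  assert (HS : forall pi q, pr pi q ∈ S <->
     pi ∈ D /\ cond M c q /\ exists s, pr pi s ∈ tau /\ le M c q s /\ frc q (upd nu 0 pi) phi).
  { intros pi q. unfold S. rewrite in_sep, pr_in_prod, <- HC by auto. split.
    - intros [[H1 H2] (pi' & q' & s & E & ?)]. apply pr_inj in E as [-> ->]. eauto.
    - intros (H1 & H2 & s & ?). split; auto. exists pi, q, s. tauto. }
  assert (HSn : name S).
  { apply name_intro. intros w Hw. pose proof Hw as Hw'. unfold S in Hw.
    apply in_sep in Hw as [Hw _]; auto. apply in_prod in Hw as (pi & q & H1 & H2 & ->).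
    exists pi, q. repeat split; auto. now apply HC. }
  exists (val S). intros z. rewrite !(val_mem hE) by auto. split.
  - intros (pi & q & H & HGq & ->). apply HS in H as (H1 & H2 & s & H3 & H4 & H5). split.
    + exists pi, s. repeat split; auto. apply (gf_up hG q); auto.
    + rewrite <- val_upd. apply (truth hc hG hE); eauto. apply names_upd; auto.
  - intros [(pi & s & H1 & H2 & ->) H3]. rewrite <- val_upd in H3.
    assert (Hpi : pi ∈ D) by eauto.
    apply (truth hc hG hE) in H3 as (p & Hp & H3); [|apply names_upd; auto].
    destruct (filter_common hG p s Hp H2) as (q & Hq & Hcq & ? & ?).
    exists pi, q. repeat split; auto. apply HS. repeat split; auto. exists s. repeat split; auto.
    apply (forces_mono hc phi p); auto.
Qed.

Lemma extension_separation' (P : N -> Prop) (x : N) : def1 P ->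
  exists y, forall z, z ∈ y <-> z ∈ x /\ P z.
Proof.
  intros HP. destruct (two_variable_formula (fun u _ => P u) x) as (phi & E & H); [exact HP|].
  destruct (extension_separation phi E x) as [y Hy]. exists y. intros z.
  rewrite Hy, (H z (E 1)). apply and_iff_compat_l, sat_ext. intros i _.
  unfold upd. destruct (Nat.eqb_spec i 1) as [->|]; auto.
Qed.

(** As the extension may be ill-founded from outside, minimal elements are found by
    induction on names inside the ground model: a condition forcing that there is none
    forces no name to be an element. *)
Lemma extension_foundation (x : N) : (exists y, y ∈ x) ->
  exists y, y ∈ x /\ ~ exists z, z ∈ y /\ z ∈ x.
Proof.
  intros [y0 Hy0]. apply NNPP. intros N0. destruct (ext_surj hE x) as (tau & Ht & <-).
  set (phi := All 1 (Neg (And (Mem 1 0) (All 2 (Neg (And (Mem 2 1) (Mem 2 0))))))).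
  assert (Hs : sat N (fun i => val ((fun _ => tau) i)) phi).
  { cbn. intros y [Hy H]. apply N0. exists y. split; auto. intros (z & H1 & H2). apply (H z). auto. }
  apply (truth hc hG hE) in Hs as (p0 & Hp0 & Hf); [|auto].
  assert (K : forall pi, forall q, le M c q p0 -> name pi -> ~ forces_mem M c q pi tau).
  { apply (trcl_ind (fun pi => forall q, le M c q p0 -> name pi -> ~ forces_mem M c q pi tau)); [df|].
    intros pi IH q Hq Hpi Hm. apply (Hf pi Hpi q Hq). split; [exact Hm|].
    intros rho Hrho r Hr [H1 H2]. cbn in H1, H2. rewrite fmem_iff in H1.
    destruct (H1 r) as (r' & pi' & s & Hr' & Hp' & Hs & He).
    { apply (le_refl hc). now apply (le_cond hc) in Hr. }
    apply (IH pi') with r'.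
    - apply (mem_dom_trcl pi' s); auto.
    - apply (le_trans hc _ r); auto. apply (le_trans hc _ q); auto.
    - exact (proj1 (name_pair _ _ _ Hpi Hp')).
    - apply (fmem_feq_l hc r' rho); auto. apply (fmem_mono hc r); auto. }
  destruct (ext_surj hE y0) as (pi & Hpi & <-).
  apply (truth_mem hc hG hE) in Hy0 as (p & Hp & Hm); auto.
  destruct (filter_common hG p p0 Hp Hp0) as (r & _ & _ & ? & ?).
  apply (K pi r); auto. apply (fmem_mono hc p); auto.
Qed.

(** Every subset of [val tau] is the value of a set of pairs of subnames of [tau] with
    conditions, and these sets form a power set of the ground model. *)
Lemma extension_powerset (x : N) : exists p, forall z, z ∈ p <-> subset z x.
Proof.
  destruct (ext_surj hE x) as (tau & Ht & <-).
  destruct (closed_superset tau Ht) as (D & HtD & HD & Hcl).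
  destruct (conditions_set hc) as [C HC].
  assert (HP : forall nu, nu ∈ power (prod D C) -> name nu).
  { intros nu Hnu. apply in_power in Hnu. apply name_intro. intros w Hw. apply Hnu in Hw.
    apply in_prod in Hw as (pi & q & H1 & H2 & ->). exists pi, q. repeat split; auto. now apply HC. }
  destruct (set_of_values _ HP) as [B HB].
  destruct (extension_separation' (fun z => subset z (val tau)) B) as [p Hp]; [df|].
  exists p. intros z. rewrite Hp. split; [tauto|]. intros Hz. split; auto. apply HB.
  destruct (ext_surj hE z) as (sigma & Hs & <-).
  assert (DS : def1 (fun w => exists pi q, w = pr pi q /\ forces_mem M c q pi sigma)) by df.
  set (nu := sep (prod D C) (fun w => exists pi q, w = pr pi q /\ forces_mem M c q pi sigma)).
  assert (Hnu : forall pi q, pr pi q ∈ nu <-> pi ∈ D /\ cond M c q /\ forces_mem M c q pi sigma).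
  { intros pi q. unfold nu. rewrite in_sep, pr_in_prod, <- HC by auto. split.
    - intros [? (pi' & q' & E & ?)]. apply pr_inj in E as [-> ->]. tauto.
    - intros (? & ? & ?). split; auto. exists pi, q. auto. }
  assert (Hin : nu ∈ power (prod D C)).
  { apply in_power. intros w Hw. unfold nu in Hw. apply in_sep in Hw; tauto. }
  exists nu. split; auto. apply (extension_ext hc hG hE). intros y. split.
  - intros Hy. pose proof (Hz y Hy) as Hy'. apply (val_mem hE) in Hy' as (pi & s & H1 & H2 & ->); auto.
    assert (Hpi : pi ∈ D) by eauto.
    apply (truth_mem hc hG hE) in Hy as (q & Hq & Hm); auto.
    apply (val_mem hE); auto. exists pi, q. repeat split; auto. apply Hnu. repeat split; auto.
    now apply (gf_cond hG).
  - intros Hy. apply (val_mem hE) in Hy as (pi & q & H1 & H2 & ->); auto.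
    apply Hnu in H1 as (Hpi & _ & Hm). apply (truth_mem hc hG hE); eauto.
Qed.

(** Collection in the ground model provides names of the values for all pairs of a subname
    and a condition at once. *)
Lemma extension_replacement phi (e : nat -> N) (x : N) :
  (forall u, u ∈ x -> exists! v, sat N (upd (upd e 0 u) 1 v) phi) ->
  exists y, forall v, v ∈ y <-> exists u, u ∈ x /\ sat N (upd (upd e 0 u) 1 v) phi.
Proof.
  intros Hu. destruct (names_choose e) as (nu & Hn & ->). destruct (ext_surj hE x) as (tau & Ht & <-).
  destruct (closed_superset tau Ht) as (D & HtD & HD & Hcl).
  destruct (conditions_set hc) as [C HC].
  destruct (collection (fun w rho => exists pi q, w = pr pi q /\ name rho /\
     frc q (upd (upd nu 0 pi) 1 rho) phi) (prod D C)) as [b Hb]; [df|].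
  assert (Dn : def1 (is_name M c)) by df.
  destruct (set_of_values (sep b name)) as [B HB].
  { intros rho H. apply in_sep in H; tauto. }
  destruct (extension_separation' (fun v => exists u, u ∈ val tau /\
     sat N (upd (upd (fun i => val (nu i)) 0 u) 1 v) phi) B) as [y Hy].
  { unfold def1. apply dfn_ex. apply dfn_and; [dfn_tac|].
    apply dfn_iff with (fun i e => sat N (fun n => (fun n (i : unit) (e : nat -> N) =>
      if n =? 1 then e 1 else if n =? 0 then e 0 else val (nu n)) n i e) phi).
    - intros _ e. apply sat_ext. reflexivity.
    - apply dfn_sat. intros n. destruct (n =? 1), (n =? 0); dfn_tac. }
  exists y. intros v. rewrite Hy. split; [tauto|]. intros (u & Hx & Hv).
  split; [|eauto]. apply HB.
  destruct (Hu u Hx) as (v0 & Hv0 & Uv).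
  assert (Ev : v = v0) by (symmetry; auto). subst v0. clear Hv0.
  apply (val_mem hE) in Hx as (pi & s & H1 & H2 & ->); auto.
  assert (Hpi : pi ∈ D) by eauto.
  destruct (ext_surj hE v) as (rho & Hr & <-). rewrite <- !val_upd in Hv.
  apply (truth hc hG hE) in Hv as (q & Hq & Hf); [|repeat apply names_upd; auto].
  destruct (Hb (pr pi q)) as (rho' & Hr' & pi' & q' & E & Hr'n & Hf').
  { apply pr_in_prod. split; auto. apply HC. now apply (gf_cond hG). }
  { exists rho, pi, q. auto. }
  apply pr_inj in E as [<- <-]. exists rho'. split; [now apply in_sep|].
  apply Uv. rewrite <- !val_upd. apply (truth hc hG hE); eauto. repeat apply names_upd; auto.
Qed.

Lemma extension_union (x : N) : exists u, forall z, z ∈ u <-> exists y, y ∈ x /\ z ∈ y.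
Proof.
  destruct (ext_surj hE x) as (tau & Ht & <-).
  destruct (closed_superset tau Ht) as (D & HtD & HD & Hcl).
  destruct (set_of_values D HD) as [B HB].
  destruct (extension_separation' (fun z => exists y, y ∈ val tau /\ z ∈ y) B) as [u Hu]; [df|].
  exists u. intros z. rewrite Hu. split; [tauto|]. intros H. split; auto. apply HB.
  destruct H as (y & Hy & Hz). apply (val_mem hE) in Hy as (pi & s & H1 & _ & ->); auto.
  apply (val_mem hE) in Hz as (pi' & s' & H1' & _ & ->); eauto.
Qed.

Lemma extension_pairing (x y : N) : exists z, is_upair z x y.
Proof.
  destruct (ext_surj hE x) as (sigma & Hs & <-), (ext_surj hE y) as (tau & Ht & <-).
  destruct (set_of_values (upair sigma tau)) as [B HB].
  { intros pi H. apply in_upair in H as [-> | ->]; auto. }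
  exists B. intros z. rewrite HB. split.
  - intros (pi & H & ->). apply in_upair in H as [-> | ->]; auto.
  - intros [-> | ->]; eexists; (split; [|reflexivity]); apply in_upair; auto.
Qed.

Theorem extension_ZF : ZF N.
Proof.
  constructor.
  - exact (extension_ext hc hG hE).
  - exact extension_foundation.
  - exact extension_pairing.
  - exact extension_union.
  - exact extension_powerset.
  - destruct (omega_inductive (W := M)) as [O1 O2]. exists (val (check c omega)). split.
    + exists (val (check c emp)). split; [apply (val_check hc hG hE); eauto|].
      intros z Hz. apply (val_check hc hG hE) in Hz as (y & Hy & _). exact (in_emp _ Hy).
    + intros x Hx. apply (val_check hc hG hE) in Hx as (n & Hn & ->).
      exists (val (check c (suc n))). split; [apply (val_check hc hG hE); eauto|].
      intros z. rewrite !(val_check hc hG hE). split.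
      * intros (m & Hm & ->). apply in_suc in Hm as [Hm | ->]; eauto.
      * intros [(m & Hm & ->) | ->]; eexists; (split; [|reflexivity]); apply in_suc; auto.
  - exact extension_separation.
  - exact extension_replacement.
Qed.
End ExtensionAxioms.

Section Absoluteness.
Context {M W : structure} {hM : ZF M} {hW : ZF W} {j : M -> W}.
Hypothesis hj : trans_embedding M W j.

Lemma te_in x y : y ∈ j x <-> exists z, z ∈ x /\ y = j z.
Proof.
  split.
  - intros H. destruct (te_trans hj _ _ H) as [z ->]. exists z. split; auto. now apply (te_mem hj).
  - intros (z & Hz & ->). now apply (te_mem hj).
Qed.
Lemma te_emp : j emp = emp.
Proof.
  apply ext. intros z. rewrite te_in. split; [intros (w & Hw & _)|intros Hz].
  - destruct (in_emp _ Hw).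
  - destruct (in_emp _ Hz).
Qed.
Lemma te_upair x y : j (upair x y) = upair (j x) (j y).
Proof.
  apply ext. intros z. rewrite te_in, in_upair. split.
  - intros (w & Hw & ->). apply in_upair in Hw as [-> | ->]; auto.
  - intros [-> | ->]; eexists; (split; [|reflexivity]); apply in_upair; auto.
Qed.
Lemma te_sing x : j (sing x) = sing (j x).
Proof. apply te_upair. Qed.
Lemma te_pr x y : j (pr x y) = pr (j x) (j y).
Proof. unfold pr. now rewrite te_upair, te_sing, te_upair. Qed.
Lemma te_pr_in x y z : pr (j x) (j y) ∈ j z <-> pr x y ∈ z.
Proof. now rewrite <- te_pr, (te_mem hj). Qed.
Lemma te_pr_in_inv a b z : pr a b ∈ j z -> exists x y, a = j x /\ b = j y /\ pr x y ∈ z.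
Proof.
  intros H. pose proof H as H'. apply te_in in H as (w & Hw & E).
  assert (Ha : sing a ∈ j w) by (rewrite <- E; apply in_upair; auto).
  assert (Hb : upair a b ∈ j w) by (rewrite <- E; apply in_upair; auto).
  apply te_in in Ha as (w1 & _ & E1). apply te_in in Hb as (w2 & _ & E2).
  assert (Ha : a ∈ j w1) by (rewrite <- E1; now apply in_sing).
  assert (Hb : b ∈ j w2) by (rewrite <- E2; apply in_upair; auto).
  apply te_in in Ha as (x & _ & ->). apply te_in in Hb as (y & _ & ->).
  exists x, y. rewrite te_pr_in in H'. auto.
Qed.
Lemma te_transitive_set x : transitive_set (j x) <-> transitive_set x.
Proof.
  split; intros H y Hy z Hz.
  - apply (te_mem hj). apply (H (j y)); now apply (te_mem hj).
  - apply te_in in Hy as (y' & Hy & ->). apply te_in in Hz as (z' & Hz & ->).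
    apply (te_mem hj). exact (H y' Hy z' Hz).
Qed.
Lemma te_ordinal x : ordinal (j x) <-> ordinal x.
Proof.
  unfold ordinal. rewrite te_transitive_set. split; intros [H1 H2]; split; auto; intros y Hy.
  - apply te_transitive_set. apply H2. now apply (te_mem hj).
  - apply te_in in Hy as (y' & Hy & ->). apply te_transitive_set. auto.
Qed.
Lemma te_subset x y : subset (j x) (j y) <-> subset x y.
Proof.
  split; intros H z Hz.
  - apply (te_mem hj). apply H. now apply (te_mem hj).
  - apply te_in in Hz as (z' & Hz & ->). apply (te_mem hj). auto.
Qed.
End Absoluteness.

Section PairNames.
Context {M : structure} {hM : ZF M} {c : M} {G : M -> Prop}.
Hypothesis hc : is_poset M c.
Hypothesis hG : generic_filter M c G.
Context {N : structure} {val : M -> N}.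
Hypothesis hE : extension M c G N val.
Local Notation name := (is_name M c).

Definition upair_name (sigma tau : M) : M := prod (upair sigma tau) (sing (one c)).
Definition pair_name (sigma tau : M) : M := upair_name (upair_name sigma sigma) (upair_name sigma tau).
Lemma upair_name_name sigma tau : name sigma -> name tau -> name (upair_name sigma tau).
Proof.
  intros Hs Ht. apply name_intro. intros w Hw. apply in_prod in Hw as (pi & s & Hpi & Hs' & ->).
  apply in_sing in Hs'. subst s. exists pi, (one c). repeat split; auto; [|now apply one_cond].
  apply in_upair in Hpi as [-> | ->]; auto.
Qed.
Lemma pair_name_name sigma tau : name sigma -> name tau -> name (pair_name sigma tau).
Proof. intros. repeat apply upair_name_name; auto. Qed.
Lemma val_upair_name {hN : ZF N} sigma tau : name sigma -> name tau ->
  val (upair_name sigma tau) = upair (val sigma) (val tau).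
Proof.
  intros Hs Ht. apply ext. intros z. rewrite (val_mem hE), in_upair by now apply upair_name_name.
  split.
  - intros (pi & s & H & _ & ->). apply pr_in_prod in H as [H _]. apply in_upair in H as [-> | ->]; auto.
  - intros [-> | ->]; eexists; exists (one c);
      (split; [apply pr_in_prod; rewrite in_upair, in_sing; split; [|reflexivity]|]);
      [left; reflexivity|split; [exact (one_in hc hG)|reflexivity]
      |right; reflexivity|split; [exact (one_in hc hG)|reflexivity]].
Qed.
Lemma val_pair_name {hN : ZF N} sigma tau : name sigma -> name tau ->
  val (pair_name sigma tau) = pr (val sigma) (val tau).
Proof.
  intros Hs Ht. unfold pair_name, pr, sing.
  rewrite !val_upair_name; auto using upair_name_name.
Qed.

Lemma tm_upair_name (t u : unit -> (nat -> M) -> M) :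
  tm (S := fun _ => M) (fun _ => True) t -> tm (S := fun _ => M) (fun _ => True) u ->
  tm (S := fun _ => M) (fun _ => True) (fun i e => upair_name (t i e) (u i e)).
Proof.
  intros Ht Hu. unfold tm. apply dfn_iff with (fun i e => forall w, w ∈ e 0 <-> exists pi,
    pi ∈ upair (t i (fun n => e (S n))) (u i (fun n => e (S n))) /\ w = pr pi (one c)).
  - intros i e. split.
    + intros H. apply ext. intros w. unfold upair_name. rewrite H, in_prod. split.
      * intros (pi & ? & ->). exists pi, (one c). rewrite in_sing. auto.
      * intros (pi & s & ? & Hs & ->). apply in_sing in Hs. subst. eauto.
    + intros -> w. unfold upair_name. rewrite in_prod. split.
      * intros (pi & s & ? & Hs & ->). apply in_sing in Hs. subst. eauto.
      * intros (pi & ? & ->). exists pi, (one c). rewrite in_sing. auto.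
  - dfn_tac.
Qed.

End PairNames.

Section ExtensionChoice.
Context {M : structure} {hM : ZFC M} {c : M} {G : M -> Prop}.
Hypothesis hc : is_poset M c.
Hypothesis hG : generic_filter M c G.
Context {N : structure} {val : M -> N}.
Hypothesis hE : extension M c G N val.

(** For choice: every set of the extension is the image of an ordinal of the ground model,
    by evaluating an enumeration of names, and least indices make the selection. *)
Theorem extension_ZFC : ZFC N.
Proof.
  pose proof (extension_ZF hc hG hE) as hN.
  assert (Ch : forall x : N,
    (forall y, y ∈ x -> exists z, z ∈ y) ->
    (forall y y' z, y ∈ x -> y' ∈ x -> z ∈ y -> z ∈ y' -> y = y') ->
    exists c, forall y, y ∈ x -> exists! z, z ∈ y /\ z ∈ c).
  { intros x Hne Hdis. destruct (ext_surj hE x) as (tau & Ht & <-).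
    destruct (closed_superset tau Ht) as (D & HtD & HD & Hcl).
    destruct (enumeration D) as (a & h & Ha & Hh & Hhm & Hht).
    assert (HF : exists f : N, forall b z, pr b z ∈ f <->
       exists x y, pr x y ∈ h /\ b = val (check c x) /\ z = val y).
    { destruct (replacement (fun p n => exists x y, p = pr x y /\ n = pair_name (c := c) (check c x) y) h)
        as [E HEE].
      { unfold pair_name. unfold def2. dfn_tac. apply tm_upair_name; apply tm_upair_name; dfn_tac. }
      { intros p n n' _ (x & y & -> & ->) (x' & y' & E & ->). apply pr_inj in E as [-> ->]. auto. }
      assert (HEn : forall n, n ∈ E -> exists x y, pr x y ∈ h /\ n = pair_name (c := c) (check c x) y).
      { intros n Hn. apply HEE in Hn as (p & Hp & x & y & -> & ->). eauto. }
      destruct (set_of_values hc hG hE E) as [f Hf].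
      { intros n Hn. apply HEn in Hn as (x & y & Hxy & ->). apply (pair_name_name hc); [now apply check_name|].
        apply HD. now apply Hhm in Hxy. }
      exists f. intros b z. rewrite Hf. split.
      - intros (n & Hn & Ep). apply HEn in Hn as (x & y & Hxy & ->).
        rewrite (val_pair_name hc hG hE) in Ep by
          (first [assumption | now apply check_name | apply HD; now apply Hhm in Hxy]).
        apply pr_inj in Ep as [-> ->]. eauto.
      - intros (x & y & Hxy & -> & ->). exists (pair_name (c := c) (check c x) y). split.
        + apply HEE. exists (pr x y). eauto.
        + rewrite (val_pair_name hc hG hE); auto;
            first [assumption | now apply check_name | apply HD; now apply Hhm in Hxy]. }
    destruct HF as [f Hf].
    pose proof (check_embedding hc hG hE) as hj.
    assert (Ff : functional f).
    { intros b z z' Hz Hz'. apply Hf in Hz as (x & y & Hxy & -> & ->), Hz' as (x' & y' & Hxy' & E & ->).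
      apply (te_inj hj) in E. subst x'. now rewrite (Hh x y y'). }
    set (P := fun z => exists y, y ∈ val tau /\ z ∈ y /\ exists b, pr b z ∈ f /\
        forall b', b' ∈ b -> forall z', pr b' z' ∈ f -> ~ z' ∈ y).
    assert (DP : def1 P) by (unfold P; df).
    exists (sep (union (val tau)) P). intros y Hy.
    assert (Hmin : exists b z, pr b z ∈ f /\ z ∈ y /\
       forall b', b' ∈ b -> forall z', pr b' z' ∈ f -> ~ z' ∈ y).
    { assert (Dq : def1 (fun b => exists z, pr b z ∈ f /\ z ∈ y)) by df.
      destruct (ax_foundation (sep (val (check c a)) (fun b => exists z, pr b z ∈ f /\ z ∈ y)))
        as (b & Hb & Hmin).
      - destruct (Hne y Hy) as [z Hz].
        pose proof Hy as Hy'. apply (val_mem hE) in Hy' as (pi & s & H1 & _ & ->); auto.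
        assert (Hpi : pi ∈ D) by eauto.
        pose proof Hz as Hz'. apply (val_mem hE) in Hz' as (rho & s' & H2 & _ & ->); auto.
        destruct (Hht rho) as [x Hx]; [eauto|]. exists (val (check c x)). apply in_sep; auto. split.
        + apply (te_mem hj). now apply Hhm in Hx.
        + exists (val rho). split; auto. apply Hf. eauto.
      - apply in_sep in Hb as [Hb (z & H1 & H2)]; auto. exists b, z. split; auto. split; auto.
        intros b' Hb' z' Hz' Hzy. apply Hmin. exists b'. split; auto. apply in_sep; auto.
        split; [|eauto]. apply Hf in Hz' as (x' & y' & Hxy & -> & ->). apply (te_mem hj).
        now apply Hhm in Hxy. }
    destruct Hmin as (b & z & Hbz & Hzy & Hmin).
    exists z. split.
    - split; auto. apply in_sep; auto. split; [apply in_union; eauto|]. exists y. split; auto.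
      split; auto. exists b. auto.
    - intros z' [Hz'y Hz']. apply in_sep in Hz' as [_ (y' & Hy' & Hzy' & b' & Hbz' & Hmin')]; auto.
      assert (y' = y) by (apply (Hdis y' y z'); auto). subst y'.
      pose proof Hbz as K. apply Hf in K as (u & v & Huv & Eb & _).
      pose proof Hbz' as K'. apply Hf in K' as (u' & v' & Huv' & Eb' & _).
      destruct (ordinal_linear u u') as [O|[O|O]].
      + apply (ordinal_mem a); auto. now apply Hhm in Huv.
      + apply (ordinal_mem a); auto. now apply Hhm in Huv'.
      + exfalso. apply (Hmin' b) with z; auto. rewrite Eb, Eb'. now apply (te_mem hj).
      + subst u'. rewrite Eb in Hbz. rewrite Eb' in Hbz'. now apply (Ff (val (check c u))).
      + exfalso. apply (Hmin b') with z'; auto. rewrite Eb, Eb'. now apply (te_mem hj). }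
  destruct hN; constructor; assumption.
Qed.
End ExtensionChoice.

(** * Ground models inside their extensions *)

(** ** Values of names *)
Section Value.
Context {W : structure} {hW : ZF W}.
Implicit Types x y z w g : W.

Lemma value_exists g : exists H : W -> W, def2 (fun x y => y = H x) /\
  forall x w, w ∈ H x <-> exists pi p, pr pi p ∈ x /\ p ∈ g /\ w = H pi.
Proof.
  assert (B : forall x a, exists s, forall w, w ∈ s <->
      exists pi p, pr pi p ∈ x /\ p ∈ g /\ pr pi w ∈ a).
  { intros x a. destruct (separation (fun w => exists pi p, pr pi p ∈ x /\ p ∈ g /\ pr pi w ∈ a)
      (union (union a))) as [s Hs]; [df|].
    exists s. intros w. rewrite Hs. split; [tauto|]. intros H. split; auto.
    destruct H as (pi & p & _ & _ & Hu). now apply pr_in_uu in Hu. }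
  set (F := fun x a => compr (fun w => exists pi p, pr pi p ∈ x /\ p ∈ g /\ pr pi w ∈ a)).
  assert (HF : forall x a w, w ∈ F x a <-> exists pi p, pr pi p ∈ x /\ p ∈ g /\ pr pi w ∈ a).
  { intros x a. exact (in_compr_ex _ (B x a)). }
  destruct (recursion' F) as (H & HH & E).
  - unfold def3. apply dfn_iff with (fun _ e => forall w, w ∈ e 2 <->
       exists pi p, pr pi p ∈ e 0 /\ p ∈ g /\ pr pi w ∈ e 1); [|df].
    intros _ e. split; [|intros ->; auto]. intros H. apply ext. intros w. now rewrite H, HF.
  - intros x a a' Ha. apply ext. intros w. rewrite !HF.
    split; intros (pi & p & Hp & Hg & Hw); exists pi, p; repeat split; auto;
      apply (Ha pi); auto; apply (mem_dom_trcl pi p); auto.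
  - exists H. split; auto. intros x w. rewrite E, HF. split.
    + intros (pi & p & Hp & Hg & Hw). apply in_graph in Hw as [_ ->]; eauto.
    + intros (pi & p & Hp & Hg & ->). exists pi, p. rewrite in_graph by auto. repeat split; auto.
      apply (mem_dom_trcl pi p); auto.
Qed.

Definition value g : W -> W :=
  proj1_sig (constructive_indefinite_description _ (value_exists g)).
Lemma def_value g : def2 (fun x y => y = value g x).
Proof. exact (proj1 (proj2_sig (constructive_indefinite_description _ (value_exists g)))). Qed.
Lemma in_value g x w : w ∈ value g x <-> exists pi p, pr pi p ∈ x /\ p ∈ g /\ w = value g pi.
Proof. exact (proj2 (proj2_sig (constructive_indefinite_description _ (value_exists g))) x w). Qed.
End Value.

Ltac dfn_ext8 := first
  [ dfn_ext7
  | lazymatch goal with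
    | |- tm _ (fun i e => value ?g _) => apply (tm_fun1 (value g) _ (def_value g))
    end ].
Ltac dfn_ext ::= dfn_ext8.

Section Value2.
Context {W : structure} {hW : ZF W}.
Implicit Types x y z w g : W.

(** The attempts in the definition of [is_value] agree with the operation [value], which
    needs no set of names to live on. *)
Lemma is_value_iff c g tau x : is_value W c g tau x <-> is_name W c tau /\ x = value g tau.
Proof.
  split.
  - intros (D & f & HD & Hf & H & Ht & Hx). split; [exists D; auto|].
    assert (U : forall s, forall t, s ∈ D -> pair_in s t f -> t = value g s).
    { apply (trcl_ind (fun s => forall t, s ∈ D -> pair_in s t f -> t = value g s)); [df|].
      intros s IH t Hs Hst. apply ext. intros w. rewrite (H s t Hs Hst), in_value.
      rewrite closed_names_iff in HD.
      split; intros (pi & p & H1 & H2 & H3); exists pi, p.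
      - apply pair_in_iff in H1. repeat split; auto.
        destruct (HD s _ Hs H1) as (pi' & p' & E & Hpi & _). apply pr_inj in E as [<- <-].
        apply (IH pi); auto. apply (mem_dom_trcl pi p); auto.
      - destruct (HD s _ Hs H1) as (pi' & p' & E & Hpi & _). apply pr_inj in E as [<- <-].
        destruct (Hf pi Hpi) as (v & Hv & _).
        rewrite pair_in_iff. repeat split; auto. subst w.
        rewrite <- (IH pi (mem_dom_trcl pi p s H1) v Hpi Hv). auto. }
    eauto.
  - intros [(D & HD & Ht) ->]. exists D, (graph (value g) D).
    assert (Hg : forall s t, pair_in s t (graph (value g) D) <-> s ∈ D /\ t = value g s).
    { intros s t. rewrite pair_in_iff. apply in_graph. apply def_value. }
    split; auto. split; [|split; [|split; auto; apply Hg; auto]].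
    + intros s Hs. exists (value g s). split; [apply Hg; auto|]. intros t Hst. apply Hg in Hst.
      symmetry. tauto.
    + intros s t Hs Hst w. apply Hg in Hst as [_ ->]. rewrite in_value.
      rewrite closed_names_iff in HD.
      split; intros (pi & p & H1 & H2 & H3); exists pi, p.
      * destruct (HD s _ Hs H1) as (pi' & p' & E & Hpi & _). apply pr_inj in E as [<- <-].
        rewrite pair_in_iff. repeat split; auto. now apply Hg.
      * apply pair_in_iff in H1. apply Hg in H3. tauto.
Qed.
End Value2.

(** ** Absoluteness of posets, names and values *)
Section ForcingAbsoluteness.
Context {M W : structure} {hM : ZF M} {hW : ZF W} {j : M -> W}.
Hypothesis hj : trans_embedding M W j.

(** The graph of the evaluation on a transitive set of the submodel is mapped to a set that
    satisfies the same recursion in [W]. *)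
Lemma te_value g x : j (value g x) = value (j g) (j x).
Proof.
  set (f := graph (value g) (trcl (sing x))).
  assert (Hf : forall s t, pr s t ∈ f <-> s ∈ trcl (sing x) /\ t = value g s).
  { intros s t. apply in_graph. apply def_value. }
  assert (K : forall y, forall v, pr y v ∈ j f -> v = value (j g) y).
  { apply (trcl_ind (fun y => forall v, pr y v ∈ j f -> v = value (j g) y)); [df|].
    intros y IH v Hv. destruct (te_pr_in_inv hj _ _ _ Hv) as (s & t & -> & -> & Hst).
    apply Hf in Hst as [Hs ->]. apply ext. intros w. rewrite (te_in hj), in_value.
    assert (Sub : forall pi p, pr pi p ∈ s -> pr (j pi) (j (value g pi)) ∈ j f).
    { intros pi p Hp. apply (te_pr_in hj), Hf. split; auto.
      apply (trcl_in _ _ Hs). apply (mem_dom_trcl pi p); auto. }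
    split.
    - intros (w' & Hw & ->). apply in_value in Hw as (pi & p & H1 & H2 & ->).
      exists (j pi), (j p). rewrite (te_pr_in hj), (te_mem hj). repeat split; auto.
      apply IH; eauto. apply (mem_dom_trcl (j pi) (j p)). now apply (te_pr_in hj).
    - intros (pi & p & H1 & H2 & ->). pose proof H1 as H1'.
      apply (te_pr_in_inv hj) in H1 as (pi' & p' & -> & -> & H1).
      exists (value g pi'). apply (te_mem hj) in H2. split; [apply in_value; eauto|].
      symmetry. apply IH; eauto. apply (mem_dom_trcl (j pi') (j p')); auto. }
  apply K. apply (te_pr_in hj), Hf. split; auto. apply trcl_sub. now apply in_sing.
Qed.

Context {c : M}.
Hypothesis hc : is_poset M c.

Lemma te_cond x : cond W (j c) x <-> exists p, x = j p /\ cond M c p.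
Proof.
  destruct (poset_data hc) as (C & l & o & E & _ & HC & _). split.
  - intros (C' & l' & o' & E' & Hx). apply is_triple_iff in E'.
    rewrite E, !(te_pr hj) in E'. apply pr_inj in E' as [E' _]. apply pr_inj in E' as [<- _].
    apply (te_in hj) in Hx as (p & Hp & ->). exists p. rewrite HC. auto.
  - intros (p & -> & Hp). exists (j C), (j l), (j o). rewrite is_triple_iff, (te_mem hj), <- HC.
    split; auto. now rewrite E, !(te_pr hj).
Qed.
Lemma te_le x y : le W (j c) x y <-> exists p q, x = j p /\ y = j q /\ le M c p q.
Proof.
  destruct (poset_data hc) as (C & l & o & E & _ & _ & Hl & _). split.
  - intros (C' & l' & o' & E' & Hx). apply is_triple_iff in E'.
    rewrite E, !(te_pr hj) in E'. apply pr_inj in E' as [E' _]. apply pr_inj in E' as [_ <-].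
    apply pair_in_iff, (te_pr_in_inv hj) in Hx as (p & q & -> & -> & Hpq). exists p, q. rewrite Hl. auto.
  - intros (p & q & -> & -> & Hp). exists (j C), (j l), (j o).
    rewrite is_triple_iff, pair_in_iff, (te_pr_in hj), <- Hl.
    split; auto. now rewrite E, !(te_pr hj).
Qed.
Lemma te_le' p q : le W (j c) (j p) (j q) <-> le M c p q.
Proof.
  rewrite te_le. split; [|eauto]. intros (p' & q' & E1 & E2 & H).
  apply (te_inj hj) in E1, E2. now subst.
Qed.
Lemma te_name tau : is_name M c tau -> is_name W (j c) (j tau).
Proof.
  intros (D & HD & Ht). exists (j D). rewrite (te_mem hj). split; auto.
  rewrite closed_names_iff in HD. apply closed_names_iff. intros s w Hs Hw.
  apply (te_in hj) in Hs as (s' & Hs & ->). apply (te_in hj) in Hw as (w' & Hw & ->).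
  destruct (HD s' w' Hs Hw) as (pi & p & -> & Hpi & Hp). exists (j pi), (j p).
  rewrite (te_pr hj), (te_mem hj), te_cond. repeat split; eauto.
Qed.

Context {G : M -> Prop} {g : W}.
Hypothesis hG : generic_filter M c G.
Hypothesis hg : forall x, x ∈ g <-> exists p, G p /\ x = j p.

Lemma in_trace p : j p ∈ g <-> G p.
Proof.
  rewrite hg. split; eauto. intros (q & Hq & E). apply (te_inj hj) in E. now subst.
Qed.

Lemma in_value_name tau w : w ∈ value g (j tau) <->
  exists pi s, pr pi s ∈ tau /\ G s /\ w = value g (j pi).
Proof.
  rewrite in_value. split.
  - intros (pi & p & H1 & H2 & ->). apply (te_pr_in_inv hj) in H1 as (pi' & s & -> & -> & H1).
    apply in_trace in H2. eauto.
  - intros (pi & s & H1 & H2 & ->). exists (j pi), (j s). rewrite (te_pr_in hj), in_trace. auto.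
Qed.

(** Check names are defined by recursion in the submodel, so the induction runs in [W] over
    the image of the graph of that recursion. *)
Lemma value_check x : value g (j (check c x)) = j x.
Proof.
  set (f := graph (check c) (trcl (sing x))).
  assert (Hf : forall s t, pr s t ∈ f <-> s ∈ trcl (sing x) /\ t = check c s).
  { intros s t. apply in_graph. apply def_check_with. }
  assert (K : forall y, forall v, pr y v ∈ j f -> value g v = y).
  { apply (trcl_ind (fun y => forall v, pr y v ∈ j f -> value g v = y)); [df|].
    intros y IH v Hv. destruct (te_pr_in_inv hj _ _ _ Hv) as (s & t & -> & -> & Hst).
    apply Hf in Hst as [Hs ->]. apply ext. intros w. rewrite in_value_name, (te_in hj).
    assert (Sub : forall z, z ∈ s -> value g (j (check c z)) = j z).
    { intros z Hz. apply IH; [apply trcl_sub; now apply (te_mem hj)|].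
      apply (te_pr_in hj), Hf. split; auto. exact (trcl_trans _ s Hs z Hz). }
    split.
    - intros (pi & p & H1 & _ & ->). apply in_check in H1 as (z & Hz & E).
      apply pr_inj in E as [-> ->]. exists z. auto.
    - intros (z & Hz & ->). exists (check c z), (one c). rewrite in_check. repeat split; eauto.
      + exact (one_in hc hG).
      + symmetry; auto. }
  apply K. apply (te_pr_in hj), Hf. split; auto. apply trcl_sub. now apply in_sing.
Qed.

(** The two inclusions are compared by induction on names inside [W], where the forcing
    relation on a set of names is available as a set of the ground model; the truth
    lemma cannot be used before the values are known to form an extension. *)
Lemma value_eq_iff sigma tau : is_name M c sigma -> is_name M c tau ->
  (value g (j sigma) = value g (j tau) <-> exists p, G p /\ forces_eq M c p sigma tau).
Proof.
  intros Hsig Htau. destruct Hsig as (D1 & HD1 & Hs), Htau as (D2 & HD2 & Ht).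
  set (D := cup D1 D2).
  assert (HD : closed_names M c D) by now apply closed_names_cup.
  assert (Hs' : sigma ∈ D) by (apply in_cup; auto).
  assert (Ht' : tau ∈ D) by (apply in_cup; auto). clearbody D. clear D1 HD1 Hs D2 HD2 Ht.
  assert (HDn : forall pi, pi ∈ D -> is_name M c pi) by (intros pi Hpi; exists D; auto).
  assert (HDc : forall sigma pi s, sigma ∈ D -> pr pi s ∈ sigma -> pi ∈ D).
  { intros s pi p H1 H2. rewrite closed_names_iff in HD.
    destruct (HD _ _ H1 H2) as (pi' & p' & E & ? & _). apply pr_inj in E as [-> _]. auto. }
  destruct (conditions_set hc) as [C HC].
  assert (HR : exists R, forall p s t, s ∈ D -> t ∈ D -> cond M c p ->
     (pr (pr p s) t ∈ R <-> forces_eq M c p s t)).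
  { destruct (separation (fun w => exists p s t, w = pr (pr p s) t /\ forces_eq M c p s t)
      (prod (prod C D) D)) as [R HR]; [df|]. exists R. intros p s t H1 H2 H3.
    rewrite HR, !pr_in_prod, <- HC. split.
    - intros [_ (p' & s' & t' & E & H)]. apply pr_inj in E as [E ->].
      apply pr_inj in E as [-> ->]. auto.
    - intros H. split; auto. exists p, s, t. auto. }
  destruct HR as [R HR].
  assert (HRg : forall s t, s ∈ D -> t ∈ D -> ((exists p, p ∈ g /\ pr (pr p (j s)) (j t) ∈ j R) <->
     exists p, G p /\ forces_eq M c p s t)).
  { intros s t H1 H2. split.
    - intros (p & Hp & H). apply hg in Hp as (p' & Hp & ->).
      rewrite <- (te_pr hj), (te_pr_in hj), HR in H; eauto. now apply (gf_cond hG).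
    - intros (p & Hp & H). exists (j p). rewrite in_trace, <- (te_pr hj), (te_pr_in hj), HR; auto.
      now apply (gf_cond hG). }
  assert (K : forall x, forall y, x ∈ j D -> y ∈ j D ->
    (value g x = value g y <-> exists p, p ∈ g /\ pr (pr p x) y ∈ j R)).
  2:{ rewrite <- HRg by auto. apply K; now apply (te_mem hj). }
  apply (trcl_ind (fun x => forall y, x ∈ j D -> y ∈ j D ->
    (value g x = value g y <-> exists p, p ∈ g /\ pr (pr p x) y ∈ j R))); [df|].
  intros x IH' y Hx Hy. apply (te_in hj) in Hx as (s & Hs & ->). apply (te_in hj) in Hy as (t & Ht & ->).
  rewrite HRg by auto.
  assert (IH : forall pi q u, pr pi q ∈ s -> u ∈ D ->
    (value g (j pi) = value g (j u) <-> exists p, G p /\ forces_eq M c p pi u)).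
  { intros pi q u H1 H2. rewrite <- HRg; eauto. apply IH'; try (apply (te_mem hj); eauto).
    apply (mem_dom_trcl _ (j q)). now apply (te_pr_in hj). }
  clear IH'. split.
  - intros E. destruct (feq_decided hc hG s t) as (q & Hq & [Hf|(sg & ta & Ho & pi & r & Hpi & Hqr & Hn)]); eauto.
    exfalso.
    assert (H1 : value g (j pi) ∈ value g (j sg)).
    { apply in_value_name. exists pi, r. repeat split; auto. apply (gf_up hG q); auto. }
    assert (H2 : value g (j pi) ∈ value g (j ta)).
    { destruct Ho as [[-> ->]|[-> ->]]; congruence. }
    apply in_value_name in H2 as (pi' & r' & Hpi' & Hr' & E').
    assert (Hf : exists p, G p /\ forces_eq M c p pi pi').
    { destruct Ho as [[-> ->]|[-> ->]].
      - apply (IH pi r pi') in E'; eauto.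
      - symmetry in E'. apply (IH pi' r' pi) in E' as (p & Hp & Hf); eauto.
        exists p. split; auto. apply feq_sym; auto. now apply (gf_cond hG). }
    destruct Hf as (p & Hp & Hf).
    destruct (filter_common hG q p Hq Hp) as (u & Hu & _ & Huq & Hup).
    destruct (filter_common hG u r' Hu Hr') as (u' & Hu' & _ & Hu'u & Hu'r).
    apply (Hn u' pi' r'); auto; [apply (le_trans hc _ u); auto|].
    apply (feq_mono hc p); auto. apply (le_trans hc _ u); auto.
  - intros (p & Hp & Hf). pose proof (gf_cond hG p Hp) as Hcp.
    rewrite forces_eq_iff in Hf by auto.
    assert (St : forall sg ta, (sg = s /\ ta = t) \/ (sg = t /\ ta = s) ->
      forall pi r, pr pi r ∈ sg -> G r ->
      exists q pi' r', G q /\ pr pi' r' ∈ ta /\ G r' /\ forces_eq M c q pi pi').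
    { intros sg ta Ho pi r Hpi Hr.
      destruct (filter_common hG p r Hp Hr) as (u & Hu & _ & Hup & Hur).
      destruct (generic_dense_below hc hG (fun q => exists pi' r', pr pi' r' ∈ ta /\ le M c q r' /\
        forces_eq M c q pi pi') u) as (q & Hq & _ & pi' & r' & H1 & H2 & H3); auto.
      - df.
      - intros u' Hu'. destruct (Hf sg ta Ho pi r Hpi u') as (q & pi' & r' & ? & ? & ? & ?).
        + apply (le_trans hc _ u); auto. + apply (le_trans hc _ u); auto.
        + exists q. split; auto. exists pi', r'. auto.
      - exists q, pi', r'. repeat split; auto. apply (gf_up hG q); auto. }
    apply ext. intros w. rewrite !in_value_name. split.
    + intros (pi & r & Hpi & Hr & ->).
      destruct (St s t (or_introl (conj eq_refl eq_refl)) pi r Hpi Hr) as (q & pi' & r' & ? & ? & ? & ?).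
      exists pi', r'. repeat split; auto. apply (IH pi r pi'); eauto.
    + intros (pi & r & Hpi & Hr & ->).
      destruct (St t s (or_intror (conj eq_refl eq_refl)) pi r Hpi Hr) as (q & pi' & r' & ? & ? & ? & ?).
      exists pi', r'. repeat split; auto. symmetry. apply (IH pi' r' pi); eauto.
      exists q. split; auto. apply feq_sym; auto. now apply (gf_cond hG).
Qed.

(** The values computed in [W] may be seen through any transitive embedding onto them. *)
Lemma values_extension (N : structure) (k : N -> W) (val : M -> N) :
  trans_embedding N W k ->
  (forall tau, is_name M c tau -> k (val tau) = value g (j tau)) ->
  (forall x, exists tau, is_name M c tau /\ val tau = x) -> extension M c G N val.
Proof.
  intros hk Hv Hs. constructor; auto.
  - intros tau y Ht. rewrite <- (te_mem hk), Hv, in_value_name by auto.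
    split; intros (pi & s & H1 & H2 & H3); exists pi, s; (split; [|split; auto]);
      try (now apply pair_in_iff);
      assert (is_name M c pi) by (first [exact (proj1 (name_pair _ _ _ Ht H1))|
        apply pair_in_iff in H1; exact (proj1 (name_pair _ _ _ Ht H1))]).
    + apply (te_inj hk). now rewrite Hv.
    + rewrite H3. now apply Hv.
  - intros sigma tau H1 H2. rewrite <- (value_eq_iff sigma tau), <- !Hv by auto.
    split; [congruence|apply (te_inj hk)].
Qed.
End ForcingAbsoluteness.

Lemma id_embedding (W : structure) : trans_embedding W W (fun x => x).
Proof. constructor; auto; [tauto|eauto]. Qed.

Lemma compose_embedding (M N W : structure) (j : M -> N) (k : N -> W) :
  trans_embedding M N j -> trans_embedding N W k -> trans_embedding M W (fun x => k (j x)).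
Proof.
  intros hj hk. constructor.
  - intros x y H. now apply (te_inj hk), (te_inj hj) in H.
  - intros x y. now rewrite (te_mem hk), (te_mem hj).
  - intros z y H. destruct (te_trans hk _ _ H) as [u ->].
    apply (te_mem hk) in H. destruct (te_trans hj _ _ H) as [v ->]. eauto.
Qed.

(** The relation between an extension and its ground model, seen from the extension: [g]
    is the filter as a set of [N], and the names are evaluated in [N]. *)
Record ground_of (M : structure) (c : M) (G : M -> Prop) (N : structure) {hN : ZF N}
    (j : M -> N) (g : N) : Prop := {
  go_emb : trans_embedding M N j;
  go_filter : forall x, x ∈ g <-> exists p, G p /\ x = j p;
  go_values : forall x, exists tau, is_name M c tau /\ value g (j tau) = x
}.
Arguments go_emb {M c G N hN j g}. Arguments go_filter {M c G N hN j g}.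
Arguments go_values {M c G N hN j g}.

Section GroundOf.
Context {M : structure} {hM : ZF M} {c : M} {G : M -> Prop}.
Hypothesis hc : is_poset M c.
Hypothesis hG : generic_filter M c G.

Lemma ground_of_extension {N : structure} {hN : ZF N} {j : M -> N} {g : N} :
  ground_of M c G N j g -> extension M c G N (fun tau => value g (j tau)).
Proof.
  intros H. apply (values_extension (go_emb H) hc hG (go_filter H) N (fun x => x)); auto.
  - apply id_embedding.
  - apply (go_values H).
Qed.

Lemma ground_of_truth {N : structure} {hN : ZF N} {j : M -> N} {g : N} (H : ground_of M c G N j g)
  phi nu : (forall i, free i phi -> is_name M c (nu i)) ->
  (sat N (fun i => value g (j (nu i))) phi <-> exists p, G p /\ forces M c p nu phi).
Proof. intros Hn. exact (truth_free hc hG (ground_of_extension H) phi nu Hn). Qed.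

Lemma forced_at_sound {N : structure} {hN : ZF N} {j : M -> N} {g : N} (H : ground_of M c G N j g)
  phi e : forced_at M c e phi -> sat N (fun i => j (e i)) phi.
Proof.
  intros F. assert (F' : forced M c (fun i => check c (e i)) phi).
  { apply F. intros i _. now apply is_check_iff. }
  destruct (gf_inhabited hG) as [p Hp].
  apply (sat_ext _ phi (fun i => value g (j (check c (e i)))) (fun i => j (e i))).
  { intros i _. apply (value_check (go_emb H) hc hG (go_filter H)). }
  apply (ground_of_truth H); [intros; now apply check_name|].
  exists p. split; auto. apply F'. now apply (gf_cond hG).
Qed.

Definition filter_name : M := compr (fun w => exists p, cond M c p /\ w = pr (check c p) p).
Lemma in_filter_name w : w ∈ filter_name <-> exists p, cond M c p /\ w = pr (check c p) p.
Proof.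
  unfold filter_name. rewrite in_compr_ex; [tauto|].
  destruct (conditions_set hc) as [C HC].
  destruct (replacement (fun p w => w = pr (check c p) p) C) as [s Hs]; [df|congruence|].
  exists s. intros z. rewrite Hs. split; intros (p & ? & ?); exists p; split; auto; now apply HC.
Qed.
Lemma filter_name_name : is_name M c filter_name.
Proof.
  apply name_intro. intros w Hw. apply in_filter_name in Hw as (p & Hp & ->).
  exists (check c p), p. repeat split; auto. now apply check_name.
Qed.

(** The filter is the value of the canonical name, and the internal evaluation of the
    copies of names agrees with the given one since both satisfy the same recursion. *)
Lemma extension_ground_of {N : structure} {val : M -> N} (hE : extension M c G N val) {hN : ZF N} :
  ground_of M c G N (fun x => val (check c x)) (val filter_name) /\
  forall tau, is_name M c tau -> val tau = value (val filter_name) (val (check c tau)).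
Proof.
  pose proof (check_embedding hc hG hE) as hj.
  assert (hg : forall x, x ∈ val filter_name <-> exists p, G p /\ x = val (check c p)).
  { intros x. rewrite (val_mem hE) by apply filter_name_name. split.
    - intros (pi & s & H & Hs & ->). apply in_filter_name in H as (p & _ & E).
      apply pr_inj in E as [-> ->]. eauto.
    - intros (p & Hp & ->). exists (check c p), p. repeat split; auto. apply in_filter_name.
      exists p. split; auto. now apply (gf_cond hG). }
  assert (V : forall tau, is_name M c tau -> val tau = value (val filter_name) (val (check c tau))).
  { intros tau Ht. destruct (closed_superset tau Ht) as (D & HtD & HD & Hcl).
    destruct (replacement (fun s n => n = pair_name (c := c) (check c s) s) D) as [E HEE].
    { unfold pair_name. unfold def2. dfn_tac. apply tm_upair_name; apply tm_upair_name; dfn_tac. }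
    { congruence. }
    destruct (set_of_values hc hG hE E) as [f Hf].
    { intros n Hn. apply HEE in Hn as (s & Hs & ->). apply (pair_name_name hc); auto. now apply check_name. }
    assert (Hf' : forall a b, pr a b ∈ f <-> exists s, s ∈ D /\ a = val (check c s) /\ b = val s).
    { intros a b. rewrite Hf. split.
      - intros (n & Hn & E'). apply HEE in Hn as (s & Hs & ->).
        rewrite (val_pair_name hc hG hE) in E'; auto; [|now apply check_name].
        apply pr_inj in E' as [-> ->]. eauto.
      - intros (s & Hs & -> & ->). exists (pair_name (c := c) (check c s) s). split; [apply HEE; eauto|].
        rewrite (val_pair_name hc hG hE); auto. now apply check_name. }
    assert (K : forall x, forall v, pr x v ∈ f -> v = value (val filter_name) x).
    { apply (trcl_ind (fun x => forall v, pr x v ∈ f -> v = value (val filter_name) x)); [df|].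
      intros x IH v Hv. apply Hf' in Hv as (s & Hs & -> & ->).
      apply ext. intros w. rewrite (val_mem hE), (in_value_name hj hg) by auto.
      split; intros (pi & r & H1 & H2 & ->); exists pi, r; repeat split; auto.
      - apply IH; [|apply Hf'; eauto]. apply (mem_dom_trcl _ (val (check c r))). now apply (te_pr_in hj).
      - symmetry. apply IH; [|apply Hf'; eauto]. apply (mem_dom_trcl _ (val (check c r))).
        now apply (te_pr_in hj). }
    apply K. apply Hf'. eauto. }
  split; auto. constructor; auto.
  intros x. destruct (ext_surj hE x) as (tau & Ht & <-). exists tau. split; auto. symmetry. auto.
Qed.
End GroundOf.

Lemma sub_ext {W : structure} {X : W -> Prop} (x y : sub W X) : proj1_sig x = proj1_sig y -> x = y.
Proof. intros E. apply eq_sig_hprop; auto. intros; apply proof_irrelevance. Qed.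

Lemma sub_embedding {W : structure} {X : W -> Prop} : (forall x y, X y -> x ∈ y -> X x) ->
  trans_embedding (sub W X) W (fun x : sub W X => proj1_sig x).
Proof.
  intros H. constructor.
  - intros x y. apply sub_ext.
  - intros x y. simpl. tauto.
  - intros z [y Hy] Hz. simpl in Hz. exists (exist _ z (H z y Hy Hz)). reflexivity.
Qed.

(** ** The submodel generated by a ground model and a filter *)
(** The values of the names of [M] form a submodel of any model of ZF that contains [M] and
    the filter; this compares models generated by different filters. *)
Section Generated.
Context {M W : structure} {hM : ZFC M} {hW : ZF W} {j : M -> W} {c : M} {G : M -> Prop} {g : W}.
Hypothesis hj : trans_embedding M W j.
Hypothesis hc : is_poset M c.
Hypothesis hG : generic_filter M c G.
Hypothesis hg : forall x, x ∈ g <-> exists p, G p /\ x = j p.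

Definition generated (x : W) : Prop := exists tau, is_name M c tau /\ x = value g (j tau).

Lemma generated_transitive x y : generated y -> x ∈ y -> generated x.
Proof.
  intros (tau & Ht & ->) Hx. apply (in_value_name hj hg) in Hx as (pi & s & H & _ & ->).
  exists pi. split; auto. exact (proj1 (name_pair _ _ _ Ht H)).
Qed.

Lemma generated_embedding : trans_embedding (sub W generated) W (fun x : sub W generated => proj1_sig x).
Proof. apply sub_embedding. exact generated_transitive. Qed.

Definition generated_val (tau : M) : sub W generated :=
  match excluded_middle_informative (is_name M c tau) with
  | left h => exist _ (value g (j tau)) (ex_intro _ tau (conj h eq_refl))
  | right _ => exist _ (value g (j emp)) (ex_intro _ emp (conj (name_emp c) eq_refl))
  end.

Lemma generated_extension : extension M c G (sub W generated) generated_val.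
Proof.
  assert (V : forall tau, is_name M c tau -> proj1_sig (generated_val tau) = value g (j tau)).
  { intros tau Ht. unfold generated_val. destruct excluded_middle_informative; [auto|contradiction]. }
  apply (values_extension hj hc hG hg _ _ _ generated_embedding); auto.
  intros [x (tau & Ht & E)]. exists tau. split; auto. apply sub_ext. rewrite V by auto. now simpl.
Qed.

Lemma generated_ZFC : ZFC (sub W generated).
Proof. exact (extension_ZFC hc hG generated_extension). Qed.

Lemma generated_ground {hN : ZF (sub W generated)} : exists jN gN,
  ground_of M c G (sub W generated) jN gN /\
  (forall x, proj1_sig (jN x) = j x) /\ proj1_sig gN = g.
Proof.
  assert (V : forall tau, is_name M c tau -> proj1_sig (generated_val tau) = value g (j tau)).
  { intros tau Ht. unfold generated_val. destruct excluded_middle_informative; [auto|contradiction]. }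
  destruct (extension_ground_of hc hG generated_extension) as [Hgr _].
  exists (fun x => generated_val (check c x)), (generated_val (filter_name (c := c))).
  split; [exact Hgr|]. split.
  - intros x. rewrite V by now apply check_name. exact (value_check hj hc hG hg x).
  - rewrite V by now apply filter_name_name.
    apply ext. intros w. rewrite (in_value_name hj hg). rewrite hg. split.
    + intros (pi & s & H & Hs & ->). apply (in_filter_name hc) in H as (p & _ & E).
      apply pr_inj in E as [-> ->]. exists p. split; auto. exact (value_check hj hc hG hg p).
    + intros (p & Hp & ->). exists (check c p), p. split; [|split; auto].
      * apply (in_filter_name hc). exists p. split; auto. now apply (gf_cond hG).
      * symmetry. exact (value_check hj hc hG hg p).
Qed.
End Generated.
Arguments generated {M W hW} j c g x.

(** * Reduction to countable models *)

Definition uniform (R : forall W : structure, (nat -> W) -> Prop) : Prop :=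
  @dfn structure (fun W => W) (fun _ => False) R.

Lemma uniform_formula R : uniform R -> exists phi, forall W e, R W e <-> sat W e phi.
Proof.
  intros (l & phi & Hl & H). destruct l as [|c l].
  - exists phi. intros W e. apply (H W e).
  - destruct (Hl c). now left.
Qed.

Section Elementary.
Variables (V0 V : structure) (f : V0 -> V).
Hypothesis hf : forall phi e, sat V0 e phi <-> sat V (fun i => f (e i)) phi.

Lemma elementary_uniform R (e : nat -> V0) : uniform R -> (R V0 e <-> R V (fun i => f (e i))).
Proof.
  intros HR. destruct (uniform_formula R HR) as [phi H]. now rewrite !H, hf.
Qed.

Lemma elementary_ZFC : inhabited V0 -> ZFC V -> ZFC V0.
Proof.
  intros [v0] hV. pose (e0 := fun _ : nat => v0).
  constructor.
  - apply (elementary_uniform (fun W _ => forall x y : W, (forall z, z ∈ x <-> z ∈ y) -> x = y) e0);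
      [unfold uniform; dfn_tac|apply hV].
  - apply (elementary_uniform (fun W _ => forall x : W, (exists y, y ∈ x) ->
      exists y, y ∈ x /\ ~ exists z, z ∈ y /\ z ∈ x) e0); [unfold uniform; dfn_tac|apply hV].
  - apply (elementary_uniform (fun W _ => forall x y : W, exists z, is_upair z x y) e0);
      [unfold uniform; dfn_tac|apply hV].
  - apply (elementary_uniform (fun W _ => forall x : W, exists u, forall z, z ∈ u <-> exists y, y ∈ x /\ z ∈ y) e0);
      [unfold uniform; dfn_tac|apply hV].
  - apply (elementary_uniform (fun W _ => forall x : W, exists p, forall z, z ∈ p <-> subset z x) e0);
      [unfold uniform; dfn_tac|apply hV].
  - apply (elementary_uniform (fun W _ => exists w : W,
    (exists o, o ∈ w /\ forall z, ~ z ∈ o) /\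
    (forall x, x ∈ w -> exists y, y ∈ w /\ forall z, z ∈ y <-> z ∈ x \/ z = x)) e0);
      [unfold uniform; dfn_tac|apply hV].
  - intros phi e x.
    apply (elementary_uniform (fun W e => exists y, forall z, z ∈ y <-> z ∈ e 0 /\
       sat W (upd (fun n => e (S n)) 0 z) phi) (scons x e)).
    + unfold uniform. apply dfn_ex, (dfn_all _ _ _ (fun i e z => z ∈ e 0 <-> z ∈ e 1 /\
        sat i (upd (fun n => e (S (S n))) 0 z) phi)).
      apply dfn_iffP; [dfn_tac|]. apply dfn_and; [dfn_tac|].
      apply dfn_iff with (fun W e => sat W (fun n => (fun n (W : structure) (e : nat -> W) =>
         if n =? 0 then e 0 else e (S (S (S n)))) n W e) phi).
      * intros W e'. apply sat_ext. reflexivity.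
      * apply dfn_sat. intros n. destruct (n =? 0); apply tm_var.
    + apply (zf_separation _ hV).
  - intros phi e x.
    apply (elementary_uniform (fun W e => (forall u, u ∈ e 0 -> exists! v,
       sat W (upd (upd (fun n => e (S n)) 0 u) 1 v) phi) ->
       exists y, forall v, v ∈ y <-> exists u, u ∈ e 0 /\
        sat W (upd (upd (fun n => e (S n)) 0 u) 1 v) phi) (scons x e)).
    + unfold uniform.
      assert (Ds : forall h k l, @dfn structure (fun W => W) (fun _ => False)
        (fun W e => sat W (upd (upd (fun n => e (h n)) 0 (e k)) 1 (e l)) phi)).
      { intros h k l.
        apply dfn_iff with (fun W e => sat W (fun n => (fun n (W : structure) (e : nat -> W) =>
         if n =? 1 then e l else if n =? 0 then e k else e (h n)) n W e) phi).
        - intros W e'. apply sat_ext. reflexivity.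
        - apply dfn_sat. intros n. destruct (n =? 1), (n =? 0); apply tm_var. }
      apply dfn_imp.
      * apply (dfn_all _ _ _ (fun W e u => u ∈ e 0 -> exists! v,
          sat W (upd (upd (fun n => e (S n)) 0 u) 1 v) phi)).
        apply dfn_imp; [dfn_tac|].
        apply (dfn_unique _ _ _ (fun W e v => sat W (upd (upd (fun n => e (S (S n))) 0 (e 0)) 1 v) phi)).
        apply (Ds (fun n => S (S (S n))) 1 0).
      * apply dfn_ex, (dfn_all _ _ _ (fun W e v => v ∈ e 0 <-> exists u, u ∈ e 1 /\
          sat W (upd (upd (fun n => e (S (S n))) 0 u) 1 v) phi)).
        apply dfn_iffP; [dfn_tac|]. apply (dfn_ex _ _ _ (fun W e u => u ∈ e 2 /\
          sat W (upd (upd (fun n => e (S (S (S n)))) 0 u) 1 (e 0)) phi)).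
        apply dfn_and; [dfn_tac|]. apply (Ds (fun n => S (S (S (S n)))) 0 1).
    + apply (zf_replacement _ hV).
  - apply (elementary_uniform (fun W _ => forall x : W,
    (forall y, y ∈ x -> exists z, z ∈ y) ->
    (forall y y' z, y ∈ x -> y' ∈ x -> z ∈ y -> z ∈ y' -> y = y') ->
    exists c, forall y, y ∈ x -> exists! z, z ∈ y /\ z ∈ c) e0); [unfold uniform; dfn_tac|apply hV].
Qed.
End Elementary.

Fixpoint formulas (n : nat) : list formula :=
  match n with
  | 0 => nil
  | S n =>
      formulas n ++ flat_map (fun x => flat_map (fun y => Mem x y :: Eq x y :: nil) (seq 0 n)) (seq 0 n)
      ++ map Neg (formulas n) ++ flat_map (fun a => map (And a) (formulas n)) (formulas n)
      ++ flat_map (fun x => map (All x) (formulas n)) (seq 0 n)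
  end.

Lemma formulas_mono n m phi : n <= m -> In phi (formulas n) -> In phi (formulas m).
Proof. induction 1; auto. intros H'. simpl. apply in_or_app. auto. Qed.

Lemma formulas_all phi : exists n, In phi (formulas n).
Proof.
  induction phi.
  - exists (S (S (max x y))). cbn [formulas]. apply in_or_app; right. apply in_or_app; left.
    apply in_flat_map. exists x. split; [apply in_seq; lia|]. apply in_flat_map. exists y.
    split; [apply in_seq; lia|]. simpl; auto.
  - exists (S (S (max x y))). cbn [formulas]. apply in_or_app; right. apply in_or_app; left.
    apply in_flat_map. exists x. split; [apply in_seq; lia|]. apply in_flat_map. exists y.
    split; [apply in_seq; lia|]. simpl; auto.
  - destruct IHphi as [n Hn]. exists (S n). cbn [formulas]. do 2 (apply in_or_app; right).
    apply in_or_app; left. now apply in_map.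
  - destruct IHphi1 as [n Hn], IHphi2 as [m Hm]. exists (S (max n m)). cbn [formulas].
    do 3 (apply in_or_app; right). apply in_or_app; left. apply in_flat_map. exists phi1.
    split; [|apply in_map]; eapply formulas_mono; try eassumption; lia.
  - destruct IHphi as [n Hn]. exists (S (max n (S x))). cbn [formulas].
    do 4 (apply in_or_app; right). apply in_flat_map. exists x. split; [apply in_seq; lia|].
    apply in_map. eapply formulas_mono; try eassumption; lia.
Qed.

Fixpoint tuples {T} (L : list T) (n : nat) : list (list T) :=
  match n with
  | 0 => nil :: nil
  | S n => tuples L n ++ flat_map (fun a => map (cons a) (tuples L n)) L
  end.
Lemma tuples_all {T} (L : list T) n l : length l <= n -> (forall a, In a l -> In a L) -> In l (tuples L n).
Proof.
  revert l. induction n; intros l Hl HL.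
  - destruct l; simpl in *; [auto|lia].
  - simpl. apply in_or_app. destruct l as [|a l].
    + left. apply IHn; simpl; [lia|tauto].
    + right. apply in_flat_map. exists a. split; [apply HL; simpl; auto|]. apply in_map.
      apply IHn; [simpl in Hl; lia|]. intros b Hb. apply HL. simpl; auto.
Qed.

(** The hull is built in stages that are finite lists, so that its countability is evident:
    stage [n] adds witnesses for finitely many formulas and tuples of bounded length. *)
Section Skolem.
Variables (V : structure) (v0 : V) (L0 : list V).

Definition list_env (l : list V) : nat -> V := fun i => nth i l v0.
Definition skolem (phi : formula) (x : nat) (l : list V) : V :=
  epsilon (inhabits v0) (fun a => ~ sat V (upd (list_env l) x a) phi).

Fixpoint hull (n : nat) : list V :=
  match n with
  | 0 => v0 :: L0
  | S n => hull n ++ flat_map (fun phi => flat_map (fun x => map (skolem phi x)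
             (tuples (hull n) n)) (seq 0 n)) (formulas n)
  end.
Definition in_hull (x : V) : Prop := exists n, In x (hull n).

Lemma hull_mono n m x : n <= m -> In x (hull n) -> In x (hull m).
Proof. induction 1; auto. intros H'. simpl. apply in_or_app. auto. Qed.

Lemma hull_countable : countable (sub V in_hull).
Proof.
  assert (H0 : in_hull v0) by (exists 0; simpl; auto).
  assert (H : forall n m, in_hull (nth m (hull n) v0)).
  { intros n m. destruct (nth_in_or_default m (hull n) v0) as [H| ->]; auto. exists n; auto. }
  exists (fun k => let p := Cantor.of_nat k in exist _ (nth (snd p) (hull (fst p)) v0) (H (fst p) (snd p))).
  intros [x [n Hx]]. destruct (In_nth _ _ v0 Hx) as (m & _ & E).
  exists (Cantor.to_nat (n, m)). apply sub_ext.
  cbv beta zeta. cbn [proj1_sig]. rewrite Cantor.cancel_of_to. exact E.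
Qed.

Lemma hull_elementary phi : forall e : nat -> sub V in_hull,
  sat (sub V in_hull) e phi <-> sat V (fun i => proj1_sig (e i)) phi.
Proof.
  assert (U : forall (e : nat -> sub V in_hull) x a,
     (fun i => proj1_sig (upd e x a i)) = upd (fun i => proj1_sig (e i)) x (proj1_sig a)).
  { intros e x a. extensionality i. unfold upd. now destruct (i =? x). }
  induction phi; cbn [sat]; intros e.
  - simpl. tauto.
  - split; [congruence|apply sub_ext].
  - now rewrite IHphi.
  - now rewrite IHphi1, IHphi2.
  - split.
    + intros H. apply NNPP. intros N. apply not_all_ex_not in N as [a N].
      set (b := max (bnd phi) (S x)).
      set (l := map (fun i => proj1_sig (e i)) (seq 0 b)).
      assert (El : forall i, i < b -> list_env l i = proj1_sig (e i)).
      { intros i Hi. unfold list_env, l.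
        rewrite nth_indep with (d' := (fun i => proj1_sig (e i)) 0) by (rewrite length_map, length_seq; auto).
        rewrite (map_nth (fun i => proj1_sig (e i))). now rewrite seq_nth. }
      assert (Es : forall a, sat V (upd (list_env l) x a) phi <-> sat V (upd (fun i => proj1_sig (e i)) x a) phi).
      { intros a'. apply sat_ext. intros i Hi. apply free_bnd in Hi. unfold upd.
        destruct (i =? x); auto. apply El. lia. }
      assert (Hs : ~ sat V (upd (list_env l) x (skolem phi x l)) phi).
      { unfold skolem. apply (epsilon_spec (inhabits v0) (fun a => ~ sat V (upd (list_env l) x a) phi)).
        exists a. now rewrite Es. }
      assert (Hh : in_hull (skolem phi x l)).
      { destruct (formulas_all phi) as [n1 Hn1].
        assert (Hn2 : exists n2, forall a, In a l -> In a (hull n2)).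
        { assert (Hl : forall a, In a l -> in_hull a).
          { intros a' Ha. unfold l in Ha. apply in_map_iff in Ha as (i & <- & _). exact (proj2_sig (e i)). }
          clear -Hl. induction l as [|a l IH]; [exists 0; simpl; tauto|].
          destruct IH as [n Hn]; [intros; apply Hl; simpl; auto|].
          destruct (Hl a) as [m Hm]; [simpl; auto|]. exists (max n m).
          intros a' [<-|Ha]; [apply (hull_mono m)|apply (hull_mono n)]; auto; lia. }
        destruct Hn2 as [n2 Hn2]. set (n := max (max n1 n2) b). exists (S n). simpl.
        apply in_or_app. right. apply in_flat_map. exists phi.
        split; [apply (formulas_mono n1); auto; lia|]. apply in_flat_map. exists x.
        split; [apply in_seq; lia|]. apply in_map. apply tuples_all.
        - unfold l. rewrite length_map, length_seq. lia.
        - intros a' Ha. apply (hull_mono n2); auto. lia. }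
      apply Hs. apply Es. specialize (H (exist _ _ Hh)). rewrite IHphi, U in H. exact H.
    + intros H a. rewrite IHphi, U. apply H.
Qed.

End Skolem.

(** Forcing arguments with actual generic filters apply to all models, by the downward
    Löwenheim-Skolem theorem. *)
Theorem countable_reduction R : uniform R ->
  (forall M, ZFC M -> countable M -> forall e, R M e) -> forall V, ZFC V -> forall e, R V e.
Proof.
  intros HR H V hV e. destruct (uniform_formula R HR) as [phi Hphi].
  set (L0 := map e (seq 0 (bnd phi))).
  assert (He : forall i, in_hull V (e 0) L0 (if i <? bnd phi then e i else e 0)).
  { intros i. exists 0. simpl. destruct (Nat.ltb_spec i (bnd phi)); auto.
    right. apply in_map, in_seq. lia. }
  set (e' := fun i => exist (in_hull V (e 0) L0) _ (He i)).
  set (f := fun x : sub V (in_hull V (e 0) L0) => proj1_sig x).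
  assert (hf : forall phi e, sat _ e phi <-> sat V (fun i => f (e i)) phi).
  { intros psi e1. apply hull_elementary. }
  assert (Hs : R V (fun i => f (e' i))).
  { apply (elementary_uniform _ V f hf R e' HR). apply H; [|apply hull_countable].
    apply (elementary_ZFC _ V f hf); auto. exact (inhabits (e' 0)). }
  rewrite Hphi in *. eapply sat_ext; [|exact Hs]. intros i Hi. apply free_bnd in Hi.
  unfold f. simpl. destruct (Nat.ltb_spec i (bnd phi)); [auto|lia].
Qed.

(** * Two-step iterations *)

Lemma triple_data {M : structure} {hM : ZF M} (c C l o : M) : c = pr (pr C l) o ->
  (forall p, cond M c p <-> p ∈ C) /\ (forall p q, le M c p q <-> pr p q ∈ l) /\
  (forall p, top M c p <-> p = o).
Proof.
  intros E.
  assert (T : forall C' l' o', is_triple c C' l' o' <-> C' = C /\ l' = l /\ o' = o).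
  { intros C' l' o'. rewrite is_triple_iff, E. split.
    - intros E'. apply pr_inj in E' as [E1 ->]. apply pr_inj in E1 as [-> ->]. auto.
    - intros (-> & -> & ->). auto. }
  repeat split.
  - intros (C' & l' & o' & E' & H). apply T in E' as (-> & -> & ->). auto.
  - intros H. exists C, l, o. rewrite T. auto.
  - intros (C' & l' & o' & E' & H). apply T in E' as (-> & -> & ->). now apply pair_in_iff.
  - intros H. exists C, l, o. rewrite T. split; auto. now apply pair_in_iff.
  - intros (C' & l' & E'). apply T in E' as (-> & -> & ->). auto.
  - intros ->. exists C, l. now rewrite T.
Qed.

Lemma poset_of_triple {M : structure} {hM : ZF M} (c C l o : M) : c = pr (pr C l) o ->
  (is_poset M c <-> preorder C l o).
Proof.
  intros E. rewrite is_poset_iff. split.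
  - intros (C' & l' & o' & E' & H). apply is_triple_iff in E'. rewrite E in E'.
    apply pr_inj in E' as [E1 ->]. apply pr_inj in E1 as [-> ->]. auto.
  - intros H. exists C, l, o. rewrite is_triple_iff. auto.
Qed.

(** [p] forces [s] to lie below [t] in the order named by [l]. *)
Definition lef {M : structure} (c l p s t : M) : Prop :=
  forces M c p (fun k => match k with 0 => s | 1 => t | _ => l end) (fPairIn 0 1 2).

Record iteration_data {M : structure} {hM : ZF M} (c Q i q l o I L t : M) : Prop := {
  it_q : is_name M c q;
  it_l : is_name M c l;
  it_o : exists s, pr o s ∈ q;
  it_triple : forced M c (fun k => match k with 0 => Q | 1 => q | 2 => l | _ => o end)
      (fTriple 0 1 2 3);
  it_i : i = pr (pr I L) t;
  it_I : forall w, w ∈ I <-> exists p s, w = pr p s /\ cond M c p /\ (exists r, pr s r ∈ q) /\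
          forces_mem M c p s q;
  it_L : forall w, w ∈ L <-> exists p s p' s', w = pr (pr p s) (pr p' s') /\ pr p s ∈ I /\
          pr p' s' ∈ I /\ le M c p p' /\ lef c l p s s';
  it_t : exists one, top M c one /\ t = pr one o
}.

Lemma iteration_unfold {M : structure} {hM : ZF M} (c Q i : M) :
  is_iteration M c Q i <-> exists q l o I L t, iteration_data c Q i q l o I L t.
Proof.
  split.
  - intros (q & l & o & Hq & Hl & (s & Ho) & HT & I & L & t & Hi & HI & HL & one & H1 & H2).
    exists q, l, o, I, L, t. constructor; auto.
    + exists s. now apply pair_in_iff.
    + now apply is_triple_iff.
    + intros w. rewrite HI. split; intros (p & s' & E & Hp & (r & Hr) & Hf); exists p, s';
        (split; [now apply is_pair_iff|]); repeat split; auto; exists r; now apply pair_in_iff.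
    + intros w. rewrite HL. split.
      * intros (u & u' & p & s1 & p' & s' & E & Hu & Hu' & E1 & E2 & H).
        apply is_pair_iff in E, E1, E2. subst. exists p, s1, p', s'. auto.
      * intros (p & s1 & p' & s' & E & Hu & Hu' & H). exists (pr p s1), (pr p' s'), p, s1, p', s'.
        rewrite !is_pair_iff. repeat (split; [solve [auto]|]). exact H.
    + exists one. split; auto. now apply is_pair_iff.
  - intros (q & l & o & I & L & t & [Hq Hl (s & Ho) HT Hi HI HL (one & H1 & H2)]).
    exists q, l, o. split; [exact Hq|]. split; [exact Hl|]. split; [|split; [exact HT|]].
    + exists s. now apply pair_in_iff.
    + exists I, L, t. split; [now apply is_triple_iff|]. split; [|split].
      * intros w. rewrite HI. split; intros (p & s' & E & Hp & (r & Hr) & Hf); exists p, s';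
        (split; [now apply is_pair_iff|]); repeat split; auto; exists r; now apply pair_in_iff.
      * intros w. rewrite HL. split.
        { intros (p & s1 & p' & s' & E & Hu & Hu' & H). exists (pr p s1), (pr p' s'), p, s1, p', s'.
          rewrite !is_pair_iff. repeat (split; [solve [auto]|]). split; apply H. }
        { intros (u & u' & p & s1 & p' & s' & E & Hu & Hu' & E1 & E2 & H).
          apply is_pair_iff in E, E1, E2. subst. exists p, s1, p', s'. auto. }
      * exists one. split; [exact H1|now apply is_pair_iff].
Qed.

Section IterationTruth.
Context {M : structure} {hM : ZF M} {c Q i q l o I L t : M}.
Hypothesis hc : is_poset M c.
Hypothesis hi : iteration_data c Q i q l o I L t.
Hypothesis hQ : is_name M c Q.

Lemma it_o_name : is_name M c o.
Proof. destruct (it_o _ _ _ _ _ _ _ _ _ hi) as [s H]. exact (proj1 (name_pair _ _ _ (it_q _ _ _ _ _ _ _ _ _ hi) H)). Qed.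

Lemma it_I_pair p s : pr p s ∈ I <-> cond M c p /\ (exists r, pr s r ∈ q) /\ forces_mem M c p s q.
Proof.
  rewrite (it_I _ _ _ _ _ _ _ _ _ hi). split.
  - intros (p' & s' & E & H). apply pr_inj in E as [-> ->]. auto.
  - intros H. exists p, s. auto.
Qed.
Lemma it_L_pair p s p' s' : pr (pr p s) (pr p' s') ∈ L <->
  pr p s ∈ I /\ pr p' s' ∈ I /\ le M c p p' /\ lef c l p s s'.
Proof.
  rewrite (it_L _ _ _ _ _ _ _ _ _ hi). split.
  - intros (p1 & s1 & p2 & s2 & E & H). apply pr_inj in E as [E1 E2].
    apply pr_inj in E1 as [-> ->]. apply pr_inj in E2 as [-> ->]. auto.
  - intros H. exists p, s, p', s'. auto.
Qed.
Lemma it_I_name p s : pr p s ∈ I -> is_name M c s.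
Proof.
  intros H. apply it_I_pair in H as (_ & (r & Hr) & _).
  exact (proj1 (name_pair _ _ _ (it_q _ _ _ _ _ _ _ _ _ hi) Hr)).
Qed.
Lemma it_cond w : cond M i w <-> w ∈ I.
Proof. apply (triple_data i I L t (it_i _ _ _ _ _ _ _ _ _ hi)). Qed.
Lemma it_le w w' : le M i w w' <-> pr w w' ∈ L.
Proof. apply (triple_data i I L t (it_i _ _ _ _ _ _ _ _ _ hi)). Qed.

Context {G : M -> Prop} {N : structure} {hN : ZF N} {val : M -> N}.
Hypothesis hG : generic_filter M c G.
Hypothesis hE : extension M c G N val.

Lemma it_val_Q : val Q = pr (pr (val q) (val l)) (val o).
Proof.
  apply is_triple_iff.
  apply (sat_fTriple N (fun k => val ((fun k => match k with 0 => Q | 1 => q | 2 => l | _ => o end) k)) 0 1 2 3).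
  apply (truth hc hG hE).
  - intros [|[|[|k]]]; auto using it_o_name; apply hi.
  - destruct (gf_inhabited hG) as [p Hp]. exists p. split; auto. apply hi. now apply (gf_cond hG).
Qed.

Lemma lef_truth s s' : is_name M c s -> is_name M c s' ->
  (pr (val s) (val s') ∈ val l <-> exists p, G p /\ lef c l p s s').
Proof.
  intros Hs Hs'. rewrite <- pair_in_iff.
  rewrite <- (sat_fPairIn N (fun k => val ((fun k => match k with 0 => s | 1 => s' | _ => l end) k)) 0 1 2).
  apply (truth hc hG hE). intros [|[|k]]; auto. apply hi.
Qed.
End IterationTruth.

Lemma lef_mono {M : structure} {hM : ZF M} {c l : M} (hc : is_poset M c) p p' s s' :
  le M c p p' -> lef c l p' s s' -> lef c l p s s'.
Proof. intros H. now apply (forces_mono hc). Qed.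

(** ** Facts forced by conditions, read off from the extensions of a countable model *)
Section IterationForced.
Context {M : structure} {hM : ZFC M} {c Q i q l o I L t : M}.
Hypothesis hcount : countable M.
Hypothesis hc : is_poset M c.
Hypothesis hi : iteration_data c Q i q l o I L t.
Hypothesis hQ : is_name M c Q.
Hypothesis hP : forced M c (fun _ => Q) (fPoset 0).

Lemma it_preorder {G : M -> Prop} {N : structure} {hN : ZF N} {val : M -> N} :
  generic_filter M c G -> extension M c G N val -> preorder (val q) (val l) (val o).
Proof.
  intros hG hE.
  apply (poset_of_triple (val Q) _ _ _ (it_val_Q hc hi hQ hG hE)).
  apply (truth hc hG hE (fPoset 0) (fun _ => Q)); auto.
  destruct (gf_inhabited hG) as [p Hp]. exists p. split; auto. apply hP. now apply (gf_cond hG).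
Qed.

Lemma forces_lef p s s' : cond M c p -> is_name M c s -> is_name M c s' ->
  (forall G N (hN : ZF N) (val : M -> N), generic_filter M c G -> G p -> extension M c G N val ->
     pr (val s) (val s') ∈ val l) -> lef c l p s s'.
Proof.
  intros Hp Hs Hs' H. apply (forces_by_extensions hc hcount); auto.
  - intros [|[|k]] _; auto. apply hi.
  - intros G N val HG HGp HE _. apply sat_fPairIn. pose proof (extension_ZF hc HG HE) as hN.
    apply pair_in_iff. eapply H; eauto.
Qed.

Lemma lef_refl p s : pr p s ∈ I -> lef c l p s s.
Proof.
  intros H. pose proof (it_I_name hi _ _ H) as Hs. apply (it_I_pair hi) in H as (Hp & _ & Hm).
  apply forces_lef; auto. intros G N hN val HG HGp HE.
  destruct (it_preorder HG HE) as (_ & _ & Hr & _). apply pair_in_iff, Hr.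
  apply (truth_mem hc HG HE); eauto. apply hi.
Qed.
Lemma lef_trans p s s' s'' : cond M c p -> is_name M c s -> is_name M c s' -> is_name M c s'' ->
  lef c l p s s' -> lef c l p s' s'' -> lef c l p s s''.
Proof.
  intros Hp Hs Hs' Hs'' H1 H2. apply forces_lef; auto. intros G N hN val HG HGp HE.
  destruct (it_preorder HG HE) as (Hl & _ & _ & Ht & _).
  assert (K1 : pr (val s) (val s') ∈ val l) by (apply (lef_truth hc hi HG HE); eauto).
  assert (K2 : pr (val s') (val s'') ∈ val l) by (apply (lef_truth hc hi HG HE); eauto).
  assert (K : forall a b, pr a b ∈ val l -> a ∈ val q /\ b ∈ val q).
  { intros a b Hab. destruct (Hl _ Hab) as (x & Hx & y & Hy & E).
    apply is_pair_iff, pr_inj in E as [-> ->]. auto. }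
  destruct (K _ _ K1), (K _ _ K2).
  apply pair_in_iff. apply (Ht _ H _ H0 _ H4); now apply pair_in_iff.
Qed.
Lemma lef_top p s : pr p s ∈ I -> lef c l p s o.
Proof.
  intros H. pose proof (it_I_name hi _ _ H) as Hs. apply (it_I_pair hi) in H as (Hp & _ & Hm).
  apply forces_lef; auto; [apply (it_o_name hi)|]. intros G N hN val HG HGp HE.
  destruct (it_preorder HG HE) as (_ & _ & _ & _ & Hr). apply pair_in_iff, Hr.
  apply (truth_mem hc HG HE); eauto. apply hi.
Qed.
Lemma lef_eq p s s' s'' : cond M c p -> is_name M c s -> lef c l p s s' -> forces_eq M c p s' s'' ->
  lef c l p s s''.
Proof.
  intros Hp Hs H He. destruct (feq_names _ _ _ He) as [Hs' Hs''].
  apply forces_lef; auto. intros G N hN val HG HGp HE.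
  assert (E : val s' = val s'') by (apply (ext_eq HE); eauto).
  rewrite <- E. apply (lef_truth hc hi HG HE); eauto.
Qed.
Lemma top_in_I p : cond M c p -> pr p o ∈ I.
Proof.
  intros Hp. apply (it_I_pair hi). split; auto. split; [apply hi|].
  apply (forces_by_extensions hc hcount p (Mem 0 1) (fun k => match k with 0 => o | _ => q end)); auto.
  - intros [|k] _; [apply (it_o_name hi)|apply hi].
  - intros G N val HG HGp HE _. cbn. pose proof (extension_ZF hc HG HE) as hN.
    exact (proj1 (proj2 (it_preorder HG HE))).
Qed.

Lemma iteration_poset : is_poset M i.
Proof.
  apply (poset_of_triple i I L t (it_i _ _ _ _ _ _ _ _ _ hi)).
  destruct (it_t _ _ _ _ _ _ _ _ _ hi) as (o1 & H1 & Et).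
  assert (Hmax : forall p, cond M c p -> le M c p o1).
  { intros p Hp. destruct (top_ex hc) as (o' & Ho' & _ & Hm).
    rewrite (top_unique hc o1 o'); auto. }
  assert (Ho1 : cond M c o1).
  { destruct (top_ex hc) as (o' & Ho' & Hc' & _). now rewrite (top_unique hc o1 o'). }
  assert (HI : forall w, w ∈ I -> exists p s, w = pr p s /\ cond M c p /\ is_name M c s).
  { intros w Hw. pose proof Hw as Hw'. apply (it_I _ _ _ _ _ _ _ _ _ hi) in Hw as (p & s & -> & Hp & _).
    exists p, s. repeat split; auto. exact (it_I_name hi _ _ Hw'). }
  split; [|split; [|split; [|split]]].
  - intros w Hw. apply (it_L _ _ _ _ _ _ _ _ _ hi) in Hw as (p & s & p' & s' & -> & H & H' & _).
    exists (pr p s). split; auto. exists (pr p' s'). split; auto. now apply is_pair_iff.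
  - rewrite Et. now apply top_in_I.
  - intros w Hw. destruct (HI w Hw) as (p & s & -> & Hp & Hs). apply pair_in_iff, (it_L_pair hi).
    repeat split; auto; [now apply le_refl|now apply lef_refl].
  - intros w1 H1' w2 H2' w3 H3' H12 H23.
    destruct (HI w1 H1') as (p1 & s1 & -> & Hp1 & Hs1), (HI w2 H2') as (p2 & s2 & -> & Hp2 & Hs2),
      (HI w3 H3') as (p3 & s3 & -> & Hp3 & Hs3).
    apply pair_in_iff, (it_L_pair hi) in H12 as (_ & _ & A1 & A2), H23 as (_ & _ & B1 & B2).
    apply pair_in_iff, (it_L_pair hi). repeat split; auto.
    + apply (le_trans hc _ p2); auto.
    + apply lef_trans with s2; auto. apply (lef_mono hc _ p2); auto.
  - intros w Hw. destruct (HI w Hw) as (p & s & -> & Hp & Hs). rewrite Et.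
    apply pair_in_iff, (it_L_pair hi).
    repeat split; auto; [now apply top_in_I|now apply lef_top].
Qed.
End IterationForced.

(** ** Existence of iterations *)
Section IterationExists.
Context {M : structure} {hM : ZFC M} {c : M}.
Hypothesis hcount : countable M.
Hypothesis hc : is_poset M c.
Local Notation name := (is_name M c).

(** Collect the names forced to belong to the component; names hereditarily in
    [Q] suffice, since the elements of the components lie in the transitive closure of the
    triple. *)
Lemma component_name Q psi : name Q -> (forall k, free k psi -> k < 2) ->
  (forall N (hN : ZF N) (a y : N), sat N (fun k => match k with 0 => a | _ => y end) psi -> y ∈ trcl a) ->
  exists q, name q /\ (forall G N (hN : ZF N) val, generic_filter M c G -> extension M c G N val ->
     forall y, y ∈ val q <-> sat N (fun k => match k with 0 => val Q | _ => y end) psi).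
Proof.
  intros HQ Hf Htr. destruct (closed_superset Q HQ) as (D & HtD & HD & Hcl).
  destruct (conditions_set hc) as [C HC].
  assert (Dp : def1 (fun w => exists pi r, w = pr pi r /\
    forces M c r (fun k => match k with 0 => Q | _ => pi end) psi)) by df.
  set (q := sep (prod D C) (fun w => exists pi r, w = pr pi r /\
    forces M c r (fun k => match k with 0 => Q | _ => pi end) psi)).
  assert (Hq : forall pi r, pr pi r ∈ q <-> pi ∈ D /\ cond M c r /\
    forces M c r (fun k => match k with 0 => Q | _ => pi end) psi).
  { intros pi r. unfold q. rewrite in_sep, pr_in_prod, <- HC by auto. split.
    - intros [? (pi' & r' & E & ?)]. apply pr_inj in E as [-> ->]. tauto.
    - intros (? & ? & ?). split; auto. exists pi, r. auto. }
  assert (Hqn : name q).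
  { apply name_intro. intros w Hw. pose proof Hw as Hw'. unfold q in Hw. apply in_sep in Hw as [Hw _]; auto.
    apply in_prod in Hw as (pi & r & H1 & H2 & ->). exists pi, r. repeat split; auto. now apply HC. }
  exists q. split; auto. intros G N hN val HG HE y.
  assert (Tr : forall pi, name pi -> (sat N (fun k => match k with 0 => val Q | _ => val pi end) psi <->
     exists r, G r /\ forces M c r (fun k => match k with 0 => Q | _ => pi end) psi)).
  { intros pi Hpi. rewrite <- (truth hc HG HE); [|intros [|k]; auto].
    apply sat_ext. intros [|k] _; auto. }
  assert (HB : forall y, y ∈ trcl (val Q) -> exists pi, pi ∈ D /\ y = val pi).
  { destruct (set_of_values hc HG HE D HD) as [B HB].
    intros y' Hy. apply HB. revert y' Hy. apply trcl_least.
    - intros u Hu v Hv. apply HB in Hu as (pi & Hpi & ->).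
      apply (val_mem HE) in Hv as (pi' & s & H & _ & ->); auto. apply HB. eauto.
    - intros u Hu. apply (val_mem HE) in Hu as (pi & s & H & _ & ->); auto. apply HB. eauto. }
  rewrite (val_mem HE) by auto. split.
  - intros (pi & r & H & HGr & ->). apply Hq in H as (Hpi & _ & H). apply Tr; eauto.
  - intros Hs. destruct (HB y (Htr N hN _ _ Hs)) as (pi & Hpi & ->). apply Tr in Hs as (r & Hr & Hs); auto.
    exists pi, r. repeat split; auto. apply Hq. repeat split; auto. now apply (gf_cond HG).
Qed.

Definition component (k : nat) : formula := Ex 2 (Ex 3 (Ex 4 (And (fTriple 0 2 3 4) (Mem 1 k)))).
Lemma sat_component (N : structure) (hN : ZF N) (a y : N) k : k = 2 \/ k = 3 \/ k = 4 ->
  (sat N (fun k => match k with 0 => a | _ => y end) (component k) <->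
   exists C l o, a = pr (pr C l) o /\ y ∈ match k with 2 => C | 3 => l | _ => o end).
Proof.
  intros Hk. unfold component.
  transitivity (exists C l o, is_triple a C l o /\ y ∈ match k with 2 => C | 3 => l | _ => o end).
  - apply iff_Ex. intros C. apply iff_Ex. intros l. apply iff_Ex. intros o. apply iff_And.
    + apply sat_fTriple.
    + destruct Hk as [->|[->| ->]]; cbn; tauto.
  - split; intros (C & l & o & E & H); exists C, l, o; split; auto; now apply is_triple_iff.
Qed.
Lemma component_free k n : k = 2 \/ k = 3 \/ k = 4 -> free n (component k) -> n < 2.
Proof. intros [->|[->| ->]]; unfold component; cbn; intuition lia. Qed.

Lemma component_trcl (N : structure) (hN : ZF N) (a y : N) k : k = 2 \/ k = 3 \/ k = 4 ->
  sat N (fun k => match k with 0 => a | _ => y end) (component k) -> y ∈ trcl a.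
Proof.
  intros Hk H. apply (proj1 (sat_component N hN a y k Hk)) in H as (C & l & o & -> & H).
  assert (P1 : forall x z w : N, pr x z ∈ trcl w -> x ∈ trcl w /\ z ∈ trcl w).
  { intros x z w Hw.
    assert (H1 : upair x z ∈ trcl w) by (apply (trcl_trans w _ Hw); apply in_upair; auto).
    split; apply (trcl_trans w _ H1); apply in_upair; auto. }
  assert (P2 : pr C l ∈ trcl (pr (pr C l) o) /\ o ∈ trcl (pr (pr C l) o)).
  { assert (H1 : upair (pr C l) o ∈ trcl (pr (pr C l) o)) by (apply trcl_sub; apply in_upair; auto).
    split; apply (trcl_trans _ _ H1); apply in_upair; auto. }
  destruct P2 as [P2 P3]. apply P1 in P2 as [P2 P4].
  destruct Hk as [->|[->| ->]]; [apply (trcl_trans _ _ P2)|apply (trcl_trans _ _ P4)|apply (trcl_trans _ _ P3)]; auto.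
Qed.

(** Names [q], [l], [o] of the components of the poset named by [Q] are found first.  The
    pair of [o] with the largest condition is added to [q], because the definition asks
    for [o] in the domain of [q]. *)
Theorem iteration_exists Q : name Q -> forced M c (fun _ => Q) (fPoset 0) ->
  exists i, is_iteration M c Q i.
Proof.
  intros HQ HP.
  destruct (component_name Q (component 2) HQ (fun n => component_free 2 n (or_introl eq_refl))
    (fun N hN a y => component_trcl N hN a y 2 (or_introl eq_refl))) as (q0 & Hq0 & Vq0).
  destruct (component_name Q (component 3) HQ (fun n => component_free 3 n (or_intror (or_introl eq_refl)))
    (fun N hN a y => component_trcl N hN a y 3 (or_intror (or_introl eq_refl)))) as (l & Hl & Vl).
  destruct (component_name Q (component 4) HQ (fun n => component_free 4 n (or_intror (or_intror eq_refl)))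
    (fun N hN a y => component_trcl N hN a y 4 (or_intror (or_intror eq_refl)))) as (o & Ho & Vo).
  set (q := cup q0 (sing (pr o (one c)))).
  assert (Hq : name q).
  { apply name_intro. intros w Hw. apply in_cup in Hw as [Hw|Hw]; [now apply (name_dom q0)|].
    apply in_sing in Hw. subst w. exists o, (one c). repeat split; auto. now apply one_cond. }
  assert (HT : forced M c (fun k => match k with 0 => Q | 1 => q | 2 => l | _ => o end) (fTriple 0 1 2 3)).
  { intros p Hp. apply (forces_by_extensions hc hcount); auto.
    - intros [|[|[|k]]] _; auto.
    - intros G N val HG HGp HE _. pose proof (extension_ZF hc HG HE) as hN.
      apply sat_fTriple. apply is_triple_iff.
      assert (HPN : is_poset N (val Q)).
      { apply (truth hc HG HE (fPoset 0) (fun _ => Q)); eauto. }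
      apply is_poset_iff in HPN as (C' & l' & o' & E & (_ & Ho' & _)). apply is_triple_iff in E.
      assert (U : forall C1 l1 o1, val Q = pr (pr C1 l1) o1 -> C1 = C' /\ l1 = l' /\ o1 = o').
      { intros C1 l1 o1 E1. rewrite E in E1. apply pr_inj in E1 as [E1 ->].
        apply pr_inj in E1 as [-> ->]. auto. }
      assert (E3 : val o = o').
      { apply ext. intros y. rewrite (Vo G N hN val HG HE), sat_component by auto. split.
        - intros (C1 & l1 & o1 & E1 & H). apply U in E1 as (-> & -> & ->). auto.
        - intros H. exists C', l', o'. auto. }
      assert (E2 : val l = l').
      { apply ext. intros y. rewrite (Vl G N hN val HG HE), sat_component by auto. split.
        - intros (C1 & l1 & o1 & E1 & H). apply U in E1 as (-> & -> & ->). auto.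
        - intros H. exists C', l', o'. auto. }
      assert (E1 : val q0 = C').
      { apply ext. intros y. rewrite (Vq0 G N hN val HG HE), sat_component by auto. split.
        - intros (C1 & l1 & o1 & E1 & H). apply U in E1 as (-> & -> & ->). auto.
        - intros H. exists C', l', o'. auto. }
      assert (E1' : val q = C').
      { apply ext. intros y. rewrite (val_mem HE), <- E1, (val_mem HE) by auto. split.
        - intros (pi & s & H & Hs & ->). apply in_cup in H as [H|H]; eauto.
          apply in_sing, pr_inj in H as [-> ->]. apply (val_mem HE); auto. now rewrite E1, E3.
        - intros (pi & s & H & Hs & ->). exists pi, s. repeat split; auto. apply in_cup; auto. }
      rewrite E1', E2, E3. exact E. }
  destruct (conditions_set hc) as [C HC].
  destruct (separation (fun w => exists p s, w = pr p s /\ cond M c p /\ (exists r, pr s r ∈ q) /\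
          forces_mem M c p s q) (prod C (union (union q)))) as [I HI]; [df|].
  destruct (separation (fun w => exists p s p' s', w = pr (pr p s) (pr p' s') /\ pr p s ∈ I /\
          pr p' s' ∈ I /\ le M c p p' /\ lef c l p s s') (prod I I)) as [L HL]; [unfold lef; df|].
  exists (pr (pr I L) (pr (one c) o)). apply iteration_unfold.
  exists q, l, o, I, L, (pr (one c) o). constructor; auto.
  - exists (one c). apply in_cup. right. now apply in_sing.
  - intros w. rewrite HI. split; [tauto|]. intros H; split; auto.
    destruct H as (p & s & -> & Hp & (r & Hr) & _). apply pr_in_prod. split; [now apply HC|].
    now apply pr_in_uu in Hr.
  - intros w. rewrite HL. split; [tauto|]. intros H; split; auto.
    destruct H as (p & s & p' & s' & -> & H1 & H2 & _). now apply pr_in_prod.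
  - exists (one c). split; auto. now apply one_top.
Qed.

(** [rho] follows [sigma] below [p0] and [tau] below the conditions incompatible with [p0]. *)
Lemma mixed_name p0 sigma tau : cond M c p0 -> name sigma -> name tau ->
  exists rho, name rho /\ forall G N (hN : ZF N) val, generic_filter M c G -> extension M c G N val ->
    (G p0 -> val rho = val sigma) /\ (~ G p0 -> val rho = val tau).
Proof.
  intros Hp0 Hs Ht. destruct (closed_superset sigma Hs) as (D1 & H1D & HD1 & Hcl1).
  destruct (closed_superset tau Ht) as (D2 & H2D & HD2 & Hcl2).
  destruct (conditions_set hc) as [C HC].
  set (P := fun w => exists pi r, w = pr pi r /\ ((le M c r p0 /\ forces_mem M c r pi sigma) \/
     ((~ exists u, le M c u r /\ le M c u p0) /\ forces_mem M c r pi tau))).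
  assert (DP : def1 P) by (unfold P; df).
  set (rho := sep (prod (cup D1 D2) C) P).
  assert (Hr : forall pi r, pr pi r ∈ rho <-> (pi ∈ D1 \/ pi ∈ D2) /\ cond M c r /\
    ((le M c r p0 /\ forces_mem M c r pi sigma) \/
     ((~ exists u, le M c u r /\ le M c u p0) /\ forces_mem M c r pi tau))).
  { intros pi r. unfold rho. rewrite in_sep, pr_in_prod, in_cup, <- HC by auto. split.
    - intros [? (pi' & r' & E & ?)]. apply pr_inj in E as [-> ->]. tauto.
    - intros (? & ? & ?). split; auto. exists pi, r. auto. }
  assert (HDn : forall pi, pi ∈ D1 \/ pi ∈ D2 -> name pi) by (intros pi [?|?]; auto).
  assert (Hrn : name rho).
  { apply name_intro. intros w Hw. pose proof Hw as Hw'. unfold rho in Hw. apply in_sep in Hw as [Hw _]; auto.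
    apply in_prod in Hw as (pi & r & H1 & H2 & ->). exists pi, r. apply in_cup in H1.
    repeat split; auto. now apply HC. }
  exists rho. split; auto. intros G N hN val HG HE. split; intros HGp; apply ext; intros y;
    rewrite (val_mem HE) by auto; split.
  - intros (pi & r & H & Hr' & ->). apply Hr in H as (Hpi & _ & [[H1 H2]|[H1 H2]]).
    + apply (truth_mem hc HG HE); eauto.
    + exfalso. apply H1. destruct (gf_dir HG r p0 Hr' HGp) as (u & _ & ? & ?). eauto.
  - intros Hy. pose proof Hy as Hy'. apply (val_mem HE) in Hy' as (pi & s & H1 & H2 & ->); auto.
    assert (Hpi : pi ∈ D1) by eauto.
    apply (truth_mem hc HG HE) in Hy as (p & Hp & Hm); auto.
    destruct (filter_common HG p p0 Hp HGp) as (r & Hr' & Hcr & Hrp & Hrp0).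
    exists pi, r. repeat split; auto. apply Hr. repeat split; auto. left. split; auto.
    apply (fmem_mono hc p); auto.
  - intros (pi & r & H & Hr' & ->). apply Hr in H as (Hpi & _ & [[H1 H2]|[H1 H2]]).
    + exfalso. apply HGp. apply (gf_up HG r); auto.
    + apply (truth_mem hc HG HE); eauto.
  - intros Hy. pose proof Hy as Hy'. apply (val_mem HE) in Hy' as (pi & s & H1 & H2 & ->); auto.
    assert (Hpi : pi ∈ D2) by eauto.
    apply (truth_mem hc HG HE) in Hy as (p & Hp & Hm); auto.
    destruct (generic_dense hc HG (fun r => le M c r p0 \/ ~ exists u, le M c u r /\ le M c u p0))
      as (r0 & Hr0 & [Hd|Hd]).
    + df.
    + intros r Hcr. destruct (classic (exists u, le M c u r /\ le M c u p0)) as [(u & ? & ?)|Nu].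
      * exists u. auto.
      * exists r. split; auto. now apply le_refl.
    + exfalso. apply HGp. apply (gf_up HG r0); auto.
    + destruct (filter_common HG p r0 Hp Hr0) as (r & Hr' & Hcr & Hrp & Hrp0).
      exists pi, r. repeat split; auto. apply Hr. repeat split; auto. right. split.
      * intros (u & H3 & H4). apply Hd. exists u. split; auto. apply (le_trans hc _ r); auto.
      * apply (fmem_mono hc p); auto.
Qed.
End IterationExists.

Lemma fPoset_of_fClass {M : structure} {hM : ZF M} {c : M} chi p nu :
  forces M c p nu (fClass chi 0) -> forces M c p nu (fPoset 0).
Proof. intros H. exact (proj1 H). Qed.

(** In this form a poset that a condition merely forces into the class can be iterated:
    the name is changed outside [p0] into one that is forced into the class outright. *)
Definition iterable (chi : formula) (M : structure) (c : M) : Prop :=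
  (exists T, is_name M c T /\ forced M c (fun _ => T) (fClass chi 0)) ->
  forall p0 Q0, cond M c p0 -> is_name M c Q0 -> forces M c p0 (fun _ => Q0) (fClass chi 0) ->
  exists Q i, is_name M c Q /\ forced M c (fun _ => Q) (fClass chi 0) /\
    forces_eq M c p0 Q Q0 /\ is_iteration M c Q i /\ is_poset M i.

Lemma free_fClass chi i x : (forall i, free i chi -> i = 0) -> free i (fClass chi x) -> i = x.
Proof.
  intros Hchi. unfold fClass. cbn [free]. cbv zeta. intros [H|H].
  - revert H. unfold fPoset. cbv zeta. cbn. intuition lia.
  - cbn in H. intuition. apply Hchi in H. lia.
Qed.

Lemma countable_iterable chi M (hM : ZFC M) c : (forall i, free i chi -> i = 0) ->
  countable M -> is_poset M c -> iterable chi M c.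
Proof.
  intros Hchi Hcount hc (T & HT & HTf) p0 Q0 Hp0 HQ0 HQf.
  destruct (mixed_name hc p0 Q0 T Hp0 HQ0 HT) as (Q & HQ & HV).
  assert (HQc : forced M c (fun _ => Q) (fClass chi 0)).
  { intros p Hp. apply (forces_by_extensions hc Hcount); auto.
    intros G N val HG HGp HE _. pose proof (extension_ZF hc HG HE) as hN.
    destruct (HV G N hN val HG HE) as [V1 V2]. destruct (classic (G p0)) as [H|H].
    - rewrite V1 by auto. apply (truth hc HG HE (fClass chi 0) (fun _ => Q0)); eauto.
    - rewrite V2 by auto. apply (truth hc HG HE (fClass chi 0) (fun _ => T)); eauto. }
  assert (HQp : forced M c (fun _ => Q) (fPoset 0)).
  { intros p Hp. eapply fPoset_of_fClass. apply HQc. auto. }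
  destruct (iteration_exists Hcount hc Q HQ HQp) as [i Hi].
  exists Q, i. split; auto. split; auto. split; [|split; auto].
  - apply (forces_by_extensions hc Hcount p0 (Eq 0 1) (fun k => match k with 0 => Q | _ => Q0 end)); auto.
    + intros [|k] _; auto.
    + intros G N val HG HGp HE _. pose proof (extension_ZF hc HG HE) as hN. cbn.
      now apply (HV G N hN val HG HE).
  - apply iteration_unfold in Hi as (q & l & o & I & L & t & Hi).
    exact (iteration_poset Hcount hc Hi HQ HQp).
Qed.

Theorem all_iterable chi M (hM : ZFC M) c : (forall i, free i chi -> i = 0) ->
  is_poset M c -> iterable chi M c.
Proof.
  intros Hchi hc.
  apply (countable_reduction (fun M e => is_poset M (e 0) -> iterable chi M (e 0))) with (e := fun _ => c); auto.
  - unfold uniform, iterable. dfn_tac.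
  - intros M' hM' Hcount e. now apply countable_iterable.
Qed.

(** ** An extension of an extension is an extension by the iteration *)

Section Compose.
Context {M N W : structure} {hM : ZFC M} {hN : ZFC N} {hW : ZFC W}.
Context {c Q i : M} {G : M -> Prop} {j1 : M -> N} {g : N} {R : N} {H : N -> Prop} {j2 : N -> W} {h : W}.
Hypothesis hc : is_poset M c.
Hypothesis hQ : is_name M c Q.
Hypothesis hi : is_iteration M c Q i.
Hypothesis hip : is_poset M i.
Hypothesis hG : generic_filter M c G.
Hypothesis hg : ground_of M c G N j1 g.
Hypothesis hRQ : R = value g (j1 Q).
Hypothesis hR : is_poset N R.
Hypothesis hH : generic_filter N R H.
Hypothesis hh : ground_of N R H W j2 h.

(** The filter for the iteration consists of the pairs [(p,s)] with [p] in the first filter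
    and the value of [s] in the second.  It meets a dense set because the values of the
    second components, over conditions of the first filter, are dense in the second
    poset. *)
Theorem compose_grounds : exists K k,
  generic_filter M i K /\ ground_of M i K W (fun x => j2 (j1 x)) k.
Proof.
  destruct (proj1 (iteration_unfold c Q i) hi) as (q & l & o & I & L & t & Hi).
  pose proof (ground_of_extension hc hG hg) as hE.
  set (val := fun tau => value g (j1 tau)) in *.
  assert (EQ : R = pr (pr (val q) (val l)) (val o)).
  { rewrite hRQ. exact (it_val_Q hc Hi hQ hG hE). }
  destruct (triple_data _ _ _ _ EQ) as (Rc & Rl & Rt).
  pose proof (it_q _ _ _ _ _ _ _ _ _ Hi) as Hq. pose proof (it_l _ _ _ _ _ _ _ _ _ Hi) as Hl.
  pose proof (it_I_pair Hi) as HI. pose proof (it_L_pair Hi) as HL.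
  pose proof (it_cond Hi) as Ic. pose proof (it_le Hi) as Il.
  assert (InQ : forall x, x ∈ val q -> exists s p, G p /\ pr p s ∈ I /\ x = val s /\ is_name M c s).
  { intros x Hx. pose proof Hx as Hx'. apply (val_mem hE) in Hx' as (s & r & Hs & Hr & ->); auto.
    assert (Hsn : is_name M c s) by exact (proj1 (name_pair _ _ _ Hq Hs)).
    apply (truth_mem hc hG hE) in Hx as (p & Hp & Hm); auto.
    exists s, p. repeat split; auto. apply HI. repeat split; eauto. now apply (gf_cond hG). }
  set (K := fun x => exists p s, x = pr p s /\ x ∈ I /\ G p /\ H (val s)).
  assert (HK : forall p s, K (pr p s) <-> pr p s ∈ I /\ G p /\ H (val s)).
  { intros p s. split.
    - intros (p' & s' & E & H1 & H2 & H3). apply pr_inj in E as [-> ->]. auto.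
    - intros (H1 & H2 & H3). exists p, s. auto. }
  assert (Iform : forall w, w ∈ I -> exists p s, w = pr p s).
  { intros w Hw. apply (it_I _ _ _ _ _ _ _ _ _ Hi) in Hw as (p & s & -> & _). eauto. }
  assert (hK : generic_filter M i K).
  { constructor.
    - intros w (p & s & _ & Hw & _). now apply Ic.
    - destruct (gf_inhabited hH) as [x Hx]. pose proof (gf_cond hH x Hx) as Hx'.
      apply Rc, InQ in Hx' as (s & p & Hp & Hps & -> & _). exists (pr p s). now apply HK.
    - intros w w' (p & s & -> & Hw & Hp & Hs) Hle. apply Il in Hle.
      pose proof Hle as Hle'. apply (it_L _ _ _ _ _ _ _ _ _ Hi) in Hle' as (p1 & s1 & p' & s' & E & _ & Hw' & H1 & H2).
      apply pr_inj in E as [E ->]. apply pr_inj in E as [<- <-]. apply HK. split; auto.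
      split; [exact (gf_up hG p p' Hp H1)|]. apply (gf_up hH (val s)); auto. apply Rl.
      apply (lef_truth hc Hi hG hE); [exact (it_I_name Hi _ _ Hw)|exact (it_I_name Hi _ _ Hw')|eauto].
    - intros w w' (p & s & -> & Hw & Hp & Hs) (p' & s' & -> & Hw' & Hp' & Hs').
      destruct (gf_dir hH _ _ Hs Hs') as (x & Hx & Hx1 & Hx2).
      pose proof (gf_cond hH x Hx) as Hx'. apply Rc, InQ in Hx' as (u & r & Hr & Hru & -> & Hun).
      pose proof (it_I_name Hi _ _ Hw) as Hsn. pose proof (it_I_name Hi _ _ Hw') as Hsn'.
      apply Rl, (lef_truth hc Hi hG hE) in Hx1 as (p1 & Hp1 & Hf1); auto.
      apply Rl, (lef_truth hc Hi hG hE) in Hx2 as (p2 & Hp2 & Hf2); auto.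
      destruct (filter_common hG p p' Hp Hp') as (a1 & Ha1 & _ & ? & ?).
      destruct (filter_common hG p1 p2 Hp1 Hp2) as (a2 & Ha2 & _ & ? & ?).
      destruct (filter_common hG a1 a2 Ha1 Ha2) as (a3 & Ha3 & _ & ? & ?).
      destruct (filter_common hG a3 r Ha3 Hr) as (a & Ha & Hca & ? & ?).
      assert (Hau : pr a u ∈ I).
      { apply HI in Hru as (_ & Hu1 & Hu2). apply HI. repeat split; auto. apply (fmem_mono hc r); auto. }
      assert (L1 : le M c a a1) by (apply (le_trans hc _ a3); auto).
      assert (L2 : le M c a a2) by (apply (le_trans hc _ a3); auto).
      exists (pr a u). split; [now apply HK|]. split; apply Il, HL; repeat split; auto.
      + apply (le_trans hc _ a1); auto.
      + apply (lef_mono hc _ p1); auto. apply (le_trans hc _ a2); auto.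
      + apply (le_trans hc _ a1); auto.
      + apply (lef_mono hc _ p2); auto. apply (le_trans hc _ a2); auto.
    - intros D HD Hd.
      (* the values of the second components of members of [D] over the first filter are
         dense in the second poset *)
      destruct (generic_dense hR hH (fun x => exists p s, pr (j1 p) (j1 s) ∈ j1 D /\ (j1 p) ∈ g /\ x = value g (j1 s)))
        as (x & Hx & p & s & H1 & H2 & ->).
      + apply dfn_iff with (fun _ e => exists p s, pr p s ∈ j1 D /\ p ∈ g /\ e 0 = value g s); [|df].
        intros _ e. split.
        * intros (p & s & H1 & H2 & E). apply (te_pr_in_inv (go_emb hg)) in H1 as (p' & s' & -> & -> & H1).
          exists p', s'. now rewrite (te_pr_in (go_emb hg)).
        * intros (p & s & H1 & H2 & E). exists (j1 p), (j1 s). auto.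
      + intros x Hx. apply Rc, InQ in Hx as (s & p & Hp & Hps & -> & Hsn).
        destruct (generic_dense_below hc hG (fun r => exists s', pr r s' ∈ D /\ lef c l r s' s) p)
          as (r & Hr & Hrp & s' & Hrs & Hf); auto.
        * unfold lef. df.
        * intros r Hr. assert (Hrs : pr r s ∈ I).
          { apply HI in Hps as (_ & Hu1 & Hu2). apply HI. repeat split; auto;
            [now apply (le_cond hc) in Hr|apply (fmem_mono hc p); auto]. }
          destruct (Hd (pr r s)) as (w & Hw & Hwle); [now apply Ic|].
          apply Il in Hwle. pose proof Hwle as Hwle'.
          apply (it_L _ _ _ _ _ _ _ _ _ Hi) in Hwle' as (r' & s' & r1 & s1 & E & _ & _ & A & B).
          apply pr_inj in E as [-> E]. apply pr_inj in E as [<- <-].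
          exists r'. split; auto. exists s'. auto.
        * assert (Hs'n : is_name M c s').
          { apply (it_I_name Hi r). apply Ic. auto. }
          exists (val s'). split.
          { apply Rl, (lef_truth hc Hi hG hE); eauto. }
          exists r, s'. rewrite (te_pr_in (go_emb hg)), (in_trace (go_emb hg) (go_filter hg)). auto.
      + exists (pr p s). rewrite (te_pr_in (go_emb hg)) in H1. split; auto.
        apply HK. rewrite (in_trace (go_emb hg) (go_filter hg)) in H2. repeat split; auto.
        apply Ic. auto. }
  set (j := fun x => j2 (j1 x)).
  pose proof (compose_embedding _ _ _ _ _ (go_emb hg) (go_emb hh)) as hj. fold j in hj.
  assert (Ev : forall x, value (j2 g) (j x) = j2 (val x)).
  { intros x. unfold j, val. now rewrite (te_value (go_emb hh)). }
  assert (Hin : forall x, j2 x ∈ h <-> H x).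
  { intros x. apply (in_trace (go_emb hh) (go_filter hh)). }
  set (P := fun w => exists p s, w = pr p s /\ p ∈ j2 g /\ value (j2 g) s ∈ h).
  assert (DP : def1 P) by (unfold P; df).
  set (k := sep (j I) P).
  assert (Hk : forall x, x ∈ k <-> exists w, K w /\ x = j w).
  { intros x. unfold k. rewrite in_sep by auto. split.
    - intros [Hx (p & s & -> & Hp & Hs)]. apply (te_pr_in_inv hj) in Hx as (p' & s' & -> & -> & Hps).
      exists (pr p' s'). rewrite (te_pr hj). split; auto. apply HK.
      rewrite Ev, Hin in Hs. unfold j in Hp. rewrite (te_mem (go_emb hh)), (in_trace (go_emb hg) (go_filter hg)) in Hp.
      auto.
    - intros (w & (p & s & -> & Hps & Hp & Hs) & ->). split; [now apply (te_mem hj)|].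
      exists (j p), (j s). rewrite (te_pr hj), Ev, Hin. split; auto. split; auto.
      apply (te_mem (go_emb hh)). now apply (in_trace (go_emb hg) (go_filter hg)). }
  exists K, k. split; auto. constructor; auto.
  (* the submodel generated by [k] contains both filters, hence everything *)
  pose proof (generated_ZFC hj hip hK Hk) as hX.
  pose proof (generated_embedding (c := i) hj Hk) as hx.
  destruct (generated_ground hj hip hK Hk) as (jX & kX & hgX & EjX & EkX).
  set (X := generated j i k) in *.
  (* the first filter consists of the first components of [k] *)
  assert (Xg : exists a : sub W X, proj1_sig a = j2 g).
  { assert (Da : def1 (fun x : sub W X => exists s, pr x s ∈ kX)) by df.
    exists (sep (union (union kX)) (fun x : sub W X => exists s, pr x s ∈ kX)).
    assert (Tk : forall (x s : sub W X), pr x s ∈ kX <-> pr (proj1_sig x) (proj1_sig s) ∈ k).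
    { intros x s. rewrite <- EkX. symmetry. apply (te_pr_in hx). }
    apply ext. intros x. rewrite (te_in hx). split.
    - intros (x' & Hx & ->). apply in_sep in Hx as [_ [s Hs]]; auto. apply Tk, Hk in Hs as (w & (p & s' & -> & _ & Hp & _) & E).
      rewrite (te_pr hj) in E. apply pr_inj in E as [-> _]. apply (te_mem (go_emb hh)).
      now apply (in_trace (go_emb hg) (go_filter hg)).
    - intros Hx. apply (te_in (go_emb hh)) in Hx as (y & Hy & ->). apply (go_filter hg) in Hy as (p & Hp & ->).
      assert (Ht1 : t ∈ I).
      { pose proof (proj1 (poset_of_triple _ _ _ _ (it_i _ _ _ _ _ _ _ _ _ Hi)) hip) as (_ & Ht1 & _). exact Ht1. }
      destruct (it_t _ _ _ _ _ _ _ _ _ Hi) as (o1 & Ho1 & Et). rewrite Et in Ht1.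
      apply HI in Ht1 as (Hc1 & H1 & H2).
      assert (Hpo : pr p o ∈ I).
      { apply HI. repeat split; auto; [now apply (gf_cond hG)|]. apply (fmem_mono hc o1); auto.
        destruct (top_ex hc) as (o2 & Ho2 & _ & Hm). rewrite (top_unique hc o1 o2) by auto.
        apply Hm. now apply (gf_cond hG). }
      assert (HKp : K (pr p o)).
      { apply HK. repeat split; auto. apply (top_in_filter hR hH). now apply Rt. }
      assert (Hs : pr (jX p) (jX o) ∈ kX).
      { apply Tk. rewrite !EjX. apply Hk. exists (pr p o). split; auto. now rewrite (te_pr hj). }
      exists (jX p). split; [|now rewrite EjX]. apply in_sep; auto. split; eauto.
      now apply pr_in_uu in Hs. }
  destruct Xg as [a Ea].
  assert (XN : forall y : N, exists b : sub W X, proj1_sig b = j2 y).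
  { intros y. destruct (go_values hg y) as (tau & _ & <-). exists (value a (jX tau)).
    rewrite (te_value hx), Ea, EjX. exact (Ev tau). }
  (* the second filter consists of the values of the second components *)
  assert (Xh : exists b : sub W X, proj1_sig b = h).
  { destruct (replacement (fun s v : sub W X => v = value a s /\ exists p, pr p s ∈ kX) (union (union kX)))
      as [b Hb]; [df|intros u v v' _ [-> _] [-> _]; auto|].
    assert (Tk : forall (x s : sub W X), pr x s ∈ kX <-> pr (proj1_sig x) (proj1_sig s) ∈ k).
    { intros x s. rewrite <- EkX. symmetry. apply (te_pr_in hx). }
    exists b. apply ext. intros x. rewrite (te_in hx). split.
    - intros (v & Hv & ->). apply Hb in Hv as (s & _ & -> & p & Hp). apply Tk, Hk in Hp as (w & (p' & s' & -> & _ & _ & Hs) & E).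
      rewrite (te_pr hj) in E. apply pr_inj in E as [_ E]. rewrite (te_value hx), Ea, E, Ev. now apply Hin.
    - intros Hx. apply (go_filter hh) in Hx as (y & Hy & ->). pose proof (gf_cond hH y Hy) as Hy'.
      apply Rc, InQ in Hy' as (s & p & Hp & Hps & -> & Hsn).
      assert (Hs : pr (jX p) (jX s) ∈ kX).
      { apply Tk. rewrite !EjX. apply Hk. exists (pr p s). split; [now apply HK|]. now rewrite (te_pr hj). }
      exists (value a (jX s)). rewrite (te_value hx), Ea, EjX, Ev. split; auto.
      apply Hb. exists (jX s). split; [now apply pr_in_uu in Hs|]. eauto. }
  destruct Xh as [b Eb].
  intros x. destruct (go_values hh x) as (tau & _ & <-). destruct (XN tau) as [tau' Et].
  assert (Xx : X (value h (j2 tau))).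
  { rewrite <- Eb, <- Et, <- (te_value hx). exact (proj2_sig (value b tau')). }
  destruct Xx as (sigma & Hs & E). exists sigma. split; auto.
Qed.
End Compose.

Definition fDense : formula := All 3 (Imp (Mem 3 1) (Ex 4 (And (Mem 4 0) (fPairIn 4 3 2)))).
Lemma sat_fDense (N : structure) (e : nat -> N) : sat N e fDense <->
  forall x, x ∈ e 1 -> exists y, y ∈ e 0 /\ pair_in y x (e 2).
Proof. unfold fDense. sat_tac. Qed.

Section Decompose.
Context {M W : structure} {hM : ZFC M} {hW : ZFC W}.
Context {c Q i : M} {K : M -> Prop} {j : M -> W} {k : W}.
Hypothesis hcount : countable M.
Hypothesis hc : is_poset M c.
Hypothesis hQ : is_name M c Q.
Hypothesis hP : forced M c (fun _ => Q) (fPoset 0).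
Hypothesis hi : is_iteration M c Q i.
Hypothesis hK : generic_filter M i K.
Hypothesis hk : ground_of M i K W j k.

(** In an extension by a filter containing [p] there is an element of the dense set below
    the value of [s]; some condition of the filter forces this, for a name [u] in the
    domain of [q]. *)
Lemma dense_below_iteration q l o I L t eps p0 : iteration_data c Q i q l o I L t ->
  is_name M c eps ->
  forces M c p0 (fun k => match k with 0 => eps | 1 => q | _ => l end)
    fDense ->
  forall p s, le M c p p0 -> pr p s ∈ I ->
    exists r u, le M c r p /\ pr r u ∈ I /\ lef c l r u s /\ forces_mem M c r u eps.
Proof.
  intros Hi He Hf p s Hp Hps.
  pose proof (it_I_pair Hi) as HI. pose proof Hps as Hps'. apply HI in Hps' as (Hcp & _ & Hm).
  pose proof (it_I_name Hi _ _ Hps) as Hs.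
  pose proof (it_q _ _ _ _ _ _ _ _ _ Hi) as Hq. pose proof (it_l _ _ _ _ _ _ _ _ _ Hi) as Hl.
  destruct (generic_exists hc hcount p Hcp) as (G & HG & HGp).
  assert (HX : exists (N : structure) (val : M -> N), extension M c G N val).
  { exists (quotient c G), (quotient_val c G). exact (quotient_extension c G hc HG). }
  destruct HX as (N & val & hE).
  pose proof (extension_ZF hc HG hE) as hN.
  destruct (it_preorder hc Hi hQ hP HG hE) as (Hlq & _).
  assert (Hsat : sat N (fun n => val ((fun k => match k with 0 => eps | 1 => q | _ => l end) n))
    fDense).
  { apply (truth hc HG hE); [intros [|[|n]]; auto|]. exists p0. split; auto. exact (gf_up HG p p0 HGp Hp). }
  assert (Hd : forall x, x ∈ val q -> exists y, y ∈ val eps /\ pair_in y x (val l)).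
  { exact (proj1 (sat_fDense N _) Hsat). }
  destruct (Hd (val s)) as (y & Hy & Hys); [apply (truth_mem hc HG hE); eauto|].
  apply pair_in_iff in Hys.
  assert (Hyq : y ∈ val q).
  { destruct (Hlq _ Hys) as (a & Ha & b & Hb & E). apply is_pair_iff, pr_inj in E as [-> _]. auto. }
  pose proof Hyq as Hyq'. apply (val_mem hE) in Hyq' as (u & r1 & Hu & Hr1 & ->); auto.
  assert (Hun : is_name M c u) by exact (proj1 (name_pair _ _ _ Hq Hu)).
  apply (truth_mem hc HG hE) in Hyq as (p1 & Hp1 & Hm1); auto.
  apply (truth_mem hc HG hE) in Hy as (p2 & Hp2 & Hm2); auto.
  apply (lef_truth hc Hi HG hE) in Hys as (p3 & Hp3 & Hm3); auto.
  destruct (filter_common HG p1 p2 Hp1 Hp2) as (a & Ha & _ & A1 & A2).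
  destruct (filter_common HG a p3 Ha Hp3) as (b & Hb & _ & B1 & B2).
  destruct (filter_common HG b p Hb HGp) as (r & Hr & Hcr & C1 & C2).
  assert (L1 : le M c r a) by exact (le_trans hc _ _ _ C1 B1).
  exists r, u. split; auto. split; [|split].
  - apply HI. split; auto. split; [eauto|]. exact (fmem_mono hc p1 _ _ _ (le_trans hc _ _ _ L1 A1) Hm1).
  - exact (lef_mono hc r p3 _ _ (le_trans hc _ _ _ C1 B2) Hm3).
  - exact (fmem_mono hc p2 _ _ _ (le_trans hc _ _ _ L1 A2) Hm2).
Qed.

(** The first filter consists of the first components of the filter [K], the second of the
    values of the second components. *)
Theorem decompose_ground : exists (N : structure) (hN : ZFC N) G jN gN H (e : N -> W) h,
  generic_filter M c G /\ ground_of M c G N jN gN /\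
  is_poset N (value gN (jN Q)) /\
  generic_filter N (value gN (jN Q)) H /\ ground_of N (value gN (jN Q)) H W e h /\
  forall x, e (jN x) = j x.
Proof.
  destruct (proj1 (iteration_unfold c Q i) hi) as (q & l & o & I & L & t & Hi).
  pose proof (iteration_poset hcount hc Hi hQ hP) as hip.
  pose proof (it_q _ _ _ _ _ _ _ _ _ Hi) as Hq. pose proof (it_l _ _ _ _ _ _ _ _ _ Hi) as Hl.
  pose proof (it_I_pair Hi) as HI. pose proof (it_L_pair Hi) as HL.
  pose proof (it_cond Hi) as Ic. pose proof (it_le Hi) as Il.
  pose proof (it_I_name Hi) as In. pose proof (go_emb hk) as hj.
  assert (KI : forall w, K w -> exists p s, w = pr p s /\ w ∈ I).
  { intros w Hw. pose proof (gf_cond hK w Hw) as Hw'. apply Ic in Hw'. pose proof Hw' as Hw2.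
    apply (it_I _ _ _ _ _ _ _ _ _ Hi) in Hw2 as (p & s & -> & _). eauto. }
  assert (KL : forall p s r u, K (pr r u) -> pr p s ∈ I -> le M c r p -> lef c l r u s -> K (pr p s)).
  { intros p s r u Hk Hps Hle Hf. apply (gf_up hK (pr r u)); auto. apply Il, HL.
    split; [|auto]. apply Ic. now apply (gf_cond hK). }
  assert (KD : forall p s p' s', K (pr p s) -> K (pr p' s') -> exists r u, K (pr r u) /\ cond M c r /\
     le M c r p /\ lef c l r u s /\ le M c r p' /\ lef c l r u s').
  { intros p s p' s' H1 H2. destruct (gf_dir hK _ _ H1 H2) as (w & Hw & A & B).
    destruct (KI w Hw) as (r & u & -> & Hru). apply Il, HL in A as (_ & _ & A1 & A2), B as (_ & _ & B1 & B2).
    exists r, u. repeat split; auto. now apply (le_cond hc) in A1. }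
  set (G := fun p => exists s, K (pr p s)).
  assert (Gtop : forall p, G p -> K (pr p o)).
  { intros p [s Hs]. assert (Hps : pr p s ∈ I) by (apply Ic; now apply (gf_cond hK)).
    assert (Hcp : cond M c p) by now apply HI in Hps.
    apply (KL p o p s); auto.
    - exact (top_in_I hcount hc Hi hQ hP p Hcp).
    - now apply le_refl.
    - exact (lef_top hcount hc Hi hQ hP p s Hps). }
  assert (hG : generic_filter M c G).
  { constructor.
    - intros p [s Hs]. assert (Hps : pr p s ∈ I) by (apply Ic; now apply (gf_cond hK)). now apply HI in Hps.
    - destruct (gf_inhabited hK) as [w Hw]. destruct (KI w Hw) as (p & s & -> & _). exists p, s. auto.
    - intros p p' Hp Hle. exists o. pose proof (Gtop p Hp) as Hpo.
      assert (Hps : pr p o ∈ I) by (apply Ic; now apply (gf_cond hK)).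
      apply (KL p' o p o); auto.
      + apply (top_in_I hcount hc Hi hQ hP). now apply (le_cond hc) in Hle.
      + exact (lef_refl hcount hc Hi hQ hP p o Hps).
    - intros p p' [s Hs] [s' Hs']. destruct (KD _ _ _ _ Hs Hs') as (r & u & Hr & _ & A & _ & B & _).
      exists r. split; [exists u; auto|auto].
    - intros D HD Hd.
      destruct (generic_dense hip hK (fun w => exists p s, w = pr p s /\ p ∈ D)) as (w & Hw & p & s & -> & Hp); [df| |].
      + intros w Hw. apply Ic in Hw. pose proof Hw as Hw'.
        apply (it_I _ _ _ _ _ _ _ _ _ Hi) in Hw' as (p & s & -> & Hp & (r & Hr) & Hm).
        destruct (Hd p Hp) as (p' & Hp' & Hle). assert (Hcp' : cond M c p') by now apply (le_cond hc) in Hle.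
        assert (Hp's : pr p' s ∈ I) by (apply HI; repeat split; eauto; exact (fmem_mono hc p _ _ _ Hle Hm)).
        exists (pr p' s). split; [|eauto]. apply Il, HL. repeat split; auto.
        exact (lef_refl hcount hc Hi hQ hP p' s Hp's).
      + exists p. split; auto. exists s. auto. }
  assert (Tk : forall p s, pr (j p) (j s) ∈ k <-> K (pr p s)).
  { intros p s. rewrite <- (te_pr hj). exact (in_trace hj (go_filter hk) (pr p s)). }
  assert (Tk' : forall x y, pr x y ∈ k -> exists p s, x = j p /\ y = j s /\ K (pr p s)).
  { intros x y H. apply (go_filter hk) in H as (w & Hw & E). destruct (KI w Hw) as (p & s & -> & _).
    rewrite (te_pr hj) in E. apply pr_inj in E as [-> ->]. eauto. }
  assert (Dg : def1 (fun x : W => exists s, pr x s ∈ k)) by df.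
  set (g := sep (union (union k)) (fun x : W => exists s, pr x s ∈ k)).
  assert (hg : forall x, x ∈ g <-> exists p, G p /\ x = j p).
  { intros x. unfold g. rewrite in_sep by auto. split.
    - intros [_ [s Hs]]. apply Tk' in Hs as (p & s' & -> & -> & H). exists p. split; auto. exists s'. auto.
    - intros (p & [s Hs] & ->). apply Tk in Hs. split; [now apply pr_in_uu in Hs|eauto]. }
  pose proof (generated_ZFC hj hc hG hg) as hN.
  pose proof (generated_embedding (c := c) hj hg) as he.
  destruct (generated_ground hj hc hG hg) as (jN & gN & hgN & EjN & EgN).
  set (N := sub W (generated j c g)) in *. set (e := fun x : N => proj1_sig x) in *.
  pose proof (ground_of_extension hc hG hgN) as hE. set (val := fun tau => value gN (jN tau)) in *.
  assert (hT : forced M c (fun _ => Q) (fPoset 0)) by exact hP.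
  assert (hR : is_poset N (val Q)).
  { apply (truth hc hG hE (fPoset 0) (fun _ => Q)); auto.
    destruct (gf_inhabited hG) as [p Hp]. exists p. split; auto. apply hP. now apply (gf_cond hG). }
  pose proof (it_val_Q hc Hi hQ hG hE) as EQ.
  destruct (triple_data _ _ _ _ EQ) as (Rc & Rl & Rt).
  pose proof (it_preorder hc Hi hQ hP hG hE) as (Pl & _).
  assert (Ev : forall s, e (val s) = value g (j s)).
  { intros s. unfold val. rewrite (te_value he). now rewrite EgN, EjN. }
  assert (GK : forall p, G p -> exists s, K (pr p s)) by auto.
  set (H := fun x => exists p s, K (pr p s) /\ x = val s).
  assert (KG : forall p s, K (pr p s) -> G p) by (intros p s Hps; exists s; auto).
  assert (Kin : forall p s, K (pr p s) -> pr p s ∈ I) by (intros p s Hps; apply Ic; now apply (gf_cond hK)).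
  assert (hH : generic_filter N (val Q) H).
  { constructor.
    - intros x (p & s & Hps & ->). apply Rc. pose proof (Kin _ _ Hps) as Hi'.
      pose proof (In _ _ Hi') as Hs. apply HI in Hi' as (_ & _ & Hm).
      apply (truth_mem hc hG hE); eauto.
    - destruct (gf_inhabited hK) as [w Hw]. destruct (KI w Hw) as (p & s & -> & _). exists (val s), p, s. auto.
    - intros x y (p & s & Hps & ->) Hle. apply Rl in Hle.
      assert (Hy : y ∈ val q).
      { destruct (Pl _ Hle) as (a & Ha & b & Hb & E). apply is_pair_iff, pr_inj in E as [_ ->]. auto. }
      pose proof Hy as Hy'. apply (val_mem hE) in Hy' as (s' & r' & Hs' & Hr' & ->); auto.
      assert (Hs'n : is_name M c s') by exact (proj1 (name_pair _ _ _ Hq Hs')).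
      pose proof (In _ _ (Kin _ _ Hps)) as Hsn.
      apply (truth_mem hc hG hE) in Hy as (p1 & [t1 Hp1] & Hm1); auto.
      apply (lef_truth hc Hi hG hE) in Hle as (p2 & [t2 Hp2] & Hm2); auto.
      destruct (KD _ _ _ _ Hp1 Hp2) as (a & u1 & Ha & _ & A1 & _ & A2 & _).
      destruct (KD _ _ _ _ Ha Hps) as (r & u & Hr & Hcr & B1 & _ & B2 & B3).
      assert (Hrs' : pr r s' ∈ I).
      { apply HI. split; auto. split; [eauto|].
        exact (fmem_mono hc p1 _ _ _ (le_trans hc _ _ _ B1 A1) Hm1). }
      exists r, s'. split; auto. apply (KL r s' r u); auto; [now apply le_refl|].
      apply (lef_trans hcount hc Hi hQ hP r u s s'); auto.
      + exact (In _ _ (Kin _ _ Hr)).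
      + exact (lef_mono hc r p2 _ _ (le_trans hc _ _ _ B1 A2) Hm2).
    - intros x y (p & s & Hps & ->) (p' & s' & Hps' & ->).
      destruct (KD _ _ _ _ Hps Hps') as (r & u & Hr & Hcr & A1 & A2 & B1 & B2).
      pose proof (In _ _ (Kin _ _ Hr)). pose proof (In _ _ (Kin _ _ Hps)). pose proof (In _ _ (Kin _ _ Hps')).
      exists (val u). split; [exists r, u; auto|].
      split; apply Rl, (lef_truth hc Hi hG hE); eauto.
    - intros E HE Hd. destruct (ext_surj hE E) as (eps & Heps & <-).
      assert (Hsat : sat N (fun n => val ((fun k => match k with 0 => eps | 1 => q | _ => l end) n))
        fDense).
      { assert (Hd' : forall x, x ∈ val q -> exists y, y ∈ val eps /\ pair_in y x (val l)).
        { intros x Hx. apply Rc in Hx. destruct (Hd x Hx) as (y & Hy & Hle). exists y. split; auto.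
          now apply pair_in_iff, Rl. }
        exact (proj2 (sat_fDense N _) Hd'). }
      apply (truth hc hG hE) in Hsat as (p0 & Hp0 & Hf); [|intros [|[|n]]; auto].
      pose proof (Gtop p0 Hp0) as Hw0.
      destruct (generic_dense_below hip hK (fun w => exists p s, w = pr p s /\ forces_mem M c p s eps)
        (pr p0 o)) as (w & Hw & _ & p & s & -> & Hm); auto.
      + df.
      + intros w Hw. apply Il in Hw. pose proof Hw as Hw'.
        apply (it_L _ _ _ _ _ _ _ _ _ Hi) in Hw' as (p & s & p1 & s1 & E & Hps & _ & Hle & _).
        apply pr_inj in E as [-> E]. apply pr_inj in E as [<- <-].
        destruct (dense_below_iteration q l o I L t eps p0 Hi Heps Hf p s Hle Hps) as (r & u & A & B & C & D).
        exists (pr r u). split; [|eauto]. apply Il, HL. auto.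
      + exists (val s). split; [|exists p, s; auto].
        apply (truth_mem hc hG hE); eauto. }
  assert (Hh : exists h, forall x, x ∈ h <-> exists y, H y /\ x = e y).
  { destruct (replacement (fun s v : W => v = value g s /\ exists p, pr p s ∈ k) (union (union k)))
      as [h Hh]; [df|intros u v v' _ [-> _] [-> _]; auto|].
    exists h. intros x. rewrite Hh. split.
    - intros (s & _ & -> & p & Hp). apply Tk' in Hp as (p' & s' & -> & -> & Hp).
      exists (val s'). split; [exists p', s'; auto|]. now rewrite Ev.
    - intros (y & (p & s & Hps & ->) & ->). apply Tk in Hps. exists (j s).
      split; [now apply pr_in_uu in Hps|]. split; [now rewrite Ev|eauto]. }
  destruct Hh as [h hh].
  exists N, hN, G, jN, gN, H, e, h. split; auto. split; auto. split; auto. split; auto.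
  split; [|exact EjN].
  constructor; auto.
  (* the submodel generated by [h] over [N] contains [K], hence everything *)
  pose proof (generated_ZFC he hR hH hh) as hX.
  pose proof (generated_embedding (c := val Q) he hh) as hx.
  destruct (generated_ground he hR hH hh) as (jX & hX' & hgX & EjX & EhX).
  set (X := generated e (val Q) h) in *.
  assert (EjX' : forall x, proj1_sig (jX (jN x)) = j x).
  { intros x. rewrite EjX. apply EjN. }
  assert (Egx : proj1_sig (jX gN) = g) by (rewrite EjX; exact EgN).
  (* [K] is recovered from the two filters *)
  assert (Kchar : forall p s, K (pr p s) <-> pr p s ∈ I /\ G p /\ H (val s)).
  { intros p s. split.
    - intros Hps. repeat split; eauto. exists p, s. auto.
    - intros (Hps & [t1 Hp] & (p' & s' & Hp's' & E)).
      pose proof (In _ _ Hps) as Hsn. pose proof (In _ _ (Kin _ _ Hp's')) as Hs'n.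
      apply (ext_eq hE) in E as (r0 & [t0 Hr0] & Hf); auto.
      destruct (KD _ _ _ _ Hp Hr0) as (a & u1 & Ha & _ & A1 & _ & A2 & _).
      destruct (KD _ _ _ _ Ha Hp's') as (r & u & Hr & Hcr & B1 & _ & B2 & B3).
      apply (KL p s r u); auto; [exact (le_trans hc _ _ _ B1 A1)|].
      apply (lef_eq hcount hc Hi r u s' s); auto.
      + exact (In _ _ (Kin _ _ Hr)).
      + apply feq_sym; auto. exact (feq_mono hc r0 _ _ _ (le_trans hc _ _ _ B1 A2) Hf). }
  assert (Xk : exists b : sub W X, proj1_sig b = k).
  { assert (Db : def1 (fun w : sub W X => exists p s, w = pr p s /\ p ∈ jX gN /\ value (jX gN) s ∈ hX')) by df.
    exists (sep (jX (jN I)) (fun w : sub W X => exists p s, w = pr p s /\ p ∈ jX gN /\ value (jX gN) s ∈ hX')).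
    assert (HhX : forall x : N, proj1_sig (jX x) ∈ proj1_sig hX' <-> H x).
    { intros x. rewrite EjX, EhX. exact (in_trace he hh x). }
    assert (EvX : forall s, proj1_sig (value (jX gN) (jX (jN s))) = proj1_sig (jX (val s))).
    { intros s. rewrite (te_value hx), Egx, EjX', EjX, Ev. reflexivity. }
    apply ext. intros x. rewrite (te_in hx), (go_filter hk). split.
    - intros (w & Hw & ->). apply in_sep in Hw as [Hw (p & s & -> & Hp & Hs)]; auto.
      pose proof (compose_embedding _ _ _ _ _ (go_emb hgN) (go_emb hgX)) as hjX.
      apply (te_pr_in_inv hjX) in Hw as (p' & s' & -> & -> & Hps).
      exists (pr p' s'). split.
      + apply Kchar. split; auto. split.
        * apply (te_mem (go_emb hgX)) in Hp. now apply (in_trace (go_emb hgN) (go_filter hgN)).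
        * apply HhX. change (proj1_sig (jX (val s')) ∈ proj1_sig hX'). rewrite <- EvX. exact Hs.
      + rewrite (te_pr hx), !EjX', (te_pr hj). reflexivity.
    - intros (w & Hw & ->). destruct (KI w Hw) as (p & s & -> & Hps). apply Kchar in Hw as (_ & Hp & Hs).
      pose proof (compose_embedding _ _ _ _ _ (go_emb hgN) (go_emb hgX)) as hjX.
      exists (pr (jX (jN p)) (jX (jN s))). split.
      + apply in_sep; auto. split; [now apply (te_pr_in hjX)|].
        exists (jX (jN p)), (jX (jN s)). split; auto. split.
        * apply (te_mem (go_emb hgX)). now apply (in_trace (go_emb hgN) (go_filter hgN)).
        * change (proj1_sig (value (jX gN) (jX (jN s))) ∈ proj1_sig hX'). rewrite EvX. now apply HhX.
      + rewrite (te_pr hx), !EjX', (te_pr hj). reflexivity. }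
  destruct Xk as [b Eb].
  intros x. destruct (go_values hk x) as (tau & _ & <-).
  assert (Xx : X (value k (j tau))).
  { rewrite <- Eb, <- EjX', <- (te_value hx). exact (proj2_sig (value b (jX (jN tau)))). }
  destruct Xx as (sigma & Hs & E). exists sigma. split; auto.
Qed.
End Decompose.

(** * Grounds as inner models *)

Lemma sat_iso {M N : structure} (f : M -> N) : trans_embedding M N f -> (forall y, exists x, y = f x) ->
  forall phi e, sat M e phi <-> sat N (fun i => f (e i)) phi.
Proof.
  intros hf Hs phi. induction phi; cbn [sat]; intros e.
  - now rewrite (te_mem hf).
  - split; [congruence|apply (te_inj hf)].
  - now rewrite IHphi.
  - now rewrite IHphi1, IHphi2.
  - split.
    + intros H a. destruct (Hs a) as [b ->]. specialize (H b). apply IHphi in H.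
      eapply sat_ext; [|exact H]. intros i _. unfold upd. now destruct (i =? x).
    + intros H a. apply IHphi. eapply sat_ext; [|exact (H (f a))].
      intros i _. unfold upd. now destruct (i =? x).
Qed.

(** An ordinal of the extension outside the ground model would lie above all ordinals of the
    ground model, while only a set of them can be named below a given set. *)
Lemma ordinals_in_ground {M N : structure} {hM : ZF M} {hN : ZF N} {c G j g} :
  is_poset M c -> generic_filter M c G -> ground_of M c G N j g ->
  forall a : N, ordinal a -> exists b, a = j b.
Proof.
  intros hc hG hg a Ha. pose proof (go_emb hg) as hj.
  destruct (go_values hg (suc a)) as (tau & Ht & Ev).
  destruct (closed_superset tau Ht) as (D & HtD & HD & Hcl).
  destruct (conditions_set hc) as [C HC].
  destruct (replacement (fun w b => exists pi p, w = pr pi p /\ cond M c p /\ forces_eq M c p (check c b) pi)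
    (prod D C)) as [S HS].
  { df. }
  { intros w b b' _ (pi & p & -> & Hp & H1) (pi' & p' & E & _ & H2). apply pr_inj in E as [<- <-].
    apply (feq_check_inj hc b b' p); auto. apply (feq_trans hc p _ pi); auto. now apply feq_sym. }
  assert (HjS : forall x, x ∈ suc a -> forall b, x = j b -> b ∈ S).
  { intros x Hx b Eb. rewrite <- Ev in Hx. apply (in_value_name hj (go_filter hg)) in Hx as (pi & s & Hpi & Hs & E).
    assert (HpiD : pi ∈ D) by eauto.
    assert (E' : value g (j (check c b)) = value g (j pi)).
    { rewrite (value_check hj hc hG (go_filter hg)). congruence. }
    apply (value_eq_iff hj hc hG (go_filter hg)) in E' as (p & Hp & Hf); [|now apply check_name|auto].
    apply HS. exists (pr pi p). pose proof (gf_cond hG p Hp). split; [|eauto].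
    apply pr_in_prod. split; auto. now apply HC. }
  apply NNPP. intros Na.
  assert (Osuc : ordinal (suc a)).
  { split.
    - intros y Hy z Hz. apply in_suc. left. apply in_suc in Hy as [Hy| ->]; auto. exact (proj1 Ha y Hy z Hz).
    - intros y Hy. apply in_suc in Hy as [Hy| ->]; [exact (proj2 Ha y Hy)|exact (proj1 Ha)]. }
  assert (DA : def1 (fun x : N => ~ x ∈ j S)) by df.
  destruct (ax_foundation (sep (suc a) (fun x => ~ x ∈ j S))) as (y & Hy & Hmin).
  { exists a. apply in_sep; auto. split; [apply in_suc; auto|]. intros H.
    apply (te_in hj) in H as (b & _ & E). eauto. }
  apply in_sep in Hy as [Hy HyS]; auto.
  pose proof (ordinal_mem _ _ Osuc Hy) as Oy.
  assert (Ny : ~ exists b, y = j b).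
  { intros [b E]. apply HyS. rewrite E. apply (te_mem hj). exact (HjS y Hy b E). }
  apply (burali_forti S). intros b Ob.
  assert (Ob' : ordinal (j b)) by now apply te_ordinal.
  destruct (ordinal_linear (j b) y Ob' Oy) as [H|[H|H]].
  - apply (HjS (j b)); auto. exact (proj1 Osuc y Hy _ H).
  - exfalso. eauto.
  - exfalso. apply Ny. apply (te_in hj) in H as (b' & _ & ->). eauto.
Qed.

Section Conversion.
Context {M W : structure} {hM : ZFC M} {hW : ZFC W}.
Context {c : M} {G : M -> Prop} {j : M -> W} {g : W} (X : W -> Prop).
Hypothesis hc : is_poset M c.
Hypothesis hG : generic_filter M c G.
Hypothesis hg : ground_of M c G W j g.
Hypothesis HX : forall x, X x <-> exists y, x = j y.

Definition to_sub (y : M) : sub W X := exist _ (j y) (proj2 (HX (j y)) (ex_intro _ y eq_refl)).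

Lemma to_sub_embedding : trans_embedding M (sub W X) to_sub.
Proof.
  pose proof (go_emb hg) as hj. constructor.
  - intros x y H. apply (f_equal (fun z : sub W X => proj1_sig z)) in H. now apply (te_inj hj) in H.
  - intros x y. exact (te_mem hj x y).
  - intros [z Hz] y H. simpl in H. destruct (te_trans hj _ _ H) as [x ->]. exists x. now apply sub_ext.
Qed.
Lemma to_sub_onto y : exists x, y = to_sub x.
Proof. destruct y as [y Hy]. destruct (proj1 (HX y) Hy) as [x E]. exists x. apply sub_ext. exact E. Qed.
Lemma to_sub_sat phi e : sat M e phi <-> sat (sub W X) (fun i => to_sub (e i)) phi.
Proof. exact (sat_iso to_sub to_sub_embedding to_sub_onto phi e). Qed.

Lemma from_sub_elementary : exists f : sub W X -> M, (forall y, to_sub (f y) = y) /\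
  forall phi e, sat (sub W X) e phi <-> sat M (fun i => f (e i)) phi.
Proof.
  destruct (choice (fun y x => y = to_sub x) to_sub_onto) as [f Hf]. exists f. split; auto.
  intros phi e. rewrite to_sub_sat. apply sat_ext. auto.
Qed.

Lemma to_sub_ZFC : ZFC (sub W X).
Proof.
  destruct from_sub_elementary as (f & _ & Hf). apply (elementary_ZFC _ M f Hf); auto.
  exact (inhabits (to_sub emp)).
Qed.

Lemma ground_inner_model : inner_model W X.
Proof.
  split; [|split; [|exact to_sub_ZFC]].
  - intros x y Hy Hx. apply HX in Hy as [z ->]. apply HX. exact (te_trans (go_emb hg) _ _ Hx).
  - intros x Hx. apply HX. exact (ordinals_in_ground hc hG hg x Hx).
Qed.

Lemma uniform_to_sub R e : uniform R -> (R M e <-> R (sub W X) (fun i => to_sub (e i))).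
Proof. intros HR. destruct (uniform_formula R HR) as [phi H]. now rewrite !H, to_sub_sat. Qed.

(** The absoluteness lemmas translate the description through the embedding into the one
    through the class of its values. *)
Lemma ground_extends_to : extends_to W X (to_sub c).
Proof.
  pose proof (go_emb hg) as hj.
  split.
  - apply (uniform_to_sub (fun M e => is_poset M (e 0)) (fun _ => c)); auto. unfold uniform. dfn_tac.
  - exists g. split.
    + simpl. split; [|split; [|split; [|split]]].
      * intros p Hp. apply (go_filter hg) in Hp as (q & Hq & ->). apply (te_cond hj hc).
        exists q. split; auto. now apply (gf_cond hG).
      * destruct (gf_inhabited hG) as [p Hp]. exists (j p). now apply (in_trace hj (go_filter hg)).
      * intros p q Hp Hq. apply (te_le hj hc) in Hq as (p' & q' & -> & -> & Hle).
        apply (in_trace hj (go_filter hg)). apply (in_trace hj (go_filter hg)) in Hp.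
        exact (gf_up hG p' q' Hp Hle).
      * intros p q Hp Hq. apply (go_filter hg) in Hp as (p' & Hp & ->), Hq as (q' & Hq & ->).
        destruct (gf_dir hG p' q' Hp Hq) as (r & Hr & A & B). exists (j r).
        rewrite (in_trace hj (go_filter hg)), !(te_le' hj hc). auto.
      * intros D HD HDc HDd. apply HX in HD as [D' ->].
        destruct (gf_dense hG D') as (p & Hp & HGp).
        { intros p Hp. assert (H : cond W (j c) (j p)) by (apply HDc; now apply (te_mem hj)).
          apply (te_cond hj hc) in H as (q & E & Hq). apply (te_inj hj) in E. now subst. }
        { intros p Hp. destruct (HDd (j p)) as (x & Hx & Hle); [apply (te_cond hj hc); eauto|].
          apply (te_in hj) in Hx as (q & Hq & ->). exists q. rewrite (te_le' hj hc) in Hle. auto. }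
        exists (j p). rewrite (te_mem hj), (in_trace hj (go_filter hg)). auto.
    + intros x. destruct (go_values hg x) as (tau & Ht & <-). exists (to_sub tau). split.
      * apply (uniform_to_sub (fun M e => is_name M (e 0) (e 1)) (fun i => match i with 0 => c | _ => tau end)); auto.
        unfold uniform. dfn_tac.
      * apply is_value_iff. split; auto. now apply (te_name hj hc).
Qed.

Lemma ground_from : ground W X.
Proof. split; [exact ground_inner_model|]. exists (to_sub c). exact ground_extends_to. Qed.

End Conversion.

(** The converse direction: the inclusion of the class is the embedding. *)
Lemma ground_of_sub {W : structure} {hW : ZFC W} (X : W -> Prop) (c : sub W X)
  (hM : ZFC (sub W X)) : inner_model W X -> extends_to W X c ->
  exists (G : sub W X -> Prop) (g : W), is_poset (sub W X) c /\ generic_filter (sub W X) c G /\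
    ground_of (sub W X) c G W (fun x => proj1_sig x) g.
Proof.
  intros (Htr & _ & _) (hc & g & (G1 & G2 & G3 & G4 & G5) & Hv).
  pose proof (sub_embedding Htr) as hj.
  set (j := fun x : sub W X => proj1_sig x) in *.
  change (proj1_sig c) with (j c) in *.
  assert (hg : forall x, x ∈ g <-> exists p : sub W X, j p ∈ g /\ x = j p).
  { intros x. split; [|intros (p & Hp & ->); auto].
    intros Hx. pose proof (G1 x Hx) as H. apply (te_cond hj hc) in H as (p & -> & _). eauto. }
  exists (fun p => j p ∈ g), g. split; auto. split.
  - constructor.
    + intros p Hp. apply G1, (te_cond hj hc) in Hp as (q & E & Hq). apply (te_inj hj) in E. now subst.
    + destruct G2 as [x Hx]. pose proof (G1 x Hx) as H. apply (te_cond hj hc) in H as (p & -> & _). eauto.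
    + intros p q Hp Hq. apply (G3 (j p)); auto. now apply (te_le' hj hc).
    + intros p q Hp Hq. destruct (G4 _ _ Hp Hq) as (x & Hx & A & B).
      pose proof (G1 x Hx) as H. apply (te_cond hj hc) in H as (r & -> & _).
      exists r. rewrite (te_le' hj hc) in A, B. auto.
    + intros D HD Hd. destruct (G5 (j D)) as (x & Hx & Hg).
      * exact (proj2_sig D).
      * intros x Hx. apply (te_in hj) in Hx as (p & Hp & ->). apply (te_cond hj hc). eauto.
      * intros x Hx. apply (te_cond hj hc) in Hx as (p & -> & Hp). destruct (Hd p Hp) as (q & Hq & Hle).
        exists (j q). rewrite (te_mem hj), (te_le' hj hc). auto.
      * apply (te_in hj) in Hx as (p & Hp & ->). eauto.
  - constructor; auto. intros x. destruct (Hv x) as (tau & Ht & Hx). exists tau. split; auto.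
    apply is_value_iff in Hx as [_ ->]. reflexivity.
Qed.

(** ** The trivial poset *)
Definition trivial_poset {M : structure} {hM : ZF M} : M :=
  pr (pr (sing emp) (sing (pr emp emp))) emp.

Lemma trivial_preorder {M : structure} {hM : ZF M} : @preorder M (sing emp) (sing (pr emp emp)) emp.
Proof.
  split; [|split; [|split; [|split]]].
  - intros w Hw. apply in_sing in Hw. exists emp. rewrite in_sing. split; auto.
    exists emp. rewrite in_sing, is_pair_iff. auto.
  - now apply in_sing.
  - intros x Hx. apply in_sing in Hx. rewrite pair_in_iff, in_sing. congruence.
  - intros x Hx y Hy z Hz _ _. apply in_sing in Hx, Hy, Hz. rewrite pair_in_iff, in_sing. congruence.
  - intros x Hx. apply in_sing in Hx. rewrite pair_in_iff, in_sing. congruence.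
Qed.

Lemma trivial_sat {M : structure} {hM : ZF M} (e : nat -> M) n : e n = trivial_poset -> sat M e (fTrivialPoset n).
Proof.
  intros E. apply sat_fTrivialPoset. exists (sing emp), (sing (pr emp emp)), emp.
  split; [apply is_triple_iff; exact E|]. split; [exact trivial_preorder|]. intros x. apply in_sing.
Qed.
Lemma trivial_is_poset {M : structure} {hM : ZF M} : is_poset M trivial_poset.
Proof. apply (poset_of_triple _ _ _ _ eq_refl). exact trivial_preorder. Qed.

Lemma trivial_ground {M : structure} {hM : ZF M} :
  generic_filter M trivial_poset (fun p => p = emp) /\
  ground_of M trivial_poset (fun p => p = emp) M (fun x => x) (sing emp).
Proof.
  destruct (triple_data (trivial_poset (M := M)) _ _ _ eq_refl) as (Tc & Tl & Tt).
  assert (hG : generic_filter M trivial_poset (fun p => p = emp)).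
  { constructor.
    - intros p ->. apply Tc. now apply in_sing.
    - eauto.
    - intros p q -> H. apply Tl, in_sing, pr_inj in H. tauto.
    - intros p q -> ->. exists emp. rewrite Tl, in_sing. auto.
    - intros D HD Hd. destruct (Hd emp) as (q & Hq & Hle); [apply Tc; now apply in_sing|].
      apply Tl, in_sing, pr_inj in Hle as [-> _]. eauto. }
  split; auto.
  assert (hf : forall x, x ∈ sing (emp (W := M)) <-> exists p, p = emp /\ x = p).
  { intros x. rewrite in_sing. split; [intros ->; eauto|intros (p & -> & ->); auto]. }
  constructor; auto; [apply id_embedding|].
  intros x. exists (check trivial_poset x). split; [apply check_name; exact trivial_is_poset|].
  exact (value_check (id_embedding M) trivial_is_poset hG hf x).
Qed.

Lemma self_ground {V : structure} (hV : ZFC V) : ground V (fun _ => True).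
Proof.
  destruct (trivial_ground (M := V)) as [hG hg].
  apply (ground_from (fun _ => True) trivial_is_poset hG hg). intros x. split; eauto.
Qed.

(** * From recurrence to maximality *)

Fixpoint close_off (F : nat -> Prop) (b : nat) (phi : formula) : formula :=
  match b with
  | 0 => phi
  | S b => if excluded_middle_informative (F b) then close_off F b phi
           else All b (close_off F b phi)
  end.

(** Quantifying over the variables on which the truth value does not depend removes them.
    Parameters of buttons are only required for free variables, so formulas found
    semantically must not acquire new ones. *)
Lemma formula_with_free (R : forall W : structure, (nat -> W) -> Prop) (F : nat -> Prop) : uniform R ->
  (forall (W : structure) (e e' : nat -> W), (forall i, F i -> e i = e' i) -> R W e -> R W e') ->
  exists phi, (forall W e, R W e <-> sat W e phi) /\ forall i, free i phi -> F i.
Proof.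
  intros HR HF. destruct (uniform_formula R HR) as [phi Hphi].
  exists (close_off F (bnd phi) phi).
  assert (H : forall b, (forall W e, R W e <-> sat W e (close_off F b phi)) /\
    forall i, free i (close_off F b phi) -> F i \/ (b <= i /\ free i phi)).
  { induction b; cbn [close_off].
    - split; auto. intros i Hi. right. split; auto. lia.
    - destruct IHb as [IH1 IH2]. destruct (excluded_middle_informative (F b)) as [Hb|Hb].
      + split; auto. intros i Hi. destruct (IH2 i Hi) as [?|[H1 H2]]; auto.
        destruct (Nat.eq_dec i b) as [->|]; auto. right. split; auto. lia.
      + split.
        * intros W e. cbn [sat]. split.
          { intros H a. apply IH1. apply (HF W e); auto. intros i Hi. unfold upd.
            destruct (Nat.eqb_spec i b) as [->|]; [contradiction|auto]. }
          { intros H. specialize (H (e b)). apply IH1 in H. apply (HF W (upd e b (e b))); auto.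
            intros i Hi. unfold upd. destruct (Nat.eqb_spec i b) as [->|]; auto. }
        * cbn [free]. intros i [Hn Hi]. destruct (IH2 i Hi) as [?|[H1 H2]]; auto.
          right. split; auto. lia. }
  split; [apply H|]. intros i Hi. destruct (proj2 (H (bnd phi)) i Hi) as [|[H1 H2]]; auto.
  apply free_bnd in H2. lia.
Qed.

(** A valid conjunct makes up for free variables that have got lost, so that a ground
    containing the parameters of the new formula contains those of the old one. *)
Lemma pad_free (R : forall W : structure, (nat -> W) -> Prop) psi phi :
  (forall W e, R W e <-> sat W e psi) -> (forall i, free i psi -> free i phi) ->
  exists psi', (forall W e, R W e <-> sat W e psi') /\ forall i, free i psi' <-> free i phi.
Proof.
  intros H1 H2. exists (And psi (Neg (And phi (Neg phi)))). split.
  - intros W e. rewrite H1. cbn [sat]. tauto.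
  - intros i. cbn [free]. split; [intros [H|H]; [auto|tauto]|auto].
Qed.

Definition all_force (chi phi : formula) (W : structure) (e : nat -> W) : Prop :=
  forall Q, in_class W chi Q -> forced_at W Q e phi.

Lemma forced_at_ext {W : structure} (c : W) phi e e' : (forall i, free i phi -> e i = e' i) ->
  forced_at W c e phi -> forced_at W c e' phi.
Proof. intros E H nu Hnu. apply H. intros i Hi. rewrite E; auto. Qed.

Lemma all_force_formula chi phi : exists phi',
  (forall W e, all_force chi phi W e <-> sat W e phi') /\ forall i, free i phi' <-> free i phi.
Proof.
  destruct (formula_with_free (all_force chi phi) (fun i => free i phi)) as (phi' & H1 & H2).
  - unfold uniform, all_force.
    apply (dfn_all _ _ _ (fun W e Q => in_class W chi Q -> forced_at W Q e phi)).
    dfn_tac; apply tm_var.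
  - intros W e e' E H Q HQ. apply (forced_at_ext Q phi e); auto.
  - exact (pad_free _ phi' phi H1 H2).
Qed.

Section Normality.
Variable chi : formula.
Hypothesis hchi : forall i, free i chi -> i = 0.

Lemma free_fNormal i : ~ free i (fNormal chi).
Proof.
  unfold fNormal. cbn [free]. intros [[H1 H]|[H1 [H2 H]]].
  - revert H. cbn [free Imp]. intros [H|H].
    + revert H. unfold fTrivialPoset. cbv zeta. cbn. intuition lia.
    + apply free_fClass in H; auto.
  - revert H. cbn [free Imp]. intros [H|[H|[H|H]]].
    + revert H. unfold fPoset. cbv zeta. cbn. intuition lia.
    + apply free_fClass in H; auto.
    + revert H. unfold fForcingEquivalent. cbv zeta. cbn. intuition lia.
    + apply free_fClass in H; auto.
Qed.

Lemma normal_trivial {M : structure} {hM : ZF M} e :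
  sat M e (fNormal chi) -> in_class M chi trivial_poset.
Proof.
  intros [H _]. cbn [sat] in H. specialize (H trivial_poset).
  pose proof (proj1 (iff_Imp M (upd e 1 trivial_poset) (fTrivialPoset 1) (fClass chi 1) _ _
    (iff_refl _) (iff_refl _)) H) as H'.
  assert (K : sat M (upd e 1 trivial_poset) (fClass chi 1)) by (apply H', trivial_sat, upd_eq).
  apply sat_fClass in K; auto. apply in_class_iff; auto.
Qed.

Lemma te_trivial {M N : structure} {hM : ZF M} {hN : ZF N} {j : M -> N} :
  trans_embedding M N j -> j trivial_poset = trivial_poset.
Proof.
  intros hj. unfold trivial_poset. now rewrite !(te_pr hj), !(te_sing hj), (te_pr hj), (te_emp hj).
Qed.

Definition class_name (M : structure) (c : M) : Prop :=
  exists T, is_name M c T /\ forced M c (fun _ => T) (fClass chi 0).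

(** The trivial poset belongs to the class in every extension by [c]. *)
Lemma class_name_of_normal (M : structure) (hM : ZFC M) (c : M) : is_poset M c ->
  forced M c (fun _ => c) (fNormal chi) -> class_name M c.
Proof.
  apply (countable_reduction (fun M e => is_poset M (e 0) ->
    forced M (e 0) (fun _ => e 0) (fNormal chi) -> class_name M (e 0))) with (e := fun _ => c); auto.
  - unfold uniform, class_name. dfn_tac.
  - clear M hM c. intros M hM Hc e hc Hn. exists (check (e 0) trivial_poset).
    split; [now apply check_name|]. intros p Hp.
    apply (forces_by_extensions hc Hc); auto; [intros; now apply check_name|].
    intros G N val HG HGp HE _. pose proof (extension_ZF hc HG HE) as hN.
    assert (HnN : sat N (fun _ => val (check (e 0) (e 0))) (fNormal chi)).
    { apply (truth hc HG HE (fNormal chi) (fun _ => check (e 0) (e 0))); [intros; now apply check_name|].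
      exists p. split; auto. eapply forces_ext; [|exact (Hn p Hp)].
      intros i Hi. destruct (free_fNormal i Hi). }
    apply normal_trivial in HnN. 
    assert (E : val (check (e 0) trivial_poset) = trivial_poset).
    { exact (te_trivial (check_embedding hc HG HE)). }
    rewrite E. exact HnN.
Qed.

(** Stated with the poset and the parameters in one environment, in order to be reduced to
    countable models. *)
Definition button_lifts (phi phi' : formula) (M : structure) (e : nat -> M) : Prop :=
  in_class M chi (e 0) -> class_name M (e 0) ->
  (forall Q, is_name M (e 0) Q -> forced M (e 0) (fun _ => Q) (fClass chi 0) ->
    forall i, is_iteration M (e 0) Q i -> forced_at M i (fun n => e (S n)) phi) ->
  forced_at M (e 0) (fun n => e (S n)) phi'.

(** A poset of the class in an extension by [c] is the value of a name forced into the
    class, and a further extension by it is an extension by the iteration. *)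
Lemma button_forces_all_force phi phi' :
  (forall W e, all_force chi phi W e <-> sat W e phi') -> (forall i, free i phi' -> free i phi) ->
  forall V, ZFC V -> forall e, button_lifts phi phi' V e.
Proof.
  intros Hphi' Hfree. apply countable_reduction.
  - unfold uniform, button_lifts, class_name. dfn_tac.
  - intros M hM Hcount e0. unfold button_lifts. set (c := e0 0). set (e := fun n => e0 (S n)).
    intros Hc HT Hb nu Hnu p Hp.
    assert (hc : is_poset M c) by apply (proj1 (in_class_iff M chi c hchi) Hc).
    assert (Enu : forall i, free i phi' -> nu i = check c (e i)).
    { intros i Hi. apply (is_check_iff hc). auto. }
    apply (forces_by_extensions hc Hcount); auto.
    { intros i Hi. rewrite Enu by auto. now apply check_name. }
    intros G N val HG HGp HE HcN. pose proof (extension_ZFC hc HG HE) as hN.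
    apply (sat_ext _ phi' (fun i => val (check c (e i)))); [intros i Hi; now rewrite Enu|].
    apply Hphi'. intros R HR nu2 Hnu2 q0 Hq0.
    assert (hR : is_poset N R) by apply (proj1 (in_class_iff N chi R hchi) HR).
    assert (Enu2 : forall i, free i phi -> nu2 i = check R (val (check c (e i)))).
    { intros i Hi. apply (is_check_iff hR). auto. }
    apply (forces_by_extensions hR HcN); auto.
    { intros i Hi. rewrite Enu2 by auto. now apply check_name. }
    intros H W val2 HH HHq HE2 _. pose proof (extension_ZFC hR HH HE2) as hW.
    destruct (extension_ground_of hc HG HE) as [Hg1 _].
    destruct (extension_ground_of hR HH HE2) as [Hg2 _].
    set (j1 := fun x => val (check c x)) in *. set (g1 := val (filter_name (c := c))) in *.
    set (j2 := fun x => val2 (check R x)) in *. set (g2 := val2 (filter_name (c := R))) in *.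
    destruct (go_values Hg1 R) as (Q0 & HQ0 & EQ0).
    assert (HQc : exists p0, G p0 /\ forces M c p0 (fun _ => Q0) (fClass chi 0)).
    { apply (ground_of_truth hc HG Hg1 (fClass chi 0) (fun _ => Q0)); auto.
      unfold in_class in HR. eapply sat_ext; [|exact HR]. intros i _. exact EQ0. }
    destruct HQc as (p0 & Hp0 & HQf).
    destruct (all_iterable chi M hM c hchi hc HT p0 Q0 (gf_cond HG p0 Hp0) HQ0 HQf)
      as (Q & i & HQ & HQc & HQe & Hi & hip).
    assert (EQ : R = value g1 (j1 Q)).
    { rewrite <- EQ0. symmetry. apply (value_eq_iff (go_emb Hg1) hc HG (go_filter Hg1)); eauto. }
    destruct (compose_grounds hc HQ Hi hip HG Hg1 EQ hR HH Hg2) as (K & k & HK & Hgk).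
    pose proof (forced_at_sound hip HK Hgk phi e (Hb Q HQ HQc i Hi)) as Hs.
    eapply sat_ext; [|exact Hs]. intros n Hn. simpl. rewrite Enu2 by auto. reflexivity.
Qed.
End Normality.

(** * Definability of grounds *)

Section Approximations.
Variable W : structure.
Implicit Types a b x y z I J B D E N X Y U d f g i r : W.

(** [I] enumerates a set containing [a].  In [approximation] this refers to the whole universe
    and not to [N]. *)
Definition small I a : Prop := exists f,
  (forall i y y', pair_in i y f -> pair_in i y' f -> y = y') /\
  forall y, y ∈ a -> exists i, i ∈ I /\ pair_in i y f.

(** [z] is [L x]; the recursion is expressed by a set so that a single formula says it in
    all structures. *)
Definition is_level x z : Prop := exists t f, transitive_set t /\ x ∈ t /\
  (forall u, u ∈ t -> exists v, pair_in u v f) /\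
  (forall u v, u ∈ t -> pair_in u v f -> forall y,
    y ∈ v <-> exists w v', w ∈ u /\ pair_in w v' f /\ subset y v') /\
  pair_in x z f.

Definition extensional B : Prop := forall x y, x ∈ B -> y ∈ B ->
  (forall z, z ∈ B -> (z ∈ x <-> z ∈ y)) -> x = y.

(** [r] will contain sets of the ground only.  It cannot hold the enumeration [g], but holds
    the set [D] of its indices, the membership relation [E] that it induces on them, and the
    set [R] of the indices of [X]. *)
Definition coded r B X : Prop := exists g D E R, D ∈ r /\ E ∈ r /\ R ∈ r /\
  (forall i y y', pair_in i y g -> pair_in i y' g -> y = y') /\
  (forall i y, pair_in i y g -> i ∈ D /\ y ∈ B) /\
  (forall i, i ∈ D -> exists y, pair_in i y g) /\
  (forall y, y ∈ B -> exists i, pair_in i y g) /\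
  (forall i k x y, pair_in i x g -> pair_in k y g -> (pair_in i k E <-> x ∈ y)) /\
  (forall i x, pair_in i x g -> (i ∈ R <-> x ∈ X)).

(** For a ground, [N] is its intersection with the level [U]; by [approximation_sub] these
    conditions determine it.  Their order: transitivity, intersections with levels and
    of two sets, the approximation property, the cover property, and for extensional sets
    [B] no larger than the power set of [I] the description of the subsets of [B] in the
    ground by codes. *)
Definition approximation I r N U : Prop :=
  (forall x, x ∈ N -> x ∈ U /\ subset x N) /\
  (forall x, x ∈ U -> exists l z, is_level x l /\ z ∈ N /\ forall y, y ∈ z <-> y ∈ l /\ y ∈ N) /\
  (forall x y, x ∈ N -> y ∈ N -> exists z, z ∈ N /\ forall w, w ∈ z <-> w ∈ x /\ w ∈ y) /\
  (forall X Y, Y ∈ N -> subset X Y ->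
    (forall a, a ∈ N -> small I a -> exists z, z ∈ N /\ forall w, w ∈ z <-> w ∈ X /\ w ∈ a) -> X ∈ N) /\
  (forall a Y, Y ∈ N -> subset a Y -> small I a ->
    exists d, d ∈ N /\ subset a d /\ subset d Y /\ small I d) /\
  (forall B X K, B ∈ N -> extensional B -> (forall z, z ∈ K <-> subset z I) -> small K B ->
    subset X B -> (X ∈ N <-> coded r B X)).

Definition approximated I r x : Prop := exists u U N,
  is_level u U /\ approximation I r N U /\ x ∈ N.
End Approximations.
Arguments small {W}. Arguments is_level {W}. Arguments extensional {W}. Arguments coded {W}.
Arguments approximation {W}. Arguments approximated {W}.

Section DefApproximations.
Variables (J : Type) (S : J -> structure) (K : (forall i, S i) -> Prop).
Local Notation Df := (@dfn J S K). Local Notation Tm := (@tm J S K).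
Lemma dfn_small s t : Tm s -> Tm t -> Df (fun i e => small (s i e) (t i e)).
Proof. intros. unfold small. dfn_tac. Qed.
Lemma dfn_is_level s t : Tm s -> Tm t -> Df (fun i e => is_level (s i e) (t i e)).
Proof. intros. unfold is_level. dfn_tac. Qed.
Lemma dfn_extensional s : Tm s -> Df (fun i e => extensional (s i e)).
Proof. intros. unfold extensional. dfn_tac. Qed.
Lemma dfn_coded s t u : Tm s -> Tm t -> Tm u -> Df (fun i e => coded (s i e) (t i e) (u i e)).
Proof. intros. unfold coded. dfn_tac. Qed.
End DefApproximations.
Ltac dfn_ext9 := first
  [ dfn_ext8 | apply dfn_small | apply dfn_is_level | apply dfn_extensional | apply dfn_coded ].
Ltac dfn_ext ::= dfn_ext9.
Section DefApproximations2.
Variables (J : Type) (S : J -> structure) (K : (forall i, S i) -> Prop).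
Local Notation Df := (@dfn J S K). Local Notation Tm := (@tm J S K).
Lemma dfn_approximated s t u : Tm s -> Tm t -> Tm u ->
  Df (fun i e => approximated (s i e) (t i e) (u i e)).
Proof. intros. unfold approximated, approximation. dfn_tac. Qed.
End DefApproximations2.
Ltac dfn_ext10 := first [ dfn_ext9 | apply dfn_approximated ].
Ltac dfn_ext ::= dfn_ext10.

Section Smallness.
Context {W : structure} {hW : ZF W}.
Implicit Types a b x y z I J B D E N X Y U d f g i r : W.

Lemma small_intro I a (f : W -> W -> Prop) : def2 f ->
  (forall i y y', f i y -> f i y' -> y = y') -> (forall y, y ∈ a -> exists i, i ∈ I /\ f i y) -> small I a.
Proof.
  intros Hf H1 H2. exists (sep (prod I a) (fun p => exists i y, p = pr i y /\ f i y)).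
  assert (E : forall i y, pair_in i y (sep (prod I a) (fun p => exists i y, p = pr i y /\ f i y)) <->
    i ∈ I /\ y ∈ a /\ f i y).
  { intros i y. rewrite pair_in_iff, in_sep, pr_in_prod by df. split.
    - intros [[Hi Hy] (i' & y' & Eq & H)]. apply pr_inj in Eq as [-> ->]. auto.
    - intros (? & ? & ?). eauto 6. }
  split.
  - intros i y y' A A'. apply E in A, A'. apply (H1 i); tauto.
  - intros y Hy. destruct (H2 y Hy) as (i & Hi & Hfi). exists i. rewrite E. auto.
Qed.

Lemma small_sub I a b : subset b a -> small I a -> small I b.
Proof. intros H (f & H1 & H2). exists f. split; auto. Qed.

Lemma small_sing I x i : i ∈ I -> small I (sing x).
Proof.
  intros Hi. apply (small_intro _ _ (fun j y => y = x)); [df|congruence|].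
  intros y ->%in_sing. eauto.
Qed.

Lemma small_cup I a b : (forall i j, i ∈ I -> j ∈ I -> pr i j ∈ I) -> (exists i, i ∈ I) ->
  small I a -> small I b -> small I (cup a b).
Proof.
  intros HI [i0 H0] (f & F1 & F2) (g & G1 & G2).
  assert (Hn : i0 <> pr i0 i0).
  { intros E. assert (H1 : i0 ∈ sing i0) by now apply in_sing.
    assert (H2 : sing i0 ∈ i0) by (rewrite E at 2; apply in_upair; auto).
    exact (no_mem_cycle2 _ _ H1 H2). }
  apply (small_intro _ _ (fun j y => exists i, (j = pr i0 i /\ pair_in i y f) \/
    (j = pr (pr i0 i0) i /\ pair_in i y g))); [df| |].
  - intros j y y' (i & [[-> H]|[-> H]]) (i' & [[E H']|[E H']]); apply pr_inj in E as [E1 <-]; eauto;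
      congruence.
  - intros y Hy. apply in_cup in Hy as [Hy|Hy].
    + destruct (F2 y Hy) as (i & Hi & H). exists (pr i0 i). split; auto. exists i. auto.
    + destruct (G2 y Hy) as (i & Hi & H). exists (pr (pr i0 i0) i). split; auto. exists i. auto.
Qed.

Lemma is_level_iff x z : is_level x z <-> z = L x.
Proof.
  split.
  - intros (t & f & Ht & Hx & Htot & Hf & Hz).
    assert (K : forall u v, u ∈ t -> pair_in u v f -> v = L u).
    { intros u. apply (mem_ind (fun u => forall v, u ∈ t -> pair_in u v f -> v = L u)); [df|].
      clear u. intros u IH v Hu Hv. apply ext. intros y. rewrite (Hf u v Hu Hv), in_L. split.
      - intros (w & v' & Hw & Hv' & Hy). exists w. split; auto.
        rewrite (IH w Hw v') in Hy; auto. exact (Ht u Hu w Hw).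
      - intros (w & Hw & Hy). 
        assert (Hwt : w ∈ t) by exact (Ht u Hu w Hw).
        destruct (Htot w Hwt) as [v' Hv'].
        exists w, v'. repeat split; auto. now rewrite (IH w Hw v' Hwt Hv'). }
    now apply K.
  - intros ->. exists (trcl (sing x)), (graph L (trcl (sing x))).
    assert (Hg : forall u v, pair_in u v (graph L (trcl (sing x))) <-> u ∈ trcl (sing x) /\ v = L u).
    { intros u v. rewrite pair_in_iff. apply in_graph. df. }
    assert (Hx : x ∈ trcl (sing x)) by now apply trcl_sub, in_sing.
    split; [apply trcl_trans|]. split; auto. split; [|split; [|now apply Hg]].
    + intros u Hu. exists (L u). now apply Hg.
    + intros u v Hu [_ ->]%Hg y. rewrite in_L. split.
      * intros (w & Hw & Hy). exists w, (L w). repeat split; auto. apply Hg. split; auto.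
        exact (trcl_trans _ u Hu w Hw).
      * intros (w & v' & Hw & [_ ->]%Hg & Hy). eauto.
Qed.
End Smallness.

(** ** Approximations at the same level coincide *)

Section ClosedSets.
Context {W : structure} {hW : ZFC W}.
Implicit Types a b x y z I J B D E N X Y U d f g i r : W.

Section ClosedSet.
Variables (I Y a : W) (R : W -> W -> Prop).
Hypothesis hR : def2 R.
Hypothesis hI : forall i j, i ∈ I -> j ∈ I -> pr i j ∈ I.
Hypothesis hI0 : exists i, i ∈ I.
Hypothesis hY : subset a Y.
Hypothesis ha : small I a.
Hypothesis hstep : forall s, small I s -> subset s Y -> exists d, small I d /\ subset d Y /\ R s d.

(** The elements added to each small set are enumerated by [I].  Elements of the closure are
    coded by subsets of [I]: a code for a new element consists of codes for the elements of
    a small set from which it is obtained, one for each index, and of its index in the set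
    added. *)
Lemma small_closure K : (forall z, z ∈ K <-> subset z I) -> exists B,
  subset a B /\ subset B Y /\ small K B /\
  forall s, small I s -> subset s B -> exists d, subset d B /\ R s d.
Proof.
  intros HK. destruct hI0 as [i0 Hi0]. set (i1 := pr i0 i0).
  assert (Hn : i0 <> i1).
  { intros E. assert (H1 : i0 ∈ sing i0) by now apply in_sing.
    assert (H2 : sing i0 ∈ i0) by (unfold i1 in E; rewrite E at 2; apply in_upair; auto).
    exact (no_mem_cycle2 _ _ H1 H2). }
  assert (Hi1 : i1 ∈ I) by (unfold i1; auto).
  (* [F] enumerates what is added to each small set *)
  destruct (choice_function (fun s f => (forall i y y', pair_in i y f -> pair_in i y' f -> y = y') /\
      exists d, subset d Y /\ R s d /\
        (forall y, y ∈ a \/ y ∈ d -> exists i, i ∈ I /\ pair_in i y f))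
    (sep (power Y) (small I))) as (F & F1 & _ & F2 & F3).
  { df. }
  { intros s [Hs Hsm]%in_sep; [|df]. apply in_power in Hs.
    destruct (hstep s Hsm Hs) as (d & Hd & HdY & HRd).
    assert (Had : small I (cup a d)) by (apply small_cup; eauto).
    destruct Had as (f & Hf1 & Hf2). exists f. split; auto.
    exists d. repeat split; auto. intros y Hy. apply Hf2, in_cup. auto. }
  set (slice := fun z i z' => forall k, k ∈ z' <-> k ∈ I /\ pr i0 (pr i k) ∈ z).
  assert (Hsl : def3 slice) by (unfold slice; df).
  assert (slice_fun : forall z i z' z'', slice z i z' -> slice z i z'' -> z' = z'').
  { intros z i z' z'' H1 H2. apply ext. intros k. now rewrite (H1 k), (H2 k). }
  set (Phi := fun p E => exists z y i s f, p = pr z y /\ i ∈ I /\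
    (forall i', i' ∈ I -> (pr i1 i' ∈ z <-> i' = i)) /\ pr s f ∈ F /\ pair_in i y f /\
    (forall y', y' ∈ s -> exists i' z', i' ∈ I /\ slice z i' z' /\ (exists k, k ∈ z') /\ pr z' y' ∈ E) /\
    (forall i' z', i' ∈ I -> slice z i' z' -> (exists k, k ∈ z') -> exists y', y' ∈ s /\ pr z' y' ∈ E)).
  assert (HPhi : def2 Phi) by (unfold Phi; df).
  destruct (least_fixpoint Phi (prod K Y)) as (E & HE & Hleast); [exact HPhi| |].
  { intros p E E' HEE (z & y & i & s & f & H1 & H2 & H3 & H4 & H5 & H6 & H7).
    exists z, y, i, s, f. repeat split; auto.
    - apply H3; auto.
    - apply H3; auto.
    - intros y' Hy'. destruct (H6 y' Hy') as (i' & z' & ? & ? & ? & ?). exists i', z'. auto.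
    - intros i' z' Hi' Hz' Hk. destruct (H7 i' z' Hi' Hz' Hk) as (y' & ? & ?). eauto. }
  assert (Hfun : forall z y y', pr z y ∈ E -> pr z y' ∈ E -> y = y').
  { set (P := fun p => forall z y y', p = pr z y -> pr z y' ∈ E -> y = y').
    assert (HP : def1 P) by (unfold P; df).
    assert (Hsub : subset E (sep E P)).
    { apply Hleast. intros p Hp H. apply in_sep; auto. split.
      - apply HE. split; auto. destruct H as (z & y & i & s & f & H1 & H2 & H3 & H4 & H5 & H6 & H7).
        exists z, y, i, s, f. repeat split; auto.
        + apply H3; auto.
        + apply H3; auto.
        + intros y' Hy'. destruct (H6 y' Hy') as (i' & z' & A1 & A2 & A3 & A4).
          apply in_sep in A4; auto. exists i', z'. tauto.
        + intros i' z' Hi' Hz' Hk. destruct (H7 i' z' Hi' Hz' Hk) as (y' & A1 & A2).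
          apply in_sep in A2; auto. exists y'. tauto.
      - intros z1 y1 y1' Ep Hp'.
        destruct H as (z & y & i & s & f & H1 & H2 & H3 & H4 & H5 & H6 & H7).
        rewrite H1 in Ep. apply pr_inj in Ep as [<- <-].
        apply HE in Hp' as [_ (z2 & y2 & i2 & s2 & f2 & G1 & G2 & G3 & G4 & G5 & G6 & G7)].
        apply pr_inj in G1 as [<- <-].
        assert (i2 = i) by (apply H3, G3; auto). subst i2.
        assert (s2 = s).
        { apply ext. intros y'. split; intros Hy'.
          - destruct (G6 y' Hy') as (i' & z' & A1 & A2 & A3 & A4).
            destruct (H7 i' z' A1 A2 A3) as (y'' & B1 & B2).
            apply in_sep in B2 as [B2 B3]; auto. now rewrite <- (B3 z' y'' y' eq_refl A4).
          - destruct (H6 y' Hy') as (i' & z' & A1 & A2 & A3 & A4).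
            destruct (G7 i' z' A1 A2 A3) as (y'' & B1 & B2).
            apply in_sep in A4 as [A4 A5]; auto. now rewrite (A5 z' y' y'' eq_refl B2). }
        subst s2. rewrite (F1 s f2 f) in G5 by auto.
        apply F2 in H4 as [_ [Hf _]]. apply (Hf i); auto. }
    intros z y y' H1 H2. apply Hsub, in_sep in H1 as [_ H1]; auto. exact (H1 z y y' eq_refl H2). }
  set (B := sep Y (fun y => exists z, pr z y ∈ E)).
  assert (HB : forall y, y ∈ B <-> y ∈ Y /\ exists z, pr z y ∈ E) by (intros y; unfold B; rewrite in_sep; [tauto|df]).
  assert (HEK : forall z y, pr z y ∈ E -> z ∈ K) by (intros z y [H%pr_in_prod _]%HE; tauto).
  assert (Hcode : forall z y, pr z y ∈ E -> exists k, k ∈ z).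
  { intros z y [_ (z' & y' & i & s & f & Ez & Hi & Hz & _)]%HE. apply pr_inj in Ez as [-> ->].
    exists (pr i1 i). now apply Hz. }
  assert (Hclosed : forall s f i y, small I s -> subset s B -> pr s f ∈ F -> i ∈ I -> pair_in i y f ->
    y ∈ Y -> y ∈ B).
  { intros s f i y Hs HsB HF Hi Hy HyY. apply HB. split; auto.
    destruct Hs as (h & Hh1 & Hh2).
    destruct (choice_function (fun y z => pr z y ∈ E) s) as (C & C1 & _ & C2 & C3); [df| |].
    { intros u Hu. apply HsB, HB in Hu as [_ Hu]. exact Hu. }
    set (P := fun w => (exists i' y' z' k, w = pr i0 (pr i' k) /\ pair_in i' y' h /\ pr y' z' ∈ C /\ k ∈ z') \/
      w = pr i1 i).
    assert (HP : def1 P) by (unfold P; df).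
    set (z := sep I P).
    assert (Hz : forall w, w ∈ z <-> w ∈ I /\ P w) by (intros w; unfold z; rewrite in_sep; tauto).
    assert (Hzi : forall y' z' i', pr y' z' ∈ C -> pair_in i' y' h -> i' ∈ I -> slice z i' z').
    { intros y' z' i' H1 H2 H3 k. rewrite Hz. unfold P. split.
      - intros Hk. apply C2 in H1 as H1'. destruct H1' as [_ H1'].
        assert (k ∈ I) by (apply HEK, HK in H1'; auto). repeat split; auto. left. exists i', y', z', k. auto.
      - intros (_ & _ & [(i2 & y2 & z2 & k2 & E1 & A1 & A2 & A3)|E1]).
        + apply pr_inj in E1 as [_ E1]. apply pr_inj in E1 as [<- <-].
          rewrite (Hh1 i' y2 y') in A2 by auto. now rewrite (C1 y' z' z2).
        + apply pr_inj in E1 as [E1 _]. contradiction. }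
    exists z. apply HE. split.
    { apply pr_in_prod. split; auto. apply HK. intros w Hw. now apply Hz in Hw. }
    exists z, y, i, s, f. repeat split; auto.
    - intros Hw. apply Hz in Hw as [_ [(i2 & y2 & z2 & k2 & E1 & _)|E1]]; apply pr_inj in E1 as [E1 E2];
        congruence.
    - intros ->. apply Hz. split; auto. now right.
    - intros y' Hy'. destruct (Hh2 y' Hy') as (i' & Hi' & Hiy). destruct (C3 y' Hy') as (z' & Hz').
      apply C2 in Hz' as Hz2. exists i', z'. split; [exact Hi'|]. split; [now apply (Hzi y' z' i')|].
      split; [exact (Hcode _ _ (proj2 Hz2))|tauto].
    - intros i' z' Hi' Hs' (k & Hk). apply Hs' in Hk as Hk'. destruct Hk' as [HkI Hk'].
      apply Hz in Hk' as [_ [(i2 & y2 & z2 & k2 & E1 & A1 & A2 & A3)|E1]];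
        apply pr_inj in E1 as [E1 E2]; [|contradiction].
      apply pr_inj in E2 as [<- <-]. exists y2. apply C2 in A2 as A2'. split; [tauto|].
      rewrite (slice_fun z i' z' z2); eauto. tauto. }
  exists B. split; [|split; [|split]].
  - intros y Hy. set (s := emp).
    assert (Hs : small I s) by (exists emp; split; [intros i y1 y2 H%pair_in_iff|intros y1 H];
      now apply in_emp in H).
    assert (HsB : subset s B) by (intros u Hu; now apply in_emp in Hu).
    destruct (F3 s) as (f & Hf).
    { apply in_sep; [df|]. split; auto. apply in_power. intros u Hu. now apply in_emp in Hu. }
    apply F2 in Hf as Hf'. destruct Hf' as (_ & _ & d & _ & _ & Hd).
    destruct (Hd y (or_introl Hy)) as (i & Hi & Hiy). apply (Hclosed s f i); auto.
  - intros y Hy. now apply HB in Hy.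
  - apply (small_intro _ _ (fun z y => pr z y ∈ E)); [df|exact Hfun|].
    intros y (_ & z & Hz)%HB. exists z. split; eauto.
  - intros s Hs HsB. destruct (F3 s) as (f & Hf).
    { apply in_sep; [df|]. split; auto. apply in_power. intros u Hu. apply HsB, HB in Hu. tauto. }
    apply F2 in Hf as Hf'. destruct Hf' as (_ & _ & d & HdY & HRd & Hd). exists d. split; auto.
    intros y Hy. destruct (Hd y (or_intror Hy)) as (i & Hi & Hiy). apply (Hclosed s f i); auto.
Qed.
End ClosedSet.

Section Uniqueness.
Variables (I r U u : W).
Hypothesis hI : forall i j, i ∈ I -> j ∈ I -> pr i j ∈ I.
Hypothesis hI0 : exists i, i ∈ I.
Hypothesis hU : is_level u U.

(** By the approximation property it is enough to consider the trace of [X] on a small set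
    [a].  Closing [a] under small covers from both sides yields a set [B], which is in both
    approximations: its trace on a small set of either is the trace of a cover.  Adding
    an element that distinguishes each two elements makes [B] extensional.  Then the subsets
    of [B] are determined by codes, which are the same for both sides. *)
Lemma approximation_step N1 N2 Y X : approximation I r N1 U -> approximation I r N2 U ->
  Y ∈ N1 -> Y ∈ N2 -> transitive_set Y -> subset X Y -> X ∈ N1 -> X ∈ N2.
Proof.
  intros A1 A2 HY1 HY2 HYt HXY HX.
  destruct A1 as (T1 & _ & M1 & P1 & C1 & D1), A2 as (T2 & _ & M2 & P2 & C2 & D2).
  apply (P2 X Y HY2 HXY). intros a0 Ha0 Hsa0.
  destruct (M2 a0 Y Ha0 HY2) as (a & Ha & Ea).
  assert (Hsa : small I a) by (apply (small_sub I a0); auto; intros w Hw; now apply Ea in Hw).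
  assert (HaY : subset a Y) by (intros w Hw; now apply Ea in Hw).
  set (R := fun s d => (exists d1, d1 ∈ N1 /\ subset s d1 /\ subset d1 d) /\
    (exists d2, d2 ∈ N2 /\ subset s d2 /\ subset d2 d) /\
    forall x y, (forall w, w ∈ s <-> w = x \/ w = y) -> x <> y -> exists z, z ∈ d /\ ~ (z ∈ x <-> z ∈ y)).
  assert (HR : def2 R) by (unfold R; df).
  destruct (small_closure I Y a R HR hI hI0 HaY Hsa) with (K := power I)
    as (B & HaB & HBY & HsB & HB).
  { intros s Hs HsY. destruct (C1 s Y HY1 HsY Hs) as (d1 & G1 & G2 & G3 & G4).
    destruct (C2 s Y HY2 HsY Hs) as (d2 & F1 & F2 & F3 & F4).
    destruct (small_cup I d1 d2 hI hI0 G4 F4) as [f Hf]. assert (S12 : small I (cup d1 d2)) by now exists f.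
    assert (H3 : exists d3, small I d3 /\ subset d3 Y /\
      forall x y, (forall w, w ∈ s <-> w = x \/ w = y) -> x <> y -> exists z, z ∈ d3 /\ ~ (z ∈ x <-> z ∈ y)).
    { destruct (classic (exists x y, (forall w, w ∈ s <-> w = x \/ w = y) /\ x <> y)) as [(x & y & Es & Hn)|N].
      - assert (Hz : exists z, ~ (z ∈ x <-> z ∈ y)).
        { apply NNPP. intros N. apply Hn, ext. intros z. apply NNPP. eauto. }
        destruct Hz as [z Hz]. exists (sing z). destruct hI0 as [i0 Hi0]. split; [eauto using small_sing|]. split.
        + intros w ->%in_sing. destruct (classic (z ∈ x)).
          * apply (HYt x); auto. apply HsY, Es. auto.
          * apply (HYt y); [apply HsY, Es; auto|tauto].
        + intros x' y' Es' _. exists z. split; [now apply in_sing|].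
          assert (E1 : x = x' \/ x = y') by (apply Es', Es; auto).
          assert (E2 : y = x' \/ y = y') by (apply Es', Es; auto).
          destruct E1 as [-> | ->], E2 as [-> | ->]; tauto.
      - exists emp. split; [exists emp; split; [intros i y1 y2 H%pair_in_iff|intros y1 H]; now apply in_emp in H|].
        split; [intros w Hw; now apply in_emp in Hw|]. intros x y E Hn. exfalso. eauto. }
    destruct H3 as (d3 & S3 & Q3 & H3). exists (cup (cup d1 d2) d3). split; [now apply small_cup|]. split.
    - intros w [[Hw|Hw]%in_cup|Hw]%in_cup; auto.
    - split; [|split].
      + exists d1. repeat split; auto. intros w Hw. rewrite !in_cup. auto.
      + exists d2. repeat split; auto. intros w Hw. rewrite !in_cup. auto.
      + intros x y E Hn. destruct (H3 x y E Hn) as (z & Hz & ?). exists z. rewrite in_cup. auto. }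
  { intros z. apply in_power. }
  assert (HBN : forall N, (forall x y, x ∈ N -> y ∈ N -> exists z, z ∈ N /\ forall w, w ∈ z <-> w ∈ x /\ w ∈ y) ->
    (forall s, small I s -> subset s B -> exists d, d ∈ N /\ subset s d /\ subset d B) ->
    forall b, b ∈ N -> small I b -> exists z, z ∈ N /\ forall w, w ∈ z <-> w ∈ B /\ w ∈ b).
  { intros N HM HC b Hb Hsb. assert (Hdf : def1 (fun w => w ∈ b)) by df.
    destruct (HC (sep B (fun w => w ∈ b))) as (d & Hd & Hsd & HdB).
    - apply (small_sub I b); auto. intros w Hw. apply in_sep in Hw; tauto.
    - intros w Hw. apply in_sep in Hw; tauto.
    - destruct (HM d b Hd Hb) as (z & Hz & Ez). exists z. split; auto. intros w. rewrite Ez.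
      split; intros [H1 H2]; split; auto. apply Hsd, in_sep; auto. }
  assert (HB1 : B ∈ N1).
  { apply (P1 B Y); auto. apply HBN; auto. intros s Hs HsB'. destruct (HB s Hs HsB') as (d & Hd & H & _).
    destruct H as (d1 & ? & ? & ?). exists d1. repeat split; auto. intros w Hw. auto. }
  assert (HB2 : B ∈ N2).
  { apply (P2 B Y); auto. apply HBN; auto. intros s Hs HsB'. destruct (HB s Hs HsB') as (d & Hd & _ & H & _).
    destruct H as (d1 & ? & ? & ?). exists d1. repeat split; auto. intros w Hw. auto. }
  assert (HBe : extensional B).
  { intros x y Hx Hy H. apply NNPP. intros Hn. destruct hI0 as [i0 Hi0].
    destruct (HB (cup (sing x) (sing y))) as (d & Hd & _ & _ & H3).
    - apply small_cup; eauto using small_sing.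
    - intros w [->%in_sing| ->%in_sing]%in_cup; auto.
    - destruct (H3 x y) as (z & Hz & Hz'); auto. intros w. now rewrite in_cup, !in_sing. }
  destruct (M1 X B HX HB1) as (X' & HX' & EX').
  assert (HX2 : X' ∈ N2).
  { apply (D2 B X' (power I)); auto using in_power.
    - intros w Hw. now apply EX' in Hw.
    - apply (D1 B X' (power I)); auto using in_power. intros w Hw. now apply EX' in Hw. }
  destruct (M2 X' a HX2 Ha) as (z & Hz & Ez). exists z. split; auto.
  intros w. rewrite Ez, EX', Ea. split; [tauto|]. intros [H1 H2]. repeat split; auto.
  apply HaB, Ea. auto.
Qed.

Lemma approximation_sub N1 N2 : approximation I r N1 U -> approximation I r N2 U -> subset N1 N2.
Proof.
  intros A1 A2. pose proof A1 as (T1 & L1 & _). pose proof A2 as (T2 & L2 & _).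
  apply is_level_iff in hU as EU.
  assert (Step : forall y w, y ∈ U -> (forall v, v ∈ L y -> (v ∈ N1 <-> v ∈ N2)) -> subset w (L y) ->
    (w ∈ N1 <-> w ∈ N2)).
  { intros y w Hy Heq Hw.
    destruct (L1 y Hy) as (l & z & ->%is_level_iff & Hz & Ez).
    destruct (L2 y Hy) as (l & z2 & ->%is_level_iff & Hz2 & Ez2).
    assert (z2 = z).
    { apply ext. intros v. rewrite Ez, Ez2. split; intros [H1 H2]; split; auto; apply Heq; auto. }
    subst z2.
    assert (Ht : transitive_set z).
    { intros v [Hv1 Hv2]%Ez x Hx. apply Ez. split; [exact (L_trans y v Hv1 x Hx)|now apply (T1 v)]. }
    split; intros H.
    - apply (approximation_step N1 N2 z); auto. intros v Hv. apply Ez. split; auto. now apply (T1 w).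
    - apply (approximation_step N2 N1 z); auto. intros v Hv. apply Ez2. split; auto. now apply (T2 w). }
  assert (Claim : forall x, x ∈ U -> forall w, w ∈ L x -> (w ∈ N1 <-> w ∈ N2)).
  { apply (mem_ind (fun x => x ∈ U -> forall w, w ∈ L x -> (w ∈ N1 <-> w ∈ N2))); [df|].
    intros x IH Hx w (y & Hy & Hw)%in_L.
    assert (HyU : y ∈ U) by (rewrite EU in Hx |- *; exact (L_trans u x Hx y Hy)).
    exact (Step y w HyU (IH y Hy HyU) Hw). }
  intros x Hx. apply (Step x x); auto; [now apply T1| |apply sub_L].
  apply Claim. now apply T1.
Qed.
End Uniqueness.
End ClosedSets.

(** ** Grounds are approximated *)

(** Consequences in all models of ZFC, possibly with variables identified or exchanged, can
    be drawn under the forcing relation. *)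
Lemma forces_entails_ren (f : nat -> nat) phi psi :
  (forall N, ZFC N -> forall e, sat N (fun i => e (f i)) phi -> sat N e psi) ->
  forall M (hM : ZFC M) c p nu, is_poset M c -> cond M c p -> (forall i, is_name M c (nu i)) ->
  forces M c p (fun i => nu (f i)) phi -> forces M c p nu psi.
Proof.
  intros H M hM c p nu hc Hp Hnu.
  cut ((forall k, free k phi \/ free k psi -> is_name M c (nu k) /\ is_name M c (nu (f k))) ->
    forces M c p (fun i => nu (f i)) phi -> forces M c p nu psi); [auto|]. clear Hnu. revert hc Hp.
  apply (countable_reduction (fun M e => is_poset M (e 0) -> cond M (e 0) (e 1) ->
    (forall k, free k (And phi psi) -> is_name M (e 0) (e (2 + k)) /\ is_name M (e 0) (e (2 + f k))) ->
    forces M (e 0) (e 1) (fun i => e (2 + f i)) phi -> forces M (e 0) (e 1) (fun i => e (2 + i)) psi))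
    with (e := fun n => match n with 0 => c | 1 => p | S (S i) => nu i end); auto.
  - unfold uniform. apply dfn_imp; [dfn_tac|]. apply dfn_imp; [dfn_tac|].
    apply dfn_imp.
    + apply (dfn_finite _ _ _ (fun k => free k (And phi psi)) (bnd (And phi psi))); [apply free_bnd|].
      intros k. dfn_tac.
    + dfn_tac.
  - clear M hM c p nu. intros M hM Hcount e hc Hp Hn Hphi.
    apply (forces_by_extensions hc Hcount); auto.
    { intros i Hi. apply Hn. cbn [free]. auto. }
    intros G N val HG HGp HE _. pose proof (extension_ZFC hc HG HE) as hN.
    apply (H N hN). apply (truth_free hc HG HE phi (fun i => e (2 + f i))); eauto.
    intros i Hi. apply Hn. cbn [free]. auto.
Qed.

Lemma forces_entails phi psi : (forall N, ZFC N -> forall e, sat N e phi -> sat N e psi) ->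
  forall M (hM : ZFC M) c p nu, is_poset M c -> cond M c p -> (forall i, is_name M c (nu i)) ->
  forces M c p nu phi -> forces M c p nu psi.
Proof. intros H M hM c p nu. apply (forces_entails_ren (fun i => i)); auto. Qed.

Section Sets.
Context {W : structure} {hW : ZF W}.
Implicit Types a b x y z I J B D E N X Y U d f g i r : W.

(** A level of the hierarchy whose index is closed under power sets. *)
Lemma pair_closed_superset x : exists I, subset x I /\ forall i k, i ∈ I -> k ∈ I -> pr i k ∈ I.
Proof.
  destruct (closure_under power x) as (s & Hx & Hs); [df|].
  assert (Hu : forall a b, a ∈ L s -> b ∈ L s -> upair a b ∈ L s).
  { intros a b (u & Hu & Ha)%in_L (v & Hv & Hb)%in_L.
    assert (K : forall u v a b, v ∈ s -> subset (L u) (L v) -> subset a (L u) -> subset b (L v) ->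
      upair a b ∈ L s).
    { clear a b u v Ha Hb Hu Hv. intros u v a b Hv Huv Ha Hb. apply in_L. exists (power v). split; auto.
      intros w [-> | ->]%in_upair; apply in_L; exists v; (split; [now apply in_power; intros ? ?|]); auto.
      intros w Hw. auto. }
    destruct (rank_linear u v) as [H|H].
    - replace (upair a b) with (upair b a) by (apply ext; intros w; rewrite !in_upair; tauto).
      apply (K v u); auto. now apply L_le.
    - apply (K u v); auto. }
  exists (L s). split.
  - intros y Hy. apply (L_le s x); [now apply mem_L|now apply mem_L].
  - intros i k Hi Hk. unfold pr, sing. auto.
Qed.

Lemma small_trans I A d : small I A -> small A d -> small I d.
Proof.
  intros (f & F1 & F2) (g & G1 & G2).
  apply (small_intro _ _ (fun i y => exists a, pair_in i a f /\ pair_in a y g)); [df| |].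
  - intros i y y' (a & H1 & H2) (a' & H3 & H4). rewrite (F1 i a' a) in H4 by auto. eauto.
  - intros y Hy. destruct (G2 y Hy) as (a & Ha & H1). destruct (F2 a Ha) as (i & Hi & H2). eauto 6.
Qed.

Lemma small_self I a : subset a I -> small I a.
Proof.
  intros H. apply (small_intro _ _ (fun i y => y = i)); [df|congruence|]. intros y Hy. eauto.
Qed.

Lemma small_prod I A B : (forall i k, i ∈ I -> k ∈ I -> pr i k ∈ I) -> small I A -> small I B ->
  small I (prod A B).
Proof.
  intros HI (f & F1 & F2) (g & G1 & G2).
  apply (small_intro _ _ (fun i y => exists i1 i2 a b, i = pr i1 i2 /\ y = pr a b /\
    pair_in i1 a f /\ pair_in i2 b g)); [df| |].
  - intros i y y' (i1 & i2 & a & b & -> & -> & A1 & A2) (k1 & k2 & a' & b' & E & -> & B1 & B2).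
    apply pr_inj in E as [<- <-]. f_equal; eauto.
  - intros y (a & b & Ha & Hb & ->)%in_prod.
    destruct (F2 a Ha) as (i & Hi & H1), (G2 b Hb) as (k & Hk & H2). exists (pr i k). eauto 10.
Qed.
End Sets.

Section RankAbsoluteness.
Context {M W : structure} {hM : ZF M} {hW : ZF W} {j : M -> W}.
Hypothesis hj : trans_embedding M W j.

(** Ranks are absolute although the embedding is not definable: the induction runs over the
    image of the graph of [L] on a transitive set, tested against the image of another. *)
Lemma te_level x y : j y ∈ L (j x) <-> y ∈ L x.
Proof.
  set (f := graph L (trcl (sing x))). set (B := trcl (sing y)).
  assert (Hf : forall u v, pr u v ∈ f <-> u ∈ trcl (sing x) /\ v = L u) by (intros; apply in_graph; df).
  assert (K : forall u, forall v, pr u v ∈ j f -> forall z, z ∈ j B -> (z ∈ v <-> z ∈ L u)).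
  { apply (mem_ind (fun u => forall v, pr u v ∈ j f -> forall z, z ∈ j B -> (z ∈ v <-> z ∈ L u))); [df|].
    intros u0 IH v0 Hv z0 Hz.
    destruct (te_pr_in_inv hj u0 v0 f Hv) as (u & v & -> & -> & [Hu ->]%Hf).
    apply (te_in hj) in Hz as (z & Hz & ->). rewrite (te_mem hj), !in_L.
    assert (E : forall w, w ∈ u -> (subset z (L w) <-> subset (j z) (L (j w)))).
    { intros w Hw.
      assert (IHw : forall z', z' ∈ B -> (z' ∈ L w <-> j z' ∈ L (j w))).
      { intros z' Hz'. rewrite <- (te_mem hj z' (L w)). apply IH; [now apply (te_mem hj)| |now apply (te_mem hj)].
        apply (te_pr_in hj), Hf. split; auto. exact (trcl_trans _ u Hu w Hw). }
      split.
      - intros H z'0 Hz'. apply (te_in hj) in Hz' as (z' & Hz' & ->).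
        apply IHw; auto. exact (trcl_trans _ z Hz z' Hz').
      - intros H z' Hz'. apply IHw; [exact (trcl_trans _ z Hz z' Hz')|]. apply H. now apply (te_mem hj). }
    split.
    - intros (w & Hw & Hs). exists (j w). rewrite (te_mem hj). split; auto. now apply E.
    - intros (w0 & Hw & Hs). apply (te_in hj) in Hw as (w & Hw & ->). exists w. split; auto. now apply E. }
  rewrite <- (te_mem hj y (L x)). symmetry. apply K.
  - apply (te_pr_in hj), Hf. split; auto. now apply trcl_sub, in_sing.
  - apply (te_mem hj). now apply trcl_sub, in_sing.
Qed.

Lemma value_rank (g : W) t : subset (value g t) (L t).
Proof.
  revert t. apply (trcl_ind (fun t => subset (value g t) (L t))); [df|].
  intros t IH w (pi & p & Hpi & Hp & ->)%in_value. apply in_L. exists (pr pi p). split; auto.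
  intros z Hz. apply (IH pi (mem_dom_trcl pi p t Hpi)) in Hz. revert z Hz. apply L_le.
  apply (L_trans _ (sing pi)); [|now apply in_sing]. apply mem_L. apply in_upair. auto.
Qed.
End RankAbsoluteness.

Section GroundApproximations.
Context {M W : structure} {hM : ZFC M} {hW : ZFC W}.
Context {c : M} {G : M -> Prop} {j : M -> W} {g : W}.
Hypothesis hc : is_poset M c.
Hypothesis hG : generic_filter M c G.
Hypothesis hg : ground_of M c G W j g.
Let hj : trans_embedding M W j := go_emb hg.
Let truth_at phi nu := ground_of_truth hc hG hg phi nu.

(** A set of the extension has rank at most that of its name; a member of the transitive
    closure of the name that is minimal with at least the rank of [x] has the same
    rank. *)
Lemma level_of_ground (x : W) : exists t : M, L x = L (j t).
Proof.
  destruct (go_values hg x) as (tau & _ & Hx).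
  assert (Hsub : subset x (L (j tau))) by (rewrite <- Hx; apply value_rank).
  set (S := sep (trcl (sing (j tau))) (fun y => subset (L x) (L y))).
  assert (HS : forall y, y ∈ S <-> y ∈ trcl (sing (j tau)) /\ subset (L x) (L y)).
  { intros y. unfold S. rewrite in_sep; [tauto|df]. }
  destruct (ax_foundation S) as (y & Hy & Hmin).
  { exists (j tau). apply HS. split; [now apply trcl_sub, in_sing|]. now apply L_mono. }
  apply HS in Hy as [Hy1 Hy2].
  assert (HyN : exists t, y = j t).
  { assert (H : subset (trcl (sing (j tau))) (j (trcl (sing tau)))).
    { apply trcl_least.
      - apply (te_transitive_set hj), trcl_trans.
      - rewrite <- (te_sing hj). apply (te_subset hj), trcl_sub. }
    apply H, (te_in hj) in Hy1 as (t & _ & ->). eauto. }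
  destruct HyN as [t ->]. exists t. apply ext. intros z. split; [apply Hy2|]. revert z. apply L_mono.
  intros z Hz. destruct (rank_linear x z) as [H|H]; [exact H|]. exfalso. apply Hmin. exists z. split; auto.
  apply HS. split; auto. exact (trcl_trans _ _ Hy1 z Hz).
Qed.

Lemma level_trace (x : W) : exists l : M, forall y, j y ∈ L x <-> y ∈ l.
Proof. destruct (level_of_ground x) as [t ->]. exists (L t). intros y. apply (te_level hj). Qed.

Lemma forces_check_mem p x y : cond M c p -> (forces_mem M c p (check c x) (check c y) <-> x ∈ y).
Proof.
  intros Hp. split.
  - intros H. rewrite fmem_iff in H.
    destruct (H p (le_refl hc p Hp)) as (q & pi & s & Hq & Hpi & _ & Hf).
    apply in_check in Hpi as (z & Hz & E). apply pr_inj in E as [-> ->].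
    apply (feq_check_inj hc) in Hf; [now subst|]. apply (le_cond hc) in Hq. tauto.
  - intros H. apply (fmem_intro hc (check c x) (one c)); [now apply check_name| |now apply one_max].
    apply in_check. eauto.
Qed.

(** For each condition that does not decide [X] choose an element of [Y] at which it does not.
    The set [a] of these elements is in the ground and small, hence the trace of [X] on it
    is in the ground, and the condition forcing what this trace is decides [X]. *)
Lemma ground_approximates (X : W) (Y : M) (C : M) : subset X (j Y) -> (forall p, cond M c p -> p ∈ C) ->
  (forall a : M, subset a Y -> small C a -> exists b, forall y, y ∈ b <-> j y ∈ X /\ y ∈ a) ->
  exists X', X = j X'.
Proof.
  intros HX HC Ha. destruct (go_values hg X) as (rho & Hrho & HXrho).
  set (dec := fun p y => forces_mem M c p (check c y) rho \/
    forall q, le M c q p -> ~ forces_mem M c q (check c y) rho).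
  assert (Hdec : def2 dec) by (unfold dec; df).
  destruct (choice_function (fun p y => y ∈ Y /\ ~ dec p y)
    (sep C (fun p => cond M c p /\ exists y, y ∈ Y /\ ~ dec p y))) as (f & F1 & _ & F2 & F3); [df| |].
  { intros p Hp. apply in_sep in Hp as (_ & _ & y & Hy); [eauto|df]. }
  set (a := sep Y (fun y => exists p, pr p y ∈ f)).
  assert (HaY : forall y, y ∈ a <-> y ∈ Y /\ exists p, pr p y ∈ f).
  { intros y. unfold a. rewrite in_sep; [tauto|df]. }
  destruct (Ha a) as (b & Hb).
  { intros y Hy. now apply HaY in Hy. }
  { apply (small_intro _ _ (fun p y => pr p y ∈ f)); [df|exact F1|].
    intros y (_ & p & Hp)%HaY. exists p. split; auto. apply F2 in Hp as [Hp _].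
    apply in_sep in Hp; [tauto|df]. }
  (* variables: 0 for X, 1 for a, 2 for b, 3 for a common element *)
  set (th := All 3 (Iff (Mem 3 2) (And (Mem 3 0) (Mem 3 1)))).
  assert (Hth : forall (N : structure) (e : nat -> N),
    sat N e th <-> forall w, w ∈ e 2 <-> w ∈ e 0 /\ w ∈ e 1).
  { intros N e. unfold th. apply iff_All. intros w.
    apply iff_Iff; [|apply iff_And]; cbn [sat upd Nat.eqb]; tauto. }
  set (nu := fun y n => match n with 0 => rho | 1 => check c a | 2 => check c b | _ => check c y end).
  assert (Hnu : forall y i, is_name M c (nu y i)).
  { intros y i. unfold nu. destruct i as [|[|[|]]]; auto; now apply check_name. }
  assert (HXin : forall x, x ∈ X -> exists y, x = j y /\ y ∈ Y).
  { intros x Hx. apply HX, (te_in hj) in Hx as (y & ? & ->). eauto. }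
  assert (Hcheck : forall x, value g (j (check c x)) = j x).
  { intros x. apply (value_check hj hc hG (go_filter hg)). }
  assert (Hsat : sat W (fun i => value g (j (nu emp i))) th).
  { apply Hth. intros w. cbn [nu]. rewrite HXrho, !Hcheck. split.
    - intros H. apply (te_in hj) in H as (y & Hy & ->). rewrite (te_mem hj). now apply Hb.
    - intros [H1 H2]. apply (te_in hj) in H2 as (y & Hy & ->). apply (te_mem hj), Hb. auto. }
  apply truth_at in Hsat; [|intros i _; apply Hnu]. destruct Hsat as (p & HGp & Hp).
  assert (Hcp : cond M c p) by now apply (gf_cond hG).
  assert (Hpy : forall y q, le M c q p -> forces M c q (nu y) th).
  { intros y q Hq. exact (forces_mono hc th p q (nu y) Hq Hp). }
  assert (Hdecided : forall y, y ∈ a -> dec p y).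
  { intros y Hy. pose proof (proj1 (HaY y) Hy) as [HyY _]. destruct (classic (y ∈ b)) as [Hyb|Hyb]; [left|right].
    - assert (H : forces M c p (nu y) (And th (Mem 3 2))).
      { split; [apply Hpy; now apply le_refl|]. now apply forces_check_mem. }
      apply (forces_entails (And th (Mem 3 2)) (Mem 3 0)) in H; auto.
      intros N hN e [H1 H2]. exact (proj1 (proj1 (proj1 (Hth N e) H1 _) H2)).
    - intros q Hq Hqy. assert (Hcq : cond M c q) by (apply (le_cond hc) in Hq; tauto).
      assert (H : forces M c q (nu y) (And th (And (Mem 3 0) (Mem 3 1)))).
      { split; [now apply Hpy|]. split; [exact Hqy|]. now apply forces_check_mem. }
      apply (forces_entails (And th (And (Mem 3 0) (Mem 3 1))) (Mem 3 2)) in H; auto.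
      + apply Hyb. now apply (forces_check_mem q y b Hcq).
      + intros N hN e [H1 H2]. exact (proj2 (proj1 (Hth N e) H1 _) H2). }
  assert (Hall : forall y, y ∈ Y -> dec p y).
  { intros y Hy. apply NNPP. intros N. destruct (F3 p) as (z & Hz).
    { apply in_sep; [df|]. split; auto. split; auto. eauto. }
    pose proof (proj2 (F2 _ _ Hz)) as [Hz1 Hz2]. apply Hz2, Hdecided, HaY. eauto. }
  exists (sep Y (fun y => forces_mem M c p (check c y) rho)).
  assert (Hval : forall y, j y ∈ X <-> exists q, G q /\ forces_mem M c q (check c y) rho).
  { intros y. rewrite <- (Hcheck y), <- HXrho. 
    apply (truth_at (Mem 3 0) (nu y)). auto. }
  assert (Hd1 : def1 (fun y => forces_mem M c p (check c y) rho)) by df.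
  apply ext. intros x. rewrite (te_in hj). split.
  - intros Hx. destruct (HXin x Hx) as (y & -> & Hy). exists y. split; auto. apply in_sep; auto. split; auto.
    apply Hval in Hx as (q & Hq & Hqy). destruct (Hall y Hy) as [H|H]; auto. exfalso.
    destruct (filter_common hG p q HGp Hq) as (r & _ & _ & Hrp & Hrq).
    apply (H r Hrp). now apply (fmem_mono hc q).
  - intros (y & Hy & ->). apply in_sep in Hy as [_ Hy]; auto. apply Hval. eauto.
Qed.
End GroundApproximations.

Lemma free_fPairIn i : free i (fPairIn 1 2 0) -> i = 0 \/ i = 1 \/ i = 2.
Proof. unfold fPairIn. cbv zeta. cbn. intuition lia. Qed.

Section GroundApproximations2.
Context {M W : structure} {hM : ZFC M} {hW : ZFC W}.
Context {c : M} {G : M -> Prop} {j : M -> W} {g : W}.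
Hypothesis hc : is_poset M c.
Hypothesis hG : generic_filter M c G.
Hypothesis hg : ground_of M c G W j g.
Let hj : trans_embedding M W j := go_emb hg.
Let truth_at phi nu := ground_of_truth hc hG hg phi nu.

(** A condition and a name in [S] determine at most one value of [F], once the condition forces
    [F] to be a function; collecting these values over all conditions covers [a]. *)
Lemma ground_covers (F a : W) (Y S C : M) :
  (forall i y y', pair_in i y F -> pair_in i y' F -> y = y') -> subset a (j Y) ->
  (forall s, s ∈ S -> is_name M c s) -> (forall p, cond M c p -> p ∈ C) ->
  (forall y, y ∈ a -> exists s, s ∈ S /\ pair_in (value g (j s)) y F) ->
  exists d, subset d Y /\ subset a (j d) /\ small (prod S C) d.
Proof.
  intros HF HaY HS HC Ha. destruct (go_values hg F) as (rho & Hrho & HFrho).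
  destruct (formula_with_free (fun W e => forall i y y', pair_in i y (e 0) -> pair_in i y' (e 0) -> y = y')
    (fun i => i = 0)) as (phi & Hphi & Hfree).
  { unfold uniform. dfn_tac. }
  { intros N e e' E H. rewrite <- (E 0); auto. }
  assert (Hcheck : forall x, value g (j (check c x)) = j x).
  { intros x. apply (value_check hj hc hG (go_filter hg)). }
  assert (HsF : sat W (fun i => value g (j ((fun _ => rho) i))) phi).
  { apply Hphi. rewrite HFrho. exact HF. }
  apply truth_at in HsF; [|auto]. destruct HsF as (p0 & HGp0 & Hp0).
  set (nu := fun s y (n : nat) => match n with 0 => rho | 1 => s | _ => check c y end).
  set (H := fun s p y => le M c p p0 /\ forces M c p (nu s y) (fPairIn 1 2 0)).
  assert (HH : def3 H) by (unfold H, nu; df).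
  assert (HHf : forall s p y y', is_name M c s -> H s p y -> H s p y' -> y = y').
  { intros s p y y' Hs [Hle H1] [_ H2]. assert (Hp : cond M c p) by (apply (le_cond hc) in Hle; tauto).
    set (nu' := fun n => match n with 0 => rho | 1 => s | 2 => check c y | _ => check c y' end).
    assert (Hn : forall i, is_name M c (nu' i)).
    { intros i. unfold nu'. destruct i as [|[|[|]]]; auto; now apply check_name. }
    assert (K : forces M c p nu' (And phi (And (fPairIn 1 2 0) (fPairIn 1 3 0)))).
    { split; [|split].
      - apply (forces_mono hc phi p0); auto. eapply forces_ext; [|exact Hp0].
        intros i Hi. now rewrite (Hfree i Hi).
      - eapply forces_ext; [|exact H1]. intros i Hi. apply free_fPairIn in Hi as [-> |[-> | ->]]; auto.
      - apply (forces_entails_ren (fun i => match i with 2 => 3 | _ => i end) (fPairIn 1 2 0)); auto. }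
    apply (forces_entails _ (Eq 2 3)) in K; auto; [now apply (feq_check_inj hc) in K|].
    intros N hN e (K1 & K2 & K3). rewrite sat_fPairIn in K2, K3. exact (proj2 (Hphi N e) K1 _ _ _ K2 K3). }
  set (D := fun y => exists s p, s ∈ S /\ p ∈ C /\ H s p y).
  assert (HD : def1 D).
  { unfold D. df. }
  exists (sep Y D). split; [|split].
  - intros y Hy. now apply in_sep in Hy.
  - intros y Hy. pose proof (HaY y Hy) as Hy'. apply (te_in hj) in Hy' as (y' & Hy' & ->).
    apply (te_mem hj), in_sep; auto. split; auto. destruct (Ha _ Hy) as (s & Hs & Hsy).
    assert (K : sat W (fun i => value g (j (nu s y' i))) (fPairIn 1 2 0)).
    { apply sat_fPairIn. cbn [nu]. now rewrite Hcheck, HFrho. }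
    apply truth_at in K.
    2:{ intros i _. unfold nu. destruct i as [|[|]]; auto; now apply check_name. }
    destruct K as (p & HGp & Hp). destruct (filter_common hG p p0 HGp HGp0) as (r & _ & Hr & Hr1 & Hr2).
    exists s, r. split; auto. split; auto. split; auto. now apply (forces_mono hc _ p).
  - apply (small_intro _ _ (fun i y => exists s p, s ∈ S /\ i = pr s p /\ H s p y)).
    + df.
    + intros i y y' (s & p & Hs & -> & H1) (s' & p' & Hs' & E & H2). apply pr_inj in E as [<- <-].
      apply (HHf s p); auto.
    + intros y Hy. apply in_sep in Hy as [_ (s & p & Hs & Hp & Hsp)]; auto. exists (pr s p).
      rewrite pr_in_prod. split; auto. exists s, p. auto.
Qed.

Lemma small_up (I a : M) : small I a -> small (j I) (j a).
Proof.
  intros (f & F1 & F2). exists (j f). split.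
  - intros i y y' H H'. rewrite pair_in_iff in H, H'.
    apply (te_pr_in_inv hj) in H as (i1 & y1 & -> & -> & H).
    apply (te_pr_in_inv hj) in H' as (i2 & y2 & E & -> & H').
    apply (te_inj hj) in E as <-. f_equal. apply (F1 i1); now apply pair_in_iff.
  - intros y Hy. apply (te_in hj) in Hy as (y' & Hy & ->).
    destruct (F2 y' Hy) as (i & Hi & H). exists (j i). rewrite (te_mem hj), pair_in_iff, (te_pr_in hj).
    now rewrite pair_in_iff in H.
Qed.

(** The cover property; the names in question are those of the elements of [I]. *)
Lemma ground_small_cover (I C Y : M) (a : W) : (forall i k, i ∈ I -> k ∈ I -> pr i k ∈ I) ->
  subset C I -> (forall p, cond M c p -> p ∈ C) -> subset a (j Y) -> small (j I) a ->
  exists d, subset d Y /\ subset a (j d) /\ small I d.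
Proof.
  intros HI HCI HC HaY (F & F1 & F2).
  destruct (replacement (fun i s => s = check c i) I) as [S HS]; [df|congruence|].
  destruct (ground_covers F a Y S C) as (d & D1 & D2 & D3); auto.
  - intros s Hs. apply HS in Hs as (i & _ & ->). now apply check_name.
  - intros y Hy. destruct (F2 y Hy) as (i & Hi & H). apply (te_in hj) in Hi as (i' & Hi' & ->).
    exists (check c i'). split; [apply HS; eauto|]. now rewrite (value_check hj hc hG (go_filter hg)).
  - exists d. repeat split; auto. apply (small_trans I (prod S C)); auto. apply small_prod; auto.
    + apply (small_intro _ _ (fun i s => s = check c i)); [df|congruence|].
      intros s (i & Hi & ->)%HS. eauto.
    + now apply small_self.
Qed.

(** A surjection from subsets of [I] in the extension becomes one from pairs of a name for such
    a subset and a condition. *)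
Lemma ground_small_power (I C B J : M) (K : W) : (forall i k, i ∈ J -> k ∈ J -> pr i k ∈ J) ->
  (forall p, cond M c p -> p ∈ C) -> subset C J -> subset (power (prod I C)) J ->
  (forall z, z ∈ K -> subset z (j I)) -> small K (j B) -> small J B.
Proof.
  intros HJ HC HCJ HPJ HK (F & F1 & F2).
  (* the name of a subset of [I] given by the set [x] of pairs *)
  set (nm := fun x s => forall w, w ∈ s <-> exists i p, pr i p ∈ x /\ cond M c p /\ w = pr (check c i) p).
  assert (Hnm : def2 nm) by (unfold nm; df).
  assert (Hnf : forall x s s', nm x s -> nm x s' -> s = s').
  { intros x s s' H H'. apply ext. intros w. now rewrite (H w), (H' w). }
  assert (Hne : forall x, exists s, nm x s).
  { intros x. destruct (replacement (fun w v => exists i p, w = pr i p /\ cond M c p /\ v = pr (check c i) p) x)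
      as [s Hs]; [df| |].
    - intros u v v' _ (i & p & -> & _ & ->) (i' & p' & E & _ & ->). now apply pr_inj in E as [<- <-].
    - exists s. intros w. rewrite Hs. split.
      + intros (u & Hu & i & p & -> & Hp & ->). eauto.
      + intros (i & p & Hx & Hp & ->). eauto 7. }
  destruct (replacement nm (power (prod I C))) as [S HS]; auto.
  { intros u v v' _. apply Hnf. }
  assert (HSn : forall s, s ∈ S -> is_name M c s).
  { intros s (x & _ & Hx)%HS. apply name_intro. intros w (i & p & _ & Hp & ->)%Hx.
    exists (check c i), p. repeat split; auto. now apply check_name. }
  assert (Hsurj : forall z, z ∈ K -> exists s, s ∈ S /\ value g (j s) = z).
  { intros z Hz. destruct (go_values hg z) as (tau & Htau & Ez).
    assert (Hdf : def1 (fun w => exists i p, w = pr i p /\ forces_mem M c p (check c i) tau)) by df.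
    set (x := sep (prod I C) (fun w => exists i p, w = pr i p /\ forces_mem M c p (check c i) tau)).
    assert (Hx : forall i p, pr i p ∈ x <-> i ∈ I /\ p ∈ C /\ forces_mem M c p (check c i) tau).
    { intros i p. unfold x. rewrite in_sep, pr_in_prod by auto. split.
      - intros ((? & ?) & i' & p' & E & Hf). apply pr_inj in E as [-> ->]. auto.
      - intros (? & ? & ?). eauto 6. }
    destruct (Hne x) as [s Hs]. exists s.
    assert (HsS : s ∈ S).
    { apply HS. exists x. split; auto. apply in_power. intros w Hw. now apply in_sep in Hw. }
    split; auto.
    assert (Htr : forall i, j i ∈ z <-> exists p, G p /\ forces_mem M c p (check c i) tau).
    { intros i. rewrite <- Ez, <- (value_check hj hc hG (go_filter hg) i).
      apply (truth_at (Mem 0 1) (fun n => match n with 0 => check c i | _ => tau end)).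
      intros [|n] _; auto. now apply check_name. }
    apply ext. intros w. rewrite (in_value_name hj (go_filter hg)). split.
    - intros (pi & p & Hw & HGp & ->). apply Hs in Hw as (i & p' & Hip & Hp & E).
      apply pr_inj in E as [-> ->]. rewrite (value_check hj hc hG (go_filter hg)). apply Htr.
      apply Hx in Hip as (_ & _ & Hf). eauto.
    - intros Hw. pose proof (HK z Hz w Hw) as Hw'. apply (te_in hj) in Hw' as (i & Hi & ->).
      apply Htr in Hw as (p & HGp & Hp). pose proof (gf_cond hG p HGp) as Hcp.
      exists (check c i), p. split; [|split; auto].
      + apply Hs. exists i, p. rewrite Hx. auto.
      + now rewrite (value_check hj hc hG (go_filter hg)). }
  destruct (ground_covers F (j B) B S C) as (d & D1 & D2 & D3); auto.
  { intros y Hy; auto. }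
  { intros y Hy. destruct (F2 y Hy) as (z & Hz & H). destruct (Hsurj z Hz) as (s & Hs & Ez).
    exists s. rewrite Ez. auto. }
  apply (small_sub J d). { apply (te_subset hj); auto. }
  apply (small_trans J (prod S C)); auto. apply small_prod; auto; [|now apply small_self].
  apply (small_trans J (power (prod I C))); [now apply small_self|].
  apply (small_intro _ _ nm); auto. intros s (x & Hx & Hn)%HS. eauto.
Qed.

Lemma te_pair_in a b z : pair_in a b (j z) <-> exists x y, a = j x /\ b = j y /\ pair_in x y z.
Proof.
  rewrite pair_in_iff. split.
  - intros H. apply (te_pr_in_inv hj) in H as (x & y & -> & -> & H). apply pair_in_iff in H. eauto.
  - intros (x & y & -> & -> & H). apply pair_in_iff in H. now apply (te_pr_in hj).
Qed.
Lemma te_pair_in' x y z : pair_in (j x) (j y) (j z) <-> pair_in x y z.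
Proof. now rewrite !pair_in_iff, (te_pr_in hj). Qed.

Lemma coded_up (r B X : M) : coded r B X -> coded (j r) (j B) (j X).
Proof.
  intros (h & D & E & R & HD & HE & HR & H1 & H2 & H3 & H4 & H5 & H6).
  exists (j h), (j D), (j E), (j R). rewrite !(te_mem hj). do 3 (split; [assumption|]).
  split; [|split; [|split; [|split; [|split]]]].
  - intros i y y' (i1 & y1 & -> & -> & A)%te_pair_in (i2 & y2 & E1 & -> & A')%te_pair_in.
    apply (te_inj hj) in E1 as <-. f_equal. eauto.
  - intros i y (i1 & y1 & -> & -> & A)%te_pair_in. rewrite !(te_mem hj). auto.
  - intros i Hi. apply (te_in hj) in Hi as (i' & Hi & ->). destruct (H3 i' Hi) as [y Hy].
    exists (j y). now apply te_pair_in'.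
  - intros y Hy. apply (te_in hj) in Hy as (y' & Hy & ->). destruct (H4 y' Hy) as [i Hi].
    exists (j i). now apply te_pair_in'.
  - intros i k x y (i1 & x1 & -> & -> & A)%te_pair_in (k1 & y1 & -> & -> & A')%te_pair_in.
    rewrite te_pair_in', (te_mem hj). eauto.
  - intros i x (i1 & x1 & -> & -> & A)%te_pair_in. rewrite !(te_mem hj). eauto.
Qed.

Lemma coded_intro (J B X : M) : (forall i k, i ∈ J -> k ∈ J -> pr i k ∈ J) ->
  small J B -> subset X B -> coded (j (power J)) (j B) (j X).
Proof.
  intros HJ (h & H1 & H2) HX. apply coded_up.
  set (gg := sep (prod J B) (fun w => w ∈ h)).
  assert (Hgg : forall i y, pair_in i y gg <-> i ∈ J /\ y ∈ B /\ pair_in i y h).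
  { intros i y. unfold gg. rewrite !pair_in_iff, in_sep, pr_in_prod; [tauto|df]. }
  assert (P1 : def1 (fun i => exists y, pair_in i y gg)) by df.
  assert (P2 : def1 (fun w => exists i k x y, w = pr i k /\ pair_in i x gg /\ pair_in k y gg /\ x ∈ y)) by df.
  assert (P3 : def1 (fun i => exists x, pair_in i x gg /\ x ∈ X)) by df.
  exists gg, (sep J (fun i => exists y, pair_in i y gg)),
    (sep J (fun w => exists i k x y, w = pr i k /\ pair_in i x gg /\ pair_in k y gg /\ x ∈ y)),
    (sep J (fun i => exists x, pair_in i x gg /\ x ∈ X)).
  rewrite !in_power.
  assert (Hfun : forall i y y', pair_in i y gg -> pair_in i y' gg -> y = y').
  { intros i y y' A A'. apply Hgg in A, A'. apply (H1 i); tauto. }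
  do 3 (split; [intros w Hw; apply in_sep in Hw; tauto|]).
  split; [exact Hfun|split; [|split; [|split; [|split]]]].
  - intros i y A. rewrite in_sep by auto. pose proof (proj1 (Hgg i y) A). split; [split; eauto; tauto|tauto].
  - intros i Hi. apply in_sep in Hi; tauto.
  - intros y Hy. destruct (H2 y Hy) as (i & Hi & A). exists i. apply Hgg. auto.
  - intros i k x y A A'. rewrite pair_in_iff, in_sep by auto. split.
    + intros [_ (i' & k' & x' & y' & E & B1 & B2 & B3)]. apply pr_inj in E as [<- <-].
      now rewrite (Hfun i x x'), (Hfun k y y').
    + intros Hxy. split; [|exists i, k, x, y; auto]. apply Hgg in A, A'. apply HJ; tauto.
  - intros i x A. rewrite in_sep by auto. split.
    + intros [_ (x' & B1 & B2)]. now rewrite (Hfun i x x').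
    + intros Hx. split; [apply Hgg in A; tauto|eauto].
Qed.

(** As membership on [B] is extensional, the enumeration of [B] is the only solution of a
    recursion along the coded relation, which can be solved in the ground. *)
Lemma coded_elim (r B : M) (X : W) : extensional (j B) -> coded (j r) (j B) X -> subset X (j B) ->
  exists X', X = j X'.
Proof.
  intros HB (h & D0 & E0 & R0 & HD & HE & HR & H1 & H2 & H3 & H4 & H5 & H6) HX.
  apply (te_in hj) in HD as (D & _ & ->), HE as (E & _ & ->), HR as (R & _ & ->).
  set (Phi := fun w T => exists i y, w = pr i y /\
    (forall k, k ∈ D -> pair_in k i E -> exists z, z ∈ B /\ z ∈ y /\ pair_in k z T) /\
    (forall z, z ∈ B -> z ∈ y -> exists k, k ∈ D /\ pair_in k i E /\ pair_in k z T)).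
  destruct (least_fixpoint Phi (prod D B)) as (T & HT & _).
  { unfold Phi. df. }
  { intros w T T' HTT (i & y & -> & A1 & A2). exists i, y. split; [reflexivity|]. split.
    - intros k Hk Hki. destruct (A1 k Hk Hki) as (z & ? & ? & Hz). rewrite pair_in_iff in Hz.
      exists z. rewrite pair_in_iff. auto.
    - intros z Hz Hzy. destruct (A2 z Hz Hzy) as (k & ? & ? & Hk). rewrite pair_in_iff in Hk.
      exists k. rewrite (pair_in_iff k z). auto. }
  assert (HT' : forall i y, i ∈ D -> y ∈ B -> (pair_in i y T <->
    (forall k, k ∈ D -> pair_in k i E -> exists z, z ∈ B /\ z ∈ y /\ pair_in k z T) /\
    (forall z, z ∈ B -> z ∈ y -> exists k, k ∈ D /\ pair_in k i E /\ pair_in k z T))).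
  { intros i y Hi Hy. rewrite (pair_in_iff i y), HT, pr_in_prod. split.
    - intros (_ & i' & y' & Eq & A). apply pr_inj in Eq as [<- <-]. exact A.
    - intros A. split; auto. exists i, y. auto. }
  assert (K : forall y, y ∈ j B -> forall i, i ∈ j D -> (pair_in i y (j T) <-> pair_in i y h)).
  { apply (mem_ind (fun y => y ∈ j B -> forall i, i ∈ j D -> (pair_in i y (j T) <-> pair_in i y h))); [df|].
    intros y0 IH Hy0 i0 Hi0. apply (te_in hj) in Hy0 as (y & Hy & ->), Hi0 as (i & Hi & ->).
    rewrite te_pair_in', (HT' i y Hi Hy). split.
    - intros [A1 A2]. destruct (H3 (j i)) as [y1 Hy1]; [now apply (te_mem hj)|].
      replace (j y) with y1; auto. apply HB; [apply (H2 _ _ Hy1)|now apply (te_mem hj)|].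
      intros z Hz. destruct (H4 z Hz) as [k0 Hk0]. pose proof (proj1 (H2 _ _ Hk0)) as Hk.
      apply (te_in hj) in Hk as (k & Hk & ->).
      rewrite <- (H5 _ _ _ _ Hk0 Hy1), te_pair_in'. split.
      + intros Hki. destruct (A1 k Hk Hki) as (z' & Hz' & Hzy & HzT).
        assert (Hkz : pair_in (j k) (j z') h).
        { apply IH; try now apply (te_mem hj). now apply te_pair_in'. }
        rewrite (H1 _ _ _ Hk0 Hkz). now apply (te_mem hj).
      + intros Hzy. apply (te_in hj) in Hz as (z' & Hz' & ->).
        assert (Hzy' : z' ∈ y) by now apply (te_mem hj).
        destruct (A2 z' Hz' Hzy') as (k' & Hk' & Hki & HkT).
        assert (Hkz : pair_in (j k') (j z') h).
        { apply IH; try now apply (te_mem hj). now apply te_pair_in'. }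
        apply te_pair_in'. apply (H5 _ _ _ _ Hk0 Hy1).
        apply (H5 _ _ _ _ Hkz Hy1). now apply te_pair_in'.
    - intros Hiy. split.
      + intros k Hk Hki. destruct (H3 (j k)) as [z0 Hz0]; [now apply (te_mem hj)|].
        pose proof (proj2 (H2 _ _ Hz0)) as Hz. apply (te_in hj) in Hz as (z & Hz & ->).
        assert (Hzy : j z ∈ j y) by (apply (H5 _ _ _ _ Hz0 Hiy); now apply te_pair_in').
        exists z. split; auto. split; [now apply (te_mem hj)|]. apply te_pair_in'.
        apply IH; auto; now apply (te_mem hj).
      + intros z Hz Hzy. destruct (H4 (j z)) as [k0 Hk0]; [now apply (te_mem hj)|].
        pose proof (proj1 (H2 _ _ Hk0)) as Hk. apply (te_in hj) in Hk as (k & Hk & ->).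
        exists k. split; auto. split.
        * apply te_pair_in'. apply (H5 _ _ _ _ Hk0 Hiy). now apply (te_mem hj).
        * apply te_pair_in'. apply IH; auto; now apply (te_mem hj). }
  assert (Hdf : def1 (fun y => exists i, i ∈ R /\ i ∈ D /\ pair_in i y T)) by df.
  exists (sep B (fun y => exists i, i ∈ R /\ i ∈ D /\ pair_in i y T)).
  apply ext. intros x. rewrite (te_in hj). split.
  - intros Hx. pose proof (HX x Hx) as HxB. destruct (H4 x HxB) as [i0 Hi0].
    pose proof (proj1 (H2 _ _ Hi0)) as HiD. apply (te_in hj) in HiD as (i & Hi & ->).
    apply (te_in hj) in HxB as (y & Hy & ->). exists y. split; auto. apply in_sep; auto. split; auto.
    exists i. split; [|split; auto].
    + apply (te_mem hj). now apply (H6 _ _ Hi0).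
    + apply te_pair_in'. apply K; auto; now apply (te_mem hj).
  - intros (y & Hy & ->). apply in_sep in Hy as (Hy & i & Hi & HiD & HiT); auto.
    assert (A : pair_in (j i) (j y) h).
    { apply K; try now apply (te_mem hj). now apply te_pair_in'. }
    apply (H6 _ _ A). now apply (te_mem hj).
Qed.
End GroundApproximations2.

Section GroundDefinability.
Context {M W : structure} {hM : ZFC M} {hW : ZFC W}.
Context {c : M} {G : M -> Prop} {j : M -> W} {g : W}.
Hypothesis hc : is_poset M c.
Hypothesis hG : generic_filter M c G.
Hypothesis hg : ground_of M c G W j g.
Let hj : trans_embedding M W j := go_emb hg.

Lemma ground_approximation (I C J : M) : (forall p, cond M c p -> p ∈ C) ->
  (forall i k, i ∈ I -> k ∈ I -> pr i k ∈ I) -> subset C I ->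
  (forall i k, i ∈ J -> k ∈ J -> pr i k ∈ J) -> subset C J -> subset (power (prod I C)) J ->
  forall (u : W) (l : M), (forall y, j y ∈ L u <-> y ∈ l) ->
  approximation (j I) (j (power J)) (j l) (L u).
Proof.
  intros HC HI HCI HJ HCJ HPJ u l Hl.
  assert (Hin : forall y, j y ∈ j l <-> j y ∈ L u) by (intros y; now rewrite (te_mem hj), Hl).
  assert (Hsub : forall x y, y ∈ j l -> subset (j x) y -> j x ∈ j l).
  { intros x y Hy Hxy. apply (te_in hj) in Hy as (y' & Hy & ->). apply Hin.
    apply (L_sub u _ (j y')); auto. now apply Hl. }
  split; [|split; [|split; [|split; [|split]]]].
  - intros x Hx. apply (te_in hj) in Hx as (y & Hy & ->). apply Hl in Hy. split; auto.
    intros w Hw. apply (te_in hj) in Hw as (z & Hz & ->). apply Hin.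
    apply (L_trans u (j y) Hy). now apply (te_mem hj).
  - intros x Hx. destruct (level_of_ground hg x) as [t Ht].
    destruct (level_trace hg x) as (l' & Hl'). exists (L x), (j l').
    assert (HLx : L x ∈ L u) by now apply L_in.
    assert (Hs : subset (j l') (L x)).
    { intros w Hw. apply (te_in hj) in Hw as (z & Hz & ->). now apply Hl'. }
    split; [now apply is_level_iff|]. split.
    + apply Hin. now apply (L_sub u _ (L x)).
    + intros y. split.
      * intros Hy. split; auto. apply (te_in hj) in Hy as (z & Hz & ->). apply Hin.
        apply (L_trans u (L x) HLx). now apply Hl'.
      * intros [H1 H2]. apply (te_in hj) in H2 as (z & Hz & ->). now apply (te_mem hj), Hl'.
  - intros x y Hx Hy. pose proof Hx as Hx'. apply (te_in hj) in Hx as (x' & Hx & ->), Hy as (y' & Hy & ->).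
    assert (E : forall w, w ∈ j (sep x' (fun z => z ∈ y')) <-> w ∈ j x' /\ w ∈ j y').
    { intros w. rewrite (te_in hj). split.
      - intros (z & Hz & ->). apply in_sep in Hz; [|df]. rewrite !(te_mem hj). exact Hz.
      - intros [H1 H2]. apply (te_in hj) in H1 as (z & Hz & ->). exists z. split; auto.
        apply in_sep; [df|]. split; auto. now apply (te_mem hj). }
    exists (j (sep x' (fun z => z ∈ y'))). split; auto. apply (Hsub _ (j x')); auto.
    intros w Hw. now apply E in Hw.
  - intros X Y HY HX Ha. pose proof HY as HY'. apply (te_in hj) in HY' as (Y' & HYl & ->).
    destruct (ground_approximates hc hG hg X Y' C HX HC) as [X' ->]; [|now apply (Hsub _ (j Y'))].
    intros a HaY Hsm. destruct (Ha (j a)) as (z & Hz & Ez).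
    + apply (Hsub _ (j Y')); auto. now apply (te_subset hj).
    + apply (small_up hg). apply (small_trans I C); auto. now apply small_self.
    + apply (te_in hj) in Hz as (b & Hb & ->). exists b. intros y.
      rewrite <- (te_mem hj y b), Ez, (te_mem hj). tauto.
  - intros a Y HY HaY Hsm. pose proof HY as HY'. apply (te_in hj) in HY' as (Y' & HYl & ->).
    destruct (ground_small_cover hc hG hg I C Y' a HI HCI HC HaY Hsm) as (d & D1 & D2 & D3).
    exists (j d). split; [apply (Hsub _ (j Y')); auto; now apply (te_subset hj)|].
    split; auto. split; [now apply (te_subset hj)|now apply (small_up hg)].
  - intros B X K HB HBe HK Hsm HX. pose proof HB as HB'. apply (te_in hj) in HB' as (B' & HBl & ->).
    split.
    + intros H. apply (te_in hj) in H as (X' & HX' & ->). apply (coded_intro hg); auto.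
      * apply (ground_small_power hc hG hg I C B' J K); auto. intros z Hz. now apply HK.
      * now apply (te_subset hj).
    + intros H. destruct (coded_elim hg _ B' X HBe H HX) as [X' ->]. now apply (Hsub _ (j B')).
Qed.

(** Every element of the ground lies in the part of the ground at some level, which is an
    approximation, and approximations at the same level coincide. *)
Theorem ground_definable : exists I r : W, forall x, approximated I r x <-> exists y, x = j y.
Proof.
  destruct (conditions_set hc) as [C HC].
  (* [I] enumerates the conditions and is closed under pairs, so that it enumerates pairs of
     its elements and conditions; [J] does so with names for subsets of [I] *)
  destruct (pair_closed_superset C) as (I & HCI & HI).
  destruct (pair_closed_superset (cup C (power (prod I C)))) as (J & HJ0 & HJ).
  assert (HA : forall (u : W) (l : M), (forall y, j y ∈ L u <-> y ∈ l) ->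
    approximation (j I) (j (power J)) (j l) (L u)).
  { apply (ground_approximation I C J); auto.
    - intros p. apply HC.
    - intros x Hx. apply HJ0, in_cup. auto.
    - intros x Hx. apply HJ0, in_cup. auto. }
  exists (j I), (j (power J)). intros x. split.
  - intros (u & U & N & ->%is_level_iff & HN & Hx). destruct (level_trace hg u) as (l & Hl).
    apply (approximation_sub (j I) (j (power J)) (L u) u) with (N2 := j l) in Hx; auto.
    + apply (te_in hj) in Hx as (y & _ & ->). eauto.
    + intros i k Hi Hk. apply (te_in hj) in Hi as (i' & Hi & ->), Hk as (k' & Hk & ->).
      rewrite <- (te_pr hj). apply (te_mem hj). auto.
    + exists (j (one c)). apply (te_mem hj), HCI, HC. now apply one_cond.
    + now apply is_level_iff.
  - intros [y ->]. destruct (level_trace hg (sing (j y))) as (l & Hl).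
    exists (sing (j y)), (L (sing (j y))), (j l). split; [now apply is_level_iff|]. split; auto.
    apply (te_mem hj), Hl, mem_L. now apply in_sing.
Qed.
End GroundDefinability.

(** * A finite axiomatization relative to collection *)

Section BaseTheory.
Variable S : structure.
Implicit Types A B D K Y s x y z a b i k w o : S.

Definition assignment K Y s : Prop :=
  (forall w, w ∈ s -> exists i a, i ∈ K /\ a ∈ Y /\ is_pair w i a) /\
  (forall i, i ∈ K -> exists a, a ∈ Y /\ pair_in i a s) /\
  (forall i a b, pair_in i a s -> pair_in i b s -> a = b).

(** Only the pairs matter; the sets [s'] of this kind agree as assignments. *)
Definition updated s i a s' : Prop := forall k b,
  pair_in k b s' <-> (k = i /\ b = a) \/ (k <> i /\ pair_in k b s).

(** Single axioms of ZFC, existence of assignments, and the instances of separation by which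
    the set of assignments satisfying a formula is built from those for its parts. *)
Definition base_theory : Prop :=
  (forall x y : S, (forall z, z ∈ x <-> z ∈ y) -> x = y) /\
  (forall x : S, (exists y, y ∈ x) -> exists y, y ∈ x /\ ~ exists z, z ∈ y /\ z ∈ x) /\
  (forall x y : S, exists z, is_upair z x y) /\
  (forall x : S, exists u, forall z, z ∈ u <-> exists y, y ∈ x /\ z ∈ y) /\
  (forall x : S, exists p, forall z, z ∈ p <-> subset z x) /\
  (exists w : S, (exists o, o ∈ w /\ forall z, ~ z ∈ o) /\
    (forall x, x ∈ w -> exists y, y ∈ w /\ forall z, z ∈ y <-> z ∈ x \/ z = x)) /\
  (forall x : S, (forall y, y ∈ x -> exists z, z ∈ y) ->
    (forall y y' z, y ∈ x -> y' ∈ x -> z ∈ y -> z ∈ y' -> y = y') ->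
    exists c, forall y, y ∈ x -> exists! z, z ∈ y /\ z ∈ c) /\
  (forall x a, exists y, subset x y /\ a ∈ y) /\
  (forall x y, exists z, subset x z /\ subset y z) /\
  (exists K, (exists o, o ∈ K) /\ (forall i, i ∈ K -> exists k, k ∈ K /\ i ∈ k) /\
    (forall i k l, i ∈ k -> k ∈ l -> l ∈ K -> i ∈ l) /\ (forall i, ~ i ∈ i)) /\
  (forall K Y, exists A, forall s, assignment K Y s -> s ∈ A) /\
  (forall K Y a, a ∈ Y -> exists s, assignment K Y s) /\
  (forall K Y Y' s i a, assignment K Y s -> subset Y Y' -> i ∈ K -> a ∈ Y' ->
    exists s', assignment K Y' s' /\ updated s i a s') /\
  (forall A i k, exists D, forall s, s ∈ D <-> s ∈ A /\ exists a b, pair_in i a s /\ pair_in k b s /\ a ∈ b) /\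
  (forall A i k, exists D, forall s, s ∈ D <-> s ∈ A /\ exists a, pair_in i a s /\ pair_in k a s) /\
  (forall A B, exists D, forall s, s ∈ D <-> s ∈ A /\ ~ s ∈ B) /\
  (forall A D K Y i, exists D', forall s, s ∈ D' <-> s ∈ A /\
    forall a s', a ∈ Y -> assignment K Y s' -> updated s i a s' -> s' ∈ D) /\
  (forall x D K Y s i, exists y, forall z, z ∈ y <-> z ∈ x /\
    forall s', assignment K Y s' -> updated s i z s' -> s' ∈ D).
End BaseTheory.
Arguments assignment {S}. Arguments updated {S}.

Lemma base_theory_of_ZFC (S : structure) (hS : ZFC S) : base_theory S.
Proof.
  pose proof hS as [H1 H2 H3 H4 H5 H6 H7 H8 H9].
  assert (Hsep : forall (P : S -> Prop) x, def1 P -> exists y, forall z, z ∈ y <-> z ∈ x /\ P z)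
    by (intros; now apply separation).
  unfold base_theory. do 7 (split; [assumption|]).
  split; [|split; [|split; [|split; [|split; [|split; [|split; [|split; [|split; [|split]]]]]]]]].
  - intros x a. exists (cup x (sing a)). split; [intros z Hz|]; rewrite in_cup, ?in_sing; auto.
  - intros x y. exists (cup x y). split; intros z Hz; rewrite in_cup; auto.
  - exists omega. split; [exists emp; apply omega_inductive|]. split; [|split; [|exact no_mem_cycle1]].
    + intros i Hi. exists (suc i). split; [now apply omega_inductive|apply in_suc; auto].
    + assert (K : forall l, l ∈ omega -> transitive_set l).
      { apply omega_ind; [df|intros y Hy; now apply in_emp in Hy|].
        intros n _ Hn y Hy z Hz. apply in_suc in Hy as [Hy| ->]; apply in_suc; left; auto.
        exact (Hn y Hy z Hz). }
      intros i k l Hi Hk Hl. exact (K l Hl k Hk i Hi).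
  - intros K Y. exists (power (prod K Y)). intros s (A1 & _). apply in_power. intros w Hw.
    destruct (A1 w Hw) as (i & a & Hi & Ha & E). apply is_pair_iff in E as ->. now apply pr_in_prod.
  - intros K Y a Ha. exists (prod K (sing a)). split; [|split].
    + intros w (i & b & Hi & ->%in_sing & ->)%in_prod. exists i, a. now rewrite is_pair_iff.
    + intros i Hi. exists a. rewrite pair_in_iff, pr_in_prod, in_sing. auto.
    + intros i b b' Hb Hb'. rewrite pair_in_iff, pr_in_prod, in_sing in Hb, Hb'. destruct Hb, Hb'. congruence.
  - intros K Y Y' s i a (A1 & A2 & A3) HY Hi Ha.
    set (s' := sep (prod K Y') (fun w => exists k b, w = pr k b /\
      ((k = i /\ b = a) \/ (k <> i /\ pair_in k b s)))).
    assert (Hs' : forall k b, pair_in k b s' <-> (k = i /\ b = a) \/ (k <> i /\ pair_in k b s)).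
    { intros k b. unfold s'. rewrite (pair_in_iff k b), in_sep, pr_in_prod by df. split.
      - intros (_ & k' & b' & E & H). now apply pr_inj in E as [<- <-].
      - intros H. split; [|exists k, b; auto]. destruct H as [[-> ->]|[_ H]]; auto.
        destruct H as (w & Hw & Hws). destruct (A1 w Hws) as (k' & b' & ? & ? & E).
        apply is_pair_iff in Hw, E. rewrite Hw in E. apply pr_inj in E as [-> ->]. auto. }
    exists s'. split; [|exact Hs']. split; [|split].
    + intros w Hw. apply in_sep in Hw as [Hw _]; [|df]. apply in_prod in Hw as (k & b & Hk & Hb & ->).
      exists k, b. now rewrite is_pair_iff.
    + intros k Hk. destruct (classic (k = i)) as [->|Hn].
      * exists a. rewrite Hs'. auto.
      * destruct (A2 k Hk) as (b & Hb & H). exists b. rewrite Hs'. auto.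
    + intros k b b' [[-> ->]|[Hn H]]%Hs' [[E ->]|[Hn' H']]%Hs'; try tauto; try congruence. eauto.
  - intros A i k. apply Hsep. df.
  - intros A i k. apply Hsep. df.
  - intros A B. apply Hsep. df.
  - intros A D K Y i. apply Hsep. unfold assignment, updated. df.
  - intros x D K Y s i. apply Hsep. unfold assignment, updated. df.
Qed.

Section BaseToZFC.
Context {S : structure}.
Hypothesis hS : base_theory S.
Hypothesis hcoll : forall R : S -> S -> Prop, def2 R -> forall x, exists b,
  forall u, u ∈ x -> (exists v, R u v) -> exists v, v ∈ b /\ R u v.

(** The indices of variables are a chain for [∈]; standard natural numbers outside need only
    an injection into it. *)
Lemma base_indices : exists (K : S) (num : nat -> S), (forall n, num n ∈ K) /\
  forall n m, num n = num m -> n = m.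
Proof.
  destruct hS as (_ & _ & _ & _ & _ & _ & _ & _ & _ & (K & (o & Ho) & Hn & Ht & Hi) & _).
  assert (step : forall i : {i | i ∈ K}, exists k : {i | i ∈ K}, proj1_sig i ∈ proj1_sig k).
  { intros [i H]. destruct (Hn i H) as (k & Hk & Hik). now exists (exist _ k Hk). }
  apply choice in step as [f Hf].
  set (num := fun n => Nat.iter n f (exist _ o Ho)).
  assert (Hlt : forall n d, proj1_sig (num n) ∈ proj1_sig (num (1 + d + n))).
  { intros n d. induction d; [apply Hf|]. apply (Ht _ (proj1_sig (num (1 + d + n)))); [exact IHd|exact (Hf _)|apply proj2_sig]. }
  exists K, (fun n => proj1_sig (num n)). split; [intros n; apply proj2_sig|].
  intros n m E. destruct (lt_eq_lt_dec n m) as [[H|H]|H]; auto; exfalso.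
  - apply (Hi (proj1_sig (num n))). rewrite E at 2. replace m with (1 + (m - n - 1) + n) by lia. apply Hlt.
  - apply (Hi (proj1_sig (num m))). rewrite <- E at 2. replace n with (1 + (n - m - 1) + m) by lia. apply Hlt.
Qed.

Section Satisfaction.
Variables (K : S) (num : nat -> S).
Hypothesis num_in : forall n, num n ∈ K.
Hypothesis num_inj : forall n m, num n = num m -> n = m.

Definition codes (s : S) (nu : nat -> S) : Prop := forall n, pair_in (num n) (nu n) s.

Lemma codes_updated s nu n a s' : codes s nu -> updated s (num n) a s' -> codes s' (upd nu n a).
Proof.
  intros Hs Hu m. apply Hu. unfold upd. destruct (Nat.eqb_spec m n) as [->|H]; auto.
  right. split; [|apply Hs]. intros E. now apply H, num_inj.
Qed.

Lemma codes_ex Y s : assignment K Y s -> exists nu, codes s nu /\ forall n, nu n ∈ Y.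
Proof.
  intros (_ & H & _). destruct (choice (fun n a => a ∈ Y /\ pair_in (num n) a s)) as [nu Hnu].
  { intros n. apply H, num_in. }
  exists nu. split; intros n; apply Hnu.
Qed.

(** At a quantifier, collection bounds the witnesses for all assignments into [Y], so that the
    set of assignments into a larger [Y'] satisfying the subformula can be used. *)
Lemma satisfaction_set phi : forall Y, exists D, forall s nu, assignment K Y s -> codes s nu ->
  (s ∈ D <-> sat S nu phi).
Proof.
  destruct hS as (_ & _ & _ & _ & _ & _ & _ & _ & T9 & _ & T11 & _ & T13 & T14 & T15 & T16 & T17 & _).
  induction phi; intros Y; destruct (T11 K Y) as [A HA].
  - destruct (T14 A (num x) (num y)) as [D HD]. exists D. intros s nu Hs Hnu. rewrite HD. cbn [sat]. split.
    + intros (_ & a & b & Ha & Hb & Hab). destruct Hs as (_ & _ & Hf).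
      now rewrite (Hf _ _ _ (Hnu x) Ha), (Hf _ _ _ (Hnu y) Hb).
    + intros H. split; auto. exists (nu x), (nu y). auto.
  - destruct (T15 A (num x) (num y)) as [D HD]. exists D. intros s nu Hs Hnu. rewrite HD. cbn [sat]. split.
    + intros (_ & a & Ha & Hb). destruct Hs as (_ & _ & Hf).
      now rewrite (Hf _ _ _ (Hnu x) Ha), (Hf _ _ _ (Hnu y) Hb).
    + intros H. split; auto. exists (nu x). split; [apply Hnu|]. rewrite H. apply Hnu.
  - destruct (IHphi Y) as [B HB]. destruct (T16 A B) as [D HD]. exists D. intros s nu Hs Hnu.
    rewrite HD, (HB s nu Hs Hnu). cbn [sat]. split; [tauto|auto].
  - destruct (IHphi1 Y) as [B1 HB1], (IHphi2 Y) as [B2 HB2].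
    destruct (T16 B1 B2) as [D HD]. destruct (T16 B1 D) as [D' HD']. exists D'. intros s nu Hs Hnu.
    rewrite HD', HD, (HB1 s nu Hs Hnu), (HB2 s nu Hs Hnu). cbn [sat]. tauto.
  - set (R := fun s a => forall nu, (forall n, free n phi -> pair_in (num n) (nu n) s \/ n = x) ->
      ~ sat S (upd nu x a) phi).
    assert (HR : def2 R).
    { unfold R, def2. apply (dfn_all_env _ _ _ (fun _ e nu =>
        (forall n, free n phi -> pair_in (num n) (nu n) (e 0) \/ n = x) -> ~ sat S (upd nu x (e 1)) phi) (bnd phi)).
      - intros _ e nu nu' E H Hn Hs. apply (H).
        + intros n Hf. rewrite E by now apply free_bnd. auto.
        + eapply sat_ext; [|exact Hs]. intros n Hf. unfold upd. destruct (n =? x); auto.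
          apply E. now apply free_bnd.
      - intros t Ht f. apply dfn_imp.
        + apply (dfn_finite _ _ _ (fun n => free n phi) (bnd phi)); [apply free_bnd|]. intros n.
          apply dfn_or; [|apply dfn_const]. dfn_tac. apply Ht.
        + apply dfn_not. apply (dfn_sat _ _ _ phi (fun n i e => if n =? x then e (f 1) else t n i e)).
          intros n. destruct (n =? x); auto. dfn_tac. }
    destruct (hcoll R HR A) as [b Hb]. destruct (T9 Y b) as (Y' & HY & HbY).
    destruct (IHphi Y') as [D HD]. destruct (T17 A D K Y' (num x)) as [D' HD']. exists D'.
    intros s nu Hs Hnu. rewrite HD'. cbn [sat]. split.
    + intros [_ H] a. apply NNPP. intros Ha.
      assert (HRa : forall a, R s a <-> ~ sat S (upd nu x a) phi).
      { intros a'. split; [intros H'; apply H'; intros n _; left; apply Hnu|].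
        intros H' mu Hmu Hs'. apply H'. eapply sat_ext; [|exact Hs']. intros n Hn. unfold upd.
        destruct (Nat.eqb_spec n x) as [|Hne]; auto. destruct (Hmu n Hn) as [Hp|]; [|contradiction].
        destruct Hs as (_ & _ & Hf). symmetry. exact (Hf _ _ _ Hp (Hnu n)). }
      destruct (Hb s (HA s Hs)) as (a' & Ha' & HR'); [exists a; exact (proj2 (HRa a) Ha)|].
      apply (proj1 (HRa a') HR'). destruct (T13 K Y Y' s (num x) a' Hs HY (num_in x) (HbY _ Ha'))
        as (s' & Hs' & Hu).
      apply (HD s'); auto. now apply (codes_updated s). apply (H a'); auto.
    + intros H. split; auto. intros a s' Ha Hs' Hu. apply (HD s' (upd nu x a)); auto.
      now apply (codes_updated s).
Qed.

Lemma base_separation phi (e : nat -> S) x : exists y, forall z, z ∈ y <-> z ∈ x /\ sat S (upd e 0 z) phi.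
Proof.
  pose proof hS as (_ & _ & _ & _ & _ & _ & _ & T8 & _ & _ & _ & T12 & T13 & _ & _ & _ & _ & T18).
  assert (HY : forall m, exists Y, subset x Y /\ forall n, n <= m -> e n ∈ Y).
  { induction m.
    - destruct (T8 x (e 0)) as (Y & H1 & H2). exists Y. split; auto. intros n Hn. now replace n with 0 by lia.
    - destruct IHm as (Y & H1 & H2). destruct (T8 Y (e (1 + m))) as (Y' & H3 & H4). exists Y'. split.
      + intros w Hw. auto.
      + intros n Hn. destruct (Nat.eq_dec n (1 + m)) as [->|]; auto. apply H3, H2. lia. }
  destruct (HY (bnd phi)) as (Y & HxY & HeY).
  (* a constant assignment is modified finitely often *)
  assert (Hs : forall m, m <= bnd phi -> exists s nu, assignment K Y s /\ codes s nu /\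
    forall n, n < m -> nu n = e n).
  { induction m; intros Hm.
    - destruct (T12 K Y (e 0)) as (s & Hs); [apply HeY; lia|].
      destruct (codes_ex Y s Hs) as (nu & Hnu & _). exists s, nu. repeat split; auto; try apply Hs. lia.
    - destruct IHm as (s & nu & Hs & Hnu & E); [lia|].
      destruct (T13 K Y Y s (num m) (e m) Hs) as (s' & Hs' & Hu); auto; [intros w Hw; exact Hw|apply HeY; lia|].
      exists s', (upd nu m (e m)). split; auto. split; [now apply (codes_updated s)|].
      intros n Hn. unfold upd. destruct (Nat.eqb_spec n m) as [->|]; auto. apply E. lia. }
  destruct (Hs (bnd phi) (le_n _)) as (s & nu & Has & Hnu & E).
  destruct (satisfaction_set phi Y) as [D HD].
  destruct (T18 x D K Y s (num 0)) as [y Hy]. exists y. intros z. rewrite Hy.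
  assert (Hz : z ∈ x -> exists s', assignment K Y s' /\ updated s (num 0) z s').
  { intros Hz. apply (T13 K Y Y); auto. intros w Hw. exact Hw. }
  assert (Hiff : forall s', assignment K Y s' -> updated s (num 0) z s' ->
    (s' ∈ D <-> sat S (upd e 0 z) phi)).
  { intros s' Hs' Hu. rewrite (HD s' (upd nu 0 z)); auto; [|now apply (codes_updated s)].
    apply sat_ext. intros n Hn. apply free_bnd in Hn. unfold upd. destruct (n =? 0); auto. }
  split; intros [Hzx H]; split; auto.
  - destruct (Hz Hzx) as (s' & Hs' & Hu). apply (Hiff s'); auto.
  - intros s' Hs' Hu. now apply (Hiff s').
Qed.
End Satisfaction.

(** Replacement follows from separation and collection. *)
Theorem ZFC_of_base : ZFC S.
Proof.
  destruct base_indices as (K & num & HK & Hinj).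
  pose proof hS as (H1 & H2 & H3 & H4 & H5 & H6 & H7 & _).
  pose proof (base_separation K num HK Hinj) as Hsep. constructor; auto.
  intros phi e x Hf.
  assert (HR : def2 (fun u v => sat S (upd (upd e 0 u) 1 v) phi)).
  { apply (dfn_sat _ _ _ phi (fun n _ E => upd (upd e 0 (E 0)) 1 (E 1) n)). intros [|[|n]]; cbn; dfn_tac. }
  destruct (hcoll _ HR x) as [b Hb].
  destruct (two_variable_formula (fun v _ => exists u, u ∈ x /\ sat S (upd (upd e 0 u) 1 v) phi) x)
    as (psi & E & HE).
  { df. }
  destruct (Hsep psi (upd E 1 x) b) as [y Hy]. exists y. intros v. rewrite Hy.
  assert (Ev : sat S (upd (upd E 1 x) 0 v) psi <-> exists u, u ∈ x /\ sat S (upd (upd e 0 u) 1 v) phi).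
  { rewrite (HE v x). apply sat_ext. intros n _. unfold upd. destruct n as [|[|n]]; reflexivity. }
  rewrite Ev. split; [tauto|]. intros (u & Hu & Hv). split; [|eauto].
  destruct (Hb u Hu) as (v' & Hv' & Hs); [eauto|]. destruct (Hf u Hu) as (v0 & _ & Hun).
  rewrite <- (Hun v Hv), (Hun v' Hs). exact Hv'.
Qed.
End BaseToZFC.

(** * Quantifying over grounds inside a model *)

(** Satisfaction in the substructure of the elements of [M], written so that it is definable
    when [M] is. *)
Fixpoint relsat (W : structure) (M : W -> Prop) (e : nat -> W) (phi : formula) : Prop :=
  match phi with
  | Mem x y => e x ∈ e y
  | Eq x y => e x = e y
  | Neg phi => ~ relsat W M e phi
  | And phi psi => relsat W M e phi /\ relsat W M e psi
  | All x phi => forall a, M a -> relsat W M (upd e x a) phi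
  end.

Lemma relsat_ext (W : structure) M phi : forall e e' : nat -> W, (forall i, free i phi -> e i = e' i) ->
  (relsat W M e phi <-> relsat W M e' phi).
Proof.
  induction phi; cbn [relsat free]; intros e e' E.
  - rewrite !E; tauto.
  - rewrite !E; tauto.
  - now rewrite (IHphi e e').
  - rewrite (IHphi1 e e'), (IHphi2 e e'); auto; tauto.
  - assert (H : forall a, relsat W M (upd e x a) phi <-> relsat W M (upd e' x a) phi).
    { intros a. apply IHphi. intros i Hi. unfold upd. destruct (Nat.eqb_spec i x); auto. }
    split; intros H' a Ha; apply H; auto.
Qed.

Lemma relsat_embedding {N W : structure} {j : N -> W} {M : W -> Prop} :
  trans_embedding N W j -> (forall x, M x <-> exists y, x = j y) ->
  forall phi e, sat N e phi <-> relsat W M (fun i => j (e i)) phi.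
Proof.
  intros hj HM. induction phi; cbn [sat relsat]; intros e.
  - now rewrite (te_mem hj).
  - split; [congruence|apply (te_inj hj)].
  - now rewrite IHphi.
  - now rewrite IHphi1, IHphi2.
  - assert (H : forall a, sat N (upd e x a) phi <-> relsat W M (upd (fun i => j (e i)) x (j a)) phi).
    { intros a. rewrite IHphi. apply relsat_ext. intros i _. unfold upd. now destruct (i =? x). }
    split.
    + intros H' b Hb. apply HM in Hb as [a ->]. now apply H.
    + intros H' a. apply H, H', HM. eauto.
Qed.

Lemma relsat_sub {W : structure} {M : W -> Prop} : (forall x y : W, M y -> x ∈ y -> M x) ->
  forall phi (e : nat -> sub W M), sat (sub W M) e phi <-> relsat W M (fun i => proj1_sig (e i)) phi.
Proof.
  intros HM. apply relsat_embedding; [now apply sub_embedding|]. intros x. split.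
  - intros Hx. now exists (exist _ x Hx).
  - intros [[y Hy] ->]. exact Hy.
Qed.

Section DefRelsat.
Variables (J : Type) (S : J -> structure) (K : (forall i, S i) -> Prop).
Local Notation Df := (@dfn J S K). Local Notation Tm := (@tm J S K).
Lemma dfn_relsat phi : forall s r, Tm s -> Tm r -> forall t : nat -> forall i, (nat -> S i) -> S i,
  (forall n, Tm (t n)) ->
  Df (fun i e => relsat (S i) (approximated (s i e) (r i e)) (fun n => t n i e) phi).
Proof.
  induction phi; cbn [relsat]; intros s r hs hr t ht.
  - apply dfn_mem; auto.
  - dfn_tac; auto.
  - apply dfn_not; auto.
  - apply dfn_and; auto.
  - apply (dfn_all _ _ _ (fun i e a => approximated (s i e) (r i e) a ->
      relsat (S i) (approximated (s i e) (r i e)) (upd (fun n => t n i e) x a) phi)).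
    apply dfn_imp; [apply dfn_approximated; [apply (tm_ren _ _ _ _ _ hs)|apply (tm_ren _ _ _ _ _ hr)|apply tm_var]|].
    apply (IHphi (fun i e => s i (fun n => e (Datatypes.S n))) (fun i e => r i (fun n => e (Datatypes.S n)))
      (tm_ren _ _ _ _ _ hs) (tm_ren _ _ _ _ _ hr)
      (fun n i e => if n =? x then e 0 else t n i (fun n => e (Datatypes.S n)))).
    intros n. destruct (n =? x); [apply tm_var|apply (tm_ren _ _ _ _ _ (ht n))].
Qed.
End DefRelsat.

Lemma base_formula : exists bt, (forall (S : structure) (e : nat -> S), base_theory S <-> sat S e bt) /\
  forall i, ~ free i bt.
Proof.
  destruct (formula_with_free (fun S _ => base_theory S) (fun _ => False)) as (bt & H1 & H2); eauto.
  unfold uniform, base_theory, assignment, updated. dfn_tac.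
Qed.

Lemma name_formula : exists nf, forall (S : structure) (e : nat -> S), is_name S (e 0) (e 1) <-> sat S e nf.
Proof. apply uniform_formula. unfold uniform. dfn_tac. Qed.

Section GroundStatement.
Variables (chi phi bt nf : formula).
Hypothesis hchi : forall i, free i chi -> i = 0.
Hypothesis hbt : forall (S : structure) (e : nat -> S), base_theory S <-> sat S e bt.
Hypothesis hbt_free : forall i, ~ free i bt.
Hypothesis hnf : forall (S : structure) (e : nat -> S), is_name S (e 0) (e 1) <-> sat S e nf.

(** The third condition makes the class inherit collection from [W], the fourth says that
    [base_theory] holds in it; together they give ZFC. *)
Definition has_ground (W : structure) (e : nat -> W) : Prop := exists I r c g : W,
  (forall x y, approximated I r y -> x ∈ y -> approximated I r x) /\
  (forall x, ordinal x -> approximated I r x) /\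
  (forall x, (forall y, y ∈ x -> approximated I r y) -> exists y, approximated I r y /\ subset x y) /\
  relsat W (approximated I r) (fun _ => c) bt /\
  approximated I r c /\
  relsat W (approximated I r) (fun _ => c) (fClass chi 0) /\
  generic W c (approximated I r) g /\
  (forall x, exists tau, approximated I r tau /\
    relsat W (approximated I r) (fun i => match i with 0 => c | _ => tau end) nf /\ is_value W c g tau x) /\
  (forall i, free i phi -> approximated I r (e i)) /\
  relsat W (approximated I r) e phi.

Lemma uniform_has_ground : uniform has_ground.
Proof.
  unfold uniform, has_ground. dfn_tac.
  all: try (apply dfn_relsat; dfn_tac).
  - apply dfn_generic; dfn_tac.
  - apply (dfn_finite _ _ _ (fun i => free i phi) (bnd phi)); [apply free_bnd|]. intros k. dfn_tac.
Qed.

Lemma has_ground_sound (W : structure) (hW : ZFC W) e : has_ground W e ->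
  exists M, class_ground W chi M /\ holds_in W M phi e.
Proof.
  intros (I & r & c & g & H1 & H2 & H3 & H4 & H5 & H6 & H7 & H8 & H9 & H10).
  set (M := approximated I r) in *. exists M.
  assert (HM1 : def1 M) by (unfold M; df).
  set (c' := exist _ c H5 : sub W M).
  assert (HbM : base_theory (sub W M)).
  { apply (hbt (sub W M) (fun _ => c')), relsat_sub; auto. }
  assert (HZ : ZFC (sub W M)).
  (* collection in the class: witnesses are bounded in [W], and the bound is covered *)
  { apply ZFC_of_base; auto. intros R HR x.
    destruct (two_variable_formula R x HR) as (psi & E & HE).
    set (R' := fun u v => M v /\ relsat W M (upd (upd (fun n => proj1_sig (E n)) 0 u) 1 v) psi).
    assert (HR' : def2 R').
    { unfold R', def2. apply dfn_and; [unfold M; dfn_tac|].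
      apply (dfn_relsat _ _ _ psi (fun _ _ => I) (fun _ _ => r)) with
        (t := fun n _ e => upd (upd (fun n => proj1_sig (E n)) 0 (e 0)) 1 (e 1) n); [dfn_tac|dfn_tac|].
      intros n. destruct n as [|[|n]]; [apply tm_var|apply tm_var|exact (tm_const _ _ _ (fun _ => proj1_sig (E (S (S n)))) Logic.I)]. }
    assert (HRR : forall u v : sub W M, R u v <-> R' (proj1_sig u) (proj1_sig v)).
    { intros u v. unfold R'. rewrite HE, relsat_sub by auto.
      rewrite (relsat_ext W M psi (fun i => proj1_sig (upd (upd E 0 u) 1 v i))
        (upd (upd (fun n => proj1_sig (E n)) 0 (proj1_sig u)) 1 (proj1_sig v))).
      - split; [|tauto]. intros H. split; auto. apply proj2_sig.
      - intros i _. unfold upd. destruct (i =? 1), (i =? 0); auto. }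
    destruct (collection R' (proj1_sig x) HR') as [b Hb].
    destruct (H3 (sep b M)) as (y & Hy & Hby).
    { intros z Hz. apply in_sep in Hz; tauto. }
    exists (exist _ y Hy). intros u Hu [v Hv]. apply HRR in Hv.
    destruct (Hb (proj1_sig u) Hu) as (v' & Hv' & HRv); [eauto|].
    destruct HRv as [Mv Hv'']. exists (exist _ v' Mv). split.
    - apply Hby, in_sep; auto.
    - apply HRR. split; auto. }
  assert (Hclass : in_class (sub W M) chi c').
  { unfold in_class. apply relsat_sub; auto. }
  split.
  - split; [split; [exact H1|split; [exact H2|exact HZ]]|]. exists c'. split; auto. split.
    + exact (proj1 (proj1 (in_class_iff (sub W M) chi c' hchi) Hclass)).
    + exists g. split; [exact H7|]. intros x. destruct (H8 x) as (tau & Ht & Hn & Hv).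
      exists (exist _ tau Ht). split; [|exact Hv].
      apply (hnf (sub W M) (fun i => match i with 0 => c' | _ => exist _ tau Ht end)), relsat_sub; auto.
      eapply relsat_ext; [|exact Hn]. intros [|i] _; reflexivity.
  - assert (He : exists e' : nat -> sub W M, forall i, free i phi -> proj1_sig (e' i) = e i).
    { destruct (choice (fun i (a : sub W M) => free i phi -> proj1_sig a = e i)) as [e' He'].
      - intros i. destruct (classic (free i phi)) as [Hi|Hi].
        + now exists (exist _ (e i) (H9 i Hi)).
        + exists c'. tauto.
      - now exists e'. }
    destruct He as [e' He']. exists e'. split; auto. apply relsat_sub; auto.
    eapply relsat_ext; [|exact H10]. exact He'.
Qed.

Lemma has_ground_complete (N W : structure) (hN : ZFC N) (hW : ZFC W) (d : N) (H : N -> Prop)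
  (k : N -> W) (h : W) (nu : nat -> N) : is_poset N d -> generic_filter N d H -> ground_of N d H W k h ->
  in_class N chi d -> sat N nu phi -> has_ground W (fun i => k (nu i)).
Proof.
  intros hd hH hh Hd Hphi. destruct (ground_definable hd hH hh) as (I & r & HX).
  pose proof (go_emb hh) as hk. pose proof (relsat_embedding hk HX) as HR.
  assert (Hin : forall y, approximated I r (k y)) by (intros y; apply HX; eauto).
  assert (Htr : forall x y, approximated I r y -> x ∈ y -> approximated I r x).
  { intros x y Hy Hxy. apply HX in Hy as [y' ->]. apply (te_in hk) in Hxy as (x' & _ & ->). auto. }
  destruct (ground_extends_to (approximated I r) hd hH hh HX) as [_ (g & Hg & Hval)].
  exists I, r, (k d), g. split; [exact Htr|]. split; [|split; [|split; [|split; [|split; [|split; [|split; [|split]]]]]]].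
  - intros x Hx. destruct (ordinals_in_ground hd hH hh x Hx) as [y ->]. auto.
  - intros x Hx. destruct (level_trace hh x) as [l Hl]. exists (k l). split; auto.
    intros y Hy. pose proof (Hx y Hy) as Hy'. apply HX in Hy' as [z ->]. apply (te_mem hk), Hl. now apply sub_L.
  - apply (HR bt (fun _ => d)), hbt. now apply base_theory_of_ZFC.
  - auto.
  - now apply (HR (fClass chi 0) (fun _ => d)).
  - exact Hg.
  - intros x. destruct (Hval x) as (tau & Hn & Hv). exists (proj1_sig tau).
    split; [apply proj2_sig|]. split; [|exact Hv].
    pose proof (proj1 (hnf (sub W (approximated I r)) (fun i => match i with 0 => to_sub _ HX d | _ => tau end)) Hn) as Hs.
    apply relsat_sub in Hs; auto. eapply relsat_ext; [|exact Hs]. intros [|i] _; reflexivity.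
  - auto.
  - now apply (HR phi nu).
Qed.
End GroundStatement.

(** [theta] says that some parameters define a class that is a ground for a poset of the class
    and satisfies [phi]. *)
Theorem ground_statement (chi phi : formula) : (forall i, free i chi -> i = 0) ->
  exists theta, (forall i, free i theta <-> free i phi) /\
  (forall W, ZFC W -> forall e, sat W e theta -> exists M, class_ground W chi M /\ holds_in W M phi e) /\
  (forall (N W : structure) (hN : ZFC N) (hW : ZFC W) (d : N) (H : N -> Prop) (k : N -> W) (h : W) nu,
    is_poset N d -> generic_filter N d H -> ground_of N d H W k h ->
    in_class N chi d -> sat N nu phi -> sat W (fun i => k (nu i)) theta).
Proof.
  intros hchi. destruct base_formula as (bt & Hbt & Hfree). destruct name_formula as (nf & Hnf).
  destruct (formula_with_free (has_ground chi phi bt nf) (fun i => free i phi)) as (theta0 & H1' & H2').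
  - apply uniform_has_ground.
  - intros W e e' E (I & r & c & g & A1 & A2 & A3 & A4 & A5 & A6 & A7 & A8 & A9 & A10).
    exists I, r, c, g. do 8 (split; [assumption|]). split.
    + intros i Hi. rewrite <- E; auto.
    + eapply relsat_ext; [|exact A10]. intros i Hi. symmetry. auto.
  - destruct (pad_free _ theta0 phi H1' H2') as (theta & H1 & H2). exists theta. split; [exact H2|]. split.
    + intros W hW e He. apply H1 in He. now apply (has_ground_sound chi phi bt nf).
    + intros N W hN hW d H k h nu hd hH hh Hd Hphi. apply H1. now apply (has_ground_complete chi phi bt nf Hbt Hnf N W hN hW d H k h nu).
Qed.

(** * The equivalences *)

(** The extension by an iteration is an extension of the extension by [c], by the poset that
    [Q] names. *)
Lemma iteration_forces_ground chi phi theta : (forall i, free i chi -> i = 0) ->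
  (forall i, free i theta -> free i phi) ->
  (forall (N W : structure) (hN : ZFC N) (hW : ZFC W) (d : N) (H : N -> Prop) (k : N -> W) (h : W) nu,
    is_poset N d -> generic_filter N d H -> ground_of N d H W k h ->
    in_class N chi d -> sat N nu phi -> sat W (fun i => k (nu i)) theta) ->
  forall V, ZFC V -> forall e : nat -> V, is_poset V (e 0) -> is_name V (e 0) (e 1) ->
  forced V (e 0) (fun _ => e 1) (fClass chi 0) -> is_iteration V (e 0) (e 1) (e 2) ->
  forced_at V (e 0) (fun n => e (3 + n)) phi -> forced_at V (e 2) (fun n => e (3 + n)) theta.
Proof.
  intros hchi Hfree Hth.
  apply (countable_reduction (fun V e => is_poset V (e 0) -> is_name V (e 0) (e 1) ->
    forced V (e 0) (fun _ => e 1) (fClass chi 0) -> is_iteration V (e 0) (e 1) (e 2) ->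
    forced_at V (e 0) (fun n => e (3 + n)) phi -> forced_at V (e 2) (fun n => e (3 + n)) theta)).
  { unfold uniform. dfn_tac. }
  intros M hM Hcount e0. set (c := e0 0). set (Q := e0 1). set (i := e0 2). set (e := fun n => e0 (3 + n)).
  intros hc HQ HQf Hi Hphi nu Hnu p Hp.
  assert (HQP : forced M c (fun _ => Q) (fPoset 0)) by (intros q Hq; apply (HQf q Hq)).
  assert (hi : is_poset M i).
  { destruct (proj1 (iteration_unfold c Q i) Hi) as (q & l & o & I & L & t & Hd).
    exact (iteration_poset Hcount hc Hd HQ HQP). }
  assert (Enu : forall n, free n theta -> nu n = check i (e n)).
  { intros n Hn. apply (is_check_iff hi). auto. }
  apply (forces_by_extensions hi Hcount); auto.
  { intros n Hn. rewrite Enu by auto. now apply check_name. }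
  intros K W val HK HKp HE _. pose proof (extension_ZFC hi HK HE) as hW.
  destruct (extension_ground_of hi HK HE) as [Hk _].
  destruct (decompose_ground Hcount hc HQ HQP Hi HK Hk)
    as (N & hN & G & jN & gN & H & k & h & HG & HgN & HR & HH & Hh & Hkj).
  apply (sat_ext _ theta (fun n => k (jN (e n)))).
  { intros n Hn. rewrite Hkj, Enu; auto. }
  apply (Hth N W hN hW (value gN (jN Q)) H k h (fun n => jN (e n))); auto.
  - destruct (gf_inhabited HG) as [q Hq].
    apply (ground_of_truth hc HG HgN (fClass chi 0) (fun _ => Q)); auto.
    exists q. split; auto. apply HQf. now apply (gf_cond HG).
  - exact (forced_at_sound hc HG HgN phi e Hphi).
Qed.

Lemma free_Eq00 i : free i (Eq 0 0) -> i = 0.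
Proof. cbn. tauto. Qed.

(** The formula [Eq 0 0] describes the class of all posets, for which being a ground for a
    poset of the class is being a ground. *)
Lemma full_class_normal (N : structure) (hN : ZFC N) e : sat N e (fNormal (Eq 0 0)).
Proof.
  split.
  - intros a. apply (proj2 (iff_Imp N _ _ _ _ _ (iff_refl _) (iff_refl _))). intros H.
    apply sat_fClass; [exact free_Eq00|]. split; [|reflexivity].
    apply sat_fTrivialPoset in H as (P & l & o & H1 & H2 & _). apply is_poset_iff. eauto.
  - intros a b. apply (proj2 (iff_Imp N _ _ _ _ _ (iff_refl _) (iff_refl _))). intros H.
    apply (proj2 (iff_Imp N _ _ _ _ _ (iff_refl _) (iff_refl _))). intros _.
    apply (proj2 (iff_Imp N _ _ _ _ _ (iff_refl _) (iff_refl _))). intros _.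
    apply sat_fClass; [exact free_Eq00|]. split; [|reflexivity].
    apply sat_fPoset in H. now apply is_poset_iff.
Qed.

Lemma full_class_name (M : structure) (hM : ZFC M) (c : M) : is_poset M c -> class_name (Eq 0 0) M c.
Proof.
  intros hc. apply (class_name_of_normal (Eq 0 0) free_Eq00 M hM c hc). intros p Hp.
  eapply (forces_ext M c); [|apply (forces_entails (All 0 (Eq 0 0)) (fNormal (Eq 0 0))
    (fun N hN e _ => full_class_normal N hN e) M hM c p (fun _ => check c c)); auto].
  - intros i Hi. destruct (free_fNormal (Eq 0 0) free_Eq00 i Hi).
  - intros _. now apply check_name.
  - intros tau Ht. cbn. now apply feq_refl.
Qed.

Lemma ground_trans {V : structure} (hV : ZFC V) (M : V -> Prop) (M' : sub V M -> Prop) :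
  ground V M -> ground (sub V M) M' -> ground V (fun x => exists h : M x, M' (exist _ x h)).
Proof.
  intros [HM [c2 Hc2]] [HM' [c1 Hc1]].
  pose proof HM as (_ & _ & hN). pose proof HM' as (_ & _ & hM).
  destruct (ground_of_sub M c2 hN HM Hc2) as (H & h & hc2 & hH & hh).
  destruct (ground_of_sub M' c1 hM HM' Hc1) as (G & g & hc1 & hG & hg).
  set (N := sub V M) in *. set (M0 := sub N M') in *.
  destruct (go_values hg c2) as (Q0 & HQ0 & EQ0).
  assert (Hf : exists p, G p /\ forces M0 c1 p (fun _ => Q0) (fClass (Eq 0 0) 0)).
  { apply (ground_of_truth hc1 hG hg (fClass (Eq 0 0) 0) (fun _ => Q0)); auto.
    rewrite EQ0. apply (in_class_iff N (Eq 0 0) c2 free_Eq00). split; [exact hc2|reflexivity]. }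
  destruct Hf as (p & HGp & Hf).
  destruct (all_iterable (Eq 0 0) M0 hM c1 free_Eq00 hc1 (full_class_name M0 hM c1 hc1) p Q0
    (gf_cond hG p HGp) HQ0 Hf) as (Q & i & HQ & _ & HQe & Hi & hi).
  assert (EQ : c2 = value g (proj1_sig Q)).
  { rewrite <- EQ0. symmetry. apply (value_eq_iff (go_emb hg) hc1 hG (go_filter hg)); eauto. }
  destruct (compose_grounds hc1 HQ Hi hi hG hg EQ hc2 hH hh) as (K & k & HK & Hk).
  apply (ground_from _ hi HK Hk). intros x. split.
  - intros [hx hx']. now exists (exist _ (exist _ x hx) hx').
  - intros [[[y hy] hy'] ->]. cbn. now exists hy.
Qed.

(** [V] is a ground of itself, so normality speaks about its extensions by [c]. *)
Lemma normal_class_name {V : structure} (hV : ZFC V) chi (c : V) : (forall i, free i chi -> i = 0) ->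
  normal V chi -> is_poset V c -> class_name chi V c.
Proof.
  intros hchi [_ Hn] hc. destruct (Hn _ (self_ground hV)) as [_ Hf].
  apply (class_name_of_normal chi hchi V hV c hc).
  destruct (uniform_formula (fun W e => is_poset W (e 0))) as [f1 H1]; [unfold uniform; dfn_tac|].
  destruct (uniform_formula (fun W e => forced W (e 0) (fun _ => e 0) (fNormal chi))) as [f2 H2];
    [unfold uniform; dfn_tac|].
  set (M := fun _ : V => True). assert (Htr : forall x y : V, M y -> x ∈ y -> M x) by (intros; exact Logic.I).
  set (c' := exist _ c Logic.I : sub V M).
  assert (Hon : forall y : V, exists x : sub V M, y = proj1_sig x) by (intros y; now exists (exist _ y Logic.I)).
  pose proof (sat_iso _ (sub_embedding Htr) Hon) as Hiso.
  apply (H2 V (fun _ => c)), (Hiso f2 (fun _ => c')), H2. apply Hf.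
  apply (H1 _ (fun _ => c')), Hiso, (H1 V (fun _ => c)). exact hc.
Qed.

Lemma sub_of_sub {V : structure} (M : V -> Prop) (M' : sub V M -> Prop) :
  (forall x y, M y -> x ∈ y -> M x) -> (forall x y, M' y -> x ∈ y -> M' x) ->
  exists f : sub (sub V M) M' -> sub V (fun x => exists h : M x, M' (exist _ x h)),
    (forall z, proj1_sig (f z) = proj1_sig (proj1_sig z)) /\
    trans_embedding _ _ f /\ forall y, exists z, y = f z.
Proof.
  intros HM HM'. set (M2 := fun x => exists h : M x, M' (exist _ x h)).
  assert (HM2 : forall x y, M2 y -> x ∈ y -> M2 x).
  { intros x y [hy hy'] Hxy. exists (HM x y hy Hxy). exact (HM' (exist _ x _) (exist _ y hy) hy' Hxy). }
  set (f := fun z : sub (sub V M) M' => match z with exist _ (exist _ x h) h' => exist M2 x (ex_intro _ h h') end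
    : sub V M2).
  assert (Hf : forall z, proj1_sig (f z) = proj1_sig (proj1_sig z)) by (now intros [[x h] h']).
  assert (Hon : forall y, exists z, y = f z).
  { intros [x [h h']]. now exists (exist _ (exist _ x h) h'). }
  exists f. split; [exact Hf|]. split; [|exact Hon]. constructor.
  - intros x y E. apply (te_inj (sub_embedding HM')), (te_inj (sub_embedding HM)). rewrite <- !Hf. congruence.
  - intros x y. change (proj1_sig (f x) ∈ proj1_sig (f y) <-> x ∈ y). rewrite !Hf. reflexivity.
  - intros z y _. apply Hon.
Qed.

Theorem proposition2p2 (V : structure) (chi : formula) (A : V)
  (hV : ZFC V)
  (hchi : forall i, free i chi -> i = 0)
  (hnormal : normal V chi) :
  (RcA_plus V chi A <-> MP V chi A) /\
  (RcA V chi A <->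
    (forall (phi : formula) (e : nat -> V),
      parameters V A phi e -> button V chi phi e ->
      exists M : V -> Prop, ground V M /\ holds_in V M phi e)).
Proof.
  (* normality provides the name of a poset of the class needed in [button_lifts] *)
  assert (Button : forall phi phi' e, (forall W e, all_force chi phi W e <-> sat W e phi') ->
    (forall i, free i phi' -> free i phi) -> button V chi phi e ->
    exists c, in_class V chi c /\ forced_at V c e phi').
  { intros phi phi' e H1 H2 (c & Hc & Hb). exists c. split; auto.
    assert (hc : is_poset V c) by exact (proj1 (proj1 (in_class_iff V chi c hchi) Hc)).
    apply (button_forces_all_force chi hchi phi phi' H1 H2 V hV (fun n => match n with 0 => c | S n => e n end)); auto.
    exact (normal_class_name hV chi c hchi hnormal hc). }
  (* the class [chi'] of the grounds that [theta] speaks of may be larger than [chi] *)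
  assert (Ground : forall chi' phi theta e c, (forall i, free i chi' -> i = 0) ->
    (forall Q, in_class V chi c -> is_name V c Q -> forced V c (fun _ => Q) (fClass chi 0) ->
      forced V c (fun _ => Q) (fClass chi' 0)) ->
    (forall i, free i theta -> free i phi) ->
    (forall (N W : structure) (hN : ZFC N) (hW : ZFC W) (d : N) (H : N -> Prop) (k : N -> W) (h : W) nu,
      is_poset N d -> generic_filter N d H -> ground_of N d H W k h ->
      in_class N chi' d -> sat N nu phi -> sat W (fun i => k (nu i)) theta) ->
    in_class V chi c -> forced_at V c e phi -> button V chi theta e).
  { intros chi' phi theta e c hchi' Hsub H1 H2 Hc Hf. exists c. split; auto. intros Q HQ HQf i Hi.
    assert (hc : is_poset V c) by exact (proj1 (proj1 (in_class_iff V chi c hchi) Hc)).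
    apply (iteration_forces_ground chi' phi theta hchi' H1 H2 V hV
      (fun n => match n with 0 => c | 1 => Q | 2 => i | S (S (S n)) => e n end)); auto. }
  split; split.
  - intros HR phi e Hpar Hb. destruct (all_force_formula chi phi) as (phi' & H1 & H2).
    destruct (Button phi phi' e H1 (fun i => proj1 (H2 i)) Hb) as (c & Hc & Hf).
    destruct (HR c Hc phi' e) as (M & [HM (d & Hd & Hext)] & (e' & He & Hs)); auto.
    { intros i Hi. apply Hpar, H2, Hi. }
    pose proof HM as (_ & _ & hM).
    destruct (ground_of_sub M d hM HM Hext) as (G & g & hd & hG & hg).
    apply H1 in Hs. pose proof (forced_at_sound hd hG hg phi e' (Hs d Hd)) as Hphi.
    eapply sat_ext; [|exact Hphi]. intros i Hi. symmetry. apply He, H2, Hi.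
  - intros HMP c Hc phi e Hpar Hf. destruct (ground_statement chi phi hchi) as (theta & H1 & H2 & H3).
    apply (H2 V hV). apply HMP; [intros i Hi; apply Hpar, H1, Hi|].
    apply (Ground chi phi theta e c); auto. intros i. apply H1.
  - intros HR phi e Hpar Hb. destruct (all_force_formula chi phi) as (phi' & H1 & H2).
    destruct (Button phi phi' e H1 (fun i => proj1 (H2 i)) Hb) as (c & Hc & Hf).
    destruct (HR c Hc phi' e) as (M & HM & (e' & He & Hs)); auto.
    { intros i Hi. apply Hpar, H2, Hi. }
    exists M. split; auto. exists e'. split; [intros i Hi; apply He, H2, Hi|].
    pose proof HM as [(_ & _ & hM) _]. destruct hnormal as [_ Hn]. destruct (Hn M HM) as [HnM _].
    apply H1 in Hs. destruct (trivial_ground (M := sub V M)) as [hG hg].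
    apply (forced_at_sound trivial_is_poset hG hg phi e'), Hs.
    exact (normal_trivial chi hchi (fun _ => trivial_poset) (HnM _)).
  - intros HS c Hc phi e Hpar Hf.
    destruct (ground_statement (Eq 0 0) phi free_Eq00) as (theta & H1 & H2 & H3).
    destruct (HS theta e) as (M & HM & (e' & He & Hs)).
    { intros i Hi. apply Hpar, H1, Hi. }
    { apply (Ground (Eq 0 0) phi theta e c); auto; [exact free_Eq00| |intros i; apply H1].
      intros Q HcQ HQ HQf p Hp.
      apply (forces_entails (fClass chi 0) (fClass (Eq 0 0) 0)); auto.
      - intros N hN e0 H. apply sat_fClass in H; auto. apply sat_fClass; [exact free_Eq00|]. split; [tauto|].
        reflexivity.
      - exact (proj1 (proj1 (in_class_iff V chi c hchi) Hc)). }
    pose proof HM as [(_ & _ & hM) _].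
    destruct (H2 _ hM e' Hs) as (M' & [HM' (d & Hd & Hext)] & (e2 & He2 & Hs2)).
    exists (fun x => exists h : M x, M' (exist _ x h)). split.
    + apply (ground_trans hV M M' HM). split; auto. exists d. exact Hext.
    + destruct (sub_of_sub M M' (proj1 (proj1 HM)) (proj1 HM')) as (f & Hf1 & Hf2 & Hf3).
      exists (fun i => f (e2 i)). split.
      * intros i Hi. rewrite Hf1, He2 by auto. apply He, H1, Hi.
      * now apply (sat_iso f Hf2 Hf3).
Qed.
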